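(* For every integer $r\geq 3$, the limit $\lim_{n\to\infty} n^{-2} f^{(r)}(n;7r-12,7)$ exists and equals $\frac{1}{r^2-r-1}$.
   Context: An $r$-graph is an $r$-uniform hypergraph. For positive integers $s,k$, an $(s,k)$-configuration is an $r$-graph with exactly $k$ edges and at most $s$ vertices; an $r$-graph is $(s,k)$-free if it contains no $(s,k)$-configuration as a subgraph. For integers $r,n,s,k$, $f^{(r)}(n;s,k)$ denotes the maximum number of edges in an $n$-vertex $r$-graph that is $(s,k)$-free. *)

(* Defs.v *)
From HB Require Import structures.
From mathcomp Require Import all_boot all_order all_algebra.
From mathcomp Require Import all_classical all_reals all_analysis.
Set Implicit Arguments. Unset Strict Implicit. Unset Printing Implicit Defensive.

Definition uniform (n r : nat) (E : {set {set 'I_n}}) : bool :=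
  [forall e in E, #|e| == r].

Definition has_config (n s k : nat) (E : {set {set 'I_n}}) : bool :=
  [exists F : {set {set 'I_n}},
     [&& F \subset E, #|F| == k & #|\bigcup_(e in F) e| <= s]].

Definition sk_free (n s k : nat) (E : {set {set 'I_n}}) : bool :=
  ~~ has_config s k E.

Definition f_r (r n s k : nat) : nat :=
  \max_(E : {set {set 'I_n}} | uniform r E && sk_free s k E) #|E|.

(* Main.v *)
(** Write [s = r - 2], and call a family [Q] of edges dense when it covers at most
    [s|Q| + 2] vertices.

    Upper bound.  Link two edges sharing at least two vertices.  A linked cluster stays
    dense when grown edge by edge, so it has at most six edges.  A cluster of [m] edges
    covers at least [m C(r,2) - (m - 1)] pairs of its own, up to a linear number of
    exceptional clusters; the deficit of those with [m >= 3] is discharged onto the pairs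
    spanned by two linked edges but covered by none.

    Lower bound.  A random collection of "diamonds" (two edges sharing a private pair, whose
    cross pairs lie in a sparse random graph) gives, after deletions, a fixed [r]-graph [EF]
    on a vertex set [V] and a set [J] of pairs, almost all covered, with
    [|EF| (r^2 - r - 1)] close to [2|J|].  Copies of [EF] are then packed into [n] vertices
    so that their copies of [J] are disjoint and cover almost all pairs, and so that [j]
    copies, [3 <= j <= 7], never span fewer than [(|V| - 2) j + 2] vertices and span exactly
    that many only if two of them share two vertices.  The packing is found by a random
    process of boundedly many rounds: each round selects every still available copy with
    a small probability, and deletes the pairs it uses and the copies that would complete
    a critical family.  Joint survival probabilities follow a deterministic trajectory up
    to a small error, by induction over the rounds. *)

Require Import Defs.
From HB Require Import structures.
From mathcomp Require Import all_boot all_order all_algebra all_fingroup.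
From mathcomp Require Import reals sequences exp.
From mathcomp Require Import ring lra zify.
Set Implicit Arguments. Unset Strict Implicit. Unset Printing Implicit Defensive.

(** The value is that of the diamond: two edges cover 2C(r,2) - 1 = r^2 - r - 1 pairs between them,
    and about n^2/2 pairs are available. The difficulty is that the natural count falls one vertex
    short. If seven edges are spread over j copies of [EF], each copy carrying m of them on at least
    sm + 2 vertices, and the copies span (|V| - 2)j + 2 vertices, inclusion-exclusion yields only 7s
    + 2. The missing vertex comes from copies spanning more, or from two copies sharing a pair
    outside [J]: one of them carries at most three of the edges, and so few edges spanning a pair
    outside [J] cover at least sm + 3 vertices. This is why [J] contains the cross pairs of the
    diamonds, and why the pairs outside [J] are reserved in advance. Blocks selected in the same
    round do not see each other. The expected number of conflicts this causes is of order
    d(dT)^(j-1) n^2, for T rounds of rate d; so d is small with dT fixed. Since T is chosen before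
    n, the error of the induction over the rounds may grow with T in any way. *)

Module RandomProcess.
Import Order.TTheory GRing.Theory Num.Theory.
Local Open Scope ring_scope.

(** * Random subsets with independent elements *)

Section RandomSubset.
Variables (R : realFieldType) (A : finType) (q : A -> R).

Definition wt (w : {set A}) : R := \prod_a (if a \in w then q a else 1 - q a).

(** Both conditions are products over the elements of [A], so by distributivity the sum over subsets
    factors into one two-term sum per element. *)
Lemma wt_ind (M K : {set A}) : [disjoint M & K] ->
  \sum_(w : {set A}) wt w * ((M \subset w) && [disjoint K & w])%:R
  = \prod_(a in M) q a * \prod_(a in K) (1 - q a).
Proof.
move=> dMK.
have indE (w : {set A}) : ((M \subset w) && [disjoint K & w])%:R =
    \prod_a (if a \in w then (a \notin K)%:R else (a \notin M)%:R) :> R.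
  case: (boolP (_ && _)) => [/andP[sMw dKw]|nMK]; symmetry.
    rewrite big1 // => a _; case: ifP => aw.
      by rewrite (disjointFl dKw aw).
    by rewrite (contraFN (subsetP sMw a) aw).
  apply/eqP/prodf_eq0; move: nMK; rewrite negb_and => /orP[/subsetPn[a aM aw]|].
    by exists a => //; rewrite (negPf aw) aM.
  by rewrite -setI_eq0 => /set0Pn[a /setIP[aK aw]]; exists a => //; rewrite aw aK.
rewrite (eq_bigr _ (fun w _ => congr1 (fun z => wt w * z) (indE w))).
transitivity (\prod_a (q a * (a \notin K)%:R + (1 - q a) * (a \notin M)%:R)).
  rewrite bigA_distr; apply: eq_bigr => w _; rewrite -big_split /=; apply: eq_bigr => a _.
  by case: ifP.
rewrite (big_mkcond (fun a => a \in M)) (big_mkcond (fun a => a \in K)) -big_split /=.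
apply: eq_bigr => a _; case: (boolP (a \in M)) => aM.
  by rewrite (disjointFr dMK aM) /=; ring.
by case: ifP => aK /=; ring.
Qed.

Lemma wt_sum : \sum_(w : {set A}) wt w = 1.
Proof.
have := @wt_ind set0 set0; rewrite !big_set0 mulr1 => <-; last by rewrite -setI_eq0 setI0.
apply: eq_bigr => w _; rewrite sub0set /= -setI_eq0 set0I eqxx mulr1 //.
Qed.

Lemma wt_ge0 (w : {set A}) : (forall a, 0 <= q a <= 1) -> 0 <= wt w.
Proof.
move=> hq; apply: prodr_ge0 => a _; case: ifP => _; have := hq a; lra.
Qed.

End RandomSubset.

(** * The selection process in rounds and its expectations *)

Section Process.
Variables (R : realType) (I H O : finType) (T : nat).
Variables (req : H -> {set I}) (thr : I -> {set H * {set H * 'I_T}}).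
Variables (w0 : O -> R) (Y0 : O -> {set I}) (th : R).

(** The items still alive, and the blocks selected so far, labelled by their round.
    [req f] lists the items [f] needs; an item [y] dies when, for some [(f, F)] in
    [thr y], [F] was selected in earlier rounds and [f] is selected now. *)
Definition state := ({set I} * {set H * 'I_T})%type.

Definition fresh (sg : state) (w : {set H}) : {set H} :=
  [set f in w | req f \subset sg.1].

Definition hit (sg : state) (nw : {set H}) (y : I) : bool :=
  [exists fr in thr y, (fr.1 \in nw) && (fr.2 \subset sg.2)].

(** Labels below [i] are kept, label [i] goes to the fresh blocks, larger labels are absent whatever
    [sg] was. Hence a tag with a future label has probability zero from any state. *)
Definition step (i : nat) (sg : state) (w : {set H}) : state :=
  ([set y in sg.1 | ~~ hit sg (fresh sg w) y],
   [set b : H * 'I_T | if (b.2 < i)%N then b \in sg.2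
                       else (b.2 == i :> nat) && (b.1 \in fresh sg w)]).

(** Expectation after [i] rounds, computed backwards: the last round is averaged out first, which
    turns [g] into a function of the preceding state. *)
Fixpoint EE (i : nat) (g : state -> R) : R :=
  if i is j.+1
  then EE j (fun sg => \sum_(w : {set H}) wt (fun=> th) w * g (step j sg w))
  else \sum_(o : O) w0 o * g (Y0 o, set0).

Hypothesis w0_ge0 : forall o, 0 <= w0 o.
Hypothesis w0_sum : \sum_o w0 o = 1.
Hypothesis th01 : 0 <= th <= 1.

Let wth_ge0 (w : {set H}) : 0 <= wt (fun=> th) w.
Proof. by apply: wt_ge0. Qed.

Lemma EE_ext i g h : g =1 h -> EE i g = EE i h.
Proof.
elim: i g h => [|i IH] g h gh /=; first by apply: eq_bigr => o _; rewrite gh.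
by apply: IH => sg; apply: eq_bigr => w _; rewrite gh.
Qed.

Lemma EE_le i g h : (forall sg, g sg <= h sg) -> EE i g <= EE i h.
Proof.
elim: i g h => [|i IH] g h gh /=.
  by apply: ler_sum => o _; rewrite ler_wpM2l.
by apply: IH => sg; apply: ler_sum => w _; rewrite ler_wpM2l.
Qed.

Lemma EE_cst i c : EE i (fun=> c) = c.
Proof.
elim: i => [|i IH] /=; first by rewrite -mulr_suml w0_sum mul1r.
rewrite -[RHS]IH; apply: EE_ext => sg; by rewrite -mulr_suml wt_sum mul1r.
Qed.

Lemma EE_sum i (X : Type) (r : seq X) (P : pred X) (F : X -> state -> R) :
  EE i (fun sg => \sum_(x <- r | P x) F x sg) = \sum_(x <- r | P x) EE i (F x).
Proof.
elim: i F => [|i IH] F /=.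
  by under eq_bigr do rewrite mulr_sumr; rewrite exchange_big.
rewrite -IH; apply: EE_ext => sg.
by under eq_bigr do rewrite mulr_sumr; rewrite exchange_big.
Qed.

Lemma EED i g h : EE i (fun sg => g sg + h sg) = EE i g + EE i h.
Proof.
have := EE_sum i [:: g; h] xpredT (fun f sg => f sg).
rewrite !big_cons big_nil addr0 => <-; apply: EE_ext => sg.
by rewrite !big_cons big_nil addr0.
Qed.

Lemma EEZ i c g : EE i (fun sg => c * g sg) = c * EE i g.
Proof.
elim: i g => [|i IH] g /=.
  by rewrite mulr_sumr; apply: eq_bigr => o _; rewrite mulrCA.
rewrite -IH; apply: EE_ext => sg; rewrite mulr_sumr.
by apply: eq_bigr => w _; rewrite mulrCA.
Qed.

Lemma EEB i g h : EE i (fun sg => g sg - h sg) = EE i g - EE i h.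
Proof.
rewrite -mulN1r -EEZ -EED; apply: EE_ext => sg; by rewrite mulN1r.
Qed.

Lemma EE_ge0 i g : (forall sg, 0 <= g sg) -> 0 <= EE i g.
Proof. by move=> h; rewrite -(EE_cst i 0); apply: EE_le. Qed.

Lemma EE_norm i g : `|EE i g| <= EE i (fun sg => `|g sg|).
Proof.
rewrite ler_norml -mulN1r -EEZ; apply/andP; split; apply: EE_le => sg.
  by rewrite mulN1r lerNl -normrN ler_norm.
exact: ler_norm.
Qed.

Lemma exists_ge_avg (X : finType) (u v : X -> R) a :
  (forall x, 0 <= u x) -> \sum_x u x = 1 ->
  a <= \sum_x u x * v x -> exists x, a <= v x.
Proof.
move=> u0 u1 le; apply/existsP; apply: contraT; rewrite negb_exists => /forallP nx.
have vlt x : v x < a by rewrite ltNge.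
have d0 x : true -> 0 <= u x * (a - v x) by rewrite mulr_ge0 // subr_ge0 ltW.
have s0 : \sum_x u x * (a - v x) = 0.
  apply/eqP; rewrite eq_le (sumr_ge0 _ d0) andbT.
  under eq_bigr do rewrite mulrBr.
  by rewrite sumrB -mulr_suml u1 mul1r subr_le0.
have uz x : u x = 0.
  have /eqP := psumr_eq0P d0 s0 (erefl : xpredT x).
  by rewrite mulf_eq0 subr_eq0 (gt_eqF (vlt x)) orbF => /eqP.
by move: u1 (oner_eq0 R) => <-; rewrite big1 ?eqxx.
Qed.

(** First-moment method along the history: the average is attained round by round while [Inv] is
    carried along, so the state found is one the process can reach. *)
Lemma EE_ex i (Inv : nat -> state -> Prop) g a :
  (forall o, Inv 0%N (Y0 o, set0)) ->
  (forall j sg w, (j < i)%N -> Inv j sg -> Inv j.+1 (step j sg w)) ->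
  a <= EE i g -> exists2 sg, Inv i sg & a <= g sg.
Proof.
move=> I0; elim: i g => [|i IH] g Is /=.
  by case/(exists_ge_avg w0_ge0 w0_sum) => o; exists (Y0 o, set0).
case/IH => [j sg w ji|sg Isg]; first by apply: Is; apply: ltnW.
by case/(exists_ge_avg wth_ge0 (wt_sum _)) => w ag; exists (step i sg w) => //; apply: Is.
Qed.

Definition ind (Z : {set I} * {set H * 'I_T}) (sg : state) : R :=
  ((Z.1 \subset sg.1) && (Z.2 \subset sg.2))%:R.

Definition PE i Z := EE i (ind Z).

Definition early (i : nat) (B : {set H * 'I_T}) := [set b in B | (b.2 < i)%N].
Definition now (i : nat) (B : {set H * 'I_T}) := [set b in B | b.2 == i :> nat].
Definition blocks (B : {set H * 'I_T}) : {set H} := [set b.1 | b in B].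
Definition reqs (B : {set H * 'I_T}) : {set I} := \bigcup_(b in B) req b.1.

Definition killers (sg : state) (Y : {set I}) : {set H} :=
  [set f | (req f \subset sg.1) &&
     [exists y in Y, [exists fr in thr y, (fr.1 == f) && (fr.2 \subset sg.2)]]].

Lemma ind_ge0 Z sg : 0 <= ind Z sg.
Proof. by rewrite /ind ler0n. Qed.

Lemma card_blocks_now i B : #|blocks (now i B)| = #|now i B|.
Proof.
apply: card_in_imset => -[f l] [f' l'] /setIdP[_ /eqP /= e] /setIdP[_ /eqP /= e'] /= ->.
by congr pair; apply: val_inj; rewrite /= e e'.
Qed.

(** One round read backwards: the tags of [B] labelled [i] are traded for their requirements, and
    survival of [Y] becomes avoidance of a set of blocks determined by the old state. Given that
    state, the event only fixes some elements of [w]. *)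
Lemma step_subset i sg w (Y : {set I}) (B : {set H * 'I_T}) : (forall b, b \in B -> (b.2 <= i)%N) ->
  (Y \subset (step i sg w).1) && (B \subset (step i sg w).2) =
  [&& (Y :|: reqs (now i B) \subset sg.1) && (early i B \subset sg.2),
      blocks (now i B) \subset w & [disjoint killers sg Y & w]].
Proof.
move=> Bi; apply/andP/and3P => [[sY sB]|[/andP[sYr sE] sb dk]].
- have sYg : Y \subset sg.1.
    by apply/subsetP => y /(subsetP sY); rewrite inE => /andP[].
  have nowf b : b \in now i B -> b.1 \in fresh sg w.
    case/setIdP => bB /eqP e; move: (subsetP sB b bB).
    by rewrite inE e ltnn eqxx.
  split.
  + apply/andP; split.
      rewrite subUset sYg /=; apply/bigcupsP => b /nowf.
      by rewrite inE => /andP[].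
    apply/subsetP => b /setIdP[bB bi]; move: (subsetP sB b bB).
    by rewrite inE bi.
  + apply/subsetP => f /imsetP[b /nowf]; rewrite inE => /andP[bw _] -> //.
  + rewrite -setI_eq0; apply/set0Pn => -[f /setIP[]]; rewrite inE.
    case/andP => rf /existsP[y /andP[yY /existsP[fr /and3P[frt /eqP ef sfr]]]] fw.
    move: (subsetP sY y yY); rewrite inE => /andP[_ /negP]; apply.
    by apply/existsP; exists fr; rewrite frt sfr ef inE fw rf.
- split.
    apply/subsetP => y yY; rewrite inE.
    rewrite (subsetP sYr) ?inE ?yY //=; apply/negP => /existsP[fr /and3P[frt]].
    rewrite inE => /andP[fw rf] sfr; move: dk => /pred0P /(_ fr.1) /=.
    rewrite fw andbT inE rf /= => /negbT/negP; apply.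
    by apply/existsP; exists y; rewrite yY; apply/existsP; exists fr; rewrite frt eqxx.
  apply/subsetP => b bB; rewrite inE; case: ifP => bi.
    by apply: (subsetP sE); rewrite inE bB.
  have e : b.2 = i :> nat by apply/eqP; rewrite eqn_leq Bi //= leqNgt bi.
  have bn : b \in now i B by rewrite inE bB e eqxx.
  rewrite e eqxx /= inE (subsetP sb) /=; last by apply/imsetP; exists b.
  apply: subset_trans sYr; apply: subset_trans (subsetUr _ _).
  exact: (bigcup_sup b).
Qed.

Lemma ind_step_future i sg w (Y : {set I}) (B : {set H * 'I_T}) b :
  b \in B -> (i < b.2)%N -> ind (Y, B) (step i sg w) = 0.
Proof.
move=> bB ib; rewrite /ind; case: (boolP (B \subset _)) => [/subsetP/(_ _ bB)|_].
  by rewrite inE ltnNge ltnW //= gtn_eqF.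
by rewrite andbF.
Qed.

(** The conditional probability given the state. The disjointness indicator says that no block can
    be both selected and avoided. *)
Lemma sum_ind_step i sg (Y : {set I}) (B : {set H * 'I_T}) : (forall b, b \in B -> (b.2 <= i)%N) ->
  \sum_(w : {set H}) wt (fun=> th) w * ind (Y, B) (step i sg w) =
  ind (Y :|: reqs (now i B), early i B) sg *
  [disjoint blocks (now i B) & killers sg Y]%:R *
  (th ^+ #|now i B| * (1 - th) ^+ #|killers sg Y|).
Proof.
move=> Bi.
under eq_bigr => w _ do rewrite {1}/ind /= step_subset //.
rewrite {1}/ind /=; case: (_ && (early i B \subset _)) => /=; last first.
  by rewrite !mul0r big1 // => w _; rewrite mulr0.
rewrite mul1r; case: (boolP [disjoint _ & killers _ _]) => [d|nd].
  by rewrite (wt_ind _ d) !prodr_const mul1r card_blocks_now.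
rewrite mul0r big1 // => w _.
case: (boolP (_ && _)) => [/andP[sb dk]|]; last by rewrite mulr0.
move: nd; rewrite -setI_eq0 => /set0Pn[f /setIP[fb fk]].
by move: (disjointFr dk fk); rewrite (subsetP sb).
Qed.

(** Every tag costs its own coin of bias [th], whatever else is asked. *)
Lemma PE_crude i Z : PE i Z <= th ^+ #|Z.2|.
Proof.
case/andP: (th01) => th0 th1.
elim: i Z => [|i IH] [Y B] /=.
  rewrite /PE /=; under eq_bigr do rewrite /ind /= subset0.
  case: (altP (B =P set0)) => [->|nB] /=; last first.
    rewrite big1 ?exprn_ge0 // => o _; rewrite andbF mulr0 //.
  rewrite cards0 expr0; apply: le_trans (_ : \sum_o w0 o <= _); last by rewrite w0_sum.
  apply: ler_sum => o _; by rewrite ler_piMr // lern1 leq_b1.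
case: (boolP [forall b in B, (b.2 <= i)%N]) => [/forallP Bi|]; last first.
  rewrite negb_forall => /existsP[b]; rewrite negb_imply -ltnNge => /andP[bB ib].
  rewrite /PE /= (_ : EE i _ = 0) ?exprn_ge0 //.
  rewrite -[RHS](EE_cst i); apply: EE_ext => sg; rewrite big1 // => w _.
  by rewrite (ind_step_future _ _ _ bB) // mulr0.
have {}Bi b : b \in B -> (b.2 <= i)%N by move=> bB; have := Bi b; rewrite bB.
have cB : #|B| = (#|early i B| + #|now i B|)%N.
  rewrite -(cardsID [set b : H * 'I_T | (b.2 < i)%N] B); congr (_ + _)%N; apply: eq_card => b.
    by rewrite !inE.
  rewrite !inE andbC; case: (boolP (b \in B)) => //= bB.
  by rewrite -leqNgt eqn_leq Bi.
rewrite /PE /= cB exprD mulrC.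
apply: le_trans (_ : EE i (fun sg => th ^+ #|now i B| * ind (set0, early i B) sg) <= _).
  apply: EE_le => sg; rewrite sum_ind_step //.
  set u := ind _ _; set v := _%:R; set x := th ^+ _; set z := _ ^+ _.
  rewrite (_ : u * v * (x * z) = x * (u * (v * z))); last by ring.
  rewrite {}/u {}/v {}/x {}/z.
  rewrite ler_wpM2l ?exprn_ge0 //.
  apply: le_trans (_ : ind (Y :|: reqs (now i B), early i B) sg <= _).
    rewrite ler_piMr ?ind_ge0 // mulr_ile1 ?exprn_ge0 ?exprn_ile1 ?subr_ge0 ?ler0n ?lern1 ?leq_b1 //.
    by rewrite lerBlDr lerDl.
  by rewrite /ind /= sub0set /= ler_nat; case: (_ \subset _); case: (_ \subset _).
rewrite EEZ ler_wpM2l ?exprn_ge0 //; exact: IH.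
Qed.

End Process.

End RandomProcess.

(** * Elementary inequalities *)

Module RealBounds.
Import RandomProcess.
Import Order.TTheory GRing.Theory Num.Theory.
Local Open Scope ring_scope.

(** Keep one representative per fibre; every other element collides with its representative, and
    distinct elements give distinct pairs. *)
Lemma card_le_imset_collisions (X Y : finType) (f : X -> Y) (A : {set X}) :
  (#|A| <= #|f @: A| +
    #|[set z : X * X | [&& z.1 \in A, z.2 \in A, z.1 != z.2 & f z.1 == f z.2]]|)%N.
Proof.
pose rep y := [pick x in A | f x == y].
pose A' := [set x in A | rep (f x) == Some x].
have repA x : x \in A -> exists2 y, y \in A & rep (f x) = Some y /\ f x = f y.
  move=> xA; rewrite /rep; case: pickP => [y /andP[yA /eqP fy]|/(_ x)]; last by rewrite xA eqxx.
  by exists y.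
rewrite -(cardsID A' A); apply: leq_add.
  have injA : {in A :&: A' &, injective f}.
    move=> x y /setIP[_] /setIdP[_ /eqP rx] /setIP[_] /setIdP[_ /eqP ry] exy.
    by move: rx; rewrite exy ry => -[].
  by rewrite -(card_in_imset injA); apply/subset_leq_card/imsetS/subsetIl.
rewrite -(card_imset _ (can_inj (g := fst) (f := fun x => (x, odflt x (rep (f x)))) _)) //.
apply/subset_leq_card/subsetP => _ /imsetP[x /setDP[xA nx] ->].
case: (repA x xA) => y yA [ry fy]; rewrite inE /= ry /= xA yA fy eqxx andbT /=.
by apply: contraNneq nx => exy; rewrite inE xA ry exy /=.
Qed.

Section Reals.
Variable R : realType.

Lemma expR_opp_le (x y : R) : 0 <= x -> 0 <= y -> `|expR (- x) - expR (- y)| <= `|x - y|.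
Proof.
wlog lexy : x y / x <= y.
  move=> wl x0 y0; case: (leP x y) => [/wl|/ltW /wl]; first exact.
  by rewrite distrC (distrC x); apply.
move=> x0 y0.
have e1 : expR (- x) <= 1 by rewrite -expR0 ler_expR oppr_le0.
have e2 : expR (- y) <= expR (- x) by rewrite ler_expR lerN2.
rewrite ger0_norm ?subr_ge0 // distrC ger0_norm ?subr_ge0 //.
have -> : expR (- y) = expR (- x) * expR (x - y) by rewrite -expRD; congr expR; ring.
have h := expR_ge1Dx (x - y).
have h0 : 0 <= expR (- x) by exact: expR_ge0.
nra.
Qed.

Lemma pow1B_expR (x : R) n : 0 <= x <= 1 ->
  `|(1 - x) ^+ n - expR (- (x * n%:R))| <= n%:R * x ^+ 2.
Proof.
case/andP=> x0 x1.
have ex0 : 0 <= expR (- x) by exact: expR_ge0.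
have ex1 : expR (- x) <= 1 by rewrite -expR0 ler_expR oppr_le0.
have dx : `|1 - x - expR (- x)| <= x ^+ 2.
  have h1 := expR_ge1Dx (- x); have h2 := expR_ge1Dx x.
  have h3 : expR x * expR (- x) = 1 by rewrite -expRD subrr expR0.
  rewrite ler_norml; apply/andP; split; nra.
elim: n => [|n IH]; first by rewrite mulr0 oppr0 expR0 expr0 subrr normr0 mul0r.
have -> : expR (- (x * n.+1%:R)) = expR (- (x * n%:R)) * expR (- x).
  by rewrite -expRD -opprD -[n.+1%:R]natr1; congr (expR (- _)); ring.
rewrite exprSr.
set a := (1 - x) ^+ n in IH *; set b := expR (- (x * n%:R)) in IH *.
have a0 : 0 <= a by rewrite exprn_ge0 // subr_ge0.
have a1 : a <= 1 by rewrite exprn_ile1 ?subr_ge0 // lerBlDr lerDl.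
have -> : a * (1 - x) - b * expR (- x) = a * (1 - x - expR (- x)) + (a - b) * expR (- x) by ring.
apply: le_trans (ler_normD _ _) _; rewrite !normrM (ger0_norm a0) (ger0_norm ex0).
rewrite -[n.+1%:R]natr1; have := normr_ge0 (a - b); have := normr_ge0 (1 - x - expR (- x)).
move: IH dx; set u := `|_|; set v := `|_|; set z := n%:R * _ => *.
rewrite mulrDl mul1r -/z; nra.
Qed.

Lemma pow1B_lip (x : R) (k n : nat) : 0 <= x <= 1 -> (k <= n)%N ->
  `|(1 - x) ^+ k - (1 - x) ^+ n| <= x * (n%:R - k%:R).
Proof.
case/andP=> x0 x1 /subnK <-; move: (n - k)%N => d; rewrite natrD addrK.
have k0 : 0 <= (1 - x) ^+ k by rewrite exprn_ge0 // subr_ge0.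
have k1 : (1 - x) ^+ k <= 1 by rewrite exprn_ile1 ?subr_ge0 // lerBlDr lerDl.
have d0 : 0 <= (1 - x) ^+ d by rewrite exprn_ge0 // subr_ge0.
have d1 : (1 - x) ^+ d <= 1 by rewrite exprn_ile1 ?subr_ge0 // lerBlDr lerDl.
have bern : 1 - x * d%:R <= (1 - x) ^+ d.
  elim: d {d0 d1} => [|d IH]; first by rewrite mulr0 subr0.
  have d0 : 0 <= (1 - x) ^+ d by rewrite exprn_ge0 // subr_ge0.
  have d1 : (1 - x) ^+ d <= 1 by rewrite exprn_ile1 ?subr_ge0 // lerBlDr lerDl.
  rewrite exprS -natr1; nra.
rewrite exprD mulrC; rewrite ger0_norm; nra.
Qed.

(** Takes the place of Cauchy-Schwarz: with [l] the square root of a second-moment bound, it bounds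
    the mean absolute value. *)
Lemma norm_le_sqr (x l : R) : 0 < l -> `|x| <= l + x ^+ 2 / l.
Proof.
move=> l0; rewrite -(ler_pM2r l0) mulrDl divfK ?gt_eqF // -real_normK ?num_real //.
have := normr_ge0 x; set y := `|x|; nra.
Qed.

End Reals.

End RealBounds.

(** * Propagation of approximate independence through the rounds *)

Module Chaos.
Import RandomProcess RealBounds.
Import Order.TTheory GRing.Theory Num.Theory.
Local Open Scope ring_scope.

Lemma prod_disjU (R : comNzRingType) (X : finType) (A B : {set X}) (F : X -> R) :
  [disjoint A & B] -> \prod_(i in A :|: B) F i = \prod_(i in A) F i * \prod_(i in B) F i.
Proof. by move=> d; rewrite -bigU //; apply: eq_bigl => i; rewrite !inE. Qed.

Lemma mulr4_rot (R : comPzRingType) (a b d f : R) : a * b * (d * f) = d * (a * (b * f)).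
Proof. by rewrite mulrCA !mulrA. Qed.

Lemma step_error_sum (R : realFieldType) (f d k nu th e s P x : R) :
  f * d * k * nu <= P * x -> d ^+ 2 * k ^+ 2 * nu <= P * x -> d * k * th <= P * x ->
  d ^+ 2 * k ^+ 2 * s <= P * s -> e <= P * x -> s <= P * s -> 0 <= P * x ->
  f * (d * (k * nu)) + (d ^+ 2 * (3 * k ^+ 2 * nu) + th * (d * k) +
    (1 + 8 * d ^+ 2 * k ^+ 2) * s) + e <= 9 * P * (x + s).
Proof. by move=> *; lra. Qed.

Lemma norm_subr_le (R : realFieldType) (a b d : R) :
  0 <= a <= d -> 0 <= b <= d -> `|a - b| <= d.
Proof. by move=> /andP[? ?] /andP[? ?]; rewrite ler_norml; apply/andP; split; lra. Qed.

(** Going back one round turns up to [L] tags into requirements, hence the size [L * m.+1]; the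
    second moment attaches two threats, hence [+ m + m]. The square root is the cost of passing from
    the second moment to the first absolute one. *)
Fixpoint chaos_err (R : realType) (c : nat -> R) (nu : R) (m i L : nat) : R :=
  if i is j.+1 then
    let L1 := (L * m.+1)%N in
    let x := chaos_err c nu m j (L1 + m + m) + nu in
    9 * (L1.+1%:R ^+ 2 * c (L1 + m + m)%N ^+ 2) * (x + Num.sqrt x)
  else 0.

Lemma chaos_err_ge0 (R : realType) (c : nat -> R) (nu : R) m i L :
  0 <= nu -> 0 <= chaos_err c nu m i L.
Proof.
move=> nu0; elim: i L => [|i IH] L //=.
apply: mulr_ge0; last by rewrite !addr_ge0 ?sqrtr_ge0.
by apply: mulr_ge0 => //; apply: mulr_ge0; exact: sqr_ge0.
Qed.

Lemma chaos_err_small (R : realType) (c : nat -> R) m i L (eta : R) :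
  0 < eta -> exists2 nu0, 0 < nu0 & forall nu, 0 < nu <= nu0 -> chaos_err c nu m i L <= eta.
Proof.
elim: i L eta => [|i IH] L eta eta0; first by exists 1 => // nu _; exact: ltW.
pose L1 := (L * m.+1)%N; pose K := 9 * (L1.+1%:R ^+ 2 * c (L1 + m + m)%N ^+ 2) + 1.
have K1 : 1 <= K by rewrite lerDr; apply: mulr_ge0 => //; apply: mulr_ge0; exact: sqr_ge0.
have K0 : 0 < K by exact: lt_le_trans K1.
pose z := Num.min 1 (eta / (2 * K)).
have z0 : 0 < z by rewrite lt_min ltr01 divr_gt0 // mulr_gt0.
have z2 : 0 < z ^+ 2 / 2 by rewrite divr_gt0 // exprn_gt0.
have [nu1 nu10 h] := IH (L1 + m + m)%N _ z2.
exists (Num.min nu1 (z ^+ 2 / 2)); first by rewrite lt_min nu10.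
move=> nu /andP[nu0]; rewrite le_min => /andP[n1 n2] /=.
rewrite -/L1; set x := _ + nu.
have x0 : 0 <= x by rewrite addr_ge0 ?chaos_err_ge0 ?ltW.
have xz : x <= z ^+ 2.
  by rewrite [z ^+ 2]splitr lerD // h // nu0.
have sx : Num.sqrt x <= z.
  by rewrite -(ger0_norm (ltW z0)) -sqrtr_sqr ler_sqrt // exprn_ge0 // ltW.
have z1 : z <= 1 by rewrite ge_min lexx.
have zz : z ^+ 2 <= z by rewrite expr2 ler_piMl // ltW.
have ez : z <= eta / (2 * K) by rewrite ge_min lexx orbT.
apply: le_trans (_ : K * (z + z) <= _).
  apply: ler_pM.
  - by apply: mulr_ge0 => //; apply: mulr_ge0; exact: sqr_ge0.
  - by apply: addr_ge0 => //; exact: sqrtr_ge0.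
  - by rewrite /K lerDl.
  - by rewrite lerD // (le_trans xz).
have := ez; rewrite ler_pdivlMr ?mulr_gt0 // => h2; nra.
Qed.

Section Chaos.
Variables (R : realType) (I H O : finType) (T : nat).
Variables (req : H -> {set I}) (thr : I -> {set H * {set H * 'I_T}}).
Variables (w0 : O -> R) (Y0 : O -> {set I}) (th : R).
Hypothesis w0_ge0 : forall o, 0 <= w0 o.
Hypothesis w0_sum : \sum_o w0 o = 1.
Hypothesis th_gt0 : 0 < th.
Hypothesis th_le1 : th <= 1.

Variables (ty : I -> option bool) (kJ nJ : nat) (eps : R) (p q : nat -> R).
Variable Theta : option bool -> R -> R.

Definition pt i (t : option bool) : R :=
  match t with Some true => p i | Some false => q i | None => eps end.
Definition al i : R := p i ^+ kJ * q i * eps ^+ nJ.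
(** Probability that a threatening block has its requirements alive, given that the threatened item
    is alive. A block threatening a pair requires that very pair, so one factor [p] is dropped. *)
Definition alt (t : option bool) i : R :=
  if t is Some true then p i ^+ kJ.-1 * q i * eps ^+ nJ else al i.
Definition gl i (l : 'I_T) : R := if (l < i)%N then th * al l else 0.
Definition kap i t : R := th * alt t i * Theta t (\sum_l gl i l).

Hypothesis kJ_gt0 : (0 < kJ)%N.
Hypothesis eps01 : 0 <= eps <= 1.
Hypothesis p01 : forall i, 0 < p i <= 1.
Hypothesis q01 : forall i, 0 < q i <= 1.
Hypothesis p_rec : forall i, p i.+1 = p i * expR (- kap i (Some true)).
Hypothesis q_rec : forall i, q i.+1 = q i * expR (- kap i (Some false)).
Hypothesis Theta_static : forall x, Theta None x = 0.

(** The configurations for which independence is claimed. They are closed under the two moves of the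
    induction: trading a tag for its requirements ([good_move]) and attaching a threat ([good_ext]).
    Threats in [exc] escape the second move and are only bounded in number, by [thr_exc]. *)
Variable good : {set I} -> {set H * 'I_T} -> Prop.
Variable exc : {set I} -> {set H * 'I_T} -> I -> {set H * {set H * 'I_T}}.
Variables (c : nat -> R) (nu : R) (m : nat).

(** What the block of a nonexceptional threat of [y] requires from [Y]: [y] itself if it is a pair
    the block would cover, nothing otherwise. *)
Definition self y : {set I} := if ty y == Some true then [set y] else set0.

Definition Wt i (Y : {set I}) : R := \prod_(y in Y) pt i (ty y).
(** Up to a small relative error, alive items and selections behave as independent
    events: [p], [q], [eps] are the survival probabilities by type, [al] that of all
    requirements of one block, and [kap] the hazard rate of an item. *)
Definition pred i Y (B : {set H * 'I_T}) : R := Wt i Y * \prod_(b in B) gl i b.2.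

Hypothesis th_nu : th <= nu.
Hypothesis nu_le1 : nu <= 1.
Hypothesis c_ge1 : forall L, 1 <= c L.
Hypothesis c_pow : forall L, (2 ^ L)%:R <= c L.
Hypothesis req_m : forall f, (#|req f| <= m)%N.
Hypothesis thr_m : forall y fr, fr \in thr y -> (#|req fr.1| + #|fr.2| <= m)%N.
Hypothesis good_init : forall Y, good Y set0 -> \sum_o w0 o * (Y \subset Y0 o)%:R = Wt 0 Y.
Hypothesis req_types : forall (u : option bool -> R) f,
  \prod_(y in req f) u (ty y) = u (Some true) ^+ kJ * u (Some false) * u None ^+ nJ.
Hypothesis thr_weight : forall y (g : 'I_T -> R), (forall l, 0 <= g l) ->
  \sum_(fr in thr y) \prod_(b in fr.2) g b.2 = Theta (ty y) (\sum_l g l).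
Hypothesis good_move : forall Y B b, good Y B -> b \in B ->
  good (Y :|: req b.1) (B :\ b) /\ [disjoint Y & req b.1].
Hypothesis good_ext : forall Y B y fr, good Y B -> y \in Y -> fr \in thr y ->
  fr \notin exc Y B y ->
  [/\ good (Y :|: req fr.1) (B :|: fr.2), Y :&: req fr.1 = self y & [disjoint B & fr.2]].
Hypothesis thr_crude : forall L y (W : {set H * 'I_T}), (#|W| <= L)%N ->
  th * \sum_(fr in thr y) th ^+ #|fr.2 :\: W| <= c L.
Hypothesis thr_exc : forall L Y B y, good Y B -> (#|Y| + #|B| <= L)%N -> y \in Y ->
  th * \sum_(fr in thr y | fr \in exc Y B y) th ^+ #|fr.2 :\: B| <= c L * nu.
Hypothesis thr_codeg : forall L y f (W : {set H * 'I_T}), (#|W| <= L)%N ->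
  \sum_(fr in thr y | (fr.1 == f) && ~~ (fr.2 \subset W)) th ^+ #|fr.2 :\: W| <= c L * nu.
Hypothesis thr_unique : forall Y B y y' fr fr', good Y B -> y \in Y -> y' \in Y ->
  fr \in thr y -> fr \notin exc Y B y -> fr' \in thr y' -> fr'.1 = fr.1 ->
  fr'.2 \subset B :|: fr.2 -> y' = y /\ fr' = fr.
Hypothesis thr_sel : forall Y B y b fr, good Y B -> y \in Y -> b \in B ->
  fr \in thr y -> fr.1 = b.1 -> ~~ (fr.2 \subset B).

Notation EE := (EE req thr w0 Y0 th).
Notation PE := (PE req thr w0 Y0 th).
Notation killers := (killers req thr).
Notation ind Y B := (@ind R I H T (Y, B)).
Local Notation tag := (H * 'I_T)%type.

Let th0 : 0 <= th. Proof. exact: ltW. Qed.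
Let th01 : 0 <= th <= 1. Proof. by rewrite th0. Qed.
Let nu0 : 0 <= nu. Proof. exact: le_trans th0 th_nu. Qed.
Let c0 L : 0 <= c L. Proof. exact: le_trans (c_ge1 L). Qed.
Let thX0 n : 0 <= th ^+ n. Proof. exact: exprn_ge0. Qed.
Let thX1 n : th ^+ n <= 1. Proof. exact: exprn_ile1. Qed.

Lemma al01 i : 0 <= al i <= 1.
Proof.
rewrite /al; case/andP: (p01 i) => /ltW a b; case/andP: (q01 i) => /ltW a' b'.
case/andP: eps01 => a'' b''.
by rewrite !mulr_ge0 ?exprn_ge0 ?mulr_ile1 ?mulr_ge0 ?exprn_ge0 ?exprn_ile1.
Qed.

Lemma alt01 t i : 0 <= alt t i <= 1.
Proof.
rewrite /alt; case: t => [[]|]; try exact: al01.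
case/andP: (p01 i) => /ltW a b; case/andP: (q01 i) => /ltW a' b'.
case/andP: eps01 => a'' b''.
by rewrite !mulr_ge0 ?exprn_ge0 ?mulr_ile1 ?mulr_ge0 ?exprn_ge0 ?exprn_ile1.
Qed.

Lemma gl_ge0 i l : 0 <= gl i l.
Proof. by rewrite /gl; case: ifP => // _; rewrite mulr_ge0 //; case/andP: (al01 l). Qed.

Lemma gl_le i l : gl i l <= th.
Proof.
by rewrite /gl; case: ifP => // _; rewrite ler_piMr //; case/andP: (al01 l).
Qed.

Lemma pt01 i t : 0 <= pt i t <= 1.
Proof.
rewrite /pt; case: t => [[]|]; last exact: eps01.
  by case/andP: (p01 i) => /ltW -> ->.
by case/andP: (q01 i) => /ltW -> ->.
Qed.

Lemma Wt01 i Y : 0 <= Wt i Y <= 1.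
Proof.
rewrite /Wt; apply: (big_ind (fun x => 0 <= x <= 1)) => [|x y|y _].
- by rewrite ler01 lexx.
- by case/andP=> a b /andP[a' b']; rewrite mulr_ge0 // mulr_ile1.
- exact: pt01.
Qed.

Lemma prodgl i (B : {set tag}) : 0 <= \prod_(b in B) gl i b.2 <= th ^+ #|B|.
Proof.
rewrite prodr_ge0 => [|b _]; last exact: gl_ge0.
rewrite -prodr_const; apply: ler_prod => b _; by rewrite gl_ge0 gl_le.
Qed.

Lemma pred_bounds i Y B : 0 <= pred i Y B <= th ^+ #|B|.
Proof.
rewrite /pred; case/andP: (Wt01 i Y) => a b; case/andP: (prodgl i B) => a' b'.
by rewrite mulr_ge0 //= (le_trans _ b') // ler_piMl.
Qed.

Lemma Wt_req i f : Wt i (req f) = al i.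
Proof. by rewrite /Wt (req_types (pt i)). Qed.

Lemma WtU i (Y Y' : {set I}) : [disjoint Y & Y'] -> Wt i (Y :|: Y') = Wt i Y * Wt i Y'.
Proof. by move=> d; rewrite /Wt prod_disjU. Qed.

Lemma Wt_ext i Y f y : Y :&: req f = self y -> Wt i (Y :|: req f) = Wt i Y * alt (ty y) i.
Proof.
move=> Yf; have -> : Y :|: req f = Y :|: (req f :\: self y).
  rewrite -Yf; apply/setP => x; rewrite !inE; by case: (x \in Y).
rewrite WtU; last first.
  rewrite -setI_eq0; apply/eqP/setP => x; rewrite -Yf !inE.
  by case: (x \in Y); case: (x \in req f).
congr (_ * _); have := Wt_req i f; rewrite /Wt (big_setID (self y)) /=.
have -> : req f :&: self y = self y by apply/setIidPr; rewrite -Yf subsetIr.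
rewrite {1}/self /alt; case ety: (ty y) => [[]|]; rewrite ?big_set0 ?mul1r //=.
have pn0 : p i != 0 by case/andP: (p01 i) => /lt0r_neq0.
rewrite big_set1 ety /= => h; apply: (mulfI pn0).
by rewrite h /al !mulrA -exprS prednK.
Qed.

Lemma pred_ext i Y B y fr : good Y B -> y \in Y -> fr \in thr y -> fr \notin exc Y B y ->
  pred i (Y :|: req fr.1) (B :|: fr.2) =
  pred i Y B * (alt (ty y) i * \prod_(b in fr.2) gl i b.2).
Proof.
move=> g yY frt fre; have [_ h1 h2] := good_ext g yY frt fre.
rewrite /pred (Wt_ext _ h1) (prod_disjU _ h2); ring.
Qed.

Lemma kap_sum i y : kap i (ty y) =
  th * \sum_(fr in thr y) alt (ty y) i * \prod_(b in fr.2) gl i b.2.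
Proof. by rewrite -mulr_sumr thr_weight /kap ?mulrA // => l; exact: gl_ge0. Qed.

Lemma kap_bounds L i y : 0 <= kap i (ty y) <= c L.
Proof.
rewrite kap_sum; case/andP: (alt01 (ty y) i) => a0 a1; apply/andP; split.
  rewrite mulr_ge0 // sumr_ge0 // => fr _; rewrite mulr_ge0 //.
  by case/andP: (prodgl i fr.2).
apply: le_trans (thr_crude y (W := set0) _); last by rewrite cards0.
rewrite ler_wpM2l // ler_sum // => fr _; rewrite setD0.
by case/andP: (prodgl i fr.2) => b0 b1; rewrite (le_trans _ b1) // ler_piMl.
Qed.

Lemma card_ext k (Y : {set I}) (B : {set tag}) y (fr : H * {set tag}) : fr \in thr y ->
  (#|Y| + #|B| <= k)%N -> (#|Y :|: req fr.1| + #|B :|: fr.2| <= k + m)%N.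
Proof.
move=> /thr_m h sz; apply: leq_trans (_ : #|Y| + #|B| + m <= _)%N; last by rewrite leq_add2r.
apply: leq_trans (leq_add (leq_card_setU _ _) (leq_card_setU _ _)) _.
by rewrite addnACA leq_add2l.
Qed.

Lemma PE_bounds i Y B : 0 <= PE i (Y, B) <= th ^+ #|B|.
Proof.
rewrite (PE_crude req thr Y0 w0_ge0 w0_sum th01 i (Y, B)) andbT.
by apply: EE_ge0 => // sg; exact: ind_ge0.
Qed.

Lemma thX_setU (B F : {set tag}) : th ^+ #|B :|: F| = th ^+ #|B| * th ^+ #|F :\: B|.
Proof.
rewrite -exprD cardsU cardsD; congr (_ ^+ _).
by rewrite addnBA ?subset_leq_card ?subsetIl // setIC.
Qed.

Lemma good_moves i k (F : {set tag}) (Y : {set I}) (B : {set tag}) : #|F| = k -> F \subset B -> good Y B ->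
  good (Y :|: reqs req F) (B :\: F) /\ Wt i (Y :|: reqs req F) = Wt i Y * al i ^+ k.
Proof.
elim: k F => [|k IH] F.
  move/eqP; rewrite cards_eq0 => /eqP -> _ g.
  by rewrite /reqs big_set0 setU0 setD0 expr0 mulr1.
move=> cF sFB g; have [b bF] : exists b, b \in F by apply/set0Pn; rewrite -card_gt0 cF.
have cF' : #|F :\ b| = k by have := cardsD1 b F; rewrite bF cF add1n => -[].
have [g' w'] := IH _ cF' (subset_trans (subD1set _ _) sFB) g.
have bB : b \in B :\: (F :\ b) by rewrite !inE eqxx (subsetP sFB).
have [g'' d] := good_move g' bB.
have rE : Y :|: reqs req F = (Y :|: reqs req (F :\ b)) :|: req b.1.
  by rewrite /reqs (big_setD1 b bF) /= -setUA [_ :|: req b.1]setUC.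
rewrite rE; split; last by rewrite WtU // w' Wt_req exprSr mulrA.
suff -> : B :\: F = (B :\: (F :\ b)) :\ b by [].
by apply/setP => z; rewrite !inE; case: (eqVneq z b) => [->|_] //=; rewrite bF.
Qed.

Section Step.
Variables (i L : nat) (e : R).
Hypothesis e0 : 0 <= e.
Hypothesis IH : forall Y B, good Y B -> (#|Y| + #|B| <= L + m + m)%N ->
  `|PE i (Y, B) - pred i Y B| <= e * th ^+ #|B|.
Let C := c (L + m + m).
Let x := e + nu.
Let C1 : 1 <= C. Proof. exact: c_ge1. Qed.
Let x0 : 0 <= x. Proof. exact: addr_ge0. Qed.

(** Nonexceptional threats lead to good configurations, where [IH] and [pred_ext] apply; for the
    exceptional ones both the true and the predicted term are bounded by [thr_exc]. *)
Lemma first_moment Y B y : good Y B -> (#|Y| + #|B| <= L + m)%N -> y \in Y ->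
  `|th * (\sum_(fr in thr y) PE i (Y :|: req fr.1, B :|: fr.2))
    - pred i Y B * kap i (ty y)| <= 2 * C * x * th ^+ #|B|.
Proof.
move=> g sz yY; rewrite kap_sum mulrCA -mulrBr mulr_sumr -sumrB.
rewrite normrM (ger0_norm th0).
apply: le_trans (_ : th * \sum_(fr in thr y) th ^+ #|B| *
   (e * th ^+ #|fr.2| + (if fr \in exc Y B y then 2 * th ^+ #|fr.2 :\: B| else 0)) <= _).
  rewrite ler_wpM2l // (le_trans (ler_norm_sum _ _ _)) // ler_sum // => fr frt.
  have fe0 : 0 <= e * th ^+ #|fr.2| by rewrite mulr_ge0.
  case: ifPn => fre.
    case/andP: (PE_bounds i (Y :|: req fr.1) (B :|: fr.2)) => a0; rewrite thX_setU => a1.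
    case/andP: (pred_bounds i Y B) => b0 b1; case/andP: (prodgl i fr.2) => d0 d1.
    case/andP: (alt01 (ty y) i) => f0 f1.
    have d1' : \prod_(b in fr.2) gl i b.2 <= th ^+ #|fr.2 :\: B|.
      by rewrite (le_trans d1) // ler_wiXn2l // subset_leq_card // subsetDl.
    have b2 : pred i Y B * (alt (ty y) i * \prod_(b in fr.2) gl i b.2) <=
       th ^+ #|B| * th ^+ #|fr.2 :\: B|.
      apply: ler_pM => //; first by rewrite mulr_ge0.
      by rewrite (le_trans _ d1') // ler_piMl.
    have b3 : 0 <= pred i Y B * (alt (ty y) i * \prod_(b in fr.2) gl i b.2).
      by apply: mulr_ge0 => //; exact: mulr_ge0.
    apply: le_trans (_ : th ^+ #|B| * th ^+ #|fr.2 :\: B| <= _).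
      by apply: norm_subr_le; apply/andP.
    rewrite ler_wpM2l // (le_trans _ (_ : 2 * th ^+ #|fr.2 :\: B| <= _)) ?lerDr //.
    by rewrite mulr_natl mulr2n lerDl.
  have [g' _ dj] := good_ext g yY frt fre.
  rewrite -(pred_ext i g yY frt fre) addr0.
  apply: le_trans (IH g' (card_ext frt sz)) _.
  have -> : th ^+ #|B :|: fr.2| = th ^+ #|B| * th ^+ #|fr.2|.
    by rewrite thX_setU; have /setDidPl -> : [disjoint fr.2 & B] by rewrite disjoint_sym.
  by rewrite mulrCA lexx.
rewrite -mulr_sumr big_split /= -mulr_sumr -big_mkcondr /= -mulr_sumr.
have h1 : th * (\sum_(fr in thr y) th ^+ #|fr.2|) <= C.
  apply: le_trans (thr_crude (L := L + m + m) y (W := set0) _); last by rewrite cards0.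
  by rewrite ler_wpM2l // ler_sum // => fr _; rewrite setD0.
have h2 : th * (\sum_(fr in thr y | fr \in exc Y B y) th ^+ #|fr.2 :\: B|) <= C * nu.
  by apply: thr_exc => //; apply: leq_trans sz (leq_addr _ _).
have -> : 2 * C * x * th ^+ #|B| = th ^+ #|B| * (2 * C * x) by ring.
rewrite mulrCA ler_wpM2l // mulrDr !mulrA.
set u := \sum_(_ in _) _ in h1 *; set v := \sum_(_ in _ | _) _ in h2 *.
have h3 := ler_wpM2l e0 h1; have h4 := mulr_ge0 e0 (le_trans ler01 C1).
rewrite (_ : th * e * u + th * 2 * v = e * (th * u) + 2 * (th * v)); last by ring.
rewrite (_ : 2 * C * x = e * C + e * C + 2 * (C * nu)); last by rewrite /x; ring.
by rewrite lerD ?ler_wpM2l // (le_trans h3) // lerDl.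
Qed.

Definition kapS (D : {set I}) : R := \sum_(y in D) kap i (ty y).
Definition count (D : {set I}) sg : R :=
  \sum_(y in D) \sum_(fr in thr y) ind (req fr.1) fr.2 sg.
Definition dev D sg : R := th * count D sg - kapS D.

Lemma indU Y B Y' B' sg : ind Y B sg * ind Y' B' sg = ind (Y :|: Y') (B :|: B') sg :> R.
Proof. by rewrite /RandomProcess.ind /= !subUset -natrM mulnb; congr (_%:R); case: (Y \subset _); case: (B \subset _); rewrite ?andbF. Qed.

(** Only one factor [dev] is expanded and [G] is carried along; with [G] again a deviation this
    yields the second moment. *)
Lemma EE_devG D (Y : {set I}) (B : {set tag}) G : EE i (fun sg => ind Y B sg * dev D sg * G sg) =
  \sum_(y in D) (th * (\sum_(fr in thr y) EE i (fun sg => ind (Y :|: req fr.1) (B :|: fr.2) sg * G sg))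
                 - kap i (ty y) * EE i (fun sg => ind Y B sg * G sg)).
Proof.
rewrite sumrB -!mulr_sumr -mulr_suml.
transitivity (EE i (fun sg => th * (\sum_(y in D) \sum_(fr in thr y)
   (ind (Y :|: req fr.1) (B :|: fr.2) sg * G sg)) - kapS D * (ind Y B sg * G sg))).
  apply: EE_ext => sg; rewrite /dev.
  rewrite (_ : \sum_(y in D) _ = ind Y B sg * count D sg * G sg); first by ring.
  rewrite /count mulr_sumr mulr_suml; apply: eq_bigr => y _.
  by rewrite mulr_sumr mulr_suml; apply: eq_bigr => fr _; rewrite indU.
rewrite EEB !EEZ EE_sum; congr (_ * _ - _); apply: eq_bigr => y _; exact: EE_sum.
Qed.

Lemma EE_dev D (Y : {set I}) (B : {set tag}) : EE i (fun sg => ind Y B sg * dev D sg) =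
  \sum_(y in D) (th * (\sum_(fr in thr y) PE i (Y :|: req fr.1, B :|: fr.2))
                 - kap i (ty y) * PE i (Y, B)).
Proof.
have e1 (F : state I H T -> R) : EE i (fun sg => F sg * 1) = EE i F.
  by apply: EE_ext => sg; rewrite mulr1.
rewrite -e1 EE_devG; apply: eq_bigr => y _; rewrite e1; congr (th * _ - _).
by apply: eq_bigr => fr _; rewrite e1.
Qed.

Lemma dev_good (D Y : {set I}) B : D \subset Y -> good Y B -> (#|Y| + #|B| <= L + m)%N ->
  `|EE i (fun sg => ind Y B sg * dev D sg)| <= #|D|%:R * (3 * C * x) * th ^+ #|B|.
Proof.
move=> sDY g sz; rewrite EE_dev (le_trans (ler_norm_sum _ _ _)) //.
rewrite -mulrA [X in _ <= X]mulr_natl -sumr_const ler_sum // => y yD.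
have h1 := first_moment g sz (subsetP sDY y yD).
have h2 := IH g (leq_trans sz (leq_addr _ _)).
case/andP: (kap_bounds (L + m + m) i y) => k0 k1.
set a := th * _ in h1 *; set k := kap _ _ in h1 k0 k1 *.
have -> : a - k * PE i (Y, B) = (a - pred i Y B * k) - k * (PE i (Y, B) - pred i Y B) by ring.
rewrite (le_trans (ler_normB _ _)) // normrM (ger0_norm k0).
have h3 : k * `|PE i (Y, B) - pred i Y B| <= C * (e * th ^+ #|B|).
  by rewrite ler_pM.
have h4 : C * (e * th ^+ #|B|) <= C * x * th ^+ #|B|.
  by rewrite mulrA ler_wpM2r // ler_wpM2l ?(le_trans ler01) // lerDl.
have -> : 3 * C * x * th ^+ #|B| = 2 * C * x * th ^+ #|B| + C * x * th ^+ #|B| by ring.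
by rewrite lerD // (le_trans h3).
Qed.

Lemma dev_crude (D Y : {set I}) (B : {set tag}) : (#|B| <= L + m + m)%N ->
  `|EE i (fun sg => ind Y B sg * dev D sg)| <= #|D|%:R * (2 * C) * th ^+ #|B|.
Proof.
move=> sz; rewrite EE_dev (le_trans (ler_norm_sum _ _ _)) //.
rewrite -mulrA [X in _ <= X]mulr_natl -sumr_const ler_sum // => y yD.
case/andP: (kap_bounds (L + m + m) i y) => k0 k1.
case/andP: (PE_bounds i Y B) => a0 a1.
have h1 : th * (\sum_(fr in thr y) PE i (Y :|: req fr.1, B :|: fr.2)) <= C * th ^+ #|B|.
  apply: le_trans (ler_wpM2r (thX0 #|B|) (thr_crude y sz)).
  rewrite -mulrA ler_wpM2l // mulr_suml ler_sum // => fr _.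
  case/andP: (PE_bounds i (Y :|: req fr.1) (B :|: fr.2)) => _; rewrite thX_setU mulrC //.
have h0 : 0 <= th * (\sum_(fr in thr y) PE i (Y :|: req fr.1, B :|: fr.2)).
  rewrite mulr_ge0 // sumr_ge0 // => fr _.
  by case/andP: (PE_bounds i (Y :|: req fr.1) (B :|: fr.2)).
have h2 : kap i (ty y) * PE i (Y, B) <= C * th ^+ #|B| by rewrite ler_pM.
have h3 : 0 <= kap i (ty y) * PE i (Y, B) by exact: mulr_ge0.
rewrite (le_trans (norm_subr_le (d := C * th ^+ #|B|) _ _)) ?h0 ?h1 ?h2 ?h3 //.
by rewrite ler_wpM2r // mulr_natl mulr2n lerDl (le_trans ler01).
Qed.

(** One deviation is expanded into threats. What remains is a mean deviation on a configuration
    enlarged by a threat: small by [dev_good] if the result is good, otherwise bounded by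
    [dev_crude] and multiplied by the rarity of exceptional threats. *)
Lemma dev_sqr (D Y : {set I}) B : D \subset Y -> good Y B -> (#|Y| + #|B| <= L)%N ->
  EE i (fun sg => ind Y B sg * dev D sg ^+ 2) <= #|D|%:R ^+ 2 * (8 * C ^+ 2 * x) * th ^+ #|B|.
Proof.
move=> sDY g sz; set d : R := #|D|%:R; have d0 : 0 <= d by exact: ler0n.
have C0 : 0 <= C by exact: le_trans C1.
have -> : EE i (fun sg => ind Y B sg * dev D sg ^+ 2) =
  EE i (fun sg => ind Y B sg * dev D sg * dev D sg).
  by apply: EE_ext => sg; rewrite expr2 mulrA.
rewrite EE_devG (_ : d ^+ 2 * _ * _ = d * (d * (8 * C ^+ 2 * x) * th ^+ #|B|)); last by ring.
rewrite [X in _ <= X]mulr_natl -sumr_const ler_sum // => y yD.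
have M0 := dev_good sDY g (leq_trans sz (leq_addr _ _)).
case/andP: (kap_bounds (L + m + m) i y) => k0 k1.
set A := th * _; set E0 := EE i _ in M0 *.
have hA : A <= d * (5 * C ^+ 2 * x) * th ^+ #|B|.
  apply: le_trans (_ : th * (\sum_(fr in thr y) (d * (3 * C * x) * th ^+ #|B| * th ^+ #|fr.2| +
     (if fr \in exc Y B y then d * (2 * C) * th ^+ #|B| * th ^+ #|fr.2 :\: B| else 0))) <= _).
    rewrite ler_wpM2l // ler_sum // => fr frt; apply: le_trans (ler_norm _) _.
    case: ifPn => fre.
      apply: le_trans (dev_crude _ _ _) _.
        have := card_ext (k := L) frt (B := B) (Y := Y) sz.
        by move=> h; apply: leq_trans (leq_addl _ _) (leq_trans h (leq_addr _ _)).
      by rewrite thX_setU !mulrA lerDr !mulr_ge0.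
    have [g' _ dj] := good_ext g (subsetP sDY y yD) frt fre.
    apply: le_trans (dev_good (subset_trans sDY (subsetUl _ _)) g' (card_ext frt sz)) _.
    rewrite thX_setU addr0.
    have /setDidPl -> : [disjoint fr.2 & B] by rewrite disjoint_sym.
    by rewrite !mulrA.
  rewrite big_split /= -mulr_sumr -big_mkcondr /= -mulr_sumr mulrDr.
  rewrite ![th * (_ * _)]mulrCA.
  have h1 : th * (\sum_(fr in thr y) th ^+ #|fr.2|) <= C.
    apply: le_trans (thr_crude (L := L + m + m) y (W := set0) _); last by rewrite cards0.
    by rewrite ler_wpM2l // ler_sum // => fr _; rewrite setD0.
  have h2 : th * (\sum_(fr in thr y | fr \in exc Y B y) th ^+ #|fr.2 :\: B|) <= C * nu.
    apply: thr_exc => //; last exact: (subsetP sDY).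
    by apply: leq_trans sz _; rewrite -addnA leq_addr.
  have h3 : nu <= x by rewrite lerDr.
  have h4 : 0 <= d * (3 * C * x) * th ^+ #|B| by rewrite !mulr_ge0.
  have h5 : 0 <= d * (2 * C) * th ^+ #|B| by rewrite !mulr_ge0.
  apply: le_trans (lerD (ler_wpM2l h4 h1) (ler_wpM2l h5 (le_trans h2 (ler_wpM2l C0 h3)))) _.
  by rewrite le_eqVlt; apply/orP; left; apply/eqP; ring.
have hB : `|kap i (ty y) * E0| <= d * (3 * C ^+ 2 * x) * th ^+ #|B|.
  rewrite normrM (ger0_norm k0); apply: le_trans (ler_pM _ _ k1 M0) _ => //.
  by rewrite le_eqVlt; apply/orP; left; apply/eqP; rewrite -/d /C; ring.
have := lerD hA (le_trans (ler_norm _) (_ : `|- (kap i (ty y) * E0)| <= _)).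
move=> /(_ (d * (3 * C ^+ 2 * x) * th ^+ #|B|)); rewrite normrN => /(_ hB) h.
apply: le_trans h _.
by rewrite le_eqVlt; apply/orP; left; apply/eqP; ring.
Qed.

Lemma dev_abs (D Y : {set I}) B : D \subset Y -> good Y B -> (#|Y| + #|B| <= L)%N ->
  EE i (fun sg => ind Y B sg * `|dev D sg|) <=
  (1 + 8 * #|D|%:R ^+ 2 * C ^+ 2) * Num.sqrt x * th ^+ #|B|.
Proof.
move=> sDY g sz; have x_gt0 : 0 < x by rewrite ltr_wpDl // (lt_le_trans th_gt0).
set l := Num.sqrt x; have l0 : 0 < l by rewrite sqrtr_gt0.
have xl : x / l = l by rewrite -[x in LHS](sqr_sqrtr x0) -/l expr2 mulfK ?gt_eqF.
apply: le_trans (_ : EE i (fun sg => l * ind Y B sg + l^-1 * (ind Y B sg * dev D sg ^+ 2)) <= _).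
  apply: EE_le => // sg; have := norm_le_sqr (dev D sg) l0.
  move=> /(ler_wpM2l (ind_ge0 R (Y, B) sg)) h; apply: le_trans h _.
  by rewrite mulrDr [l * _]mulrC lerD2l mulrA mulrC lexx.
rewrite EED !EEZ.
have li0 : 0 <= l^-1 by rewrite invr_ge0 ltW.
apply: le_trans (lerD (ler_wpM2l (ltW l0) (proj2 (andP (PE_bounds i Y B))))
   (ler_wpM2l li0 (dev_sqr sDY g sz))) _.
rewrite -[X in _ <= (_ * X) * _]xl.
rewrite (_ : (1 + 8 * #|D|%:R ^+ 2 * C ^+ 2) * (x / l) * th ^+ #|B| =
  x / l * th ^+ #|B| + l^-1 * (#|D|%:R ^+ 2 * (8 * C ^+ 2 * x) * th ^+ #|B|)); last by ring.
by rewrite xl.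
Qed.

Definition threats (D : {set I}) : {set I * (H * {set tag})} :=
  [set z | (z.1 \in D) && (z.2 \in thr z.1)].

Definition collide (z z' : I * (H * {set tag})) : bool :=
  (z'.2.1 == z.2.1) && (z' != z).

Definition coll (D : {set I}) sg : R :=
  \sum_(z in threats D) \sum_(z' in threats D | collide z z')
     ind (req z.2.1) (z.2.2 :|: z'.2.2) sg.

Lemma sum_threats D (F : I -> H * {set tag} -> R) :
  \sum_(z in threats D) F z.1 z.2 = \sum_(y in D) \sum_(fr in thr y) F y fr.
Proof. by rewrite pair_big_dep; apply: eq_bigl => z; rewrite !inE. Qed.

(** A killer is a block, while [count] counts active threats; the excess is at most the number of
    pairs of active threats with the same block. *)
Lemma killers_count D (sg : state I H T) :
  #|killers sg D|%:R <= count D sg /\ count D sg - #|killers sg D|%:R <= coll D sg.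
Proof.
pose act (z : I * (H * {set tag})) := (req z.2.1 \subset sg.1) && (z.2.2 \subset sg.2).
pose A := [set z in threats D | act z].
have cE : count D sg = #|A|%:R.
  rewrite /count -(sum_threats D (fun y fr => ind (req fr.1) fr.2 sg)).
  rewrite -sum1_card natr_sum [RHS](eq_bigl (fun z => (z \in threats D) && act z)).
    rewrite big_mkcondr; apply: eq_bigr => z _.
    by rewrite /RandomProcess.ind /act /=; case: (_ && _).
  by move=> z; rewrite inE.
have kE : killers sg D = (fun z => z.2.1) @: A.
  apply/setP => f; apply/idP/imsetP => [|[z /setIdP[zD /andP[z1 z2]] ->]].
    rewrite inE => /andP[rf /existsP[y /andP[yD /existsP[fr /and3P[frt /eqP ef sf]]]]].
    by exists (y, fr); rewrite //= !inE /act /= yD frt ef rf sf.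
  rewrite inE z1 /=; move: zD; rewrite inE => /andP[zD zt].
  apply/existsP; exists z.1; rewrite zD /=; apply/existsP; exists z.2.
  by rewrite zt z2 eqxx.
rewrite cE kE; split; first by rewrite ler_nat leq_imset_card.
rewrite lerBlDl; apply: le_trans (_ : (#|[set z.2.1 | z in A]| +
  #|[set w : (I * (H * {set tag})) * (I * (H * {set tag})) |
     [&& w.1 \in A, w.2 \in A, w.1 != w.2 & w.1.2.1 == w.2.2.1]]|)%:R <= _).
  by rewrite ler_nat card_le_imset_collisions.
rewrite natrD lerD2l -sum1_card natr_sum /coll pair_big_dep /= big_mkcond [X in _ <= X]big_mkcond.
apply: ler_sum => -[z z'] _; rewrite inE [(z, z').1]/= [(z, z').2]/=.
case: ifPn => [/and4P[/setIdP[zD /andP[z1 z2]] /setIdP[zD' /andP[_ z2']] nz ez]|_]; last first.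
  by case: ifP => // _; exact: ind_ge0.
by rewrite zD zD' /= /collide [z' == z]eq_sym nz [z'.2.1 == _]eq_sym ez /= /RandomProcess.ind subUset z1 z2 z2'.
Qed.

Lemma sum_subset_le y f (W : {set tag}) : (#|W| <= L + m + m)%N ->
  \sum_(fr in thr y | (fr.1 == f) && (fr.2 \subset W)) (1 : R) <= C.
Proof.
move=> sW; apply: le_trans (c_pow _).
pose P := [set fr in thr y | (fr.1 == f) && (fr.2 \subset W)].
rewrite (eq_bigl (fun fr => fr \in P)) => [|fr]; last by rewrite inE.
rewrite sumr_const ler_nat; apply: leq_trans (_ : 2 ^ #|W| <= _)%N; last by rewrite leq_pexp2l.
rewrite -card_powerset.
rewrite -(card_in_imset (f := fun fr : H * {set tag} => fr.2) (D := P)).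
  apply/subset_leq_card/subsetP => _ /imsetP[fr /setIdP[_ /andP[_ h]] ->].
  by rewrite inE.
by move=> [a b] [a' b'] /setIdP[_ /andP[/eqP /= -> _]] /setIdP[_ /andP[/eqP /= -> _]] /= ->.
Qed.

(** By [thr_unique], a threat colliding with a nonexceptional one needs a further tag, which is rare
    by [thr_codeg]. Against an exceptional one there may also be boundedly many colliding threats
    without further tags, but the exceptional one is itself rare. *)
Lemma coll_bound (D Y : {set I}) B : D \subset Y -> good Y B -> (#|Y| + #|B| <= L)%N ->
  th * EE i (fun sg => ind Y B sg * coll D sg) <=
  #|D|%:R ^+ 2 * (3 * C ^+ 2 * nu) * th ^+ #|B|.
Proof.
move=> sDY g sz; set d : R := #|D|%:R; have d0 : 0 <= d by exact: ler0n.
have C0 : 0 <= C by exact: le_trans C1.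
pose S y (fr : H * {set tag}) : R := d * (C * nu) + (if fr \in exc Y B y then d * C else 0).
have inner z : z \in threats D ->
    \sum_(z' in threats D | collide z z') th ^+ #|z'.2.2 :\: (B :|: z.2.2)| <= S z.1 z.2.
  case: z => y fr; rewrite inE /= => /andP[yD frt].
  have sW : (#|B :|: fr.2| <= L + m + m)%N.
    have h := card_ext (k := L) frt sz.
    by apply: leq_trans (leq_addl _ _) (leq_trans h (leq_addr _ _)).
  set W := B :|: fr.2 in sW *.
  apply: le_trans (_ : \sum_(z' in threats D)
      ((if (z'.2.1 == fr.1) && ~~ (z'.2.2 \subset W) then th ^+ #|z'.2.2 :\: W| else 0) +
       (if (fr \in exc Y B y) && ((z'.2.1 == fr.1) && (z'.2.2 \subset W)) then 1 else 0)) <= _).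
    rewrite big_mkcondr; apply: ler_sum => z' /[!inE] /andP[z'D z't].
    rewrite /collide /=; case: eqP => [ef|_] /=; last by rewrite !andbF addr0.
    case: ifPn => nz; last by rewrite addr_ge0 //; case: ifP.
    case: (boolP (z'.2.2 \subset W)) => [sub|nsub] /=; last by rewrite lerDl; case: ifP.
    rewrite add0r andbT; case: ifPn => // fre; exfalso.
    have [e1 e2] := thr_unique g (subsetP sDY _ yD) (subsetP sDY _ z'D) frt fre z't ef sub.
    by case/negP: nz; rewrite -e1 -e2 -surjective_pairing.
  rewrite (sum_threats D (fun y' fr' =>
     (if (fr'.1 == fr.1) && ~~ (fr'.2 \subset W) then th ^+ #|fr'.2 :\: W| else 0) +
     (if (fr \in exc Y B y) && ((fr'.1 == fr.1) && (fr'.2 \subset W)) then 1 else 0))).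
  rewrite /S (_ : d * (C * nu) + _ = d * (C * nu + (if fr \in exc Y B y then C else 0))); last first.
    by case: ifP => _; rewrite ?addr0 // mulrDr.
  rewrite /d [X in _ <= X]mulr_natl -sumr_const; apply: ler_sum => y' y'D.
  rewrite big_split /= -big_mkcondr /=; apply: lerD; first exact: thr_codeg.
  case: (fr \in exc Y B y) => /=; last by rewrite big1.
  by rewrite -big_mkcondr /=; apply: sum_subset_le.
have -> : EE i (fun sg => ind Y B sg * coll D sg) =
   \sum_(z in threats D) \sum_(z' in threats D | collide z z')
      PE i (Y :|: req z.2.1, B :|: (z.2.2 :|: z'.2.2)).
  rewrite /coll; transitivity (EE i (fun sg => \sum_(z in threats D)
     \sum_(z' in threats D | collide z z')
       ind (Y :|: req z.2.1) (B :|: (z.2.2 :|: z'.2.2)) sg)).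
    apply: EE_ext => sg; rewrite mulr_sumr; apply: eq_bigr => z _.
    by rewrite mulr_sumr; apply: eq_bigr => z' _; exact: indU.
  by rewrite EE_sum; apply: eq_bigr => z _; rewrite EE_sum.
apply: le_trans (_ : th * \sum_(z in threats D) (th ^+ #|B| * (th ^+ #|z.2.2 :\: B| * S z.1 z.2)) <= _).
  rewrite ler_wpM2l // ler_sum // => z zD.
  apply: le_trans (ler_wpM2l _ (ler_wpM2l _ (inner z zD))) => //.
  rewrite mulr_sumr mulr_sumr ler_sum // => z' _.
  apply: le_trans (proj2 (andP (PE_bounds _ _ _))) _.
  by rewrite setUA thX_setU thX_setU mulrA.
rewrite -mulr_sumr (sum_threats D (fun y fr => th ^+ #|fr.2 :\: B| * S y fr)) mulrCA.
rewrite [X in _ <= X]mulrC ler_wpM2l // expr2 -mulrA [X in _ <= X]mulr_natl -sumr_const.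
rewrite mulr_sumr ler_sum // => y yD.
have sB : (#|B| <= L + m + m)%N.
  by apply: leq_trans (leq_addl #|Y| _) (leq_trans sz _); rewrite -addnA leq_addr.
have h1 := thr_crude y sB.
have h2 : th * (\sum_(fr in thr y | fr \in exc Y B y) th ^+ #|fr.2 :\: B|) <= C * nu.
  apply: thr_exc => //; last exact: (subsetP sDY).
  by apply: leq_trans sz _; rewrite -addnA leq_addr.
rewrite (_ : \sum_(fr in thr y) _ = d * (C * nu) * (\sum_(fr in thr y) th ^+ #|fr.2 :\: B|)
   + d * C * (\sum_(fr in thr y | fr \in exc Y B y) th ^+ #|fr.2 :\: B|)); last first.
  rewrite !mulr_sumr [X in _ + X]big_mkcondr /= -big_split; apply: eq_bigr => fr _ /=.
  by rewrite /S; case: ifP => _; ring.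
rewrite mulrDr ![th * (_ * _)]mulrCA.
have k1 : 0 <= d * (C * nu) by rewrite !mulr_ge0.
have k2 : 0 <= d * C by rewrite mulr_ge0.
apply: le_trans (lerD (ler_wpM2l k1 h1) (ler_wpM2l k2 h2)) _.
rewrite -/C (_ : d * (3 * C ^+ 2 * nu) = d * (C * nu) * C + d * C * (C * nu) + d * C * (C * nu)); last by ring.
by rewrite lerDl !mulr_ge0.
Qed.

(** A block of [B] that also kills an item of [Y] needs, by [thr_sel], a tag outside [B]; this is
    rare by [thr_codeg]. *)
Lemma select_killer (Y : {set I}) (B F : {set tag}) (Y1 : {set I}) : good Y B -> F \subset B -> (#|B| <= L)%N ->
  EE i (fun sg => ind Y1 (B :\: F) sg * (~~ [disjoint blocks F & killers sg Y])%:R) <=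
  #|F|%:R * (#|Y|%:R * (C * nu)) * th ^+ #|B :\: F|.
Proof.
move=> g sF sB.
apply: le_trans (_ : \sum_(b in F) \sum_(y in Y) \sum_(fr in thr y | (fr.1 == b.1) &&
    ~~ (fr.2 \subset B :\: F)) th ^+ #|B :\: F| * th ^+ #|fr.2 :\: (B :\: F)| <= _).
  apply: le_trans (_ : EE i (fun sg => \sum_(b in F) \sum_(y in Y) \sum_(fr in thr y |
      (fr.1 == b.1) && ~~ (fr.2 \subset B :\: F)) ind set0 (B :\: F :|: fr.2) sg) <= _).
    apply: EE_le => // sg.
    have pos b y : 0 <= \sum_(fr in thr y | (fr.1 == b.1) && ~~ (fr.2 \subset B :\: F))
        ind set0 (B :\: F :|: fr.2) sg :> R.
      by apply: sumr_ge0 => fr _; exact: ind_ge0.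
    have pos' (b : tag) : 0 <= \sum_(y in Y) \sum_(fr in thr y | (fr.1 == b.1) && ~~ (fr.2 \subset B :\: F))
        ind set0 (B :\: F :|: fr.2) sg :> R.
      by apply: sumr_ge0 => y _; exact: pos.
    case: (boolP [disjoint _ & _]) => [_|nd]; first by rewrite mulr0 sumr_ge0.
    rewrite mulr1; case: (boolP (ind Y1 (B :\: F) sg == 0)) => [/eqP->|]; first by rewrite sumr_ge0.
    rewrite /RandomProcess.ind /=; case: (boolP (_ && _)) => [/andP[_ sS]|]; last by rewrite eqxx.
    move=> _; move: nd; rewrite -setI_eq0 => /set0Pn[f /setIP[/imsetP[b bF ->]]].
    rewrite inE => /andP[_ /existsP[y /andP[yY /existsP[fr /and3P[frt /eqP ef sf]]]]].
    rewrite (bigD1 b bF) /= (bigD1 y yY) /= (bigD1 fr) /=; last first.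
      rewrite frt ef eqxx /=; have := thr_sel g yY (subsetP sF b bF) frt ef.
      by apply: contraNN => h; apply: subset_trans h (subsetDl _ _).
    rewrite sub0set subUset sS sf /= -addrA -addrA lerDl addr_ge0 //.
      by apply: sumr_ge0 => z _; exact: ler0n.
    by apply: addr_ge0; do 3 try (apply: sumr_ge0 => ? _); exact: ler0n.
  rewrite EE_sum ler_sum // => b _; rewrite EE_sum ler_sum // => y _; rewrite EE_sum ler_sum // => fr _.
  by rewrite -thX_setU; exact: (PE_crude req thr Y0 w0_ge0 w0_sum th01).
rewrite -mulrA [X in _ <= X]mulr_natl -sumr_const ler_sum // => b _.
rewrite -mulrA [X in _ <= X]mulr_natl -sumr_const ler_sum // => y _.
rewrite -mulr_sumr mulrC ler_wpM2r // thr_codeg //.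
apply: leq_trans (subset_leq_card (subsetDl _ _)) (leq_trans sB _).
by rewrite -addnA leq_addr.
Qed.

Lemma early_now (B : {set tag}) : (forall b, b \in B -> (b.2 <= i)%N) ->
  early i B = B :\: now i B.
Proof.
move=> Bi; apply/setP => b; rewrite !inE; case: (boolP (b \in B)) => //= bB.
by rewrite andbT ltn_neqAle Bi // andbT.
Qed.

Lemma pred_step (Y : {set I}) (B : {set tag}) : (forall b, b \in B -> (b.2 <= i)%N) ->
  good Y B -> pred i.+1 Y B = th ^+ #|now i B| *
    (pred i (Y :|: reqs req (now i B)) (early i B) * expR (- kapS Y)).
Proof.
move=> Bi g; have sN : now i B \subset B by apply/subsetP => b /setIdP[].
have [_ w] := good_moves i erefl sN g.
rewrite /pred w early_now //.
have -> : Wt i.+1 Y = Wt i Y * expR (- kapS Y).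
  rewrite /Wt /kapS -sumrN expR_sum -big_split; apply: eq_bigr => y _ /=.
  rewrite /pt; case: (ty y) => [[]|]; [exact: p_rec|exact: q_rec|].
  by rewrite /kap Theta_static mulr0 oppr0 expR0 mulr1.
have -> : \prod_(b in B) gl i.+1 b.2 =
   (th * al i) ^+ #|now i B| * \prod_(b in B :\: now i B) gl i b.2.
  rewrite (big_setID (now i B)) /= (setIidPr sN); congr (_ * _).
    rewrite -prodr_const; apply: eq_bigr => b /setIdP[_ /eqP bi].
    by rewrite /gl bi ltnSn.
  rewrite -early_now //; apply: eq_bigr => b /setIdP[_ bi].
  by rewrite /gl bi ltnW.
by rewrite exprMn; ring.
Qed.

Lemma kapS_ge0 D : 0 <= kapS D.
Proof. by apply: sumr_ge0 => y _; case/andP: (kap_bounds L i y). Qed.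

Lemma count_crude (D Y : {set I}) (B : {set tag}) : (#|B| <= L)%N ->
  th * EE i (fun sg => ind Y B sg * count D sg) <= #|D|%:R * C * th ^+ #|B|.
Proof.
move=> sB; have -> : EE i (fun sg => ind Y B sg * count D sg) =
    \sum_(y in D) \sum_(fr in thr y) PE i (Y :|: req fr.1, B :|: fr.2).
  transitivity (EE i (fun sg => \sum_(y in D) \sum_(fr in thr y)
      ind (Y :|: req fr.1) (B :|: fr.2) sg)).
    apply: EE_ext => sg; rewrite mulr_sumr; apply: eq_bigr => y _.
    by rewrite mulr_sumr; apply: eq_bigr => fr _; exact: indU.
  by rewrite EE_sum; apply: eq_bigr => y _; rewrite EE_sum.
rewrite mulr_sumr -mulrA [X in _ <= X]mulr_natl -sumr_const ler_sum // => y _.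
have sB' : (#|B| <= L + m + m)%N by rewrite (leq_trans sB) // -addnA leq_addr.
apply: le_trans (ler_wpM2r (thX0 #|B|) (thr_crude y sB')).
rewrite -mulrA ler_wpM2l // mulr_suml ler_sum // => fr _.
by case/andP: (PE_bounds i (Y :|: req fr.1) (B :|: fr.2)) => _; rewrite thX_setU mulrC.
Qed.

(** Three replacements, one per error term: the number of killers by the number of threats, the
    power by an exponential, the exponent by its prediction. *)
Lemma survive_approx (sg : state I H T) (D : {set I}) :
  `|(1 - th) ^+ #|killers sg D| - expR (- kapS D)| <=
  th * coll D sg + th ^+ 2 * count D sg + `|dev D sg|.
Proof.
have [k1 k2] := killers_count D sg.
have cE : exists n : nat, count D sg = n%:R.
  exists (\sum_(y in D) \sum_(fr in thr y) (((req fr.1 \subset sg.1) && (fr.2 \subset sg.2)) : nat))%N.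
  by rewrite natr_sum; apply: eq_bigr => y _; rewrite natr_sum.
case: cE => n cn; rewrite cn ler_nat in k1.
apply: le_trans (ler_distD ((1 - th) ^+ n) _ _) _.
rewrite -addrA lerD //.
  apply: le_trans (pow1B_lip th01 k1) _; rewrite -cn ler_wpM2l //.
apply: le_trans (ler_distD (expR (- (th * n%:R))) _ _) _; rewrite lerD //.
  by rewrite cn [th ^+ 2 * _]mulrC; exact: pow1B_expR.
by rewrite /dev cn; apply: expR_opp_le; rewrite ?kapS_ge0 // mulr_ge0.
Qed.

Lemma chaos_step (Y : {set I}) (B : {set tag}) :
  good Y B -> ((#|Y| + #|B|) * m.+1 <= L)%N ->
  `|PE i.+1 (Y, B) - pred i.+1 Y B| <=
  9 * (L.+1%:R ^+ 2 * C ^+ 2) * (x + Num.sqrt x) * th ^+ #|B|.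
Proof.
move=> g sz.
have C0 : 0 <= C by exact: le_trans C1.
set La : R := L.+1%:R; have La1 : 1 <= La by rewrite ler1n.
have La0 : 0 <= La by exact: le_trans La1.
have sqx0 : 0 <= Num.sqrt x by exact: sqrtr_ge0.
have K0 : 0 <= 9 * (La ^+ 2 * C ^+ 2) * (x + Num.sqrt x) by rewrite !mulr_ge0 ?exprn_ge0 ?addr_ge0.
(* A label beyond round [i] makes both the probability and the prediction vanish. *)
case: (boolP [forall b in B, (b.2 <= i)%N]) => [/forallP Bi|]; last first.
  rewrite negb_forall => /existsP[b]; rewrite negb_imply -ltnNge => /andP[bB ib].
  rewrite [PE _ _](_ : _ = 0); last first.
    transitivity (EE i (fun=> 0)); last exact: EE_cst.
    rewrite /RandomProcess.PE /=; apply: EE_ext => sg; rewrite big1 // => w _.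
    by rewrite (ind_step_future _ _ _ _ _ _ bB) // mulr0.
  rewrite /pred (bigD1 b bB) /= {1}/gl ltnS leqNgt ib /= mul0r mulr0 subrr normr0.
  by rewrite mulr_ge0.
have {}Bi b : b \in B -> (b.2 <= i)%N by move=> bB; have := Bi b; rewrite bB.
set F := now i B; have sF : F \subset B by apply/subsetP => b /setIdP[].
set Y1 := Y :|: reqs req F; set B1 := B :\: F.
have [g1 _] := good_moves i erefl sF g.
have sYL : (#|Y| <= L)%N.
  by apply: leq_trans sz; rewrite mulnS -addnA leq_addr.
have sBL : (#|B| <= L)%N.
  by apply: leq_trans sz; rewrite mulnS -addnA [(#|B| + _)%N]addnC addnA leq_addl.
have cF : (#|F| <= #|B|)%N by exact: subset_leq_card.
have cB1 : (#|B1| <= #|B|)%N by apply/subset_leq_card/subsetDl.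
have sz1 : (#|Y1| + #|B1| <= L)%N.
  apply: leq_trans sz; rewrite mulnS [((#|Y| + _) * m)%N]mulnDl.
  have h1 : (#|reqs req F| <= #|B| * m)%N.
    apply: leq_trans (_ : #|F| * m <= _)%N; last by rewrite leq_mul2r cF orbT.
    rewrite -sum_nat_const; apply: leq_trans (_ : \sum_(b in F) #|req b.1| <= _)%N.
      rewrite /reqs; elim/big_rec2: _ => [|b k S _ le]; first by rewrite cards0.
      by apply: leq_trans (leq_card_setU _ _) _; rewrite leq_add2l.
    by apply: leq_sum.
  apply: leq_trans (leq_add (leq_trans (leq_card_setU _ _) (leq_add (leqnn _) h1)) cB1) _.
  by rewrite -!addnA leq_add2l addnC leq_add2l leq_addl.
have cBB : #|B| = (#|F| + #|B1|)%N.
  by rewrite -(cardsID F B) (setIidPr sF).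
rewrite pred_step // -/F early_now // -/F -/Y1 -/B1 cBB exprD.
have -> : PE i.+1 (Y, B) = th ^+ #|F| * EE i (fun sg => ind Y1 B1 sg *
    ([disjoint blocks F & killers sg Y]%:R * (1 - th) ^+ #|killers sg Y|)).
  rewrite -EEZ /RandomProcess.PE /=; apply: EE_ext => sg; rewrite sum_ind_step // early_now //.
  exact: mulr4_rot.
rewrite -mulrBr normrM (ger0_norm (thX0 _)).
rewrite [X in _ <= X]mulrCA ler_wpM2l //.
set ex := expR (- kapS Y).
have ex01 : 0 <= ex <= 1.
  by rewrite expR_ge0 /= -expR0 ler_expR oppr_le0 kapS_ge0.
have -> : EE i (fun sg => ind Y1 B1 sg *
    ([disjoint blocks F & killers sg Y]%:R * (1 - th) ^+ #|killers sg Y|)) -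
   pred i Y1 B1 * ex =
   EE i (fun sg => ind Y1 B1 sg *
    ([disjoint blocks F & killers sg Y]%:R * (1 - th) ^+ #|killers sg Y| - ex)) +
   ex * (PE i (Y1, B1) - pred i Y1 B1).
  set G := fun sg => ind Y1 B1 sg * (_ - ex).
  have -> : EE i G = EE i (fun sg => ind Y1 B1 sg *
      ([disjoint blocks F & killers sg Y]%:R * (1 - th) ^+ #|killers sg Y|)) - ex * PE i (Y1, B1).
    by rewrite -EEZ -EEB; apply: EE_ext => sg; rewrite /G mulrBr [ex * _]mulrC.
  by rewrite mulrBr addrA subrK [ex * pred _ _ _]mulrC.
apply: le_trans (ler_normD _ _) _.
rewrite normrM (ger0_norm (proj1 (andP ex01))).
have t5 : ex * `|PE i (Y1, B1) - pred i Y1 B1| <= e * th ^+ #|B1|.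
  apply: le_trans (IH g1 _).
    by rewrite ler_piMl // (proj2 (andP ex01)).
  by rewrite (leq_trans sz1) // -addnA leq_addr.
have t14 : `|EE i (fun sg => ind Y1 B1 sg *
    ([disjoint blocks F & killers sg Y]%:R * (1 - th) ^+ #|killers sg Y| - ex))| <=
   EE i (fun sg => ind Y1 B1 sg * (~~ [disjoint blocks F & killers sg Y])%:R) +
   (th * EE i (fun sg => ind Y1 B1 sg * coll Y sg) +
    th * (th * EE i (fun sg => ind Y1 B1 sg * count Y sg)) +
    EE i (fun sg => ind Y1 B1 sg * `|dev Y sg|)).
  have nrm g' : `|EE i g'| <= EE i (fun sg => `|g' sg|) by exact: EE_norm.
  apply: le_trans (nrm _) _.
  rewrite -!EEZ -!EED; apply: EE_le => // sg.
  rewrite normrM ger0_norm ?ind_ge0 //.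
  have fac (a b k d f h : R) : a * b + (k * (a * d) + k * (k * (a * f)) + a * h) =
      a * (b + (k * d + k ^+ 2 * f + h)) by ring.
  rewrite fac.
  rewrite ler_wpM2l ?ind_ge0 //.
  case: (boolP [disjoint _ & _]) => _ /=.
    by rewrite mul1r add0r survive_approx.
  have := survive_approx sg Y; rewrite mul0r sub0r normrN (ger0_norm (proj1 (andP ex01))).
  move=> h; apply: le_trans (proj2 (andP ex01)) _; rewrite lerDl.
  exact: le_trans (normr_ge0 _) h.
have sY1 : Y \subset Y1 by exact: subsetUl.
have t1 := select_killer Y1 g sF sBL.
have t2 := coll_bound sY1 g1 sz1.
have t3 := ler_wpM2l th0 (count_crude Y Y1 (leq_trans cB1 sBL)).
have t4 := dev_abs sY1 g1 sz1.
apply: le_trans (lerD (le_trans t14 (lerD t1 (lerD (lerD t2 t3) t4))) t5) _.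
have thB := thX0 #|B1|.
have fac (a b k d f r t : R) : a * t + (b * t + k * (d * t) + f * t) + r * t =
    (a + (b + k * d + f) + r) * t by ring.
rewrite fac ler_wpM2r // {fac}.
have dY : #|Y|%:R <= La by rewrite ler_nat (leq_trans sYL).
have dF : #|F|%:R <= La by rewrite ler_nat (leq_trans cF) // (leq_trans sBL).
have dY0 : (0 : R) <= #|Y|%:R by exact: ler0n.
have dF0 : (0 : R) <= #|F|%:R by exact: ler0n.
have nx : nu <= x by rewrite lerDr.
have ex' : e <= x by rewrite lerDl.
have tx : th <= x by exact: le_trans nx.
move: (#|Y|%:R : R) (#|F|%:R : R) dY dF dY0 dF0 => d f dY dF dY0 dF0.
have CC : C <= C ^+ 2 by rewrite expr2 ler_peMl.
have dd : d * d <= La ^+ 2 by rewrite expr2 ler_pM.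
have df : f * d <= La ^+ 2 by rewrite expr2 ler_pM.
have dl : d <= La ^+ 2 by apply: le_trans dY _; rewrite expr2 ler_peMl.
have l1 : 1 <= La ^+ 2 * C ^+ 2 by rewrite mulr_ege1 // exprn_ege1.
set P := La ^+ 2 * C ^+ 2 in l1 *.
have La20 : 0 <= La ^+ 2 by exact: exprn_ge0.
have C20 : 0 <= C ^+ 2 by exact: exprn_ge0.
have P0 : 0 <= P by exact: le_trans l1.
have u1 : f * d * C * nu <= P * x.
  by apply: ler_pM => //; rewrite ?mulr_ge0 //; apply: ler_pM => //; rewrite mulr_ge0.
have u2 : d ^+ 2 * C ^+ 2 * nu <= P * x.
  by apply: ler_pM => //; rewrite ?mulr_ge0 ?exprn_ge0 //; apply: ler_pM => //; rewrite ?exprn_ge0.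
have u3 : d * C * th <= P * x.
  by apply: ler_pM => //; rewrite ?mulr_ge0 //; apply: ler_pM.
have u4 : d ^+ 2 * C ^+ 2 * Num.sqrt x <= P * Num.sqrt x.
  by apply: ler_wpM2r => //; apply: ler_pM => //; rewrite exprn_ge0.
have u5 : e <= P * x by apply: le_trans ex' _; rewrite ler_peMl.
have u6 : Num.sqrt x <= P * Num.sqrt x by rewrite ler_peMl.
have u7 : 0 <= P * x by rewrite mulr_ge0.
exact: step_error_sum u1 u2 u3 u4 u5 u6 u7.
Qed.

End Step.

Theorem chaos i L (Y : {set I}) (B : {set tag}) : good Y B -> (#|Y| + #|B| <= L)%N ->
  `|PE i (Y, B) - pred i Y B| <= chaos_err c nu m i L * th ^+ #|B|.
Proof.
elim: i L Y B => [|i IH] L Y B g sz /=.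
  rewrite mul0r; have -> : PE 0 (Y, B) = \sum_o w0 o * ((Y \subset Y0 o) && (B == set0))%:R.
    by apply: eq_bigr => o _; rewrite /RandomProcess.ind /= subset0.
  case: (eqVneq B set0) => [B0|/set0Pn[b bB]].
    rewrite B0 in g *; rewrite /pred big_set0 mulr1 -(good_init g).
    rewrite (eq_bigr (fun o => w0 o * (Y \subset Y0 o)%:R)) ?subrr ?normr0 // => o _.
    by rewrite andbT.
  rewrite big1 => [|o _]; last by rewrite andbF mulr0.
  by rewrite /pred (bigD1 b bB) /= {1}/gl mul0r mulr0 subrr normr0.
have sz1 : ((#|Y| + #|B|) * m.+1 <= L * m.+1)%N by rewrite leq_mul2r sz orbT.
apply: (chaos_step (L := (L * m.+1)%N)) g sz1; first exact: chaos_err_ge0.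
by move=> Y' B' g' sz'; apply: IH.
Qed.

End Chaos.

End Chaos.

(** * The deterministic trajectory *)

Module Trajectory.
Import Order.TTheory GRing.Theory Num.Theory.
Local Open Scope ring_scope.

Section Trajectory.
Variable R : realType.

Lemma expR_opp_upper (x : R) : 0 <= x -> expR (- x) <= (1 + x)^-1.
Proof.
move=> x0; have x1 : 0 < 1 + x by rewrite ltr_wpDr.
by rewrite expRN lef_pV2 ?expR_ge1Dx ?posrE ?expR_gt0.
Qed.

Variables (kJ nJ : nat) (eps c1 c2 c3 eta : R).
Hypothesis kJ_gt0 : (0 < kJ)%N.
Hypothesis eps0 : 0 < eps.
Hypothesis eps1 : eps < 1.
Hypothesis c10 : 0 < c1.
Hypothesis c20 : 0 <= c2.
Hypothesis c30 : 0 <= c3.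
Hypothesis eta0 : 0 < eta.

(** A budget: selecting costs alive pairs, so [N * s] never exceeds [M]. Hence the hazard of a token
    stays below [K] per unit of selection and its survival above [qmin]; [c4] is the resulting decay
    rate of [p] while [p] exceeds [eta]. *)
Let M := (1 + c2) / c1.
Let K := c3 * (1 + M) ^+ 5.
Let qmin := expR (- (K * M)).
Let c4 := c1 * eta ^+ kJ.-1 * qmin * eps ^+ nJ.

(** By this time exponential decay at rate [c4] brings [p] down to exp(-1/eta), which is below
    [eta]. *)
Definition horizon : R := (eta * c4)^-1.

Lemma horizon_gt0 : 0 < horizon.
Proof. by rewrite invr_gt0 !mulr_gt0 ?exprn_gt0 ?expR_gt0. Qed.

Variables (T : nat) (th d N : R) (p q s Pc Qc : nat -> R).
Hypothesis d01 : 0 < d <= 1.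
Hypothesis N0 : 0 < N.
Hypothesis thE : th * N = d.
Let a i := p i ^+ kJ * q i * eps ^+ nJ.
Hypothesis p0E : p 0%N = 1 - eps.
Hypothesis q0E : q 0%N = 1.
Hypothesis s0E : s 0%N = 0.
Hypothesis p_rec : forall i, (i < T)%N -> p i.+1 = p i * expR (- (p i ^+ kJ.-1 * q i * eps ^+ nJ * Pc i)).
Hypothesis q_rec : forall i, (i < T)%N -> q i.+1 = q i * expR (- (a i * Qc i)).
Hypothesis s_rec : forall i, (i < T)%N -> s i.+1 = s i + th * a i.
Hypothesis Pc_bounds : forall i, c1 * d <= Pc i <= c2 * d.
Hypothesis Qc_bounds : forall i, 0 <= s i -> 0 <= Qc i <= d * (c3 * (1 + N * s i) ^+ 5).

Lemma trajectory_inv i : (i <= T)%N ->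
  [/\ 0 < p i <= 1, 0 < q i <= 1, 0 <= N * s i <= M * (1 - p i) & expR (- (K * (N * s i))) <= q i].
Proof.
case/andP: d01 => d0 d1.
have M0 : 0 < M by rewrite divr_gt0 // ltr_wpDr.
have K0 : 0 <= K by rewrite mulr_ge0 // exprn_ge0 // addr_ge0 // ltW.
elim: i => [|i IH] iT.
  rewrite p0E q0E s0E !mulr0 oppr0 expR0 lexx ltr01; split => //.
    by rewrite subr_gt0 eps1 lerBlDr lerDl ltW.
  by rewrite lexx opprB addrCA subrr addr0 mulr_ge0 // ltW.
have [/andP[p0 p1] /andP[q0 q1] /andP[s0 sM] qK] := IH (ltnW iT).
have s0' : 0 <= s i by rewrite -(pmulr_rge0 _ N0).
case/andP: (Pc_bounds i) => P1 P2; case/andP: (Qc_bounds s0') => Q0 Q1.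
have e0 : 0 < eps ^+ nJ by rewrite exprn_gt0.
have e1 : eps ^+ nJ <= 1 by rewrite exprn_ile1 // ltW.
pose b := p i ^+ kJ.-1 * q i * eps ^+ nJ.
have b0 : 0 < b by rewrite !mulr_gt0 // exprn_gt0.
have b1 : b <= 1 by rewrite !mulr_ile1 ?mulr_ge0 ?exprn_ge0 ?exprn_ile1 // ltW.
have aE : a i = p i * b by rewrite /a /b !mulrA -exprS prednK.
have a0 : 0 < a i by rewrite aE mulr_gt0.
pose x := b * Pc i.
have P0 : 0 <= Pc i by apply: le_trans P1; rewrite ltW // mulr_gt0.
have x0 : 0 <= x by rewrite mulr_ge0 // ltW.
have xc : x <= c2.
  apply: le_trans (_ : Pc i <= _); first by rewrite ler_piMl.
  by apply: le_trans P2 _; rewrite ler_piMr.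
have pE : p i.+1 = p i * expR (- x) by rewrite p_rec.
have ex0 := expR_gt0 (- x).
have ex1 : expR (- x) <= 1 by rewrite -expR0 ler_expR oppr_le0.
(* Selection is paid for by a proportionate loss of [p]: exp(-x) is at most 1/(1 + x), which lies
   below its chord 1 - x/(1 + c2) over [0, c2]. *)
have drop : d * a i <= M * (p i - p i.+1).
  have h1 := expR_opp_upper x0.
  have h2 : (1 + x)^-1 <= 1 - x / (1 + c2).
    have y0 : 0 < 1 + x by rewrite ltr_wpDr.
    have w0 : 0 < 1 + c2 by rewrite ltr_wpDr.
    rewrite -(ler_pM2r y0) mulVf ?gt_eqF // -(ler_pM2r w0) mul1r.
    rewrite (_ : (1 - x / (1 + c2)) * (1 + x) * (1 + c2) = (1 + c2 - x) * (1 + x)); last first.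
      by field; rewrite gt_eqF.
    nra.
  have h3 : x / (1 + c2) <= 1 - expR (- x) by lra.
  have -> : p i - p i.+1 = p i * (1 - expR (- x)) by rewrite pE; ring.
  apply: le_trans (_ : M * (p i * (x / (1 + c2))) <= _); last first.
    by rewrite ler_wpM2l ?(ltW M0) // ler_wpM2l // ltW.
  have -> : M * (p i * (x / (1 + c2))) = (a i * Pc i) / c1.
    by rewrite /M aE /x; field; rewrite !gt_eqF // ltr_wpDr.
  rewrite ler_pdivlMr // -mulrA mulrCA ler_wpM2l ?(ltW a0) //; lra.
have sE : N * s i.+1 = N * s i + d * a i.
  by rewrite s_rec // mulrDr mulrA [N * th]mulrC thE.
have p1' : p i.+1 <= p i by rewrite pE ler_piMr // ltW.
have Ns : 0 <= N * s i.+1 by rewrite sE addr_ge0 // mulr_ge0 // ltW.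
have NsM : N * s i.+1 <= M * (1 - p i.+1) by rewrite sE; nra.
split.
- by rewrite pE mulr_gt0 //= -pE (le_trans p1').
- rewrite q_rec // mulr_gt0 ?expR_gt0 //=.
  rewrite mulr_ile1 ?expR_ge0 //; first exact: ltW.
  by rewrite -expR0 ler_expR oppr_le0 mulr_ge0 // ltW.
- by rewrite Ns NsM.
- rewrite q_rec // sE mulrDr opprD expRD ler_pM ?expR_ge0 // ler_expR lerN2.
  have sM' : N * s i <= M by apply: le_trans sM _; rewrite ler_piMr ?(ltW M0) // lerBlDr lerDl ltW.
  have h : (1 + N * s i) ^+ 5 <= (1 + M) ^+ 5.
    by rewrite lerXn2r ?nnegrE ?addr_ge0 ?(ltW M0) // lerD2l.
  apply: le_trans (ler_wpM2l (ltW a0) Q1) _.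
  rewrite (_ : K * (d * a i) = a i * (d * K)); last by ring.
  by rewrite ler_wpM2l ?(ltW a0) // ler_wpM2l ?(ltW d0) // ler_wpM2l.
Qed.

Lemma trajectory_small : horizon <= d * T%:R -> p T <= eta.
Proof.
case/andP: (d01) => d0 d1 hT.
have c40 : 0 < c4 by rewrite !mulr_gt0 ?exprn_gt0 ?expR_gt0.
have M0 : 0 < M by rewrite divr_gt0 // ltr_wpDr.
have K0 : 0 <= K by rewrite mulr_ge0 // exprn_ge0 // addr_ge0 // ltW.
have key i : (i <= T)%N -> p i <= eta \/ p i <= expR (- (c4 * (d * i%:R))).
  elim: i => [|i IH] iT.
    right; rewrite p0E mulr0 mulr0 oppr0 expR0 lerBlDr lerDl ltW //.
  have [/andP[p0 p1] /andP[q0 q1] /andP[s0 sM] qK] := trajectory_inv (ltnW iT).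
  case/andP: (Pc_bounds i) => P1 P2.
  have P0 : 0 <= Pc i by apply: le_trans P1; rewrite ltW // mulr_gt0.
  have e0 : 0 < eps ^+ nJ by rewrite exprn_gt0.
  have b0 : 0 <= p i ^+ kJ.-1 * q i * eps ^+ nJ by rewrite !mulr_ge0 ?exprn_ge0 // ltW.
  have x0 : expR (- (p i ^+ kJ.-1 * q i * eps ^+ nJ * Pc i)) <= 1.
    by rewrite -expR0 ler_expR oppr_le0 mulr_ge0.
  have dec : p i.+1 <= p i by rewrite p_rec // ler_piMr // ltW.
  case: (leP (p i) eta) => [pe|/ltW pe]; first by left; exact: le_trans pe.
  case: (IH (ltnW iT)) => [pe'|pe']; first by left; exact: le_trans pe'.
  right; rewrite p_rec // -[i.+1%:R]natr1 !mulrDr mulr1 opprD expRD.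
  rewrite ler_pM ?expR_ge0 ?(ltW p0) // ler_expR lerN2.
  have qm : qmin <= q i.
    apply: le_trans qK; rewrite ler_expR lerN2 ler_wpM2l //.
    by apply: le_trans sM _; rewrite ler_piMr ?(ltW M0) // lerBlDr lerDl ltW.
  have pk : eta ^+ kJ.-1 <= p i ^+ kJ.-1 by rewrite lerXn2r // nnegrE ltW.
  apply: le_trans (_ : p i ^+ kJ.-1 * q i * eps ^+ nJ * (c1 * d) <= _); last by rewrite ler_wpM2l.
  rewrite (_ : c4 * d = eta ^+ kJ.-1 * qmin * eps ^+ nJ * (c1 * d)); last by rewrite /c4; ring.
  rewrite ler_wpM2r ?mulr_ge0 ?(ltW c10) ?(ltW d0) // ler_wpM2r ?(ltW e0) //.
  apply: ler_pM => //; last exact: expR_ge0.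
  by rewrite exprn_ge0 // ltW.
case: (key T (leqnn T)) => // h; apply: le_trans h _.
apply: le_trans (_ : expR (- (c4 * horizon)) <= _).
  by rewrite ler_expR lerN2 ler_wpM2l // ltW.
have -> : c4 * horizon = eta^-1 by rewrite /horizon; field; rewrite !gt_eqF.
apply: le_trans (expR_opp_upper _) _; first by rewrite invr_ge0 ltW.
rewrite -[X in _ <= X]invrK lef_pV2 ?posrE ?invr_gt0 ?ltr_wpDl ?invr_gt0 //.
by rewrite lerDr.
Qed.

End Trajectory.

End Trajectory.

(** * Copies of the gadget and critical families *)

Module Blocks.
Import RandomProcess.
Lemma glue_arith1 k a b x y z : k * a.+1 + 2 <= x -> k * b + 3 <= y -> z <= k + 2 ->
  z <= y -> k * (b + a) + 2 = y + x - z -> False.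
Proof. rewrite mulnS mulnDr; move: (k * a) (k * b) => ka kb; lia. Qed.

Lemma glue_arith2 k a b x yA yB c d s t : k * a.+1 + s <= x -> x = k + 2 + yA - c ->
  k * b + t <= yB -> k * (b + a) + 2 = yB + yA - d -> d <= c -> c <= yA -> c <= k + 2 ->
  s + t <= 4 /\ (s + t = 4 -> c <= d).
Proof. rewrite mulnS mulnDr; move: (k * a) (k * b) => ka kb; lia. Qed.

Lemma glue_arith3 k a y c : k * a + 3 <= y -> k + 2 + y - c = k * a.+1 + 2 -> c <= y -> 2 < c.
Proof. rewrite mulnS; move: (k * a) => ka; lia. Qed.

Section Blocks.
Variables (V : finType) (n : nat).

Definition block := {f : {ffun V -> 'I_n} | injectiveb f}.

Definition img (f : block) (e : {set V}) : {set 'I_n} := [set val f x | x in e].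
Definition vs (f : block) : {set 'I_n} := img f setT.
Definition VV (D : {set block}) : {set 'I_n} := \bigcup_(f in D) vs f.

Lemma block_inj (f : block) : injective (val f).
Proof. exact/injectiveP/(valP f). Qed.

Lemma card_img f e : #|img f e| = #|e|.
Proof. exact/card_imset/block_inj. Qed.

Lemma card_vs f : #|vs f| = #|V|.
Proof. by rewrite /vs card_img cardsT. Qed.

Lemma img_sub f e : img f e \subset vs f.
Proof. exact/imsetS/subsetT. Qed.

Lemma img_inj f : injective (img f).
Proof. exact/imset_inj/block_inj. Qed.

Lemma VV_sup f (D : {set block}) : f \in D -> vs f \subset VV D.
Proof. by move=> fD; apply: (bigcup_sup f). Qed.

Lemma VVS (D D' : {set block}) : D \subset D' -> VV D \subset VV D'.
Proof. by move=> s; apply/bigcupsP => f fD; apply/VV_sup/(subsetP s). Qed.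

Lemma VVU (D D' : {set block}) : VV (D :|: D') = VV D :|: VV D'.
Proof. exact: bigcup_setU. Qed.

Lemma VV1 f : VV [set f] = vs f.
Proof. exact: big_set1. Qed.

Lemma VV0 : VV set0 = set0.
Proof. exact: big_set0. Qed.

Lemma VVU1 f (D : {set block}) : VV (f |: D) = vs f :|: VV D.
Proof. by rewrite VVU VV1. Qed.

Hypothesis V3 : 2 < #|V|.
Let w := #|V| - 2.
Let w2 : #|V| = w + 2. Proof. by rewrite subnK // ltnW. Qed.

(** The vertex more that is asked of proper subfamilies makes these the minimal families spanning so
    little. In particular, two blocks sharing two vertices never occur in one. *)
Definition crit (C : {set block}) : bool :=
  [&& 2 < #|C|, #|C| <= 7, #|VV C| == w * #|C| + 2 &
    [forall D : {set block}, (D \proper C) && (1 < #|D|) ==> (w * #|D| + 3 <= #|VV D|)]].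

Lemma crit_sub (C D : {set block}) : crit C -> D \subset C -> D != C -> 1 < #|D| -> w * #|D| + 3 <= #|VV D|.
Proof.
by case/and4P => _ _ _ /forallP/(_ D) /implyP h s nD c; apply: h; rewrite properEneq nD s.
Qed.

Lemma crit_card (C : {set block}) : crit C -> #|VV C| = w * #|C| + 2.
Proof. by case/and4P => _ _ /eqP. Qed.

Lemma crit_pair (C : {set block}) a b : crit C -> a \in C -> b \in C -> a != b -> #|vs a :&: vs b| <= 1.
Proof.
move=> cC aC bC ab; have c2 : #|[set a; b]| = 2 by rewrite cards2 ab.
have sC : [set a; b] \subset C by apply/subsetP => x /set2P[] ->.
have := crit_sub cC sC _ _; rewrite c2 VVU !VV1 cardsU !card_vs => h.
have nC : [set a; b] != C.
  by apply: contraTneq cC => <-; rewrite /crit c2.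
have := h nC isT; have := subset_leq_card (subsetIl (vs a) (vs b)); rewrite card_vs /w.
move: V3; lia.
Qed.

Lemma VV_ge (D C : {set block}) f : crit C -> D \subset C -> D != C -> f \in D -> w * #|D| + 2 <= #|VV D|.
Proof.
move=> cC s nD fD; case: (ltnP 1 #|D|) => [c|c].
  by apply: leq_trans (crit_sub cC s nD c); rewrite leq_add2l.
have -> : D = [set f].
  by apply/eqP; rewrite eq_sym eqEcard sub1set fD cards1.
by rewrite VV1 card_vs cards1 muln1 /w subnK // ltnW.
Qed.

(* An overlap of at most two vertices cannot complete a critical family. *)
Lemma crit_attach (C : {set block}) f (D : {set block}) : crit C -> C = f |: D -> f \notin D -> #|vs f :&: VV D| <= 2 -> False.
Proof.
move=> cC eC fD o.
have cD : #|C| = #|D|.+1 by rewrite eC cardsU1 fD add1n.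
have c2 : 2 < #|C| by case/and4P: cC.
have nD : D != C by apply: contraNneq fD => ->; rewrite eC setU11.
have sD : D \subset C by rewrite eC subsetUr.
have h := crit_sub cC sD nD ltac:(lia).
have := crit_card cC; rewrite eC VVU1 cardsU card_vs -eC cD /w.
by move: h o; rewrite /w; move: V3; nia.
Qed.

(* Gluing along [vs e]: the only critical families using a new block are the new
   one itself, or a copy of it with [e] replaced by a block [u] sharing at least
   three vertices with [e]. *)
Lemma crit_glue (C0 : {set block}) e (N : {set block}) (VZ : {set 'I_n}) (C : {set block}) : crit (e |: N) -> e \notin N ->
  VV C0 \subset VZ -> vs e \subset VZ -> VV N :&: VZ \subset vs e ->
  crit C -> C \subset C0 :|: N -> ~~ [disjoint C & N] ->
  C = e |: N \/ exists2 u, u \in C0 & [/\ u != e, C = u |: N & 2 < #|vs e :&: vs u|].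
Proof.
move=> cE eN sC0 se sN cC sC nd.
pose A := C :&: N; pose B := C :\: N.
have CE : C = B :|: A by rewrite /A /B setUC setID.
have A0 : exists a, a \in A by move: nd; rewrite -setI_eq0 => /set0Pn.
have cAB : #|C| = #|B| + #|A| by rewrite /A /B addnC cardsID.
have sA : A \subset N by exact: subsetIr.
have sB : B \subset C0.
  by apply/subsetP => x /setDP[xC xN]; move: (subsetP sC x xC); rewrite inE (negPf xN) orbF.
have sAE : A \subset e |: N by rewrite (subset_trans sA) ?subsetUr.
have eA : e \notin A by apply: contra eN => /(subsetP sA).
have cN : #|e |: N| = #|N|.+1 by rewrite cardsU1 eN add1n.
have VBZ : VV B \subset VZ by apply: subset_trans (VVS sB) sC0.
have VAe : VV A :&: VZ \subset vs e by apply: subset_trans sN; rewrite setSI // VVS.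
have [a aA] := A0.
have C2 : 2 < #|C| by case/and4P: cC.
have E2 : 2 < #|e |: N| by case/and4P: cE.
have eAE : #|e |: A| = #|A|.+1 by rewrite cardsU1 eA add1n.
have sAE' : e |: A \subset e |: N by rewrite setUS.
have VC := crit_card cC; have VE := crit_card cE.
have A1 : 0 < #|A| by apply/card_gt0P; exists a.
have geA : w * #|A|.+1 + (if A == N then 2 else 3) <= #|VV (e |: A)|.
  case: eqP => [->|/eqP nA]; first by rewrite -cN VE.
  rewrite -eAE; apply: (crit_sub cE) => //; last by rewrite eAE.
  apply: contra nA => /eqP h; apply/eqP.
  by have := congr1 (fun X : {set block} => X :\ e) h; rewrite !setU1K.
have sBC : B \subset C by exact: subsetDl.
have nB : B != C.
  have /setIP[aC aN] := aA; apply/eqP => h.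
  by move: aC; rewrite -h inE aN.
case: (boolP (e \in C)) => eC.
  left; have eB : e \in B by rewrite inE eN.
  (* With two or more old members, the old and the new part would overlap in [vs e] only and span
     one vertex too many. *)
  case: (ltnP 1 #|B|) => B1.
    exfalso.
    have geB := crit_sub cC sBC nB B1.
    have VCE : VV C = VV B :|: VV (e |: A).
      by rewrite CE VVU VVU1 setUA (setUidPl (VV_sup eB)).
    have cap : VV B :&: VV (e |: A) \subset vs e.
      rewrite VVU1 setIUr subUset subsetIr /=.
      by apply: subset_trans VAe; rewrite setIC setIS.
    have := subset_leq_card cap; rewrite card_vs w2 => capc.
    have := cardsU (VV B) (VV (e |: A)); rewrite -VCE VC cAB => hc.
    apply: glue_arith1 geB capc (subset_leq_card (subsetIl _ _)) hc.
    by apply: leq_trans geA; case: ifP; rewrite ?leq_add2l.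
  have BE : B = [set e] by apply/eqP; rewrite eq_sym eqEcard sub1set eB cards1.
  have CeA : C = e |: A by rewrite {1}CE BE.
  move: geA; rewrite -CeA VC cAB BE cards1 add1n; case: eqP => [AN|_].
    by rewrite AN in CeA.
  by rewrite leq_add2l.
have eB : e \notin B by rewrite inE (negPf eC) andbF.
have [b bB] : exists b, b \in B.
  apply/set0Pn/negP => /eqP B0.
  have CA : C = A by rewrite {1}CE B0 set0U.
  have := crit_sub cE (_ : C \subset e |: N) _ _; rewrite {1}CA => /(_ sAE).
  have -> : C != e |: N by apply: contraNneq eC => ->; rewrite setU11.
  by move=> /(_ isT (ltnW C2)); rewrite VC leq_add2l.
have geB := VV_ge cC sBC nB bB.
have capAB : VV A :&: VV B \subset VV A :&: vs e.
  by rewrite subsetI subsetIl /= (subset_trans _ VAe) // setIS.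
have capc := subset_leq_card capAB.
have hU := cardsU (VV B) (VV A); rewrite -VVU -CE VC cAB [VV B :&: _]setIC in hU.
have hE := cardsU (vs e) (VV A); rewrite -VVU1 card_vs w2 [vs e :&: _]setIC in hE.
have c1 := subset_leq_card (subsetIl (VV A) (VV B)).
have c2 := subset_leq_card (subsetIl (VV A) (vs e)).
have c3 := subset_leq_card (subsetIr (VV A) (vs e)); rewrite card_vs w2 in c3.
have c4 := subset_leq_card (subsetIr (VV A) (VV B)).
have B1 : #|B| <= 1.
  rewrite leqNgt; apply/negP => /(crit_sub cC sBC nB) B1.
  have [+ _] := glue_arith2 geA hE B1 hU capc c2 c3.
  by case: ifP.
have BE : B = [set b] by apply/eqP; rewrite eq_sym eqEcard sub1set bB cards1.
have AN : A = N.
  case: (eqVneq A N) geA => // _ geA; exfalso.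
  by have [] := glue_arith2 geA hE geB hU capc c2 c3.
right; exists b; first exact: (subsetP sB).
have be : b != e by apply: contraNneq eB => <-.
split => //; first by rewrite {1}CE BE AN.
have full : #|VV A :&: VV B| = #|VV A :&: vs e|.
  apply/eqP; rewrite eqn_leq capc /=.
  rewrite AN eqxx -AN in geA.
  by have [_ ->] := glue_arith2 geA hE geB hU capc c2 c3.
have eqc : VV A :&: VV B = VV A :&: vs e by apply/eqP; rewrite eqEcard capAB full leqnn.
apply: leq_trans (_ : #|VV A :&: vs e| <= _); last first.
  apply: subset_leq_card; rewrite subsetI subsetIr /= -eqc BE VV1; exact: subsetIr.
have sNE : N \subset e |: N by exact: subsetUr.
have nNE : N != e |: N by apply: contraNneq eN => h; rewrite h setU11.
have N1 : 1 < #|N| by rewrite cN in E2.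
have := VE; rewrite cN VVU1 cardsU card_vs w2 AN [vs e :&: _]setIC => hN.
exact: glue_arith3 (crit_sub cE sNE nNE N1) hN (subset_leq_card (subsetIl _ _)).
Qed.

End Blocks.

End Blocks.

(** * Items, threats and good configurations *)

Module Items.
Import RandomProcess Blocks.
Section Items.
Variables (V : finType) (J : {set {set V}}) (n T : nat).
Hypothesis V3 : 2 < #|V|.
Hypothesis J2 : forall e, e \in J -> #|e| = 2.

Notation block := (block V n).
Notation tag := (block * 'I_T)%type.

(** [inl (p, true)]: the pair [p] may still become a [J]-pair of a selected block;
    [inl (p, false)]: [p] is reserved, once and for all at the start, for pairs of blocks
    outside [J]; [inr e]: selecting the block [e] would not complete a critical family. *)
Definition item := ({set 'I_n} * bool + block)%type.

Definition pairs2 : {set {set V}} := [set e : {set V} | #|e| == 2].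

Definition req (f : block) : {set item} :=
  (fun e : {set V} => inl (img f e, e \in J)) @: pairs2 :|: [set inr f].

Definition team (e f : block) (F : {set tag}) : {set block} := e |: (f |: blocks F).

(** A pair needs no earlier tag: one selection covers it. For a token, [fr.1] is the last selected
    of the other members of a critical family and [fr.2] holds the rest, each with a single label by
    the first condition. *)
Definition thr (i : item) : {set block * {set tag}} :=
  match i with
  | inl (p, true) => [set fr | (fr.2 == set0) && (p \in [set img fr.1 e | e in J])]
  | inl (p, false) => set0
  | inr e => [set fr | [&& #|blocks fr.2| == #|fr.2|, e != fr.1, e \notin blocks fr.2,
                          fr.1 \notin blocks fr.2 & crit (team e fr.1 fr.2)]]
  end.

(** A set that does not have two elements is a [J]-pair of no block and is never killed, hence it is
    static like a reserved pair. *)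
Definition ty (i : item) : option bool :=
  match i with
  | inl (p, true) => if #|p| == 2 then Some true else None
  | inl (p, false) => None
  | inr e => Some false
  end.

Definition foot (i : item) : {set 'I_n} :=
  match i with inl (p, _) => p | inr e => vs e end.

Definition zone (Y : {set item}) (B : {set tag}) : {set 'I_n} :=
  \bigcup_(y in Y) foot y :|: VV (blocks B).

Definition newv (fr : block * {set tag}) : {set 'I_n} := vs fr.1 :|: VV (blocks fr.2).

(* Threats that touch the configuration outside [foot y]; they lose a factor [n]. *)
Definition exc (Y : {set item}) (B : {set tag}) (y : item) : {set block * {set tag}} :=
  [set fr | ~~ (newv fr :&: zone Y B \subset foot y)].

Definition tok (Y : {set item}) : {set block} := [set e : block | inr e \in Y].

(** [good_crit] is the essential field: a critical family with at most one member not yet selected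
    would correlate the events. The bound 2 in [good_YY] excludes the exchange of [e] for another
    token that [crit_glue] leaves open. *)
Record good (Y : {set item}) (B : {set tag}) : Prop := Good {
  good_card2 : forall p b, inl (p, b) \in Y -> #|p| = 2;
  good_cons : forall p, inl (p, true) \in Y -> inl (p, false) \in Y -> False;
  good_pair : forall p b t, inl (p, b) \in Y -> t \in B -> ~~ (p \subset vs t.1);
  good_BB : forall t t', t \in B -> t' \in B -> t != t' -> #|vs t.1 :&: vs t'.1| <= 1;
  good_YB : forall e t, inr e \in Y -> t \in B -> #|vs e :&: vs t.1| <= 1;
  good_YY : forall e e', inr e \in Y -> inr e' \in Y -> e != e' -> #|vs e :&: vs e'| <= 2;
  good_crit : forall C, crit C -> C \subset tok Y :|: blocks B -> 1 < #|C :&: tok Y|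
}.

Lemma req_pair p b f : inl (p, b) \in req f ->
  exists2 e : {set V}, #|e| = 2 & p = img f e /\ b = (e \in J).
Proof.
rewrite inE => /orP[/imsetP[e ePs [-> ->]]|/set1P //].
by exists e => //; move: ePs; rewrite inE => /eqP.
Qed.

Lemma req_pair_sub p b f : inl (p, b) \in req f -> p \subset vs f /\ #|p| = 2.
Proof. by case/req_pair => e e2 [-> _]; rewrite img_sub card_img. Qed.

Lemma req_tok e f : (inr e \in req f) = (e == f).
Proof.
rewrite inE; case: imsetP => [[e' _ //]|_] /=; rewrite inE.
by apply/eqP/eqP => [[]|->].
Qed.

Lemma req_cons p f : inl (p, true) \in req f -> inl (p, false) \in req f -> False.
Proof.
move=> /req_pair[e _ [-> eJ]] /req_pair[e' _ [/img_inj <- e'J]].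
by rewrite -eJ in e'J.
Qed.

Lemma sub2_le1 (A : {set 'I_n}) (p : {set 'I_n}) : #|p| = 2 -> #|A| <= 1 -> ~~ (p \subset A).
Proof. by move=> p2 A1; apply/negP => /subset_leq_card; rewrite p2 leqNgt ltnS A1. Qed.

Lemma tok_U Y Y' : tok (Y :|: Y') = tok Y :|: tok Y'.
Proof. by apply/setP => e; rewrite !inE. Qed.

Lemma tok_req f : tok (req f) = [set f].
Proof. by apply/setP => e; rewrite inE req_tok inE. Qed.

Lemma blocks_U (A B : {set tag}) : blocks (A :|: B) = blocks A :|: blocks B.
Proof. exact: imsetU. Qed.

Lemma mem_blocks (B : {set tag}) t : t \in B -> t.1 \in blocks B.
Proof. exact: imset_f. Qed.

Lemma foot_zone (Y : {set item}) (B : {set tag}) y : y \in Y -> foot y \subset zone Y B.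
Proof. by move=> yY; rewrite /zone (subset_trans _ (subsetUl _ _)) // (bigcup_sup y). Qed.

Lemma zone_blocks (Y : {set item}) (B : {set tag}) : VV (blocks B) \subset zone Y B.
Proof. exact: subsetUr. Qed.

Lemma zone_tag (Y : {set item}) (B : {set tag}) t : t \in B -> vs t.1 \subset zone Y B.
Proof. by move=> tB; apply: subset_trans (zone_blocks Y B); apply/VV_sup/mem_blocks. Qed.

Lemma zone_tok (Y : {set item}) (B : {set tag}) : VV (tok Y :|: blocks B) \subset zone Y B.
Proof.
rewrite VVU subUset zone_blocks andbT; apply/bigcupsP => e; rewrite inE => eY.
exact: (foot_zone B eY).
Qed.

Lemma tok_blocks Y B e : good Y B -> e \in tok Y -> e \notin blocks B.
Proof.
move=> g; rewrite inE => eY; apply/imsetP => -[t tB eE].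
have := good_YB g eY tB; rewrite -eE setIid card_vs; move: V3; lia.
Qed.

(** A selected block meets the other selected blocks and the tokens in at most one vertex, so the
    pairs it requires lie in none of them. *)
Lemma good_move Y B t : good Y B -> t \in B ->
  good (Y :|: req t.1) (B :\ t) /\ [disjoint Y & req t.1].
Proof.
move=> g tB.
have BB u : u \in B :\ t -> u \in B /\ #|vs t.1 :&: vs u.1| <= 1.
  by case/setD1P => ut uB; rewrite (good_BB g) // eq_sym.
split; last first.
  rewrite -setI_eq0; apply/set0Pn => -[[[p b]|e] /setIP[yY]].
    by case/req_pair_sub => sp _; move: (good_pair g yY tB); rewrite sp.
  rewrite req_tok => /eqP ee; move: (good_YB g yY tB).
  rewrite -ee setIid card_vs; move: V3; lia.
split.
- by move=> p b /setUP[/(good_card2 g) //|/req_pair_sub[]].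
- move=> p /setUP[h1|h1] /setUP[h2|h2].
  + exact: (good_cons g h1 h2).
  + by have [s _] := req_pair_sub h2; move: (good_pair g h1 tB); rewrite s.
  + by have [s _] := req_pair_sub h1; move: (good_pair g h2 tB); rewrite s.
  + exact: req_cons h1 h2.
- move=> p b u h /BB[uB cap]; case/setUP: h => [h|/req_pair_sub[sp p2]].
    exact: (good_pair g h uB).
  apply: contra (sub2_le1 p2 cap) => pu; by rewrite subsetI sp pu.
- by move=> u u1 /BB[uB _] /BB[uB1 _]; exact: (good_BB g uB uB1).
- move=> e u /setUP[h|]; first by move=> /BB[uB _]; exact: (good_YB g h uB).
  by rewrite req_tok => /eqP -> /BB[].
- move=> e e' /setUP[h|+] /setUP[h'|+].
  + exact: (good_YY g h h').
  + by rewrite req_tok => /eqP -> _; exact: (leq_trans (good_YB g h tB)).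
  + by rewrite req_tok => /eqP -> _; rewrite setIC; exact: (leq_trans (good_YB g h' tB)).
  + by rewrite !req_tok => /eqP -> /eqP ->; rewrite eqxx.
- move=> C cC sC; rewrite tok_U tok_req.
  have sC' : C \subset tok Y :|: blocks B.
    apply: subset_trans sC _; rewrite tok_U tok_req -setUA setUS // subUset sub1set mem_blocks //=.
    exact/imsetS/subD1set.
  by apply: leq_trans (good_crit g cC sC') _; rewrite subset_leq_card // setIS // subsetUl.
Qed.

Section Extension.
Variables (Y : {set item}) (B : {set tag}) (y : item) (fr : block * {set tag}).
Hypotheses (g : good Y B) (yY : y \in Y) (frt : fr \in thr y) (nex : fr \notin exc Y B y).
Let f := fr.1.
Let F := fr.2.

Definition self : {set item} := if ty y == Some true then [set y] else set0.

Lemma newv_foot : newv fr :&: zone Y B \subset foot y.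
Proof. by move: nex; rewrite inE negbK. Qed.

(** Outside [exc], new and old vertices meet within [foot y] only; the intersection bounds for the
    extended configuration reduce to this. *)
Lemma new_foot (A B' : {set 'I_n}) : A \subset newv fr -> B' \subset zone Y B -> A :&: B' \subset A :&: foot y.
Proof.
move=> sA sB; rewrite subsetI subsetIl /=; apply: subset_trans newv_foot; exact: setISS.
Qed.

Let sf : vs f \subset newv fr. Proof. exact: subsetUl. Qed.
Let sF t : t \in F -> vs t.1 \subset newv fr.
Proof. by move=> tF; apply: subset_trans (subsetUr _ _); apply/VV_sup/mem_blocks. Qed.

Lemma new_cap_f : #|vs f :&: zone Y B| <= #|vs f :&: foot y|.
Proof. exact/subset_leq_card/new_foot. Qed.

Lemma ext_cases :
  (exists p, [/\ y = inl (p, true), F = set0, #|p| = 2 & exists2 e, e \in J & p = img f e]) \/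
  (exists e, [/\ y = inr e, crit (team e f F), e \notin f |: blocks F, f \notin blocks F &
      #|blocks F| = #|F|]).
Proof.
move: frt (yY); rewrite /thr; case: y => [[p []]|e]; rewrite inE // => fth yY'.
  left; exists p; case/andP: fth => /eqP F0 /imsetP[e eJ pe].
  by split=> //; [rewrite pe card_img J2 | exists e].
right; exists e; case/and5P: fth => /eqP h1 h2 h3 h4 h5; split => //.
by rewrite !inE negb_or h2.
Qed.

Lemma ext_foot2 : #|vs f :&: foot y| <= 2 /\ forall t, t \in F -> #|vs t.1 :&: foot y| <= 1.
Proof.
case: ext_cases => [[p [-> -> p2 _]]|[e [-> cC eN fN _]]].
  split; first by rewrite -p2 subset_leq_card // subsetIr.
  by move=> t; rewrite inE.
have fC : f \in team e f F by rewrite !inE eqxx orbT.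
have eC : e \in team e f F by rewrite !inE eqxx.
have ef : e != f by apply: contraNneq eN => ->; rewrite !inE eqxx.
split; first by rewrite setIC (leq_trans (crit_pair V3 cC eC fC ef)).
move=> t tF; have tC : t.1 \in team e f F by rewrite !inE mem_blocks ?orbT.
rewrite setIC (crit_pair V3 cC eC tC) //.
by apply: contraNneq eN => ->; rewrite !inE mem_blocks ?orbT.
Qed.

Lemma ext_f_tag t : t \in F -> #|vs f :&: vs t.1| <= 1.
Proof.
case: ext_cases => [[p [_ -> _ _]]|[e [_ cC eN fN _]] tF]; first by rewrite inE.
have fC : f \in team e f F by rewrite !inE eqxx orbT.
have tC : t.1 \in team e f F by rewrite !inE mem_blocks ?orbT.
rewrite (crit_pair V3 cC fC tC) //.
by apply: contraNneq fN => ->; rewrite mem_blocks.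
Qed.

Lemma ext_tag_tag t u : t \in F -> u \in F -> t != u -> #|vs t.1 :&: vs u.1| <= 1.
Proof.
case: ext_cases => [[p [_ -> _ _]]|[e [_ cC eN fN cF]] tF uF tu]; first by rewrite inE.
have tC : t.1 \in team e f F by rewrite !inE mem_blocks ?orbT.
have uC : u.1 \in team e f F by rewrite !inE mem_blocks ?orbT.
rewrite (crit_pair V3 cC tC uC) //.
apply: contra tu => /eqP h; apply/eqP.
have inj : {in F &, injective (fun b : tag => b.1)} by apply/imset_injP/eqP.
exact: inj.
Qed.

Lemma ext_zone_tag t : t \in F -> #|vs t.1 :&: zone Y B| <= 1.
Proof.
move=> tF; have [_ h] := ext_foot2; apply: leq_trans (h t tF).
by apply/subset_leq_card/new_foot => //; exact: sF.
Qed.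

Lemma ext_zone_f t : t \in B -> #|vs f :&: vs t.1| <= 1.
Proof.
move=> tB; have h := new_foot sf (zone_tag Y tB).
case: ext_cases => [[p [ey _ p2 _]]|[e [ey cC eN _ _]]].
  rewrite leqNgt; apply/negP => h2; have := good_pair g (_ : inl (p, true) \in Y) tB.
  rewrite -ey => /(_ yY)/negP; apply.
  rewrite ey /= in h; have h3 := subset_trans h (subsetIr _ _).
  have /eqP <- : vs f :&: vs t.1 == p by rewrite eqEcard h3 p2.
  exact: subsetIr.
apply: leq_trans (subset_leq_card h) _; rewrite ey /= setIC.
have fC : f \in team e f F by rewrite !inE eqxx orbT.
have eC : e \in team e f F by rewrite !inE eqxx.
by apply: (crit_pair V3 cC eC fC); apply: contraNneq eN => ->; rewrite !inE eqxx.
Qed.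

Lemma ext_old_f p b : inl (p, b) \in Y -> p \subset vs f -> y = inl (p, true) /\ inl (p, true) \in req f.
Proof.
move=> pY pf; have p2 := good_card2 g pY.
have pz : p \subset zone Y B by exact: (foot_zone B pY).
have h : p \subset vs f :&: foot y.
  apply: subset_trans (new_foot sf pz); by rewrite subsetI pf subxx.
case: ext_cases => [[q [ey _ q2 [e eJ qe]]]|[e [ey cC eN _ _]]].
  rewrite ey /= in h; have /eqP pq : p == q.
    by rewrite eqEcard (subset_trans h (subsetIr _ _)) p2 q2.
  split; first by rewrite ey pq.
  rewrite pq inE; apply/orP; left; apply/imsetP; exists e; last by rewrite eJ -qe.
  by rewrite inE J2.
exfalso; move: (subset_leq_card h); rewrite ey /= setIC p2 leqNgt ltnS.
have fC : f \in team e f F by rewrite !inE eqxx orbT.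
have eC : e \in team e f F by rewrite !inE eqxx.
rewrite (crit_pair V3 cC eC fC) //.
by apply: contraNneq eN => ->; rewrite !inE eqxx.
Qed.

Lemma ext_new_block : f \notin tok Y :|: blocks B.
Proof.
have [h _] := ext_foot2; apply/negP => fo.
have : vs f :&: zone Y B = vs f by apply/setIidPl/(subset_trans (VV_sup fo) (zone_tok Y B)).
by move=> e; have := new_cap_f; rewrite e card_vs => h'; move: (leq_trans h' h); rewrite leqNgt V3.
Qed.

Lemma ext_new_tag t : t \in F -> t.1 \notin tok Y :|: blocks B.
Proof.
move=> tF; have h := ext_zone_tag tF; apply/negP => fo.
move: h; rewrite (setIidPl (subset_trans (VV_sup fo) (zone_tok Y B))) card_vs.
by move: V3; lia.
Qed.

(** If [y] is a pair, a critical family using [f] would be attached along at most two vertices,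
    against [crit_attach]. If [y] is a token this is [crit_glue], where the exchanged block has to
    be a token because selected blocks meet [e] in at most one vertex. *)
Lemma ext_crit C : crit C -> C \subset (tok Y :|: blocks B) :|: (f |: blocks F) ->
  ~~ [disjoint C & f |: blocks F] ->
  (exists e, [/\ y = inr e & C = team e f F]) \/
  (exists e u, [/\ y = inr e, u \in tok Y, u != e, f \in C & u \in C] /\
     C = u |: (f |: blocks F) /\ 2 < #|vs e :&: vs u|).
Proof.
move=> cC sC nd; case: ext_cases => [[p [ey F0 p2 _]]|[e [ey cE eN fN cF]]].
  exfalso; move: sC nd; rewrite F0 /blocks imset0 setU0 => sC nd.
  have fC : f \in C by move: nd; rewrite -setI_eq0 => /set0Pn[x /setIP[xC /set1P <-]].
  apply: (crit_attach V3 cC (f := f) (D := C :\ f)); rewrite ?setD1K ?setD11 //.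
  have [h _] := ext_foot2; apply: leq_trans h; apply/subset_leq_card/new_foot => //.
  apply: subset_trans (zone_tok Y B); apply/VVS/subsetP => x /setD1P[xf xC].
  by move: (subsetP sC x xC); rewrite in_setU in_set1 (negPf xf) orbF.
have se : vs e \subset zone Y B by move: yY; rewrite ey => /(foot_zone B).
have sN : VV (f |: blocks F) :&: zone Y B \subset vs e.
  by have := newv_foot; rewrite ey /newv VVU1.
case: (crit_glue V3 cE eN (zone_tok Y B) se sN cC sC nd) => [h|[u uO [ue Cu cap]]].
  by left; exists e.
right; exists e, u; have uY : u \in tok Y.
  case/setUP: uO => // /imsetP[t tB ut]; move: cap; rewrite ut leqNgt ltnS.
  by rewrite (leq_trans (good_YB g _ tB)) // -ey.
by do ?split => //; rewrite Cu !inE eqxx ?orbT.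
Qed.

Lemma good_ext : [/\ good (Y :|: req f) (B :|: F), Y :&: req f = self & [disjoint B & F]].
Proof.
have [cf ct] := ext_foot2.
split; last 2 first.
- apply/setP => i; rewrite inE; apply/andP/idP => [[iY ir]|].
    case: i iY ir => [[p b]|e] iY ir.
      have [sp _] := req_pair_sub ir.
      have [ey rt] := ext_old_f iY sp.
      have p2 := good_card2 g iY.
      rewrite /self ey /= p2 eqxx inE; case: b iY ir => // iY ir.
      by case: (req_cons rt ir).
    move: ir; rewrite req_tok => /eqP ee.
    by move: ext_new_block; rewrite -ee !inE iY.
  rewrite /self; case: ext_cases => [[p [ey F0 p2 [e eJ pe]]]|[e [ey _ _ _ _]]]; last first.
    by rewrite ey /= inE.
  rewrite ey /= p2 eqxx inE => /eqP ->; split; first by rewrite -ey.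
  rewrite inE; apply/orP; left; apply/imsetP; exists e; last by rewrite eJ -pe.
  by rewrite inE J2.
- rewrite -setI_eq0; apply/set0Pn => -[t /setIP[tB tF]].
  by move: (ext_new_tag tF); rewrite inE mem_blocks ?orbT.
have oldF p b t : inl (p, b) \in Y -> t \in F -> ~~ (p \subset vs t.1).
  move=> pY tF; have h := ext_zone_tag tF.
  apply: contra (sub2_le1 (good_card2 g pY) h) => pt; rewrite subsetI pt.
  exact: (foot_zone B pY).
split.
- by move=> p b /setUP[/(good_card2 g) //|/req_pair_sub[]].
- move=> p /setUP[h1|h1] /setUP[h2|h2].
  + exact: (good_cons g h1 h2).
  + have [s _] := req_pair_sub h2; have [_ rt] := ext_old_f h1 s; exact: req_cons rt h2.
  + have [s _] := req_pair_sub h1; have [ey _] := ext_old_f h2 s.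
    by apply: (good_cons g _ h2); rewrite -ey.
  + exact: req_cons h1 h2.
- move=> p b t /setUP[h|h] /setUP[tB|tF].
  + exact: (good_pair g h tB).
  + exact: oldF h tF.
  + have [s p2] := req_pair_sub h; apply: contra (sub2_le1 p2 (ext_zone_f tB)) => pt.
    by rewrite subsetI s.
  + have [s p2] := req_pair_sub h; apply: contra (sub2_le1 p2 (ext_f_tag tF)) => pt.
    by rewrite subsetI s.
- move=> t u /setUP[tB|tF] /setUP[uB|uF] tu.
  + exact: (good_BB g tB uB tu).
  + rewrite setIC; apply: leq_trans (ext_zone_tag uF).
    by rewrite subset_leq_card // setIS // zone_tag.
  + by apply: leq_trans (ext_zone_tag tF); rewrite subset_leq_card // setIS // zone_tag.
  + exact: ext_tag_tag tF uF tu.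
- move=> e t /setUP[h|+] /setUP[tB|tF].
  + exact: (good_YB g h tB).
  + rewrite setIC; apply: leq_trans (ext_zone_tag tF).
    by rewrite subset_leq_card // setIS // (foot_zone B h).
  + by rewrite req_tok => /eqP ->; exact: ext_zone_f.
  + by rewrite req_tok => /eqP ->; exact: ext_f_tag.
- have ff e : inr e \in Y -> #|vs f :&: vs e| <= 2.
    move=> h; apply: leq_trans cf; apply/subset_leq_card/new_foot => //.
    exact: (foot_zone B h).
  move=> e e' /setUP[h|+] /setUP[h'|+].
  + exact: (good_YY g h h').
  + by rewrite req_tok => /eqP -> _; rewrite setIC; exact: ff.
  + by rewrite req_tok => /eqP -> _; exact: ff.
  + by rewrite !req_tok => /eqP -> /eqP ->; rewrite eqxx.
move=> C cC sC; rewrite tok_U tok_req.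
have sC' : C \subset tok Y :|: blocks B :|: (f |: blocks F).
  apply: subset_trans sC _; rewrite tok_U tok_req blocks_U.
  by apply/subsetP => x; rewrite !in_setU => /orP[/orP[->|->]|/orP[->|->]]; rewrite ?orbT.
case: (boolP [disjoint C & f |: blocks F]) => [d|nd].
  have sC0 : C \subset tok Y :|: blocks B.
    apply/subsetP => x xC; move: (subsetP sC' x xC); rewrite in_setU => /orP[//|].
    by rewrite (disjointFr d xC).
  by apply: leq_trans (good_crit g cC sC0) _; rewrite subset_leq_card // setIS // subsetUl.
have two a b : a \in C -> b \in C -> a != b -> a \in tok Y :|: [set f] -> b \in tok Y :|: [set f] ->
    1 < #|C :&: (tok Y :|: [set f])|.
  move=> aC bC ab aT bT; have <- : #|[set a; b]| = 2 by rewrite cards2 ab.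
  apply/subset_leq_card/subsetP => x /set2P[] ->; by rewrite inE ?aC ?bC ?aT ?bT.
have fT : f \in tok Y :|: [set f] by rewrite !inE eqxx orbT.
case: (ext_crit cC sC' nd) => [[e [ey Ce]]|[e [u [[ey uY ue fC uC] _]]]].
  have eT : e \in tok Y by rewrite inE -ey.
  apply: (two e f) => //; rewrite ?Ce ?in_setU ?eT ?inE ?eqxx ?orbT //.
  by apply: contraNneq ext_new_block => <-; rewrite inE eT.
apply: (two u f) => //; last by rewrite in_setU uY.
by apply: contraNneq ext_new_block => <-; rewrite inE uY.
Qed.

(** For a token, the second threat forms a critical family inside the extended configuration, and
    [ext_crit] identifies it with the first; the exchange is ruled out by [good_YY]. A pair inside
    [f] has to be [y] itself by [ext_old_f]. *)
Lemma thr_unique y' fr' : y' \in Y -> fr' \in thr y' -> fr'.1 = f ->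
  fr'.2 \subset B :|: F -> y' = y /\ fr' = fr.
Proof.
move=> yY' ft' f1 s2.
have [cf ct] := ext_foot2.
case: y' yY' ft' => [[p []]|e'] yY'; rewrite ?inE //.
  case/andP => /eqP F0 /imsetP[e eJ pe].
  have pf : p \subset vs f by rewrite pe f1 img_sub.
  have [ey _] := ext_old_f yY' pf; split => //.
  move: frt; rewrite ey inE => /andP[/eqP h _].
  by rewrite [fr']surjective_pairing [fr]surjective_pairing f1 F0 h.
case/and5P => /eqP c' e'f; rewrite f1 in e'f * => e'F fF cC'.
have eT' : e' \in tok Y by rewrite inE.
have sub : team e' f fr'.2 \subset tok Y :|: blocks B :|: (f |: blocks F).
  apply/subsetP => x; rewrite /team in_setU1 in_setU1 => /or3P[/eqP->|/eqP->|].
  - by rewrite !in_setU eT'.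
  - by rewrite !in_setU in_set1 eqxx !orbT.
  - by move=> /(subsetP (imsetS _ s2)); rewrite imsetU !in_setU => /orP[->|->]; rewrite ?orbT.
have nd : ~~ [disjoint team e' f fr'.2 & f |: blocks F].
  by rewrite -setI_eq0; apply/set0Pn; exists f; rewrite !inE eqxx ?orbT.
have e'N : e' \notin f |: blocks F.
  rewrite !inE negb_or e'f /=; apply/imsetP => -[t tF et].
  by move: (ext_new_tag tF); rewrite -et in_setU eT'.
case: (ext_crit cC' sub nd) => [[e [ey Ce]]|[e [u [[ey uY ue _ _] [Cu cap]]]]].
  have ee : e' = e.
    have : e' \in team e f F by rewrite -Ce !inE eqxx.
    by rewrite in_setU1 (negPf e'N) orbF => /eqP.
  rewrite ey ee; split => //.
  have fN : f \notin blocks F.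
    by case: ext_cases => [[p [ey' _ _ _]]|[e2 [_ _ _ ? _]]] //; rewrite ey in ey'.
  have bE : blocks fr'.2 = blocks F.
    have e'N' : e' \notin f |: blocks fr'.2 by rewrite !inE negb_or e'f.
    have := congr1 (fun X : {set block} => X :\ e') Ce; rewrite /team -ee !setU1K //.
    by move=> /(congr1 (fun X : {set block} => X :\ f)); rewrite !setU1K.
  have cF : #|blocks F| = #|F|.
    by case: ext_cases => [[p [ey' _ _ _]]|[e2 [_ _ _ _ ->]]] //; rewrite ey in ey'.
  have sFF : fr'.2 \subset F.
    apply/subsetP => t tf; case/setUP: (subsetP s2 t tf) => // tB; exfalso.
    have : t.1 \in blocks F by rewrite -bE mem_blocks.
    by case/imsetP => u uF tu; move: (ext_new_tag uF); rewrite -tu in_setU mem_blocks ?orbT.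
  have /eqP h : fr'.2 == F by rewrite eqEcard sFF -cF -c' bE leqnn.
  by rewrite [fr']surjective_pairing [fr]surjective_pairing f1 h.
exfalso; have e'u : e' = u.
  have : e' \in u |: (f |: blocks F) by rewrite -Cu !inE eqxx.
  by rewrite in_setU1 (negPf e'N) orbF => /eqP.
move: cap; rewrite -e'u leqNgt ltnS (good_YY g) // -?ey //.
by rewrite eq_sym e'u.
Qed.

End Extension.

(** Otherwise a pair of [Y] would lie in a selected block, or a critical family would consist of
    selected blocks and a single token, against [good_crit]. *)
Lemma thr_sel Y B y t fr : good Y B -> y \in Y -> t \in B -> fr \in thr y -> fr.1 = t.1 ->
  ~~ (fr.2 \subset B).
Proof.
move=> g; case: y => [[p []]|e] yY tB; rewrite ?inE //.
  case/andP => _ /imsetP[e eJ pe] ft.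
  by move: (good_pair g yY tB); rewrite pe ft img_sub.
case/and5P => _ ef eF fF cC ft; apply/negP => sB.
have eT : e \in tok Y by rewrite inE.
have sC : team e fr.1 fr.2 \subset tok Y :|: blocks B.
  rewrite /team !subUset !sub1set !in_setU eT ft mem_blocks ?orbT //=.
  by apply: subset_trans (subsetUr _ _); exact: imsetS.
have := good_crit g cC sC; rewrite ltnNge => /negP; apply.
rewrite -(cards1 e); apply/subset_leq_card/subsetP => x /setIP[].
rewrite /team in_setU1 in_set1 => /predU1P[-> //|] xr xT.
have : x \in blocks B.
  move: xr; rewrite in_setU1 => /predU1P[->|/(subsetP (imsetS _ sB)) //].
  by rewrite ft mem_blocks.
by rewrite (negPf (tok_blocks g xT)).
Qed.

End Items.

End Items.

(** * Counting families by their number of new vertices *)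

Module Counting.
Import RandomProcess Blocks Items.
Import Order.TTheory GRing.Theory Num.Theory.

(** A function is encoded by a list of [k] points containing its values outside [W] and, for each
    argument, a point of [W] or a position in the list. *)
Lemma card_small_image (A X : finType) (W : {set X}) k (x0 : X) :
  #|[set h : {ffun A -> X} | #|(h @: setT) :\: W| <= k]| <= (#|W| + k) ^ #|A| * #|X| ^ k.
Proof.
pose D : finType := ({x : X | x \in W} + 'I_k)%type.
pose dec (z : {ffun 'I_k -> X}) (d : D) := match d with inl w => val w | inr j => z j end.
pose F (zc : {ffun 'I_k -> X} * {ffun A -> D}) : {ffun A -> X} := [ffun a => dec zc.1 (zc.2 a)].
have cD : #|D| = #|W| + k by rewrite card_sum card_sig card_ord.
apply: leq_trans (_ : #|[set: {ffun 'I_k -> X} * {ffun A -> D}]| <= _); last first.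
  by rewrite cardsT card_prod !card_ffun card_ord cD mulnC.
apply: leq_trans (leq_imset_card F _); apply/subset_leq_card/subsetP => h; rewrite inE => hk.
pose S := (h @: setT) :\: W.
pose z : {ffun 'I_k -> X} := [ffun j : 'I_k => nth x0 (enum S) j].
have [c hc] : exists c : A -> D, forall a, dec z (c a) = h a.
  apply: (@fin_all_exists A (fun=> D) (fun a d => dec z d = h a)) => a.
  case: (boolP (h a \in W)) => [haW|haW]; first by exists (inl (Sub (h a) haW)).
  have haS : h a \in S by rewrite inE haW imset_f ?inE.
  have ik : index (h a) (enum S) < k.
    by apply: leq_trans hk; rewrite cardE index_mem mem_enum.
  by exists (inr (Ordinal ik)); rewrite /= ffunE /= nth_index // mem_enum.
apply/imsetP; exists (z, [ffun a => c a]); first by rewrite inE.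
by apply/ffunP => a; rewrite !ffunE.
Qed.

Lemma leq_exp2rW a b k : a <= b -> a ^ k <= b ^ k.
Proof. by move=> ab; case: k => // k; rewrite leq_exp2r. Qed.

Section Counting.
Variables (V : finType) (n T : nat).
Notation block := (block V n).
Notation tag := (block * 'I_T)%type.
Hypothesis n0 : 0 < n.

Lemma card_families (A : finType) (W : {set 'I_n}) k :
  #|[set t : {ffun A -> block} | #|VV (t @: setT) :\: W| <= k]| <=
  (#|W| + k) ^ (#|A| * #|V|) * n ^ k.
Proof.
pose F (t : {ffun A -> block}) : {ffun A * V -> 'I_n} := [ffun ax => val (t ax.1) ax.2].
have Fi : injective F.
  move=> t t' /ffunP e; apply/ffunP => a; apply/val_inj/ffunP => x.
  by have := e (a, x); rewrite !ffunE.
rewrite -(card_imset _ Fi) -card_prod.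
have := @card_small_image (A * V)%type 'I_n W k (Ordinal n0); rewrite card_ord; apply: leq_trans.
apply/subset_leq_card/subsetP => _ /imsetP[t tk ->]; move: tk; rewrite !inE.
suff -> : F t @: setT = VV (t @: setT) by [].
apply/setP => y; apply/imsetP/bigcupP => [[[a x] _ ->]|[f /imsetP[a _ ->] /imsetP[x _ ->]]].
  by exists (t a); rewrite ?imset_f ?inE // ffunE imset_f ?inE.
by exists (a, x); rewrite ?inE // ffunE.
Qed.

Lemma card_pairs u k (W : {set 'I_n}) :
  #|[set fu : block * {set tag} | (#|fu.2| == u) &&
      (#|(vs fu.1 :|: VV (blocks fu.2)) :\: W| <= k)]| <=
  (#|W| + k) ^ (u.+1 * #|V|) * n ^ k * T ^ u.
Proof.
pose dec (tl : {ffun option 'I_u -> block} * {ffun 'I_u -> 'I_T}) : block * {set tag} :=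
  (tl.1 None, [set (tl.1 (Some i), tl.2 i) | i : 'I_u]).
pose S := setX [set t : {ffun option 'I_u -> block} | #|VV (t @: setT) :\: W| <= k]
   [set: {ffun 'I_u -> 'I_T}].
apply: leq_trans (_ : #|S| <= _); last first.
  rewrite cardsX cardsT card_ffun !card_ord leq_mul2r; apply/orP; right.
  by apply: leq_trans (card_families _ W k) _; rewrite card_option card_ord.
apply: leq_trans (leq_imset_card dec _); apply/subset_leq_card/subsetP => -[f U].
rewrite inE /= => /andP[/eqP cU Uk].
pose e (i : 'I_u) : tag := enum_val (cast_ord (esym cU) i).
pose t : {ffun option 'I_u -> block} := [ffun o => if o is Some i then (e i).1 else f].
pose l : {ffun 'I_u -> 'I_T} := [ffun i => (e i).2].
have eU i : e i \in U by exact: enum_valP.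
have eS x : x \in U -> exists i, x = e i.
  move=> xU; exists (cast_ord cU (enum_rank_in xU x)).
  by rewrite /e cast_ordK enum_rankK_in.
have UE : U = [set (t (Some i), l i) | i : 'I_u].
  apply/setP => x; apply/idP/imsetP => [/eS[i ->]|[i _ ->]].
    by exists i => //; rewrite !ffunE -surjective_pairing.
  by rewrite !ffunE -surjective_pairing.
apply/imsetP; exists (t, l); last by rewrite /dec /= -UE ffunE.
rewrite inE /= !inE andbT.
suff -> : VV (t @: setT) = vs f :|: VV (blocks U) by [].
rewrite -VVU1; congr VV; apply/setP => g; apply/imsetP/idP => [[[i|] _ ->]|].
- by rewrite ffunE !inE (imset_f (fun b : tag => b.1)) ?orbT.
- by rewrite ffunE !inE eqxx.
- case/setU1P => [->|/imsetP[x /eS[i ->] ->]]; first by exists None; rewrite ?ffunE.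
  by exists (Some i); rewrite ?ffunE.
Qed.

Local Open Scope ring_scope.
Variable R : realType.
Variables (d th : R).
Let w := (#|V| - 2)%N.
Hypothesis d01 : 0 < d <= 1.
Hypothesis thE : th * n%:R ^+ w = d.

(** The factors count the trace on [B], the number of further tags (0 to 5), the codes of
    [card_small_image] and the labels. *)
Definition sum_const (L W : nat) : R :=
  (2 ^ L * 6 * ((W + 6 * #|V|) ^ (6 * #|V|) * T.+1 ^ 5))%:R.

Let N0 : (0 : R) < n%:R. Proof. by rewrite ltr0n. Qed.

Lemma th_pos : 0 < th.
Proof.
case/andP: d01 => d0 _; rewrite -(pmulr_lgt0 _ (exprn_gt0 w N0)) thE //.
Qed.

(** A free vertex is worth n and a tag at most n^-w, so a lack of [z] new vertices gains n^-z. The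
    exponent [k] is 1 when the selection of the threatening block is weighted as well, 0 when that
    block is fixed. *)
Lemma tags_sum (S : {set block * {set tag}}) (B : {set tag}) (W : {set 'I_n}) z k L W0 :
  (forall fr, fr \in S -> (#|fr.2| <= 5)%N /\
     (#|(vs fr.1 :|: VV (blocks (fr.2 :\: B))) :\: W| + z <= w * (#|fr.2 :\: B| + k))%N) ->
  (#|B| <= L)%N -> (#|W| <= W0)%N -> (k <= 1)%N ->
  th ^+ k * (\sum_(fr in S) th ^+ #|fr.2 :\: B|) <= sum_const L W0 * (n%:R^-1) ^+ z.
Proof.
move=> hS BL WW k1; have th0 := ltW th_pos.
rewrite (partition_big (fun fr => fr.2 :&: B) (fun X => X \in powerset B)) /=; last first.
  by move=> fr _; rewrite inE subsetIr.
pose K : R := (6 * ((W0 + 6 * #|V|) ^ (6 * #|V|) * T.+1 ^ 5))%:R * (n%:R^-1) ^+ z.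
have K0 : 0 <= K by rewrite mulr_ge0 // exprn_ge0 // invr_ge0 ltW.
apply: le_trans (_ : \sum_(X in powerset B) K <= _); last first.
  rewrite sumr_const card_powerset -[X in X <= _]mulr_natl /K mulrA -natrM /sum_const -mulnA.
  rewrite ler_wpM2r ?exprn_ge0 ?invr_ge0 ?(ltW N0) // ler_nat leq_mul2r; apply/orP; right.
  by rewrite leq_pexp2l.
rewrite mulr_sumr; apply: ler_sum => X _.
rewrite (partition_big (fun fr : block * {set tag} => inord #|fr.2 :\: B| : 'I_6) predT) //=.
rewrite /K natrM -mulrA mulr_sumr [X in _ <= X]mulr_natl.
set K1 := (_%:R * _); have -> : K1 *+ 6 = \sum_(u < 6) K1 by rewrite sumr_const card_ord.
rewrite {}/K1; apply: ler_sum => u _.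
pose P := [set fr in S | (fr.2 :&: B == X) && (#|fr.2 :\: B| == u)].
rewrite (eq_bigl (fun fr => fr \in P)); last first.
  move=> fr; rewrite inE; case: (boolP (fr \in S)) => //= frS; congr (_ && _).
  have [h _] := hS fr frS; rewrite -val_eqE /= inordK // ltnS.
  by apply: leq_trans h; rewrite subset_leq_card // subsetDl.
rewrite (eq_bigr (fun=> th ^+ u)) => [|fr]; last by rewrite inE => /and3P[_ _ /eqP ->].
rewrite sumr_const -[X in th ^+ k * X]mulr_natl mulrCA -exprD.
case: (set_0Vmem P) => [->|[fr0 fr0P]].
  by rewrite cards0 mul0r mulr_ge0 // exprn_ge0 // invr_ge0 ltW.
have zw : (z <= w * (u + k))%N.
  move: fr0P; rewrite inE => /and3P[/hS[_ h] _ /eqP e]; rewrite -e.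
  exact: leq_trans (leq_addl _ _) h.
pose k' := (w * (u + k) - z)%N.
have cP : (#|P| <= (W0 + 6 * #|V|) ^ (6 * #|V|) * T.+1 ^ 5 * n ^ k')%N.
  pose G (fr : block * {set tag}) := (fr.1, fr.2 :\: B).
  have Gi : {in P &, injective G}.
    move=> [a b] [a' b']; rewrite !inE /= => /and3P[_ /eqP e _] /and3P[_ /eqP e' _] [-> h].
    by rewrite -(setID b B) -(setID b' B) e e' h.
  rewrite -(card_in_imset Gi); apply: leq_trans (_ : (#|W| + k') ^ (u.+1 * #|V|) * n ^ k' * T ^ u <= _)%N.
    apply: leq_trans (card_pairs u k' W); apply/subset_leq_card/subsetP => _ /imsetP[fr frP ->].
    move: frP; rewrite !inE /= => /and3P[frS _ /eqP e]; rewrite e eqxx /=.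
    by have [_ h] := hS fr frS; rewrite /k' -e leq_subRL ?e // -?e addnC.
  have k6 : (k' <= 6 * #|V|)%N.
    rewrite /k'; have := ltn_ord u; have : (w <= #|V|)%N by rewrite leq_subr.
    move: (nat_of_ord u) k1 => uu; clear; nia.
  rewrite -mulnA [(n ^ _ * _)%N]mulnC mulnA leq_mul2r; apply/orP; right.
  apply: leq_mul; last first.
    apply: leq_trans (_ : T.+1 ^ u <= _)%N; first by apply: leq_exp2rW.
    by rewrite leq_pexp2l // -ltnS.
  apply: leq_trans (_ : (W0 + 6 * #|V|) ^ (u.+1 * #|V|) <= _)%N.
    by apply: leq_exp2rW; rewrite leq_add.
  case: (posnP #|V|) => [->|Vp]; first by rewrite !muln0.
  by rewrite leq_pexp2l ?addn_gt0 ?muln_gt0 ?Vp ?orbT // leq_mul2r ltn_ord orbT.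
apply: le_trans (ler_wpM2r (exprn_ge0 _ th0) (_ : #|P|%:R <= ((W0 + 6 * #|V|) ^ (6 * #|V|) * T.+1 ^ 5 * n ^ k')%:R)) _.
  by rewrite ler_nat.
rewrite natrM -mulrA ler_wpM2l // natrX.
have -> : th ^+ (k + u) = d ^+ (u + k) * (n%:R ^+ (w * (u + k)))^-1.
  by rewrite -thE exprMn exprM mulfK ?expf_neq0 ?gt_eqF // addnC.
have -> : n%:R ^+ (w * (u + k)) = n%:R ^+ k' * n%:R ^+ z :> R by rewrite -exprD subnK.
set a := n%:R ^+ k'; set b := n%:R ^+ z.
have a0 : a != 0 by rewrite expf_neq0 ?gt_eqF.
have b0 : b != 0 by rewrite expf_neq0 ?gt_eqF.
rewrite (_ : a * (d ^+ (u + k) * (a * b)^-1) = d ^+ (u + k) * b^-1); last by field; rewrite a0 b0.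
case/andP: d01 => d0 d1.
by rewrite exprVn ler_piMl ?invr_ge0 ?exprn_ge0 ?(ltW N0) ?exprn_ile1 // ltW.
Qed.

End Counting.

End Counting.

(** * Rarity of exceptional and colliding threats *)

Module ThreatBounds.
Import RandomProcess Blocks Items Counting.
Import Order.TTheory GRing.Theory Num.Theory.

Lemma card_setD_le (X : finType) (A B C : {set X}) : B \subset A -> C \subset A ->
  A \subset B :|: C -> forall Z : {set X}, B \subset Z -> #|C :\: Z| + #|B| <= #|A|.
Proof.
move=> sB sC sA Z sZ; have d : [disjoint C :\: Z & B].
  rewrite -setI_eq0; apply/eqP/setP => x; rewrite !inE.
  by case: (boolP (x \in B)) => [/(subsetP sZ) ->|]; rewrite ?andbF.
have -> : #|C :\: Z| + #|B| = #|(C :\: Z) :|: B|.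
  by rewrite cardsU; move: d; rewrite -setI_eq0 => /eqP ->; rewrite cards0 subn0.
by apply/subset_leq_card; rewrite subUset sB andbT (subset_trans (subsetDl _ _)).
Qed.

Lemma team_arith1 w a b x y z : a + b = y -> x <= w * (2 + y) + 2 -> z + (w * (1 + a) + 2) <= x ->
  z <= w * (b + 1).
Proof. move=> <-; rewrite !mulnDr; move: (w * a) (w * b) => ? ?; lia. Qed.

Lemma team_arith2 w a b x y z : a + b = y -> x <= w * (2 + y) + 2 -> z + (w * (1 + a) + 3) <= x ->
  z + 1 <= w * (b + 1).
Proof. move=> <-; rewrite !mulnDr; move: (w * a) (w * b) => ? ?; lia. Qed.

Lemma team_arith3 w a b x y z : a + b = y -> x <= w * (2 + y) + 2 -> z + (w * (2 + a) + 3) <= x ->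
  z + 1 <= w * b.
Proof. move=> <-; rewrite !mulnDr; move: (w * a) (w * b) => ? ?; lia. Qed.

Lemma sub2_add3 v : 2 < v -> v - 2 + 3 <= 1 + v.
Proof. lia. Qed.

Lemma zone_arith a b v L x : a <= v -> b <= x * v -> x <= L -> a + b <= v * (L + 3).
Proof. by move=> *; nia. Qed.

Lemma zone_arith2 a b v L x : a <= v -> b <= x * v -> x <= L -> a + (v + b) <= v * (L + 3).
Proof. by move=> *; nia. Qed.

Lemma zone_arith3 a b v L x y z : a <= y * v -> b <= x * v -> x <= z -> y + z <= L ->
  a + b <= v * (L + 3).
Proof. by move=> *; nia. Qed.

Lemma cap_arith c v : 3 <= c -> c <= v -> v - c + 1 <= v - 2.
Proof. lia. Qed.

Section Team.
Variables (V : finType) (n T : nat).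
Notation block := (block V n).
Notation tag := (block * 'I_T)%type.
Hypothesis V3 : 2 < #|V|.
Let w := #|V| - 2.
Variables (e f : block) (F : {set tag}).
Hypotheses (cF : #|blocks F| = #|F|) (ef : e != f) (eF : e \notin blocks F)
  (fF : f \notin blocks F) (cC : crit (team e f F)).

Let inj : {in F &, injective (fun b : tag => b.1)}. Proof. exact/imset_injP/eqP. Qed.

Lemma card_blocks_sub (F' : {set tag}) : F' \subset F -> #|blocks F'| = #|F'|.
Proof. by move=> s; apply: card_in_imset => x y /(subsetP s) ? /(subsetP s) ?; exact: inj. Qed.

Lemma card_team : #|team e f F| = 2 + #|F|.
Proof. by rewrite /team !cardsU1 !inE negb_or ef eF fF cF. Qed.

Lemma team_size5 : #|F| <= 5.
Proof. by case/and4P: cC => _; rewrite card_team. Qed.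

Lemma VV_team : VV (team e f F) = vs e :|: (vs f :|: VV (blocks F)).
Proof. by rewrite /team !VVU1. Qed.

Lemma card_VV_team : #|VV (team e f F)| = w * (2 + #|F|) + 2.
Proof. by rewrite (crit_card cC) card_team. Qed.

Variables (B : {set tag}) (Z : {set 'I_n}).
Hypotheses (eZ : vs e \subset Z) (FZ : VV (blocks (F :&: B)) \subset Z).
Let B1 := F :&: B.
Let U := F :\: B.
Let sB1 : B1 \subset F. Proof. exact: subsetIl. Qed.
Let F_split : #|B1| + #|U| = #|F|. Proof. exact: cardsID. Qed.
Let blocksF : blocks F = blocks B1 :|: blocks U.
Proof. by rewrite -imsetU setID. Qed.
Let eB1 : e \notin blocks B1. Proof. by apply: contra eF; apply/subsetP/imsetS. Qed.
Let fB1 : f \notin blocks B1. Proof. by apply: contra fF; apply/subsetP/imsetS. Qed.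

Let sub1 : e |: blocks B1 \subset team e f F.
Proof. by rewrite setUS // (subset_trans (imsetS _ sB1)) // subsetUr. Qed.
Let ne1 : e |: blocks B1 != team e f F.
Proof.
apply: contraNneq (_ : f \notin e |: blocks B1) => [->|]; first by rewrite !inE eqxx orbT.
by rewrite !inE negb_or eq_sym ef.
Qed.
Let card1 : #|e |: blocks B1| = 1 + #|B1|.
Proof. by rewrite cardsU1 eB1 card_blocks_sub. Qed.

Let new := vs f :|: VV (blocks U).

Let peel (X : {set 'I_n}) : X \subset VV (team e f F) -> vs e :|: VV (blocks B1) \subset X -> X \subset Z ->
  #|new :\: Z| + #|X| <= #|VV (team e f F)|.
Proof.
move=> sX sX' sZ; apply: card_setD_le => //.
  rewrite VV_team blocksF VVU; apply: subset_trans (subsetUr _ _).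
  by rewrite setUS // subsetUr.
rewrite VV_team blocksF VVU subUset; apply/andP; split.
  by rewrite (subset_trans (subset_trans (subsetUl _ _) sX')) // subsetUl.
rewrite /new setUCA subUset; apply/andP; split; last exact: subsetUr.
by rewrite (subset_trans (subset_trans (subsetUr _ _) sX')) // subsetUl.
Qed.

Let peel1 : #|new :\: Z| + #|VV (e |: blocks B1)| <= #|VV (team e f F)|.
Proof.
apply: peel; rewrite ?VVS // VVU1 //.
by rewrite subUset eZ.
Qed.

(** The critical family spans exactly w(2 + |F|) + 2 vertices; those of the proper subfamily formed
    by [e] and the present tags are old, and minimality bounds their number from below. *)
Lemma team_new : #|new :\: Z| <= w * (#|U| + 1).
Proof.
apply: (team_arith1 F_split (eq_leq card_VV_team)); apply: leq_trans peel1.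
rewrite leq_add2l -card1; apply: (VV_ge V3 cC sub1 ne1 (f := e)).
exact: setU11.
Qed.

(** A present tag gives the old subfamily a second member, and the stricter bound on subfamilies
    gains one vertex. *)
Lemma team_new_old : B1 != set0 -> #|new :\: Z| + 1 <= w * (#|U| + 1).
Proof.
rewrite -card_gt0 => B10; apply: (team_arith2 F_split (eq_leq card_VV_team)); apply: leq_trans peel1.
by rewrite leq_add2l -card1; apply: (crit_sub cC sub1 ne1); rewrite card1.
Qed.

(** Either a tag is already present, or the vertex of the zone outside [vs e] is one fewer new
    vertex. *)
Lemma team_new_exc : ~~ ((vs f :|: VV (blocks F)) :&: Z \subset vs e) ->
  #|new :\: Z| + 1 <= w * (#|U| + 1).
Proof.
case: (eqVneq B1 set0) => [B10|B1n _]; last exact: team_new_old.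
case/subsetPn => x /setIP[xn xZ] xe.
apply: (team_arith2 F_split (eq_leq card_VV_team)).
apply: leq_trans (_ : #|new :\: Z| + #|x |: vs e| <= _).
  by rewrite leq_add2l cardsU1 xe card_vs B10 cards0 addn0 muln1 /w sub2_add3.
apply: peel.
- rewrite VV_team subUset sub1set subsetUl andbT inE xn orbT //.
- by rewrite B10 /blocks imset0 VV0 setU0 subsetUr.
- by rewrite subUset sub1set xZ.
Qed.

(** Here [f] is old too: the old subfamily has at least two members, and since a tag is missing it
    is still proper. *)
Lemma team_codeg : vs f \subset Z -> U != set0 -> #|new :\: Z| + 1 <= w * #|U|.
Proof.
rewrite -card_gt0 => fZ U0.
have sub2 : e |: (f |: blocks B1) \subset team e f F by rewrite !setUS // imsetS.
have card2 : #|e |: (f |: blocks B1)| = 2 + #|B1|.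
  by rewrite !cardsU1 !inE negb_or ef eB1 fB1 card_blocks_sub.
have ne2 : e |: (f |: blocks B1) != team e f F.
  apply/eqP => h; have := congr1 (fun X : {set block} => #|X|) h.
  rewrite /= card2 card_team -F_split => /eqP; rewrite eqn_add2l -{1}[#|B1|]addn0 eqn_add2l.
  by rewrite eq_sym gtn_eqF.
apply: (team_arith3 F_split (eq_leq card_VV_team)).
apply: leq_trans (_ : #|new :\: Z| + #|VV (e |: (f |: blocks B1))| <= _).
  by rewrite leq_add2l -card2; apply: (crit_sub cC sub2 ne2); rewrite card2.
apply: peel; first exact: VVS.
  by rewrite !VVU1 setUS // subsetUr.
by rewrite !VVU1 !subUset eZ fZ.
Qed.

End Team.

Section Bounds.
Local Open Scope ring_scope.
Variables (R : realType) (V : finType) (J : {set {set V}}) (n T : nat) (d th : R).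
Notation block := (block V n).
Notation tag := (block * 'I_T)%type.
Notation thr := (@thr V J n T).
Hypothesis n0 : (0 < n)%N.
Hypothesis V3 : (2 < #|V|)%N.
Hypothesis J2 : forall e, e \in J -> #|e| = 2%N.
Hypothesis d01 : 0 < d <= 1.
Hypothesis thE : th * n%:R ^+ (#|V| - 2) = d.

Definition cst (L : nat) : R := sum_const V T R L (#|V| * (L + 3)).

Lemma cst_ge (L : nat) : (2 ^ L)%:R <= cst L.
Proof.
rewrite ler_nat -mulnA leq_pmulr // muln_gt0 /= muln_gt0 !expn_gt0 /=.
by rewrite addn_gt0 !muln_gt0 addn3 /= (leq_trans _ V3).
Qed.

Lemma cst_ge1 L : 1 <= cst L.
Proof. by apply: le_trans (cst_ge L); rewrite ler1n expn_gt0. Qed.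

Lemma card_VV (D : {set block}) : (#|VV D| <= #|D| * #|V|)%N.
Proof.
rewrite -sum_nat_const; apply: leq_trans (_ : \sum_(f in D) #|vs f| <= _)%N; last first.
  by apply: leq_sum => f _; rewrite card_vs.
rewrite /VV; elim/big_rec2: _ => [|f k S _ le]; first by rewrite cards0.
by apply: leq_trans (leq_card_setU _ _) _; rewrite leq_add2l.
Qed.

Lemma card_foot (y : item V n) fr : fr \in thr y -> (#|foot y| <= #|V|)%N.
Proof.
case: y => [[p []]|e] //=; rewrite ?inE ?card_vs //.
by case/andP => _ /imsetP[e /J2 e2 ->]; rewrite card_img e2 ltnW.
Qed.

Lemma thr_size (y : item V n) fr : fr \in thr y -> (#|fr.2| <= 5)%N.
Proof.
case: y => [[p []]|e]; rewrite inE //; first by case/andP => /eqP -> _; rewrite cards0.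
by case/and5P => /eqP a b c k; exact: team_size5.
Qed.

Lemma foot_pair p (fr : block * {set tag}) : fr \in thr (inl (p, true)) ->
  [/\ fr.2 = set0, p \subset vs fr.1 & #|p| = 2%N].
Proof.
by rewrite inE => /andP[/eqP -> /imsetP[e /J2 e2 ->]]; rewrite img_sub card_img e2.
Qed.

Let new (fr : block * {set tag}) B := vs fr.1 :|: VV (blocks (fr.2 :\: B)).

Let card_zone0 (y : item V n) fr (W : {set tag}) L : fr \in thr y -> (#|W| <= L)%N ->
  (#|foot y :|: VV (blocks W)| <= #|V| * (L + 3))%N.
Proof.
move=> ft WL; apply: leq_trans (leq_card_setU _ _) _.
apply: zone_arith (card_foot ft) (card_VV (blocks W)) _.
exact: leq_trans (leq_imset_card _ _) WL.
Qed.

Lemma sumset0 (X : finType) (S : {set X}) (G : X -> R) c : (forall x, x \in S -> \sum_(z in S) G z <= c) ->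
  0 <= c -> \sum_(z in S) G z <= c.
Proof.
move=> h c0; case: (set_0Vmem S) => [->|[x xS]]; first by rewrite big_set0.
exact: h xS.
Qed.

Lemma thr_crude L (y : item V n) (W : {set tag}) : (#|W| <= L)%N ->
  th * (\sum_(fr in thr y) th ^+ #|fr.2 :\: W|) <= cst L.
Proof.
move=> WL; case: (set_0Vmem (thr y)) => [->|[fr0 fr0t]].
  by rewrite big_set0 mulr0 (le_trans ler01) ?cst_ge1.
rewrite -[th in th * _]expr1 -[cst L]mulr1 -[X in cst L * X](expr0 n%:R^-1).
apply: (tags_sum n0 d01 thE _ WL (card_zone0 fr0t WL)) => // fr frt.
split; first exact: thr_size frt.
rewrite addn0; case: y frt {fr0 fr0t} => [[p []]|e] frt; last 1 first.
- move: (frt); rewrite inE => /and5P[/eqP a b c k cC].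
  apply: (team_new V3 a b c k cC); first exact: subsetUl.
  by apply: subset_trans (subsetUr _ _); apply/VVS/imsetS/subsetIr.
- have [-> sp p2] := foot_pair frt; rewrite set0D cards0 add0n muln1.
  rewrite /blocks imset0 VV0 setU0 -(card_vs fr.1) -p2 /= cardsD.
  by rewrite leq_sub2l // subset_leq_card // subsetI sp subsetUl.
- by rewrite inE in frt.
Qed.

Lemma thr_exc L Y B (y : item V n) : good Y B -> (#|Y| + #|B| <= L)%N -> y \in Y ->
  th * (\sum_(fr in thr y | fr \in exc Y B y) th ^+ #|fr.2 :\: B|) <= cst L * n%:R^-1.
Proof.
move=> g sz yY; have BL := leq_trans (leq_addl _ _) sz.
rewrite -[th in th * _]expr1 -[X in cst L * X]expr1.
rewrite (eq_bigl (fun fr => fr \in thr y :&: exc Y B y)); last by move=> fr; rewrite !inE.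
have zL : (#|zone Y B| <= #|V| * (L + 3))%N.
  apply: leq_trans (leq_card_setU _ _) _.
  have h1 : (#|\bigcup_(y in Y) foot y| <= #|Y| * #|V|)%N.
    rewrite -sum_nat_const; apply: leq_trans (_ : \sum_(y in Y) #|foot y| <= _)%N.
      elim/big_rec2: _ => [|i k S _ le]; first by rewrite cards0.
      by apply: leq_trans (leq_card_setU _ _) _; rewrite leq_add2l.
    apply: leq_sum => -[[p b]|e] iY /=; last by rewrite card_vs.
    by rewrite (good_card2 g iY) ltnW.
  exact: zone_arith3 h1 (card_VV (blocks B)) (leq_imset_card _ _) sz.
apply: (tags_sum n0 d01 thE _ BL zL) => // fr /setIP[frt]; rewrite inE => fex.
split; first exact: thr_size frt.
have fz := foot_zone B yY.
have bz : VV (blocks (fr.2 :&: B)) \subset zone Y B.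
  by apply: subset_trans (zone_blocks Y B); apply/VVS/imsetS/subsetIr.
case: y yY frt fex fz => [[p []]|e] yY frt fex fz; last 1 first.
- move: (frt); rewrite inE => /and5P[/eqP a b c k cC].
  exact: (team_new_exc V3 a b c k cC fz bz fex).
- have [f0 sp p2] := foot_pair frt; move: fex; rewrite /newv f0 set0D cards0 add0n muln1.
  rewrite /blocks imset0 VV0 setU0 /= => /subsetPn[x /setIP[xf xz] xp].
  have : (#|x |: p| <= #|vs fr.1 :&: zone Y B|)%N.
    by apply/subset_leq_card; rewrite subUset sub1set inE xf xz subsetI sp.
  rewrite cardsU1 xp p2 cardsD card_vs => /cap_arith; apply.
  by move: (subset_leq_card (subsetIl (vs fr.1) (zone Y B))); rewrite card_vs.
- by rewrite inE in frt.
Qed.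

Lemma thr_codeg L (y : item V n) f (W : {set tag}) : (#|W| <= L)%N ->
  \sum_(fr in thr y | (fr.1 == f) && ~~ (fr.2 \subset W)) th ^+ #|fr.2 :\: W| <= cst L * n%:R^-1.
Proof.
move=> WL; rewrite -[X in cst L * X]expr1.
pose S := [set fr in thr y | (fr.1 == f) && ~~ (fr.2 \subset W)].
rewrite (eq_bigl (fun fr => fr \in S)); last by move=> fr; rewrite inE.
have c0 : 0 <= cst L * n%:R^-1 ^+ 1.
  by apply: mulr_ge0; [exact: le_trans (cst_ge1 L)|rewrite expr1 invr_ge0 ler0n].
apply: sumset0 => // fr0; rewrite inE => /and3P[fr0t _ _].
rewrite -[X in X <= _]mul1r -[X in X * _](expr0 th).
have ZL : (#|foot y :|: (vs f :|: VV (blocks W))| <= #|V| * (L + 3))%N.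
  apply: leq_trans (leq_card_setU _ _) _.
  apply: leq_trans (leq_add (leqnn _) (leq_card_setU _ _)) _; rewrite card_vs.
  apply: zone_arith2 (card_foot fr0t) (card_VV (blocks W)) _.
  exact: leq_trans (leq_imset_card _ _) WL.
apply: (tags_sum n0 d01 thE _ WL ZL) => // fr; rewrite inE => /and3P[frt /eqP ff nsub].
split; first exact: thr_size frt.
case: y frt {fr0 fr0t ZL S c0} => [[p []]|e] frt; last 1 first.
- move: (frt); rewrite inE => /and5P[/eqP a b c k cC]; rewrite addn0.
  set Z := foot _ :|: _.
  have eZ : vs e \subset Z by exact: subsetUl.
  have FZ : VV (blocks (fr.2 :&: W)) \subset Z.
    apply: subset_trans (subset_trans _ (subsetUr _ _)) (subsetUr _ _).
    exact/VVS/imsetS/subsetIr.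
  have fZ : vs fr.1 \subset Z by rewrite ff; apply: subset_trans (subsetUl _ _) (subsetUr _ _).
  have U0 : fr.2 :\: W != set0 by rewrite setD_eq0.
  exact: (team_codeg a b c k cC eZ FZ fZ U0).
- by have [f0 _ _] := foot_pair frt; rewrite f0 sub0set in nsub.
- by rewrite inE in frt.
Qed.

End Bounds.

End ThreatBounds.

(** * Vertex permutations and the uniformity of degrees *)

Module Symmetry.
Import RandomProcess Blocks Items Counting.
Import Order.TTheory GRing.Theory Num.Theory.

Section Symmetry.
Variables (V : finType) (J : {set {set V}}) (n : nat).
Notation block := (block V n).

Lemma pact_proof (s : {perm 'I_n}) (f : block) : injectiveb [ffun x => s (val f x)].
Proof. by apply/injectiveP => x y; rewrite !ffunE => /perm_inj /block_inj. Qed.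

Definition pact (s : {perm 'I_n}) (f : block) : block :=
  exist (fun g : {ffun V -> 'I_n} => injectiveb g) _ (pact_proof s f).

Lemma pactE s f x : val (pact s f) x = s (val f x).
Proof. by rewrite ffunE. Qed.

Lemma pactM s t f : pact (s * t)%g f = pact t (pact s f).
Proof. by apply/val_inj/ffunP => x; rewrite !pactE permM. Qed.

Lemma pact1 f : pact 1%g f = f.
Proof. by apply/val_inj/ffunP => x; rewrite pactE perm1. Qed.

Lemma pactK s : cancel (pact s) (pact s^-1%g).
Proof. by move=> f; rewrite -pactM mulgV pact1. Qed.

Lemma pactKV s : cancel (pact s^-1%g) (pact s).
Proof. by move=> f; rewrite -pactM mulVg pact1. Qed.

Lemma pact_inj s : injective (pact s).
Proof. exact: can_inj (pactK s). Qed.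

Lemma img_pact s f e : img (pact s f) e = s @: img f e.
Proof.
by rewrite -imset_comp; apply: eq_imset => x; rewrite pactE.
Qed.

Lemma VV_pact s (C : {set block}) : VV (pact s @: C) = s @: VV C.
Proof.
apply/setP => y; apply/bigcupP/imsetP => [[_ /imsetP[f fC ->]]|[x /bigcupP[f fC xf] ->]].
  by rewrite /vs img_pact => /imsetP[x xf ->]; exists x => //; apply/bigcupP; exists f.
by exists (pact s f); rewrite ?imset_f // /vs img_pact imset_f.
Qed.

Lemma crit_pact s (C : {set block}) : crit C -> crit (pact s @: C).
Proof.
have cV (D : {set block}) : #|VV (pact s @: D)| = #|VV D| by rewrite VV_pact card_imset //; exact: perm_inj.
have cD (D : {set block}) : #|pact s @: D| = #|D| by apply: card_imset; exact: pact_inj.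
case/and4P => h1 h2 h3 /forallP h4; apply/and4P; rewrite cV cD; split => //.
apply/forallP => D; have -> : D = pact s @: (pact s^-1%g @: D).
  by rewrite -imset_comp (eq_imset (g := id)) ?imset_id // => x /=; rewrite pactKV.
rewrite cV cD; apply/implyP => /andP[pr c]; apply: (implyP (h4 _)); rewrite c andbT.
move: pr; rewrite !properEneq => /andP[ne sub]; apply/andP; split.
  by apply: contraNneq ne => ->.
apply/subsetP => x xD; have := subsetP sub _ (imset_f (pact s) xD).
by rewrite mem_imset //; exact: pact_inj.
Qed.

(** One vertex is corrected at a time by a transposition that leaves the correct ones in place. *)
Lemma pact_trans (e e' : block) : exists s, pact s e = e'.
Proof.
pose D (s : {perm 'I_n}) := [set x | s (val e x) != val e' x].
suff h k : forall s : {perm 'I_n}, #|D s| <= k -> exists s, pact s e = e'.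
  exact: (h _ 1%g (leqnn _)).
elim: k => [|k IH] s.
  rewrite leqn0 cards_eq0 => /eqP /setP h; exists s; apply/val_inj/ffunP => x.
  by have := h x; rewrite inE in_set0 pactE => /negbFE/eqP.
case: (set_0Vmem (D s)) => [D0 _|[x xD] Dk]; first by apply: (IH s); rewrite D0 cards0.
apply: (IH (s * tperm (s (val e x)) (val e' x))%g); rewrite -ltnS; apply: leq_trans Dk.
apply: (@leq_ltn_trans #|D s :\ x|); last by rewrite [ltnRHS](cardsD1 x) xD.
apply/subset_leq_card/subsetP => y; rewrite !inE permM => ny.
case: (eqVneq y x) ny => [->|yx] ny /=; first by rewrite tpermL eqxx in ny.
apply: contraNneq ny => sy; rewrite tpermD ?sy //.
  by rewrite -sy; apply: contra yx => /eqP /perm_inj /block_inj ->.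
by apply: contra yx => /eqP /block_inj ->.
Qed.

Lemma perm_pair (p p' : {set 'I_n}) : #|p| = 2 -> #|p'| = 2 -> exists s : {perm 'I_n}, s @: p = p'.
Proof.
move=> /eqP/cards2P[a [b [ab ->]]] /eqP/cards2P[c [d [cd ->]]].
exists (tperm a c * tperm (tperm a c b) d)%g.
have h x : (tperm a c * tperm (tperm a c b) d)%g x = tperm (tperm a c b) d (tperm a c x).
  exact: permM.
rewrite imsetU !imset_set1 !h tpermL tpermL tpermD //; last by rewrite eq_sym.
by rewrite -{2}(tpermL a c) (inj_eq perm_inj) eq_sym.
Qed.

(** Threats of a token with the labels forgotten. By transitivity their number depends on [k] alone,
    so all tokens have the same hazard. *)
Definition partners k (e : block) : {set block * {set block}} :=
  [set fR : block * {set block} | [&& #|fR.2| == k, e != fR.1, e \notin fR.2, fR.1 \notin fR.2 &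
     crit (e |: (fR.1 |: fR.2))]].

Lemma card_partners k e e' : #|partners k e| = #|partners k e'|.
Proof.
suff le a b : #|partners k a| <= #|partners k b| by apply/eqP; rewrite eqn_leq !le.
have [s sab] := pact_trans a b.
pose G (fR : block * {set block}) := (pact s fR.1, pact s @: fR.2).
have Gi : injective G.
  move=> [f X] [g Z] /pair_equal_spec[/= /pact_inj -> h]; congr pair.
  exact: (imset_inj (@pact_inj s) h).
rewrite -(card_imset _ Gi); apply/subset_leq_card/subsetP => _ /imsetP[[f X] fX ->].
move: fX; rewrite !inE /= -sab => /and5P[h1 h2 h3 h4 h5].
rewrite card_imset ?h1; last exact: pact_inj.
rewrite (inj_eq (@pact_inj s)) h2 !mem_imset ?h3 ?h4 /=; try exact: pact_inj.
by have := crit_pact s h5; rewrite !imsetU !imset_set1.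
Qed.

Definition covers (p : {set 'I_n}) : {set block} := [set f | p \in [set img f e | e in J]].

Lemma card_covers (p p' : {set 'I_n}) : #|p| = 2 -> #|p'| = 2 -> #|covers p| = #|covers p'|.
Proof.
move=> p2 p2'.
suff le (a b : {set 'I_n}) : #|a| = 2 -> #|b| = 2 -> #|covers a| <= #|covers b|.
  by apply/eqP; rewrite eqn_leq !le.
move=> a2 b2; have [s <-] := perm_pair a2 b2.
rewrite -(card_imset _ (@pact_inj s)); apply/subset_leq_card/subsetP => _ /imsetP[f + ->].
rewrite !inE => /imsetP[e eJ ->]; apply/imsetP; exists e => //.
by rewrite img_pact.
Qed.

Hypothesis J2 : forall e, e \in J -> #|e| = 2.

Lemma covers_total (p : {set 'I_n}) : #|p| = 2 -> 'C(n, 2) * #|covers p| = #|J| * #|[set: block]|.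
Proof.
move=> p2; have <- : #|[set q : {set 'I_n} | #|q| == 2]| = 'C(n, 2).
  by rewrite card_draws card_ord.
rewrite -sum_nat_const [RHS]mulnC -sum_nat_const.
transitivity (\sum_(q in [set q : {set 'I_n} | #|q| == 2])
   \sum_(f : block | q \in [set img f e | e in J]) 1).
  apply: eq_bigr => q; rewrite inE => /eqP q2; rewrite (card_covers p2 q2) -sum1_card.
  by apply: eq_bigl => f; rewrite inE.
rewrite (exchange_big_dep predT) //=; apply: eq_big => [f|f _]; first by rewrite inE.
rewrite sum1_card -[RHS](card_imset _ (@img_inj _ _ f)); apply: eq_card => q.
rewrite unfold_in inE; case: (boolP (q \in _)) => [/imsetP[e eJ ->]|]; last by rewrite andbF.
by rewrite card_img J2.
Qed.

End Symmetry.

Section Labels.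
Local Open Scope ring_scope.
Variables (R : comNzRingType) (H : finType) (T : nat) (g : 'I_T -> R).
Hypothesis T0 : (0 < T)%N.
Notation tag := (H * 'I_T)%type.

(** Tag sets over [X] with one label per block are functions from [X] to labels, and distributivity
    gives the power. *)
Lemma sum_labels (X : {set H}) :
  \sum_(F : {set tag} | (#|blocks F| == #|F|) && (blocks F == X)) \prod_(b in F) g b.2 =
  (\sum_l g l) ^+ #|X|.
Proof.
pose j0 := Ordinal T0.
pose h (phi : {ffun H -> 'I_T}) : {set tag} := [set (a, phi a) | a in X].
pose h' (F : {set tag}) : {ffun H -> 'I_T} := [ffun a => odflt j0 [pick l | (a, l) \in F]].
have hE phi a l : ((a, l) \in h phi) = (a \in X) && (l == phi a).
  by apply/imsetP/andP => [[b bX [-> ->]]|[aX /eqP ->]]; rewrite ?bX //; exists a.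
have blh phi : blocks (h phi) = X.
  by rewrite /blocks /h -imset_comp (eq_imset (g := id)) ?imset_id.
have cardh phi : #|h phi| = #|X| by apply: card_imset => a b [].
rewrite (reindex_onto h h') /=; last first.
  move=> F /andP[/imset_injP inj /eqP FX]; apply/setP => -[a l]; rewrite hE ffunE.
  have aX : (a \in X) = [exists l', (a, l') \in F].
    rewrite -FX; apply/imsetP/existsP => [[[b l'] bF /= ->]|[l' aF]]; first by exists l'.
    by exists (a, l').
  case: pickP => [l1 al1|no] /=.
    have -> : a \in X by rewrite aX; apply/existsP; exists l1.
    by apply/eqP/idP => [->//|al]; have [] := inj _ _ al al1 erefl.
  rewrite aX (_ : [exists _, _] = false) /=; last by apply/existsP => -[l']; rewrite no.
  by rewrite no.
rewrite -prodr_const (big_distr_big j0 (mem X) predT) /=.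
apply: eq_big => phi; last first.
  by move=> _; rewrite /h big_imset //= => a b _ _ [].
rewrite blh eqxx cardh eqxx /=; apply/eqP/pffun_onP => [e|[sup _]].
  split=> [|l _]; last by [].
  apply/subsetP => a; rewrite unfold_in; apply: contraR => aX.
  by rewrite -e ffunE; case: pickP => [l|//]; rewrite hE (negPf aX).
apply/ffunP => a; rewrite ffunE; case: (boolP (a \in X)) => aX.
  case: pickP => [l|/(_ (phi a))]; first by rewrite hE aX => /eqP.
  by rewrite hE aX eqxx.
case: pickP => [l|_] /=; first by rewrite hE (negPf aX).
apply/eqP; rewrite eq_sym; apply: contraR aX => h1; exact: (subsetP sup).
Qed.

End Labels.

End Symmetry.

(** * Threat degrees and hazard polynomials *)

Module Weights.
Import RandomProcess RealBounds Chaos Trajectory Blocks Items Counting ThreatBounds Symmetry.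
Import Order.TTheory GRing.Theory Num.Theory.

Section Weights.
Variables (V : finType) (J : {set {set V}}) (n : nat).
Notation block := (block V n).
Hypothesis V3 : 2 < #|V|.
Hypothesis J2 : forall e, e \in J -> #|e| = 2.

Definition cover_deg : nat := \max_(p : {set 'I_n} | #|p| == 2) #|covers J p|.
Definition partner_deg k : nat := \max_(e : block) #|partners k e|.

Lemma cover_degE (p : {set 'I_n}) : #|p| = 2 -> #|covers J p| = cover_deg.
Proof.
move=> p2; apply/eqP; rewrite eqn_leq; apply/andP; split.
  by apply: leq_bigmax_cond; rewrite p2.
by apply/bigmax_leqP => q /eqP q2; rewrite (card_covers J q2 p2).
Qed.

Lemma partner_degE k (e : block) : #|partners k e| = partner_deg k.
Proof.
apply/eqP; rewrite eqn_leq leq_bigmax /=.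
by apply/bigmax_leqP => e' _; rewrite (card_partners k e' e).
Qed.

Lemma covers_n2 (p : {set 'I_n}) : #|p| != 2 -> covers J p = set0.
Proof.
move=> p2; apply/setP => f; rewrite !inE; apply/imsetP => -[e /J2 e2 pe].
by move: p2; rewrite pe card_img e2.
Qed.

(** From the double count [covers_total]; the 2 stands for the two orientations of a pair. *)
Lemma cover_deg_ffact : 1 < n -> cover_deg = (2 * #|J| * (n - 2) ^_ (#|V| - 2))%N.
Proof.
move=> n1; have [a [b ab]] : exists a, exists b : 'I_n, a != b.
  by exists (Ordinal (ltnW n1)), (Ordinal n1).
have p2 : #|[set a; b]| = 2 by rewrite cards2 ab.
have := covers_total J2 p2; rewrite (cover_degE p2) cardsT.
have -> : #|{: block}| = (n ^_ 2 * (n - 2) ^_ (#|V| - 2))%N.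
  rewrite card_sig; have := card_inj_ffuns V 'I_n; rewrite cardsE card_ord => ->.
  by rewrite -{1}(subnK (ltnW V3)) addn2 !ffactnS ffactn0 muln1 mulnA -!subn1 -subnDA.
have e2 : n ^_ 2 = 'C(n, 2) * 2 by rewrite -bin_ffact.
rewrite e2 -!mulnA mulnCA => /eqP; rewrite eqn_pmul2l ?bin_gt0 // => /eqP ->.
by rewrite mulnCA.
Qed.

Lemma ffact_lower w : 2 * (w + 2) <= n -> n ^ w <= 2 ^ w * (n - 2) ^_ w.
Proof.
move=> h; rewrite ffact_prod -[w in _ ^ w](card_ord w) -[w in 2 ^ w](card_ord w).
rewrite -!prod_nat_const -big_split /=; apply: leq_prod => i _.
by have := ltn_ord i; lia.
Qed.

Lemma ffact_upper m w : m ^_ w <= m ^ w.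
Proof.
rewrite ffact_prod -[w in _ ^ w](card_ord w) -prod_nat_const.
by apply: leq_prod => i _; exact: leq_subr.
Qed.

Local Open Scope ring_scope.
Variable R : realType.

(** For a token, the generating polynomial of its threats by number of tags. The degree is at most
    5, as a critical family has at most seven members including the token and the block selected
    last. *)
Definition Theta (t : option bool) (x : R) : R :=
  match t with
  | Some true => cover_deg%:R
  | Some false => \sum_(k < 6) (partner_deg k)%:R * x ^+ k
  | None => 0
  end.

Lemma thr_weight T (y : item V n) (g : 'I_T -> R) : (0 < T)%N ->
  \sum_(fr in @thr V J n T y) \prod_(b in fr.2) g b.2 = Theta (ty y) (\sum_l g l).
Proof.
move=> T0; case: y => [[p []]|e].
- pose h (f : block) : block * {set block * 'I_T} := (f, set0).
  have -> : @thr V J n T (inl (p, true)) = h @: covers J p.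
    apply/setP => -[f F]; rewrite inE; apply/andP/imsetP => /= [[/eqP -> pf]|[f' + [-> ->]]].
      by exists f; rewrite ?inE.
    by rewrite inE => ->; rewrite eqxx.
  rewrite big_imset /=; last by move=> a b _ _ [].
  rewrite (eq_bigr (fun=> 1)); last by move=> f _; rewrite big_set0.
  rewrite /=; case: eqP => /= [/cover_degE <-|/eqP /covers_n2 ->]; first by rewrite sumr_const.
  by rewrite big_set0.
- by rewrite /= big_set0.
pose P : {set block * {set block}} := [set fX : block * {set block} |
   [&& e != fX.1, e \notin fX.2, fX.1 \notin fX.2 & crit (e |: (fX.1 |: fX.2))]].
have P5 fX : fX \in P -> (#|fX.2| < 6)%N.
  rewrite inE => /and4P[h1 h2 h3 /and4P[_]].
  by rewrite !cardsU1 h3 !inE negb_or h1 h2 /= !add1n.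
rewrite (partition_big (fun fr : block * {set block * 'I_T} => (fr.1, blocks fr.2))
  (fun fX => fX \in P)) /=; last first.
  by move=> fr; rewrite !inE => /and5P[_ -> -> -> ->].
rewrite (eq_bigr (fun fX : block * {set block} => (\sum_l g l) ^+ #|fX.2|)); last first.
  move=> [f X] /[1!inE] /= /and4P[h1 h2 h3 h4].
  rewrite -(sum_labels g T0 X).
  rewrite (reindex_onto (fun F => (f, F)) snd) /=; last first.
    by move=> [f' F] /= /andP[_ /eqP[-> _]].
  apply: eq_bigl => F; rewrite eqxx andbT inE /= xpair_eqE eqxx /=.
  rewrite /team; case: (eqVneq (blocks F) X) => [->|]; rewrite ?andbF //.
  by rewrite h1 h2 h3 h4 !andbT.
rewrite (partition_big (fun fX : block * {set block} => inord #|fX.2| : 'I_6) predT) //=.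
apply: eq_bigr => k _; rewrite -(partner_degE k e) -sumr_const mulr_suml.
apply: eq_big => [fX|fX /andP[/P5 fXP /eqP <-]]; last by rewrite inordK // mul1r.
rewrite [RHS]inE; case: (boolP (fX \in P)) => fXP.
  have := fXP; rewrite inE => /and4P[-> -> -> ->]; rewrite !andbT /=.
  by rewrite -val_eqE /= inordK // P5.
by rewrite inE in fXP; rewrite (negPf fXP) andbF.
Qed.

Lemma cover_deg_bounds : (2 * #|V| <= n)%N ->
  (2 * #|J|)%:R / 2 ^+ (#|V| - 2) * n%:R ^+ (#|V| - 2) <= cover_deg%:R :> R /\
  cover_deg%:R <= (2 * #|J|)%:R * n%:R ^+ (#|V| - 2) :> R.
Proof.
move=> nV; have n1 : (1 < n)%N by lia.
rewrite cover_deg_ffact //; set w := (#|V| - 2)%N; set A := (2 * #|J|)%N.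
split; last first.
  by rewrite natrM ler_wpM2l // -natrX ler_nat (leq_trans (ffact_upper _ _)) // leq_exp2rW // leq_subr.
rewrite natrM -mulrA ler_wpM2l // mulrC ler_pdivrMr ?exprn_gt0 // mulrC.
by rewrite -!natrX -natrM ler_nat ffact_lower // subnK // ltnW.
Qed.

(** Read off from [thr_crude] with a single round and [d] equal to 1, where a tag weighs exactly
    n^-w: one term of [Theta] is at most the whole sum. *)
Lemma partner_deg_le k : (0 < n)%N -> (k < 6)%N -> 
  (partner_deg k)%:R <= cst R V 1 0 * (n%:R ^+ (#|V| - 2)) ^+ k.+1 :> R.
Proof.
move=> n0 k6; set w := (#|V| - 2)%N.
have N0 : (0 : R) < n%:R ^+ w by rewrite exprn_gt0 // ltr0n.
case: (pickP (fun _ : block => true)) => [e _|no]; last first.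
  rewrite /partner_deg big1 => [|e]; last by have := no e.
  apply: mulr_ge0; last by rewrite exprn_ge0 // ltW.
  exact: le_trans ler01 (cst_ge1 _ _ V3 _).
have thE : (n%:R ^+ w)^-1 * n%:R ^+ w = 1 :> R by rewrite mulVf ?gt_eqF.
have d1 : 0 < (1 : R) <= 1 by rewrite ltr01 lexx.
have := @thr_crude R V J n 1 1 _ n0 V3 J2 d1 thE 0 (inr e) set0; rewrite cards0 => /(_ isT).
rewrite (eq_bigr (fun fr : block * {set block * 'I_1} => \prod_(b in fr.2) (n%:R ^+ w)^-1)); last first.
  by move=> fr _; rewrite prodr_const setD0.
rewrite (thr_weight (inr e) (fun=> (n%:R ^+ w)^-1)) // big_ord1 /= => h.
rewrite exprS -ler_pdivrMr ?mulr_gt0 ?exprn_gt0 ?ltr0n //; apply: le_trans _ h.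
rewrite (bigD1 (Ordinal k6)) //= mulrDr exprVn invfM mulrCA -[X in X <= _]addr0.
rewrite lerD2l mulr_ge0 ?invr_ge0 ?(ltW N0) // sumr_ge0 // => i _.
by rewrite mulr_ge0 // exprn_ge0 // invr_ge0 ltW.
Qed.

End Weights.

End Weights.

(** * The initial reservation and the recursion of the trajectory *)

Module InitialState.
Import RandomProcess RealBounds Chaos Trajectory Blocks Items Counting ThreatBounds Symmetry Weights.
Import Order.TTheory GRing.Theory Num.Theory.
Local Open Scope ring_scope.

Section Types.
Variables (V : finType) (J : {set {set V}}) (n : nat) (R : realType).
Notation block := (block V n).
Hypothesis J2 : forall e, e \in J -> #|e| = 2%N.

Lemma req_types (u : option bool -> R) (f : block) :
  \prod_(y in req J f) u (ty y) =
  u (Some true) ^+ #|J| * u (Some false) * u None ^+ #|pairs2 V :\: J|.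
Proof.
have JP : J \subset pairs2 V by apply/subsetP => e /J2 e2; rewrite inE e2.
rewrite /req prod_disjU; last first.
  by rewrite -setI_eq0; apply/eqP/setP => i; rewrite !inE; apply/negP => /andP[/imsetP[e _ ->]].
rewrite big_set1 big_imset /=; last by move=> a b _ _ [/img_inj].
rewrite -{1}(setID (pairs2 V) J) (setIidPr JP) prod_disjU; last first.
  by rewrite -setI_eq0; apply/eqP/setP => i; rewrite !inE; case: (i \in J).
rewrite -mulrA -[RHS]mulrA [u _ * _ in RHS]mulrC mulrA [in RHS]mulrA; congr (_ * _ * _).
  rewrite -prodr_const; apply: eq_bigr => e eJ.
  by rewrite eJ /= card_img (J2 eJ).
rewrite -prodr_const; apply: eq_bigr => e; rewrite inE => /andP[/negPf -> _] //.
Qed.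

Lemma card_req (f : block) : (#|req J f| <= #|pairs2 V| + 1)%N.
Proof.
rewrite /req; apply: leq_trans (leq_card_setU _ _) _.
by rewrite cards1 leq_add2r leq_imset_card.
Qed.

(** Pairs in [o] may be covered as [J]-pairs, the others are reserved; all tokens start alive. *)
Definition start (o : {set {set 'I_n}}) : {set item V n} :=
  [set y | match y with inl (p, b) => (p \in o) == b | inr _ => true end].

(** Independence is exact at the start, because [good_cons] keeps a pair from being required in both
    roles. *)
Lemma start_types (eps : R) (q0 : R) T (Y : {set item V n}) : q0 = 1 ->
  @good V n T Y set0 ->
  \sum_o wt (fun=> 1 - eps) o * (Y \subset start o)%:R =
  \prod_(y in Y) match ty y with Some true => 1 - eps | Some false => q0 | None => eps end.
Proof.
move=> -> g; pose M := [set p | inl (p, true) \in Y]; pose K := [set p | inl (p, false) \in Y].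
have d : [disjoint M & K].
  by rewrite -setI_eq0; apply/set0Pn => -[p /setIP[]]; rewrite !inE => h1 h2; exact: (good_cons g h1 h2).
have e (o : {set {set 'I_n}}) : (Y \subset start o) = (M \subset o) && [disjoint K & o].
  apply/subsetP/andP => [h|[/subsetP sM /pred0P dK] [[p b]|f] yY]; last by rewrite inE.
    split; first by apply/subsetP => p; rewrite inE => /h; rewrite inE => /eqP.
    rewrite -setI_eq0; apply/set0Pn => -[p /setIP[]]; rewrite inE => /h; rewrite inE => /eqP -> //.
  rewrite inE; case: b yY => yY; first by rewrite sM // inE.
  by have := dK p; rewrite /= inE yY /= => ->.
rewrite (eq_bigr _ (fun o _ => congr1 (fun b : bool => wt _ o * b%:R) (e o))) wt_ind //.
rewrite [X in _ * X = _](eq_bigr (fun=> eps)) => [|p _]; last by rewrite subKr.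
rewrite (big_mkcond (fun y => y \in Y)) big_sumType /=.
rewrite [X in _ = _ * X]big1 ?mulr1; last by move=> f _; case: ifP.
pose G (i : item V n) : R := if i \in Y then
  match ty i with Some true => 1 - eps | Some false => 1 | None => eps end else 1.
rewrite [RHS](_ : _ = \prod_p \prod_(b : bool) G (inl (p, b))); last first.
  by rewrite pair_bigA; apply: eq_bigr => -[p b] _.
rewrite (big_mkcond (fun y => y \in M)) (big_mkcond (fun y => y \in K)) -big_split /=.
apply: eq_bigr => p _; rewrite big_bool /G /= !inE; congr (_ * _).
by case: ifP => // pY; rewrite (good_card2 g pY).
Qed.

End Types.

Section Traj.
Variables (R : realType) (kJ nJ : nat) (eps th Pc : R) (Qc : R -> R) (T : nat).
(** The third component accumulates the selection probabilities [gl]; its cutoff at [T] reflects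
    that labels lie in ['I_T]. *)
Fixpoint traj (i : nat) : R * R * R :=
  if i is j.+1 then
    let: (p, q, s) := traj j in
    (p * expR (- (p ^+ kJ.-1 * q * eps ^+ nJ * Pc)),
     q * expR (- (p ^+ kJ * q * eps ^+ nJ * Qc s)),
     s + (if (j < T)%N then th * (p ^+ kJ * q * eps ^+ nJ) else 0))
  else (1 - eps, 1, 0).
Definition tp i := (traj i).1.1.
Definition tq i := (traj i).1.2.
Definition ts i := (traj i).2.

Lemma tpS i : tp i.+1 = tp i * expR (- (tp i ^+ kJ.-1 * tq i * eps ^+ nJ * Pc)).
Proof. by rewrite /tp /tq /=; case: (traj i) => [[p q] s]. Qed.
Lemma tqS i : tq i.+1 = tq i * expR (- (tp i ^+ kJ * tq i * eps ^+ nJ * Qc (ts i))).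
Proof. by rewrite /tp /tq /ts /=; case: (traj i) => [[p q] s]. Qed.
Lemma tsS i : ts i.+1 = ts i + (if (i < T)%N then th * (tp i ^+ kJ * tq i * eps ^+ nJ) else 0).
Proof. by rewrite /tp /tq /ts /=; case: (traj i) => [[p q] s]. Qed.

Hypothesis eps01 : 0 < eps < 1.
Hypothesis th0 : 0 <= th.
Hypothesis Pc0 : 0 <= Pc.
Hypothesis Qc0 : forall x, 0 <= x -> 0 <= Qc x.

Lemma traj_bounds i : [/\ 0 < tp i <= 1, 0 < tq i <= 1 & 0 <= ts i].
Proof.
case/andP: eps01 => e0 e1.
elim: i => [|i [/andP[p0 p1] /andP[q0 q1] s0]].
  by rewrite /tp /tq /ts /=; split; try (apply/andP; split); lra.
have en0 : 0 <= eps ^+ nJ by rewrite exprn_ge0 // ltW.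
have a0 k : 0 <= tp i ^+ k * tq i * eps ^+ nJ.
  by rewrite mulr_ge0 // mulr_ge0 ?exprn_ge0 // ltW.
have dec x z : 0 < x <= 1 -> 0 <= z -> 0 < x * expR (- z) <= 1.
  move=> /andP[x0 x1] z0; rewrite mulr_gt0 ?expR_gt0 // mulr_ile1 ?expR_ge0 ?(ltW x0) //.
  by rewrite -expR0 ler_expR oppr_le0.
rewrite tpS tqS tsS; split.
- by apply: dec; rewrite ?p0 // mulr_ge0.
- by apply: dec; rewrite ?q0 // mulr_ge0 // Qc0.
- by rewrite addr_ge0 //; case: ifP => // _; rewrite mulr_ge0.
Qed.

Lemma ts_sum i : \sum_(l < T) (if (l < i)%N then th * (tp l ^+ kJ * tq l * eps ^+ nJ) else 0) = ts i.
Proof.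
elim: i => [|i IH]; first by rewrite big1.
rewrite tsS -IH; case: ifP => iT.
  rewrite (bigD1 (Ordinal iT)) //= ltnS leqnn [X in _ = X + _](bigD1 (Ordinal iT)) //= ltnn add0r addrC.
  congr (_ + _); apply: eq_bigr => l; rewrite -val_eqE /= => li.
  by rewrite ltnS leq_eqVlt (negPf li).
rewrite addr0; apply: eq_bigr => l _; rewrite ltnS leq_eqVlt.
by case: eqP => // li; move: iT; rewrite -li ltn_ord.
Qed.

End Traj.

End InitialState.

(** * Survival probability of a pair *)

Module Survival.
Import RandomProcess RealBounds Chaos Trajectory Blocks Items Counting ThreatBounds Symmetry Weights InitialState.
Import Order.TTheory GRing.Theory Num.Theory.
Local Open Scope ring_scope.

Section Alive.
Variables (V : finType) (J : {set {set V}}) (R : realType) (eps eta : R).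
Hypothesis V3 : (2 < #|V|)%N.
Hypothesis J2 : forall e, e \in J -> #|e| = 2%N.
Hypothesis J0 : (0 < #|J|)%N.
Hypothesis eps01 : 0 < eps < 1.
Hypothesis eta0 : 0 < eta.
Let w := (#|V| - 2)%N.
Let kJ := #|J|.
Let nJ := #|pairs2 V :\: J|.
Let c1 : R := (2 * #|J|)%:R / 2 ^+ w.
Let c2 : R := (2 * #|J|)%:R.
Let c3 : R := 6 * cst R V 1 0.

Definition rounds_scale : R := horizon kJ nJ eps c1 c2 c3 eta.

Let c10 : 0 < c1. Proof. by rewrite divr_gt0 ?exprn_gt0 // ltr0n muln_gt0. Qed.
Let c20 : 0 <= c2. Proof. exact: ler0n. Qed.
Let c31 : 1 <= cst R V 1 0. Proof. exact: cst_ge1. Qed.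
Let c30 : 0 <= c3. Proof. by rewrite mulr_ge0 // (le_trans ler01). Qed.

Lemma rounds_scale_gt0 : 0 < rounds_scale.
Proof. by case/andP: eps01 => e0 e1; exact: horizon_gt0. Qed.

Variable T : nat.
Hypothesis T0 : (0 < T)%N.
Hypothesis tT : rounds_scale <= T%:R.
Let d : R := rounds_scale / T%:R.
Let d01 : 0 < d <= 1.
Proof. by rewrite divr_gt0 ?rounds_scale_gt0 ?ltr0n //= ler_pdivrMr ?ltr0n // mul1r. Qed.

(** A pair lies in about n^w blocks, so it is hit at a rate of order [d] per round; and [T] rounds
    of rate [d] last exactly until the horizon. *)
Definition rate n : R := d / n%:R ^+ w.

Section Fixed.
Variable n : nat.
Hypothesis n0 : (0 < n)%N.
Hypothesis nV : (2 * #|V| <= n)%N.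
Let N : R := n%:R ^+ w.
Let N0 : 0 < N. Proof. by rewrite exprn_gt0 // ltr0n. Qed.
Let th := rate n.

Lemma rateE : th * N = d. Proof. by rewrite divfK // gt_eqF. Qed.

Lemma rate_gt0 : 0 < th. Proof. by case/andP: d01 => d0 _; rewrite divr_gt0. Qed.

Lemma rate_le : th <= n%:R^-1.
Proof.
case/andP: d01 => d0 d1; rewrite /th /rate -/N ler_pdivrMr //.
have [k wk] : exists k, w = k.+1 by exists w.-1; rewrite prednK // subn_gt0.
by rewrite /N wk exprS mulKf ?gt_eqF ?ltr0n // (le_trans d1) // exprn_ege1 // ler1n.
Qed.

Let Dc : R := th * (cover_deg J n)%:R.
Let Qc (x : R) : R := th * Theta J n (Some false) x.

Let p := tp kJ nJ eps th Dc Qc T.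
Let q := tq kJ nJ eps th Dc Qc T.
Let s := ts kJ nJ eps th Dc Qc T.

Let Dc0 : 0 <= Dc. Proof. by rewrite mulr_ge0 // ltW // rate_gt0. Qed.

Let Qc_bounds x : 0 <= x -> 0 <= Qc x <= d * (c3 * (1 + N * x) ^+ 5).
Proof.
move=> x0; have th0 := ltW rate_gt0.
apply/andP; split.
  rewrite mulr_ge0 // sumr_ge0 // => k _; by rewrite mulr_ge0 // exprn_ge0.
rewrite /Qc mulr_sumr /c3.
have -> : d * (6 * cst R V 1 0 * (1 + N * x) ^+ 5) =
  \sum_(k < 6) d * (cst R V 1 0 * (1 + N * x) ^+ 5).
  by rewrite sumr_const card_ord -mulr_natl; ring.
apply: ler_sum => k _.
have Nx : 0 <= N * x by rewrite mulr_ge0 // ltW.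
apply: le_trans (_ : th * (cst R V 1 0 * N ^+ k.+1 * x ^+ k) <= _).
  rewrite ler_wpM2l // ler_wpM2r ?exprn_ge0 //.
  exact: (partner_deg_le V3 J2 R n0 (ltn_ord k)).
have -> : th * (cst R V 1 0 * N ^+ k.+1 * x ^+ k) = d * (cst R V 1 0 * (N * x) ^+ k).
  by rewrite -rateE exprS exprMn; ring.
case/andP: d01 => d0 _; rewrite ler_wpM2l ?(ltW d0) // ler_wpM2l ?(le_trans ler01) //.
apply: le_trans (_ : (1 + N * x) ^+ k <= _).
  by rewrite lerXn2r ?nnegrE ?addr_ge0 // lerDr.
by rewrite ler_weXn2l ?lerDl // -ltnS.
Qed.

Let Dc_bounds : c1 * d <= Dc <= c2 * d.
Proof.
have [h1 h2] := cover_deg_bounds V3 J2 R nV; have th0 := ltW rate_gt0.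
rewrite /Dc -rateE -/N; apply/andP; split.
  by rewrite mulrCA ler_wpM2l.
by rewrite [c2 * _]mulrCA ler_wpM2l.
Qed.

Let tb := traj_bounds kJ nJ T eps01 (ltW rate_gt0) Dc0 (fun x x0 => proj1 (andP (Qc_bounds x0))).

Let p_small : p T <= eta.
Proof.
case/andP: eps01 => e0 e1.
apply: (trajectory_small (q := q) (s := s) (Pc := fun=> Dc) (Qc := fun i => Qc (s i)) J0 e0 e1 c10 c20 c30 eta0 d01 N0 rateE) => //.
- by move=> i _; exact: tpS.
- by move=> i _; exact: tqS.
- by move=> i iT; rewrite /s tsS iT.
- by move=> i; exact: Qc_bounds.
- by rewrite /d divfK // pnatr_eq0 -lt0n.
Qed.

Definition alive_req_bound := (#|pairs2 V| + 6)%N.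

(** A single pair is a good configuration of size 1, so its survival probability is within [eta] of
    [p T], which is itself at most [eta]. *)
Lemma alive_PE (e : {set 'I_n}) : #|e| = 2%N ->
  chaos_err (cst R V T) n%:R^-1 alive_req_bound T 1 <= eta ->
  PE (@req V J n) (@thr V J n T) (wt (fun=> 1 - eps)) (@start V n) th T ([set inl (e, true)], set0) <= 2 * eta.
Proof.
move=> e2 err; case/andP: eps01 => e0 e1; have th0 := rate_gt0.
have nu1 : n%:R^-1 <= 1 :> R by rewrite invf_le1 ?ltr0n // ler1n.
have eps0' : 0 <= 1 - eps <= 1 by lra.
have gY : @good V n T [set inl (e, true)] set0.
  split=> //.
  - by move=> p0 b /set1P[-> _].
  - by move=> p0 _ /set1P[].
  - by move=> p0 b t _; rewrite inE.
  - by move=> t t'; rewrite inE.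
  - by move=> e0' t; rewrite inE.
  - by move=> a b /set1P.
  - move=> C cC; have -> : tok [set inl (e, true)] :|: blocks (set0 : {set block V n * 'I_T}) = set0.
      by rewrite /blocks imset0 setU0; apply/eqP; rewrite -subset0; apply/subsetP => x; rewrite !inE.
    by rewrite subset0 => /eqP C0; move: cC; rewrite C0 /crit cards0.
have gls i : \sum_(l < T) gl th kJ nJ eps p q i l = s i.
  by rewrite -[RHS]ts_sum; apply: eq_bigr.
have h : `|PE (@req V J n) (@thr V J n T) (wt (fun=> 1 - eps)) (@start V n) th T ([set inl (e, true)], set0)
    - p T| <= eta.
  rewrite (_ : p T = pred th (@ty V n) kJ nJ eps p q T [set inl (e, true)] (set0 : {set block V n * 'I_T})); last first.
    by rewrite /pred /Wt big_set1 big_set0 mulr1 /= e2.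
  refine (le_trans _ err); rewrite [X in _ <= X](_ : _ = chaos_err (cst R V T) n%:R^-1 alive_req_bound T 1 * th ^+ #|@set0 (block V n * 'I_T)%type|); last first.
    by rewrite cards0 mulr1.
  have sz : (#|@set1 (item V n) (inl (e, true))| + #|@set0 (block V n * 'I_T)%type| <= 1)%N.
    by rewrite cards1 cards0.
  refine (@chaos R (item V n) (block V n) {set {set 'I_n}} T (@req V J n) (@thr V J n T)
    (wt (fun=> 1 - eps)) (@start V n) th _ _ th0 _ (@ty V n) kJ nJ eps p q (@Theta V J n R) J0 _ _ _ _ _ _
    (@good V n T) (@exc V n T) (cst R V T) n%:R^-1 alive_req_bound _ _ _ _ _ _ _ _ _ _ _ _ _ _ _
    T 1 [set inl (e, true)] set0 gY sz) => //.
  - by move=> o; apply: wt_ge0.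
  - exact: wt_sum.
  - exact: le_trans rate_le nu1.
  - by rewrite !ltW.
  - by move=> i; have [] := tb i.
  - by move=> i; have [] := tb i.
  - by move=> i; rewrite /kap gls /p tpS; congr (_ * expR (- _)); rewrite [LHS]mulrCA -[RHS]mulrA.
  - by move=> i; rewrite /kap gls /q tqS; congr (_ * expR (- _)); rewrite [LHS]mulrCA -[RHS]mulrA.
  - exact: rate_le.
  - exact: cst_ge1.
  - exact: cst_ge.
  - by move=> f; apply: leq_trans (card_req _ f) _; rewrite leq_add2l.
  - move=> y fr frt; rewrite /alive_req_bound -[6%N]/(1 + 5)%N addnA.
    by apply: leq_add; [exact: card_req|exact: thr_size frt].
  - by move=> Y; exact: start_types.
  - exact: req_types.
  - by move=> y g _; exact: thr_weight.
  - by move=> Y B b; exact: good_move.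
  - by move=> Y B y fr; exact: good_ext.
  - by move=> L y W; exact: (thr_crude n0 V3 J2 d01 rateE).
  - by move=> L Y B y; exact: (thr_exc n0 V3 J2 d01 rateE).
  - by move=> L y f W; exact: (thr_codeg n0 V3 J2 d01 rateE).
  - by move=> Y B y y' fr fr' g yY y'Y frt nex; exact: (Items.thr_unique V3 J2 g yY frt nex y'Y).
  - by move=> Y B y b fr; exact: Items.thr_sel.
by move: h p_small; rewrite ler_norml => /andP[_]; lra.
Qed.

End Fixed.

Lemma few_alive : exists n1, forall n, (n1 <= n)%N -> 
  [/\ (0 < n)%N, (2 * #|V| <= n)%N & forall e : {set 'I_n}, #|e| = 2%N ->
  PE (@req V J n) (@thr V J n T) (wt (fun=> 1 - eps)) (@start V n) (rate n) T ([set inl (e, true)], set0) <= 2 * eta].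
Proof.
have [nu0 nu00 h] := chaos_err_small (cst R V T) alive_req_bound T 1 eta0.
pose n1 := maxn (2 * #|V|) (Num.truncn nu0^-1).+1; exists n1 => n.
rewrite geq_max => /andP[nV nn]; have n0 : (0 < n)%N by exact: leq_ltn_trans nn.
split=> // e e2; apply: alive_PE => //; apply: h.
rewrite invr_gt0 ltr0n n0 /= -[nu0]invrK lef_pV2 ?posrE ?invr_gt0 ?ltr0n //.
apply: ltW; apply: lt_le_trans (truncnS_gt _) _; by rewrite ler_nat.
Qed.

End Alive.

End Survival.

(** * Expected number of conflicts the process does not prevent *)

Module BadFamilies.
Import RandomProcess Blocks Items Counting Weights.
Import Order.TTheory GRing.Theory Num.Theory.

Lemma expn_ffact T j : T ^ j <= T ^_ j + j ^ 2 * T ^ j.-1.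
Proof.
case: j => [|j]; first by rewrite ffactn0.
elim: j => [|j IH]; first by rewrite ffactn1 expn1 leq_addr.
rewrite expnS; apply: leq_trans (leq_mul (leqnn T) IH) _; rewrite mulnDr.
apply: leq_trans (_ : T ^_ j.+2 + j.+1 * T ^ j.+1 + j.+1 ^ 2 * T ^ j.+1 <= _).
  rewrite leq_add //=; last by rewrite mulnCA -expnS.
  rewrite [T ^_ j.+2]ffactnSr [j.+1 * _]mulnC mulnC.
  apply: leq_trans (_ : T ^_ j.+1 * ((T - j.+1) + j.+1) <= _).
    by rewrite leq_mul2l addnC -leq_subLR leqnn orbT.
  rewrite mulnDr leq_add2l leq_mul2r.
  by rewrite ffact_upper orbT.
rewrite -addnA leq_add2l -mulnDl leq_mul2r /=; apply/orP; right; lia.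
Qed.

Lemma card_ninj (A : finType) T :
  #|[set h : {ffun A -> 'I_T} | ~~ injectiveb h]| <= #|A| ^ 2 * T ^ #|A|.-1.
Proof.
rewrite (_ : [set h | _] = ~: [set h : {ffun A -> 'I_T} | injectiveb h]); last by apply/setP => h; rewrite !inE.
by rewrite cardsCs setCK card_inj_ffuns card_ffun card_ord leq_subLR expn_ffact.
Qed.

Section Bad.
Variables (V : finType) (n T : nat).
Notation block := (block V n).
Notation tag := (block * 'I_T)%type.
Hypothesis n0 : 0 < n.
Let w := #|V| - 2.

(** Threats do not prevent families spanning too few vertices, nor dense families with two members
    selected in the same round, for which a threat takes effect too late. *)
Definition bad (B : {set tag}) : bool :=
  [&& 1 < #|B|, #|B| <= 7, #|blocks B| == #|B| &
    (#|VV (blocks B)| <= w * #|B| + 1) ||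
    (#|VV (blocks B)| <= w * #|B| + 2) &&
      [exists b in B, exists b' in B, (b != b') && (b.2 == b'.2)]].

Lemma card_labelled j k (P : pred {ffun 'I_j -> 'I_T}) (Q : {set tag} -> bool) :
  (forall (t : {ffun 'I_j -> block}) (l : {ffun 'I_j -> 'I_T}), injective (fun i => (t i, l i)) ->
     Q [set (t i, l i) | i : 'I_j] -> P l) ->
  #|[set B : {set tag} | [&& #|B| == j, #|VV (blocks B)| <= k & Q B]]| <=
  k ^ (j * #|V|) * n ^ k * #|[set l | P l]|.
Proof.
move=> QP.
pose dec (tl : {ffun 'I_j -> block} * {ffun 'I_j -> 'I_T}) : {set tag} :=
  [set (tl.1 i, tl.2 i) | i : 'I_j].
pose S := setX [set t : {ffun 'I_j -> block} | #|VV (t @: setT) :\: set0| <= k] [set l : {ffun 'I_j -> 'I_T} | P l].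
apply: leq_trans (_ : #|S| <= _); last first.
  rewrite cardsX leq_mul2r; apply/orP; right.
  by apply: leq_trans (card_families V n0 'I_j set0 k) _; rewrite cards0 card_ord add0n.
apply: leq_trans (leq_imset_card dec _); apply/subset_leq_card/subsetP => B.
rewrite inE => /and3P[/eqP cB Bk QB].
pose e (i : 'I_j) : tag := enum_val (cast_ord (esym cB) i).
have ei : injective e by move=> i i' /enum_val_inj /cast_ord_inj.
pose t : {ffun 'I_j -> block} := [ffun i => (e i).1].
pose l : {ffun 'I_j -> 'I_T} := [ffun i => (e i).2].
have tle i : (t i, l i) = e i by rewrite !ffunE -surjective_pairing.
have BE : B = dec (t, l).
  apply/setP => x; apply/idP/imsetP => [xB|[i _ ->]]; last by rewrite /= tle enum_valP.
  exists (cast_ord cB (enum_rank_in xB x)) => //.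
  by rewrite /= tle /e cast_ordK enum_rankK_in.
apply/imsetP; exists (t, l) => //; rewrite !inE /=; apply/andP; split.
  rewrite setD0; apply: leq_trans Bk; apply/subset_leq_card/VVS/subsetP => f /imsetP[i _ ->].
  by apply/imsetP; exists (e i); rewrite ?enum_valP // ffunE.
by apply: (QP t) => [i i'|]; [rewrite !tle => /ei | rewrite BE in QB].
Qed.

Local Open Scope ring_scope.
Variables (R : realType) (d th : R).
Hypothesis d01 : 0 < d <= 1.
Hypothesis thE : th * n%:R ^+ w = d.

Definition bad_const : R := ((7 * #|V| + 2) ^ (7 * #|V|))%:R.

(** Families short of vertices contribute O(n) for fixed [T]. The others contribute n^2, but a
    repeated label leaves only O(T^(j-1)) labellings against d^j, which is of order [d] when [d * T]
    is fixed. *)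
Lemma bad_weight_j j : (1 < j <= 7)%N ->
  \sum_(B : {set tag} | bad B && (#|B| == j)) th ^+ #|B| <=
  bad_const * T%:R ^+ 7 * n%:R + 49 * bad_const * ((1 + d * T%:R) ^+ 6 * d) * n%:R ^+ 2.
Proof.
case/andP => j1 j7; case/andP: d01 => d0 d1.
have N0 : (0 : R) < n%:R by rewrite ltr0n.
have th0 : 0 < th by rewrite -(pmulr_lgt0 _ (exprn_gt0 w N0)) thE.
have thj k : n%:R ^+ (w * j + k) * th ^+ j = d ^+ j * n%:R ^+ k.
  by rewrite -thE exprMn exprD exprM mulrAC [th ^+ j * _]mulrC.
pose S1 := [set B : {set tag} | [&& #|B| == j, #|VV (blocks B)| <= w * j + 1 & true]]%N.
pose S2 := [set B : {set tag} | [&& #|B| == j, #|VV (blocks B)| <= w * j + 2 &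
  [exists b in B, exists b' in B, (b != b') && (b.2 == b'.2)]]]%N.
apply: le_trans (_ : \sum_(B in S1 :|: S2) th ^+ j <= _).
  rewrite big_mkcond [X in _ <= X]big_mkcond; apply: ler_sum => B _; rewrite !inE.
  case: andP => [[/and4P[_ _ _ h] /eqP cB]|_].
    by move: h; rewrite cB eqxx !andbT /= => ->.
  by case: ifP => // _; rewrite exprn_ge0 // ltW.
rewrite sumr_const -[X in X <= _]mulr_natl.
apply: le_trans (_ : (#|S1| + #|S2|)%N%:R * th ^+ j <= _).
  by rewrite ler_wpM2r ?exprn_ge0 ?(ltW th0) // ler_nat leq_card_setU.
have wj : (w * j <= 7 * #|V|)%N by rewrite mulnC leq_mul // leq_subr.
have bc k : (k <= 2)%N -> ((w * j + k) ^ (j * #|V|))%:R <= bad_const.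
  move=> k2; rewrite ler_nat; apply: leq_trans (_ : (7 * #|V| + 2) ^ (j * #|V|) <= _)%N.
    by apply: leq_exp2rW; rewrite leq_add.
  by rewrite leq_pexp2l ?addn2 // leq_mul2r j7 orbT.
have b0 : 0 <= bad_const by exact: ler0n.
have Tj : (T ^ j <= T ^ 7)%N.
  by case: (posnP T) => [->|Tp]; [rewrite exp0n // ltnW | rewrite leq_pexp2l].
have dT0 : 0 <= d * T%:R by rewrite mulr_ge0 // ltW.
have key (C M k : nat) (X : R) : (k <= 2)%N -> (C <= (w * j + k) ^ (j * #|V|) * n ^ (w * j + k) * M)%N ->
    M%:R * d ^+ j <= X -> C%:R * th ^+ j <= bad_const * (X * n%:R ^+ k).
  move=> k2 CM MX; have thj0 : 0 <= th ^+ j by rewrite exprn_ge0 // ltW.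
  apply: le_trans (_ : ((w * j + k) ^ (j * #|V|) * n ^ (w * j + k) * M)%:R * th ^+ j <= _).
    by rewrite ler_wpM2r // ler_nat.
  rewrite 2!natrM (natrX _ n) (_ : _ * th ^+ j = ((w * j + k) ^ (j * #|V|))%:R * (M%:R * (n%:R ^+ (w * j + k) * th ^+ j))); last first.
    by rewrite -!mulrA; congr (_ * _); rewrite mulrCA.
  rewrite thj; apply: ler_pM; rewrite ?bc // ?mulr_ge0 ?exprn_ge0 ?(ltW d0) ?(ltW N0) //.
  by rewrite mulrA ler_wpM2r ?exprn_ge0 // ltW.
rewrite natrD mulrDl; apply: lerD.
  rewrite -[n%:R]expr1 -mulrA; apply: (key _ (T ^ j)%N) => //.
    apply: leq_trans (card_labelled (P := xpredT) _ _) _ => //.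
    have := max_card [set l : {ffun 'I_j -> 'I_T} | true]; rewrite card_ffun !card_ord => h.
    by rewrite leq_mul2l h orbT.
  apply: le_trans (_ : (T ^ j)%:R * 1 <= _); last by rewrite mulr1 -natrX ler_nat.
  by rewrite ler_wpM2l // exprn_ile1 // ltW.
rewrite -(mulrA (49 * bad_const)) -(mulrA 49) mulrCA [49 * (_ * _)]mulrA; apply: (key _ (j ^ 2 * T ^ j.-1)%N) => //.
  apply: leq_trans (card_labelled (P := fun l => ~~ injectiveb l) _ _) _ => [t l tl|].
    case/existsP=> x /andP[/imsetP[i _ ->] /existsP[y /and3P[/imsetP[i' _ ->] ne /eqP /= ll]]].
    by apply/injectiveP => li; move: ne; rewrite (li _ _ ll) eqxx.
  have := card_ninj 'I_j T; rewrite card_ord => h.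
  by rewrite leq_mul2l h orbT.
have j2 : (j ^ 2)%:R <= 49 :> R by rewrite ler_nat (leq_exp2rW 2 j7).
rewrite natrM -mulrA; apply: ler_pM => //; first by rewrite mulr_ge0 // exprn_ge0 // ltW.
have -> : d ^+ j = d ^+ j.-1 * d by rewrite -exprSr prednK // ltnW.
rewrite mulrA ler_wpM2r ?(ltW d0) // natrX -exprMn [_ * d]mulrC.
apply: le_trans (_ : (1 + d * T%:R) ^+ j.-1 <= _).
  by rewrite lerXn2r ?nnegrE ?addr_ge0 // lerDr.
by rewrite ler_weXn2l ?lerDl // -ltnS prednK // ltnW.
Qed.

End Bad.

End BadFamilies.

(** * Invariants that hold for every outcome *)

Module Invariants.
Import RandomProcess Blocks Items Counting InitialState BadFamilies.
Import Order.TTheory GRing.Theory Num.Theory.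

Section Invariant.
Variables (V : finType) (J : {set {set V}}) (n T : nat).
Notation block := (block V n).
Notation tag := (block * 'I_T)%type.
Notation state := (state (item V n) block T).
Notation thr := (@thr V J n T).
Notation req := (@req V J n).
Hypothesis V3 : 2 < #|V|.
Hypothesis J2 : forall e, e \in J -> #|e| = 2.

(** The fields about several selected blocks ask for distinct labels, since blocks of one round do
    not see one another; conflicts within a round are left to [bad]. *)
Record inv (i : nat) (sg : state) : Prop := Inv {
  inv_label : forall b, b \in sg.2 -> b.2 < i;
  inv_start : exists o, sg.1 \subset start V o /\ forall b, b \in sg.2 -> req b.1 \subset start V o;
  inv_dead : forall b e, b \in sg.2 -> e \in J -> inl (img b.1 e, true) \notin sg.1;
  inv_cov : forall b b' e e', b \in sg.2 -> b' \in sg.2 -> b.2 != b'.2 -> e \in J -> e' \in J ->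
    img b.1 e != img b'.1 e';
  inv_tok : forall e (B : {set tag}), B \subset sg.2 -> B != set0 -> {in B &, injective fst} ->
    {in B &, injective snd} -> e \notin blocks B -> crit (e |: blocks B) -> inr e \notin sg.1;
  inv_crit : forall (B : {set tag}), B \subset sg.2 -> {in B &, injective fst} -> {in B &, injective snd} ->
    ~~ crit (blocks B)
}.

Lemma req_J (f : block) e : e \in J -> inl (img f e, true) \in req f.
Proof.
move=> eJ; rewrite inE; apply/orP; left; apply/imsetP; exists e; last by rewrite eJ.
by rewrite inE J2.
Qed.

Lemma req_self (f : block) : inr f \in req f.
Proof. by rewrite req_tok. Qed.

Lemma step_sub i (sg : state) (nw : {set block}) : (step req thr i sg nw).1 \subset sg.1.
Proof. by apply/subsetP => y; rewrite inE => /andP[]. Qed.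

Lemma step_tag i (sg : state) (nw : {set block}) (b : tag) : (forall b, b \in sg.2 -> b.2 < i) ->
  b \in (step req thr i sg nw).2 -> (b \in sg.2) || (b.2 == i :> nat) && (b.1 \in fresh req sg nw).
Proof. by move=> h; rewrite inE; case: ifP => _ ->; rewrite ?orbT. Qed.

Lemma inv_init o : inv 0 (@start V n o, set0).
Proof.
split=> /=.
- by move=> b; rewrite inE.
- by exists o; split => // b; rewrite inE.
- by move=> b e; rewrite inE.
- by move=> b b' e e'; rewrite inE.
- by move=> e B; rewrite subset0 => ->.
- move=> B; rewrite subset0 => /eqP -> _ _.
  by rewrite /crit /blocks imset0 cards0.
Qed.

Lemma fresh_req (sg : state) nw f : f \in fresh req sg nw -> req f \subset sg.1.
Proof. by rewrite inE => /andP[]. Qed.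

Lemma hit_step i (sg : state) (nw : {set block}) y (fr : block * {set tag}) : fr \in thr y -> fr.1 \in fresh req sg nw ->
  fr.2 \subset sg.2 -> y \notin (step req thr i sg nw).1.
Proof.
move=> ft f1 f2; rewrite inE negb_and negbK; apply/orP; right.
by apply/existsP; exists fr; rewrite ft f1.
Qed.

Lemma inv_step i (sg : state) nw : inv i sg -> inv i.+1 (step req thr i sg nw).
Proof.
case=> lab [o [so sb]] dead cov tokd critd.
(* A family with distinct labels has at most one block from the current round; without it, the
   family was selected before. *)
have last (B : {set tag}) : B \subset (step req thr i sg nw).2 -> {in B &, injective fst} -> {in B &, injective snd} ->
    ~~ (B \subset sg.2) -> exists b, [/\ b \in B, b.1 \in fresh req sg nw, B :\ b \subset sg.2,
      blocks B = b.1 |: blocks (B :\ b) & b.1 \notin blocks (B :\ b)].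
  move=> sB inj1 inj2 /subsetPn[b bB bs]; exists b.
  have := step_tag lab (subsetP sB b bB); rewrite (negPf bs) /= => /andP[/eqP bi fb].
  split=> //.
  - apply/subsetP => c /setD1P[cb cB']; move: (subsetP sB c cB') => /(step_tag lab)/orP[//|/andP[/eqP ci _]].
    by move: cb; rewrite (inj2 c b) ?eqxx //; apply/val_inj; rewrite /= ci bi.
  - by rewrite -{1}(setD1K bB) /blocks imsetU1.
  - by apply/imsetP => -[c /setD1P[cb cB'] h]; move: cb; rewrite (inj1 c b) ?eqxx.
have injD (B : {set tag}) b : {in B &, injective fst} -> {in B :\ b &, injective fst}.
  by move=> inj1 x y /setD1P[_ xB] /setD1P[_ yB]; exact: inj1.
have injD2 (B : {set tag}) b : {in B &, injective snd} -> {in B :\ b &, injective snd}.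
  by move=> inj1 x y /setD1P[_ xB] /setD1P[_ yB]; exact: inj1.
split.
- by move=> b /(step_tag lab)/orP[/lab/ltnW //|/andP[/eqP -> _]].
- exists o; split; first exact: subset_trans (step_sub _ _ _) so.
  move=> b /(step_tag lab)/orP[/sb //|/andP[_ /fresh_req h]]; exact: subset_trans h so.
- move=> b e /(step_tag lab)/orP[bs|/andP[_ fb]] eJ.
    by apply: contra (dead b e bs eJ); apply/subsetP/step_sub.
  apply: (@hit_step i sg nw _ (b.1, set0)) => //=; last exact: sub0set.
  by rewrite inE eqxx /=; apply/imsetP; exists e.
- have new (b b' : tag) e e' : b \in sg.2 -> b'.1 \in fresh req sg nw -> e \in J -> e' \in J ->
      img b.1 e != img b'.1 e'.
    move=> bs fb eJ e'J; apply/eqP => h; have := dead b e bs eJ; rewrite h.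
    by rewrite (subsetP (fresh_req fb)) // req_J.
  move=> b b' e e' /(step_tag lab)/orP[bs|/andP[/eqP bi fb]] /(step_tag lab)/orP[bs'|/andP[/eqP bi' fb']] ne eJ e'J.
  + exact: cov.
  + exact: new.
  + by rewrite eq_sym; exact: new.
  + by move: ne; rewrite -val_eqE /= bi bi' eqxx.
- move=> e B sB B0 inj1 inj2 eB cB.
  case: (boolP (B \subset sg.2)) => [s|/(last B sB inj1 inj2)[b [bB fb sF BE bF]]].
    by apply: contra (tokd e B s B0 inj1 inj2 eB cB); apply/subsetP/step_sub.
  apply: (@hit_step i sg nw _ (b.1, B :\ b)) => //=; rewrite inE /= /team -BE cB andbT.
  rewrite bF andbT; apply/and3P; split.
  + by apply/eqP/card_in_imset/injD.
  + by apply: contraNneq eB => ->; rewrite mem_blocks.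
  + by apply: contra eB; apply/subsetP/imsetS/subD1set.
move=> B sB inj1 inj2.
case: (boolP (B \subset sg.2)) => [s|/(last B sB inj1 inj2)[b [bB fb sF BE bF]]]; first exact: critd.
rewrite BE; apply/negP => cB.
have B0 : B :\ b != set0.
  by apply: contraTneq cB => ->; rewrite /crit /blocks imset0 setU0 cards1.
(* The fresh block required its own token, which the rest of the family had already killed. *)
have := tokd b.1 _ sF B0 (injD _ _ inj1) (injD2 _ _ inj2) bF cB.
by rewrite (subsetP (fresh_req fb)) // req_self.
Qed.

End Invariant.

End Invariants.

(** * Few surviving pairs force many selected blocks *)

Module Potential.
Import RandomProcess Blocks Items Counting Weights InitialState Survival BadFamilies Invariants.
Import Order.TTheory GRing.Theory Num.Theory.

Section Potential.
Variables (V : finType) (J : {set {set V}}) (n T : nat).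
Notation block := (block V n).
Notation tag := (block * 'I_T)%type.
Notation state := (state (item V n) block T).
Notation thr := (@thr V J n T).
Notation req := (@req V J n).

Definition alive (sg : state) : {set {set 'I_n}} :=
  [set p : {set 'I_n} | (#|p| == 2) && (inl (p, true) \in sg.1)].

(** A selected block covers at most |J| alive pairs, so every lost pair is paid for by selections
    and this quantity never decreases. Its mean thus stays above the initial number of coverable
    pairs. *)
Definition potential i (sg : state) : nat :=
  #|J| * #|[set b in sg.2 | b.2 < i]| + #|alive sg|.

Lemma potential_step i (sg : state) (nw : {set block}) : i < T ->
  potential i sg <= potential i.+1 (step req thr i sg nw).
Proof.
move=> iT; set sg' := step _ _ _ _ _; pose F := fresh req sg nw.
have sel : #|[set b in sg.2 | b.2 < i]| + #|F| <= #|[set b in sg'.2 | b.2 < i.+1]|.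
  pose G : {set tag} := [set (f, Ordinal iT) | f in F].
  have <- : #|G| = #|F| by apply: card_imset => f f' [].
  have d : [disjoint [set b in sg.2 | b.2 < i] & G].
    rewrite -setI_eq0; apply/set0Pn => -[b /setIP[]]; rewrite inE => /andP[_ bi] /imsetP[f _ be].
    by move: bi; rewrite be /= ltnn.
  move: (d); rewrite -leq_card_setU => /eqP <-; apply/subset_leq_card/subsetP => b /setUP[|/imsetP[f fF ->]].
    by rewrite !inE => /andP[bs bi]; rewrite bi bs ltnW.
  by rewrite !inE /= ltnn eqxx ltnSn !andbT; move: fF; rewrite inE.
have al : #|alive sg| <= #|alive sg'| + #|J| * #|F|.
  apply: leq_trans (_ : #|alive sg' :|: \bigcup_(f in F) (img f @: J)| <= _).
    apply/subset_leq_card/subsetP => p; rewrite !inE => /andP[-> ps] /=; rewrite ps /=.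
    case: (boolP (hit _ _ _ _)) => //= /existsP[fr /and3P[frt frF _]].
    apply/bigcupP; exists fr.1; first by [].
    by move: frt; rewrite inE => /andP[].
  apply: leq_trans (leq_card_setU _ _) _; rewrite leq_add2l mulnC -sum_nat_const.
  apply: leq_trans (_ : \sum_(f in F) #|img f @: J| <= _); last first.
    by apply: leq_sum => f _; exact: leq_imset_card.
  elim/big_rec2: _ => [|f k S _ le]; first by rewrite cards0.
  by apply: leq_trans (leq_card_setU _ _) _; rewrite leq_add2l.
rewrite /potential; apply: leq_trans (leq_add (leqnn _) al) _.
rewrite [#|alive sg'| + _]addnC addnA leq_add2r -mulnDr leq_mul2l sel orbT //.
Qed.

Local Open Scope ring_scope.
Variables (R : realType) (eps th : R).
Hypothesis eps01 : 0 < eps < 1.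
Hypothesis th01 : 0 <= th <= 1.
Notation EE := (EE req thr (wt (fun=> 1 - eps)) (@start V n) th).
Notation PE := (PE req thr (wt (fun=> 1 - eps)) (@start V n) th).

Let w0 (o : {set {set 'I_n}}) : 0 <= wt (fun=> 1 - eps) o.
Proof. by apply: wt_ge0 => _; case/andP: eps01 => *; apply/andP; split; lra. Qed.
Let w1 : \sum_(o : {set {set 'I_n}}) wt (fun=> 1 - eps) o = 1. Proof. exact: wt_sum. Qed.

Lemma potential_init : EE 0 (fun sg => (potential 0 sg)%:R) = (1 - eps) * 'C(n, 2)%:R.
Proof.
rewrite /= (eq_bigr (fun o => \sum_(p : {set 'I_n} | #|p| == 2%N)
   wt (fun=> 1 - eps) o * (([set p] \subset o) && [disjoint set0 & o])%:R)) => [|o _].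
  rewrite exchange_big /= (eq_bigr (fun=> 1 - eps)) => [|p _].
    rewrite sumr_const (_ : #|_| = 'C(n, 2)) ?mulr_natr //.
    by rewrite -[n in RHS]card_ord -card_draws; apply: eq_card => p; rewrite inE.
  rewrite wt_ind ?big_set1 ?big_set0 ?mulr1 //.
  by rewrite -setI_eq0 setI0.
rewrite -mulr_sumr; congr (_ * _); rewrite /potential.
rewrite (_ : [set b in _ | _] = set0) ?cards0 ?muln0 ?add0n; last by apply/setP => b; rewrite !inE.
rewrite -sum1_card natr_sum big_mkcond [RHS]big_mkcond; apply: eq_bigr => p _.
rewrite !inE sub1set; case: eqP => //= _; rewrite -setI_eq0 set0I eqxx andbT.
by case: (p \in o).
Qed.

Lemma potential_ge i : (i <= T)%N ->
  (1 - eps) * 'C(n, 2)%:R <= EE i (fun sg => (potential i sg)%:R).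
Proof.
elim: i => [|i IH] iT; first by rewrite potential_init.
apply: le_trans (IH (ltnW iT)) _ => /=.
apply: (EE_le _ _ _ w0 th01) => sg.
apply: le_trans (_ : \sum_(nw : {set block}) wt (fun=> th) nw * (potential i sg)%:R <= _).
  by rewrite -mulr_suml wt_sum mul1r.
apply: ler_sum => nw _; rewrite ler_wpM2l ?ler_nat ?potential_step //.
exact: wt_ge0.
Qed.

Lemma alive_sum a : (forall e : {set 'I_n}, #|e| = 2%N -> PE T ([set inl (e, true)], set0) <= a) ->
  EE T (fun sg => #|alive sg|%:R) <= a * 'C(n, 2)%:R.
Proof.
move=> h; rewrite (_ : EE T _ = \sum_(p : {set 'I_n} | #|p| == 2%N) PE T ([set inl (p, true)], set0)).
  apply: le_trans (_ : \sum_(p : {set 'I_n} | #|p| == 2%N) a <= _).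
    by apply: ler_sum => p /eqP; exact: h.
  rewrite sumr_const (_ : #|_| = 'C(n, 2)) ?mulr_natr //.
  by rewrite -[n in RHS]card_ord -card_draws; apply: eq_card => p; rewrite inE.
rewrite /RandomProcess.PE -EE_sum; apply: EE_ext => sg.
rewrite /alive -sum1_card natr_sum big_mkcond [RHS]big_mkcond; apply: eq_bigr => p _.
rewrite !inE /ind /= sub1set sub0set andbT; case: eqP => //= _.
by case: (_ \in _).
Qed.

End Potential.

End Potential.

(** * From the final state to a sparse packing *)

Module SparsePacking.
Import RandomProcess Blocks Items Counting Weights InitialState Survival BadFamilies Invariants Potential.
Import Order.TTheory GRing.Theory Num.Theory.

Lemma card_bigcup_le (I X : finType) (A : {set I}) (F : I -> {set X}) :
  #|\bigcup_(i in A) F i| <= \sum_(i in A) #|F i|.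
Proof.
elim/big_rec2: _ => [|i k S _ le]; first by rewrite cards0.
by apply: leq_trans (leq_card_setU _ _) _; rewrite leq_add2l.
Qed.

(** Alteration: removing one element from each bad subset costs at most as many elements as there
    are such subsets. *)
Lemma delete_bad (X : finType) (S : {set X}) (bad : pred {set X}) :
  (forall B, bad B -> B != set0) -> exists2 S' : {set X}, S' \subset S &
  (forall B, bad B -> ~~ (B \subset S')) /\ #|S| <= #|S'| + #|[set B | bad B && (B \subset S)]|.
Proof.
move=> ne; pose h (B : {set X}) : {set X} := if [pick x in B] is Some x then [set x] else set0.
pose D := \bigcup_(B in [set B | bad B && (B \subset S)]) h B.
have h1 B : #|h B| <= 1 by rewrite /h; case: pickP => [x _|_]; rewrite ?cards1 ?cards0.
exists (S :\: D); first exact: subsetDl; split.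
  move=> B bB; apply/negP => /subsetP sB.
  have sBS : B \subset S by apply/subsetP => x /sB /setDP[].
  have [x xB] := set0Pn _ (ne B bB).
  have [y yB hy] : exists2 y, y \in B & h B = [set y].
    by rewrite /h; case: pickP => [y yB|/(_ x)]; [exists y | rewrite xB].
  have /setDP[_ /bigcupP] := sB y yB; apply; exists B; rewrite ?inE ?bB //.
  by rewrite hy inE.
rewrite -(cardsID D S) addnC leq_add2l.
apply: leq_trans (subset_leq_card (subsetIr _ _)) _.
apply: leq_trans (card_bigcup_le _ _) _; rewrite -sum1_card; exact: leq_sum.
Qed.

Lemma pair_arith x c v k : x + c = 2 * v -> 1 < c -> k + 2 = v -> x <= k * 2 + 2.
Proof. lia. Qed.

Lemma pair_arith2 c v k : k * 2 + 2 + c = 2 * v -> k + 2 = v -> c = 2.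
Proof. lia. Qed.

Section Packing.
Variables (V : finType) (J : {set {set V}}).
Hypothesis V3 : 2 < #|V|.
Hypothesis J2 : forall e, e \in J -> #|e| = 2.
Hypothesis J0 : 0 < #|J|.
Let w := #|V| - 2.

(** The first clause applies to (f, g) and to (g, f): a shared pair is a [J]-pair of neither
    copy. *)
Definition sparse_packing n (S : {set block V n}) : Prop :=
  {in S &, forall f g, f != g ->
     #|vs f :&: vs g| <= 2 /\ (#|vs f :&: vs g| = 2 -> vs f :&: vs g \notin img f @: J)} /\
  forall C : {set block V n}, C \subset S -> 2 < #|C| <= 7 ->
    w * #|C| + 2 <= #|VV C| /\
    (#|VV C| = w * #|C| + 2 -> exists f, exists g, [/\ f \in C, g \in C, f != g & #|vs f :&: vs g| = 2]).

Lemma cap_VV2 n (f g : block V n) : #|VV [set f; g]| + #|vs f :&: vs g| = 2 * #|V|.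
Proof.
rewrite VVU !VV1 cardsU !card_vs subnK; first by rewrite mul2n addnn.
by apply: leq_trans (subset_leq_card (subsetIl _ _)) _; rewrite card_vs leq_addr.
Qed.

Lemma img_pair n (f : block V n) (p : {set 'I_n}) : #|p| = 2 -> p \subset vs f ->
  exists2 e : {set V}, #|e| = 2 & p = img f e.
Proof.
move=> p2 pf; exists [set x | val f x \in p].
  rewrite -p2 -(card_img f); congr #|pred_of_set _|.
  apply/setP => y; apply/imsetP/idP => [[x + ->]|yp]; first by rewrite inE.
  by have /imsetP[x _ yx] := subsetP pf y yp; exists x; rewrite ?inE -?yx.
apply/setP => y; apply/idP/imsetP => [yp|[x + ->]]; last by rewrite inE.
by have /imsetP[x _ yx] := subsetP pf y yp; exists x; rewrite ?inE -?yx.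
Qed.

Lemma inv_packing n T i (sg : state (item V n) (block V n) T) (S' : {set block V n * 'I_T}) : inv J i sg -> S' \subset sg.2 ->
  (forall B, @bad V n T B -> ~~ (B \subset S')) ->
  {in S' &, injective fst} /\ sparse_packing (blocks S').
Proof.
move=> iv sS nb; have [e0 e0J] : exists e, e \in J by apply/card_gt0P.
have inj1 : {in S' &, injective fst}.
  move=> [f l] [g l'] b b' /= fg; rewrite -fg in b' *; congr pair.
  apply/eqP/negPn/negP => ll; have := inv_cov iv (subsetP sS _ b) (subsetP sS _ b') ll e0J e0J.
  by rewrite eqxx.
split => //.
have lift (C : {set block V n}) : C \subset blocks S' -> exists2 B : {set block V n * 'I_T}, B \subset S' & blocks B = C /\ #|B| = #|C|.
  move=> sC; exists [set b in S' | b.1 \in C]; first by apply/subsetP => b; rewrite inE => /andP[].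
  have bC : blocks [set b in S' | b.1 \in C] = C.
    apply/setP => f; apply/imsetP/idP => [[b + ->]|fC]; first by rewrite inE => /andP[].
    have /imsetP[b bS fb] := subsetP sC f fC; exists b => //.
    by rewrite inE bS -fb.
  split => //; rewrite -{2}bC card_in_imset // => x y; rewrite !inE => /andP[xS _] /andP[yS _].
  exact: inj1.
have big (C : {set block V n}) : C \subset blocks S' -> 1 < #|C| <= 7 -> w * #|C| + 2 <= #|VV C|.
  move=> /lift[B sB [BC cB]] /andP[C1 C7]; rewrite leqNgt addn2 ltnS -addn1; apply/negP => h.
  have bB : bad B by rewrite /bad BC cB C1 C7 eqxx h.
  by move/negP: (nb B bB); apply.
(* Two remaining blocks with two common vertices would form a bad family, unless they share exactly
   two and come from different rounds. *)
have pair2 b b' : b \in S' -> b' \in S' -> b != b' -> 1 < #|vs b.1 :&: vs b'.1| ->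
    #|vs b.1 :&: vs b'.1| = 2 /\ b.2 != b'.2.
  move=> bS bS' bb c1; have ff : b.1 != b'.1 by apply: contra bb => /eqP /inj1 ->.
  have c2 : #|[set b.1; b'.1]| = 2 by rewrite cards2 ff.
  have sub : [set b.1; b'.1] \subset blocks S'.
    by apply/subsetP => x /set2P[] ->; exact: imset_f.
  have := big _ sub; rewrite c2 => /(_ isT); have := cap_VV2 b.1 b'.1 => h1 h2.
  have wv : w + 2 = #|V| by rewrite subnK // ltnW.
  split; first by lia.
  apply/negP => ll; suff bB : bad [set b; b'].
    by move/negP: (nb _ bB); apply; apply/subsetP => x /set2P[] ->.
  have bE : blocks [set b; b'] = [set b.1; b'.1] by rewrite /blocks imsetU !imset_set1.
  rewrite /bad bE c2 cards2 bb /= -/w; apply/orP; right; apply/andP; split; first exact: pair_arith h1 c1 wv.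
  apply/existsP; exists b; rewrite !inE eqxx /=; apply/existsP; exists b'.
  by rewrite !inE eqxx orbT bb ll.
split.
  move=> _ _ /imsetP[b bS ->] /imsetP[b' bS' ->] ff.
  have bb : b != b' by apply: contraNneq ff => ->.
  case: (leqP #|vs b.1 :&: vs b'.1| 1) => [c1|/(pair2 _ _ bS bS' bb)[-> ll]].
    by split=> [|h]; [exact: leqW | rewrite h in c1].
  split=> // _; apply/imsetP => -[e eJ pe].
  set p := _ :&: _ in pe.
  have p2 : #|p| = 2 by rewrite pe card_img J2.
  have [e' e'2 pe'] : exists2 e' : {set V}, #|e'| = 2 & p = img b'.1 e'.
    by apply: img_pair => //; exact: subsetIr.
  have bs := subsetP sS b bS; have bs' := subsetP sS b' bS'.
  case: (boolP (e' \in J)) => e'J.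
    by have := inv_cov iv bs bs' ll eJ e'J; rewrite -pe -pe' eqxx.
  (* The pair is a [J]-pair of one block and reserved for the other, so it would lie both inside and
     outside [o]. *)
  have [o [_ so]] := inv_start iv.
  have : inl (p, true) \in start V o by apply: (subsetP (so b bs)); rewrite pe; exact: req_J.
  have : inl (p, false) \in start V o.
    apply: (subsetP (so b' bs')); rewrite inE; apply/orP; left; apply/imsetP; exists e'.
      by rewrite inE e'2.
    by rewrite (negPf e'J) pe'.
  by rewrite !inE => /eqP ->.
move=> C sC /andP[C2 C7]; split; first by apply: big => //; rewrite ltnW.
move=> VC.
(* A minimal dense subfamily either consists of two blocks, which then share a pair, or is critical;
   in that case distinct labels contradict [inv_crit] and a repeated label makes it bad. *)
pose P (D : {set block V n}) := [&& D \subset C, 1 < #|D| & #|VV D| <= w * #|D| + 2].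
have PC : P C by rewrite /P subxx (ltnW C2) VC leqnn.
have [D /minsetP[/and3P[sD D1 VD] Dmin] _] := minset_exists PC.
have D7 : #|D| <= 7 by exact: leq_trans (subset_leq_card sD) C7.
have sDS : D \subset blocks S' := subset_trans sD sC.
have VD' : #|VV D| = w * #|D| + 2 by apply/eqP; rewrite eqn_leq VD big // D1.
have [B sB [BD cB]] := lift D sDS.
case: (leqP #|D| 2) => D2.
  have /eqP/cards2P[f [g [fg DE]]] : #|D| = 2 by apply/eqP; rewrite eqn_leq D2.
  exists f, g; split=> //; try by apply: (subsetP sD); rewrite DE !inE eqxx ?orbT.
  have wv : w + 2 = #|V| by rewrite subnK // ltnW.
  have := cap_VV2 f g; rewrite -DE VD' DE cards2 fg /= => h; exact: pair_arith2 h wv.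
have cD : crit D.
  rewrite /crit D2 D7 VD' eqxx /=; apply/forallP => D'; apply/implyP => /andP[pr c1].
  rewrite addn3 ltnNge -addn2; apply/negP => h.
  have := Dmin D' _ (proper_sub pr); rewrite /P c1 h (subset_trans (proper_sub pr) sD).
  by move=> /(_ isT) e; move: pr; rewrite e properxx.
have injB : {in B &, injective fst}.
  by move=> x y xB yB; apply: inj1; exact: (subsetP sB).
case: (boolP (dinjectiveb snd (mem B))) => [/dinjectiveP inj2|/dinjectivePn[x xB [y /andP[yx yB] xy]]].
  have := inv_crit iv (subset_trans sB sS) injB inj2.
  by rewrite BD cD.
exfalso; suff bB : bad B by move/negP: (nb B bB); apply.
rewrite /bad BD cB D1 D7 eqxx VD /=; apply/orP; right.
apply/existsP; exists x; rewrite xB; apply/existsP; exists y.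
by rewrite yB eq_sym yx xy eqxx.
Qed.

End Packing.

End SparsePacking.

(** * Choice of the parameters and existence of packings *)

Module PackingExistence.
Import RandomProcess Blocks Items Counting Weights InitialState Survival BadFamilies Invariants Potential SparsePacking.
Import Order.TTheory GRing.Theory Num.Theory.
Local Open Scope ring_scope.

Lemma natr_large (R : realType) (x : R) : exists m : nat, forall n, (m <= n)%N -> x <= n%:R.
Proof.
exists (Num.truncn x).+1 => n mn; apply: le_trans (ltW (truncnS_gt x)) _.
by rewrite ler_nat.
Qed.

Lemma bin2_lower (R : realType) n : (1 < n)%N -> n%:R ^+ 2 <= 4 * 'C(n, 2)%:R :> R.
Proof.
move=> n1; rewrite -natrX -natrM ler_nat.
have -> : (4 * 'C(n, 2) = 2 * (n * n.-1))%N by have := mul_bin_diag n 1; rewrite bin1 => ->; rewrite mulnA.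
case: n n1 => // n n1; rewrite /= -mulnn mulnCA leq_mul2l /=; lia.
Qed.

Section Exists.
Variables (R : realType) (V : finType) (J : {set {set V}}).
Hypothesis V3 : (2 < #|V|)%N.
Hypothesis J2 : forall e, e \in J -> #|e| = 2%N.
Hypothesis J0 : (0 < #|J|)%N.

Lemma packing_at (eps eta d : R) n T : 0 < eps < 1 -> (0 < n)%N -> 0 < d <= 1 ->
  (forall e : {set 'I_n}, #|e| = 2%N -> PE (@req V J n) (@thr V J n T) (wt (fun=> 1 - eps))
     (@start V n) (d / n%:R ^+ (#|V| - 2)) T ([set inl (e, true)], set0) <= eta) ->
  exists2 S : {set block V n}, sparse_packing J S &
    (1 - eps - eta) * 'C(n, 2)%:R - #|J|%:R * (8 * (bad_const V R * T%:R ^+ 7 * n%:R +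
      49 * bad_const V R * ((1 + d * T%:R) ^+ 6 * d) * n%:R ^+ 2)) <= #|J|%:R * #|S|%:R.
Proof.
set K : R := _ * n%:R + _; set th := d / _ => eps01 n0 d01 hPE.
have N0 : (0 : R) < n%:R ^+ (#|V| - 2) by rewrite exprn_gt0 // ltr0n.
have thE : th * n%:R ^+ (#|V| - 2) = d by rewrite divfK // gt_eqF.
case/andP: (d01) => d0 d1.
have th0 : 0 <= th by rewrite divr_ge0 ?ltW.
have th1 : th <= 1.
  by rewrite ler_pdivrMr // mul1r (le_trans d1) // exprn_ege1 // ler1n.
have th01 : 0 <= th <= 1 by rewrite th0.
pose EE' := EE (@req V J n) (@thr V J n T) (wt (fun=> 1 - eps)) (@start V n) th T.
have w0 (o : {set {set 'I_n}}) : 0 <= wt (fun=> 1 - eps) o.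
  by apply: wt_ge0 => _; case/andP: eps01 => *; apply/andP; split; lra.
have w1 : \sum_(o : {set {set 'I_n}}) wt (fun=> 1 - eps) o = 1 by exact: wt_sum.
pose nbad (sg : state (item V n) (block V n) T) : R :=
  \sum_(B : {set block V n * 'I_T} | bad B) (B \subset sg.2)%:R.
have badE : EE' nbad <= 8 * K.
  rewrite /EE' EE_sum; apply: le_trans (_ : \sum_(B : {set block V n * 'I_T} | bad B) th ^+ #|B| <= _).
    apply: ler_sum => B _; have := PE_crude (@req V J n) (@thr V J n T) (@start V n) w0 w1 th01 T (set0, B).
    apply: le_trans; rewrite le_eqVlt; apply/orP; left; apply/eqP/EE_ext => sg.
    by rewrite /ind /= sub0set.
  rewrite (partition_big (fun B : {set block V n * 'I_T} => inord #|B| : 'I_8) predT) //=.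
  rewrite [8 * K]mulr_natl -[8%N in X in _ <= X]card_ord -sumr_const; apply: ler_sum => j _.
  have K0 : 0 <= K.
    apply: addr_ge0; first by apply: mulr_ge0 => //; apply: mulr_ge0; [exact: ler0n|exact: exprn_ge0].
    apply: mulr_ge0; last exact: exprn_ge0.
    apply: mulr_ge0; first by apply: mulr_ge0 => //; exact: ler0n.
    apply: mulr_ge0; last exact: ltW.
    by apply: exprn_ge0; apply: addr_ge0 => //; apply: mulr_ge0 => //; exact: ltW.
  rewrite (eq_bigl (fun B : {set block V n * 'I_T} => bad B && (#|B| == j))); last first.
    move=> B; case: (boolP (bad B)) => //= /and4P[_ B7 _ _].
    by rewrite -val_eqE /= inordK // ltnS.
  case: (ltnP 1 j) => j1; first by apply: bad_weight_j => //; rewrite j1 -ltnS ltn_ord.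
  rewrite big_pred0 // => B; apply/negP => /andP[/and4P[B1 _ _ _] /eqP Bj].
  by move: B1; rewrite Bj ltnNge j1.
pose g (sg : state (item V n) (block V n) T) : R := #|J|%:R * #|[set b in sg.2 | (b.2 < T)%N]|%:R - #|J|%:R * nbad sg.
have avg : (1 - eps - eta) * 'C(n, 2)%:R - #|J|%:R * (8 * K) <= EE' g.
  rewrite /EE' EEB EEZ -/EE'.
  apply: lerD; last by rewrite lerN2 ler_wpM2l.
  have h1 := @potential_ge V J n T R eps th eps01 th01 T (leqnn T).
  have h2 := alive_sum (J := J) hPE.
  have -> : EE' (fun sg => #|J|%:R * #|[set b in sg.2 | (b.2 < T)%N]|%:R) =
     EE' (fun sg => (potential J T sg)%:R) - EE' (fun sg => #|alive sg|%:R).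
    rewrite -EEB; apply: EE_ext => sg.
    by rewrite /potential natrD natrM addrK.
  by rewrite mulrBl; apply: lerB.
have [sg iv le] := EE_ex (Inv := @inv V J n T) w0 w1 th01 (fun o => inv_init J T o) (fun j sg nw _ h => inv_step J2 nw h) avg.
have [S' sS [nb cS]] := @delete_bad _ sg.2 (@bad V n T) ltac:(by move=> B /and4P[B1 _ _ _]; rewrite -card_gt0 ltnW).
have [inj1 sp] := inv_packing V3 J2 J0 iv sS nb.
exists (blocks S') => //; apply: le_trans le _.
rewrite /g -mulrBr ler_wpM2l // lerBlDr.
have -> : [set b in sg.2 | (b.2 < T)%N] = sg.2.
  by apply/setP => b; rewrite inE ltn_ord andbT.
have -> : nbad sg = #|[set B | bad B && (B \subset sg.2)]|%:R.
  rewrite -sum1_card natr_sum /nbad [LHS]big_mkcond [RHS]big_mkcond /=; apply: eq_bigr => B _.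
  by rewrite inE; case: (bad B) => //=; case: (B \subset _).
by rewrite -natrD ler_nat card_in_imset.
Qed.

Theorem packing (e : R) : 0 < e -> exists n1, forall n, (n1 <= n)%N -> exists2 S : {set block V n},
  sparse_packing J S & (1 - e) * 'C(n, 2)%:R <= #|J|%:R * #|S|%:R.
Proof.
(* Four losses of [e'] each: reserved pairs, surviving pairs and the two kinds of bad families. *)
move=> e0; pose e' : R := Num.min e 1 / 4.
have e'0 : 0 < e' by rewrite divr_gt0 // lt_min e0 ltr01.
have e'4 : e' * 4 <= e by rewrite /e' divfK ?pnatr_eq0 // ge_min lexx.
have e'1 : e' < 1.
  by rewrite ltr_pdivrMr // mul1r (@le_lt_trans _ _ 1) ?ge_min ?lexx ?orbT ?ltr1n.
have eps01 : 0 < e' < 1 by rewrite e'0.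
have eta0 : 0 < e' / 2 by rewrite divr_gt0.
pose t := rounds_scale J e' (e' / 2).
have t0 : 0 < t by exact: rounds_scale_gt0.
pose K := bad_const V R.
have K0 : 0 <= K by exact: ler0n.
(* [A / T] is the same-round loss per n^2; [T] is taken so large that this is at most [e' / 4]. *)
pose A := #|J|%:R * (8 * (49 * K * ((1 + t) ^+ 6 * t))).
have [T1 hT1] := natr_large (Num.max t (4 * A / e')).
pose T := T1.+1.
have := hT1 T (leqnSn _); rewrite ge_max => /andP[tT AT].
have T0 : (0 : R) < T%:R by rewrite ltr0n.
pose d := t / T%:R.
have d01 : 0 < d <= 1 by rewrite divr_gt0 //= ler_pdivrMr // mul1r.
have dT : d * T%:R = t by rewrite divfK // gt_eqF.
have [n1 hn1] := few_alive V3 J2 J0 eps01 eta0 (ltn0Sn T1) tT.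
pose A2 := #|J|%:R * (8 * (K * T%:R ^+ 7)).
have [n2 hn2] := natr_large (4 * A2 / e').
exists (maxn n1 (maxn n2 2)) => n; rewrite !geq_max => /and3P[/hn1[n0 nV al] /hn2 nA n2'].
have [S sp hS] := packing_at eps01 n0 d01 al.
exists S => //; apply: le_trans hS; rewrite dT -/K.
have N0 : (0 : R) < n%:R by rewrite ltr0n.
have C0 := bin2_lower R n2'.
have b1 : A2 * n%:R <= e' * 'C(n, 2)%:R.
  move: nA; rewrite ler_pdivrMr // => /(ler_wpM2r (ltW N0)) h.
  rewrite -(@ler_pM2l _ 4) // mulrA; apply: le_trans h _.
  by rewrite mulrAC -expr2 mulrC [4 * _]mulrCA ler_wpM2l // ltW.
have b2 : #|J|%:R * (8 * (49 * K * ((1 + t) ^+ 6 * d) * n%:R ^+ 2)) <= e' * 'C(n, 2)%:R.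
  have -> : #|J|%:R * (8 * (49 * K * ((1 + t) ^+ 6 * d) * n%:R ^+ 2)) = A / T%:R * n%:R ^+ 2.
    by rewrite /A /d; field; rewrite gt_eqF.
  have h : A / T%:R <= e' / 4.
    by move: AT; rewrite !ler_pdivrMr //; move: (A) (T%:R : R) => a b; lra.
  apply: le_trans (ler_wpM2r (exprn_ge0 2 (ltW N0)) h) _.
  by rewrite -mulrA ler_wpM2l ?(ltW e'0) // mulrC ler_pdivrMr // mulrC.
move: b1 b2; rewrite /A2.
set C := 'C(n, 2)%:R; set j := #|J|%:R; set x := K * T%:R ^+ 7; set y := 49 * K * _.
have C1 : 0 <= C by exact: ler0n.
move=> b1 b2; have -> : j * (8 * (x * n%:R + y * n%:R ^+ 2)) = j * (8 * x) * n%:R + j * (8 * (y * n%:R ^+ 2)) by ring.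
have : e' * 4 * C <= e * C by rewrite ler_wpM2r.
lra.
Qed.

End Exists.

End PackingExistence.

(** * Clusters of linked edges *)

Module Clusters.
Lemma coverU1 (X : finType) (e : {set X}) (Q : {set {set X}}) : cover (e |: Q) = e :|: cover Q.
Proof. by rewrite /cover bigcup_setU big_set1. Qed.

Lemma coverU (X : finType) (Q Q' : {set {set X}}) : cover (Q :|: Q') = cover Q :|: cover Q'.
Proof. exact: bigcup_setU. Qed.

Lemma cover_sup (X : finType) (e : {set X}) (Q : {set {set X}}) : e \in Q -> e \subset cover Q.
Proof. by move=> eQ; apply: (bigcup_sup e). Qed.

Section Clusters.
Variables (T : finType) (s : nat) (E : {set {set T}}).
Hypothesis s0 : 0 < s.
Hypothesis Eu : forall e, e \in E -> #|e| = s + 2.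
Hypothesis free7 : forall Q : {set {set T}}, Q \subset E -> #|Q| = 7 -> s * 7 + 3 <= #|cover Q|.

Definition adj (e f : {set T}) := [&& e \in E, f \in E & 1 < #|e :&: f|].
Definition clusters : {set {set {set T}}} := equivalence_partition (connect adj) E.

Lemma adj_sym : connect_sym adj.
Proof.
apply: sym_connect_sym => e f; rewrite /adj setIC.
by case: (e \in E); case: (f \in E).
Qed.

Lemma clusters_partition : partition clusters E.
Proof.
apply: equivalence_partitionP => e f g _ _ _; split; first exact: connect0.
by move=> ef; rewrite (same_connect adj_sym ef).
Qed.

Lemma cluster_sub K : K \in clusters -> K \subset E.
Proof. by move=> KP; rewrite -(cover_partition clusters_partition); apply: bigcup_sup. Qed.

Lemma cluster_neq0 K : K \in clusters -> exists e, e \in K.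
Proof.
move=> KP; apply/set0Pn; apply: contraTneq KP => ->.
by case/and3P: clusters_partition.
Qed.

Lemma clusters_triv : trivIset clusters.
Proof. by case/and3P: clusters_partition. Qed.

Lemma cluster_disj K K' : K \in clusters -> K' \in clusters -> K != K' -> [disjoint K & K'].
Proof. by move: clusters_triv => /trivIsetP; apply. Qed.

Lemma cluster_eq K K' e : K \in clusters -> K' \in clusters -> e \in K -> e \in K' -> K = K'.
Proof.
move=> KP KP' eK eK'; apply/eqP; apply: contraTT eK => /(cluster_disj KP KP') d.
by rewrite (disjointFl d eK').
Qed.

Lemma clusterE K e f : K \in clusters -> e \in K -> (f \in K) = (f \in E) && connect adj e f.
Proof.
move=> KP eK; have eE := subsetP (cluster_sub KP) e eK.
rewrite -(def_pblock clusters_triv KP eK).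
case: (boolP (f \in E)) => fE /=; last first.
  rewrite (def_pblock clusters_triv KP eK); apply: contraNF fE; exact: (subsetP (cluster_sub KP)).
rewrite pblock_equivalence_partition // => a b c _ _ _; split; first exact: connect0.
by move=> ab; rewrite (same_connect adj_sym ab).
Qed.

Lemma cluster_closed K e f : K \in clusters -> e \in K -> f \in E -> 1 < #|e :&: f| -> f \in K.
Proof.
move=> KP eK fE ef; rewrite (clusterE _ KP eK) fE connect1 // /adj fE ef.
by rewrite (subsetP (cluster_sub KP) e eK).
Qed.

Lemma cluster_grow K (Q : {set {set T}}) f0 : K \in clusters -> f0 \in K :&: Q -> ~~ (K \subset Q) ->
  exists e f, [/\ e \in K, e \notin Q, f \in K, f \in Q & 1 < #|e :&: f|].
Proof.
move=> KP /setIP[fK fQ] /subsetPn[g gK gQ].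
case: (pickP [pred ef : {set T} * {set T} | [&& ef.1 \in K, ef.1 \notin Q, ef.2 \in K, ef.2 \in Q & 1 < #|ef.1 :&: ef.2|]]) => [[e f] /= /and5P[]|no].
  by move=> *; exists e, f.
have cl : closed adj [pred x | (x \in K) && (x \in Q)].
  have key x y : adj x y -> x \in K -> x \in Q -> (y \in K) && (y \in Q).
    case/and3P => xE yE xy xK xQ; rewrite (cluster_closed KP xK yE xy) /=.
    apply: contraFT (no (y, x)) => yQ /=.
    by rewrite (cluster_closed KP xK yE xy) yQ xK xQ setIC.
  have adjC x y : adj x y -> adj y x by rewrite /adj setIC => /and3P[-> -> ->].
  move=> x y xy; rewrite !inE; apply/idP/idP => /andP[a b]; first exact: key xy a b.
  exact: key (adjC _ _ xy) a b.
have := closed_connect cl (_ : connect adj f0 g); rewrite !inE fK fQ gK (negPf gQ) => h.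
by move: gK; rewrite (clusterE _ KP fK) => /andP[_ /h].
Qed.

Lemma card_setU_cap (A B C : {set T}) : C \subset A :&: B -> #|A :|: B| + #|C| <= #|A| + #|B|.
Proof. by move=> sC; rewrite -(cardsUI A B) leq_add2l subset_leq_card. Qed.

Lemma cover_add (A C : {set T}) e a k : e \in E -> #|A| <= s * a + k -> C \subset e :&: A ->
  #|e :|: A| + #|C| <= s * a.+1 + k + 2.
Proof.
move=> /Eu e2 Aa sC; apply: leq_trans (card_setU_cap sC) _.
rewrite e2 mulnS; move: Aa; clear; lia.
Qed.

(** An edge linked to a present one brings at most [s] new vertices, so density persists. A seventh
    edge would contradict [free7], hence [K] is exhausted before. *)
Lemma grow K (X : {set {set T}}) f0 : K \in clusters -> X \subset E -> f0 \in K :&: X -> #|X| <= 7 ->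
  #|cover X| <= s * #|X| + 2 -> #|X :|: K| <= 6 /\ #|cover (X :|: K)| <= s * #|X :|: K| + 2.
Proof.
move=> KP; have [k] := ubnP #|K :\: X|; elim: k X => // k IH X; rewrite ltnS => Kk XE fX X7 cX.
have X6 : #|X| <= 6.
  rewrite leqNgt; apply/negP => X6; have X7' : #|X| = 7 by apply/eqP; rewrite eqn_leq X7.
  have := free7 XE X7'; rewrite leqNgt; move: cX; rewrite X7' !addnS !addn0 ltnS => ->.
  by [].
case: (boolP (K \subset X)) => [/setUidPl -> //|KX].
have [e [f [eK eX fK fX' ef]]] := cluster_grow KP fX KX.
have eE := subsetP (cluster_sub KP) e eK.
have -> : X :|: K = (e |: X) :|: K.
  by rewrite -setUA [X :|: K]setUC setUA (setUidPr (_ : [set e] \subset K)) ?sub1set // setUC.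
apply: IH.
- apply: leq_trans Kk; rewrite [ltnRHS](cardsD1 e) !inE eX eK add1n ltnS.
  by apply/subset_leq_card/subsetP => x; rewrite !inE negb_or => /andP[/andP[-> ->] ->].
- by rewrite subUset sub1set eE.
- by move: fX; rewrite !inE => /andP[-> ->]; rewrite orbT.
- by rewrite cardsU1 eX ltnS.
rewrite coverU1 cardsU1 eX add1n.
have sC : e :&: f \subset e :&: cover X by rewrite setIS // cover_sup.
have := cover_add eE cX sC; move: ef; clear; lia.
Qed.

Lemma cluster_card K : K \in clusters -> #|K| <= 6 /\ #|cover K| <= s * #|K| + 2.
Proof.
move=> KP; have [e eK] := cluster_neq0 KP; have eE := subsetP (cluster_sub KP) e eK.
have sK : [set e] :|: K = K by apply/setUidPr; rewrite sub1set.
have := @grow K [set e] e KP; rewrite sK sub1set !inE eqxx eK cards1 /cover big_set1 muln1.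
by rewrite (Eu eE); apply.
Qed.

Lemma cluster_ind K (P : {set {set T}} -> Prop) : K \in clusters ->
  (forall e, e \in K -> P [set e]) ->
  (forall (Q : {set {set T}}) e f, Q \subset K -> e \in K -> e \notin Q -> f \in Q -> 1 < #|e :&: f| -> P Q -> P (e |: Q)) ->
  P K.
Proof.
move=> KP P1 PS; have [e0 eK] := cluster_neq0 KP.
suff h k : forall Q : {set {set T}}, #|K :\: Q| < k -> Q \subset K -> e0 \in Q -> P Q -> P K.
  by apply: (h _ [set e0] (ltnSn _)); rewrite ?sub1set ?inE ?eqxx //; exact: P1.
elim: k => // k IH Q; rewrite ltnS => Kk QK eQ PQ.
case: (boolP (K \subset Q)) => KQ; first by have -> : K = Q by apply/eqP; rewrite eqEsubset KQ.
have fX : e0 \in K :&: Q by rewrite inE eK.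
have [e [f [eK' eX fK fX' ef]]] := cluster_grow KP fX KQ.
apply: (IH (e |: Q)); last exact: PS ef PQ.
- apply: leq_trans Kk; rewrite [ltnRHS](cardsD1 e) !inE eX eK' add1n ltnS.
  by apply/subset_leq_card/subsetP => x; rewrite !inE negb_or => /andP[/andP[-> ->] ->].
- by rewrite subUset sub1set eK'.
- by rewrite !inE eQ orbT.
Qed.

Definition degenerate (K : {set {set T}}) := #|cover K| <= s * #|K| + 1.

Lemma card_clusters (D : {set {set {set T}}}) : D \subset clusters -> #|cover D| = \sum_(K in D) #|K|.
Proof. by move=> sD; apply/esym/eqP; exact: trivIsetS sD clusters_triv. Qed.

(** A degenerate family has a vertex to spare: it absorbs an edge meeting it only in [v] and is
    still dense, so [grow] adds the whole cluster of that edge. The union of two degenerate families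
    through [v] is degenerate again. *)
Lemma degenerate_at v (D : {set {set {set T}}}) : D \subset clusters ->
  (forall K, K \in D -> degenerate K /\ v \in cover K) ->
  #|cover D| <= 6 /\ (D != set0 -> degenerate (cover D)).
Proof.
have [k] := ubnP #|D|; elim: k D => // k IH D; rewrite ltnS => Dk sD h.
case: (set_0Vmem D) => [->|[K KD]]; first by rewrite /cover big_set0 cards0 eqxx.
have KP := subsetP sD K KD; have [K6 _] := cluster_card KP; have [dK vK] := h K KD.
have sD' : D :\ K \subset clusters by rewrite (subset_trans (subsetDl _ _)).
have cE : cover D = K :|: cover (D :\ K) by rewrite -coverU1 setD1K.
have cE2 : #|cover D| = #|K| + #|cover (D :\ K)|.
  by rewrite !card_clusters // (big_setD1 K KD).
have [|K' /setD1P[_ /h] //|Y6 dY] := IH (D :\ K) _ sD'.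
  by apply: leq_trans Dk; rewrite [ltnRHS](cardsD1 K) KD.
case: (eqVneq (D :\ K) set0) => [D0|/[dup] D0 /dY {}dY].
  have c0 : cover (set0 : {set {set {set T}}}) = set0 by rewrite /cover big_set0.
  by rewrite cE D0 c0 setU0.
set Y := cover (D :\ K) in cE cE2 Y6 dY.
have [e eK ve] := bigcupP vK; have eE := subsetP (cluster_sub KP) e eK.
have [K1 K1D] := set0Pn _ D0.
have vY : v \in cover Y.
  have [_ /bigcupP[f fK vf]] := h K1 (subsetP (subD1set _ _) _ K1D).
  by apply/bigcupP; exists f => //; apply/bigcupP; exists K1.
have YE : Y \subset E by apply/bigcupsP => K' /(subsetP sD'); exact: cluster_sub.
have eY : e \notin Y.
  apply/negP => /bigcupP[K' /setD1P[ne /(subsetP sD) KP'] eK']; move: ne.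
  by rewrite (cluster_eq KP' KP eK' eK) eqxx.
have sC : [set v] \subset e :&: cover Y by rewrite sub1set inE ve.
have := @grow K (e |: Y) e KP; rewrite !inE eK eqxx subUset sub1set eE YE cardsU1 eY add1n ltnS.
move=> /(_ isT isT Y6); rewrite coverU1.
have := cover_add eE dY sC; rewrite cards1 => hc.
case=> [|r6 _]; first by move: hc; clear; lia.
have YK6 : #|cover D| <= 6.
  by apply: leq_trans r6; rewrite cE subset_leq_card // subUset subsetUr -setUA setUCA subsetUl.
split=> // _; rewrite /degenerate cE2 cE coverU.
have sC2 : [set v] \subset cover K :&: cover Y by rewrite sub1set inE vK.
have := card_setU_cap sC2; rewrite cards1 mulnDr; move: dK dY; rewrite /degenerate; clear; lia.
Qed.

End Clusters.

End Clusters.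

(** * Exceptional clusters, and pairs covered or spanned by a cluster *)

Module ClusterStructure.
Import SparsePacking Clusters.
Lemma drop2 x c y : x + c <= y + 1 + 2 -> 1 < c -> x <= y + 1.
Proof. lia. Qed.

Lemma drop3 x c y : x + c <= y + 2 + 2 -> 2 < c -> x <= y + 1.
Proof. lia. Qed.

Lemma pairs_arith q C P I u : q * C <= P + (q - 1) -> 0 < q -> I <= 1 -> P + C - I <= u ->
  q.+1 * C <= u + q.
Proof. by rewrite mulSn; lia. Qed.

Lemma pred_arith q t u : q - 1 <= t -> 0 < q -> 1 + t <= u -> q <= u.
Proof. lia. Qed.

Section Bad.
Variables (T : finType) (s : nat) (E : {set {set T}}).
Hypothesis s0 : 0 < s.
Hypothesis Eu : forall e, e \in E -> #|e| = s + 2.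
Hypothesis free7 : forall Q : {set {set T}}, Q \subset E -> #|Q| = 7 -> s * 7 + 3 <= #|cover Q|.
Notation clusters := (clusters E).
Notation degenerate := (degenerate s).

Lemma cover_cluster_neq0 K : K \in clusters -> exists v, v \in cover K.
Proof.
move=> KP; have [e eK] := cluster_neq0 KP.
have /card_gt0P[v ve] : 0 < #|e| by rewrite Eu ?addn2 // (subsetP (cluster_sub KP)).
by exists v; apply/bigcupP; exists e.
Qed.

(** Every cluster has a vertex, so a bounded load at each vertex makes the total linear. *)
Lemma sum_at_vertices (S : {set {set {set T}}}) k : S \subset clusters ->
  (forall v, \sum_(K in S | v \in cover K) #|K| <= k) -> \sum_(K in S) #|K| <= k * #|T|.
Proof.
move=> SP h; apply: leq_trans (_ : \sum_(K in S) \sum_(v in cover K) #|K| <= _).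
  apply: leq_sum => K KS; have [v vK] := cover_cluster_neq0 (subsetP SP K KS).
  by rewrite (bigD1 v) //= leq_addr.
rewrite (exchange_big_dep predT) //= mulnC -sum_nat_const.
by apply: leq_sum => v _; exact: h.
Qed.

Lemma degenerate_sum : \sum_(K in clusters | degenerate K) #|K| <= 6 * #|T|.
Proof.
rewrite (eq_bigl (fun K => K \in [set K in clusters | degenerate K])); last by move=> K; rewrite !inE.
apply: sum_at_vertices => [|v]; first by apply/subsetP => K; rewrite inE => /andP[].
pose D := [set K in clusters | degenerate K && (v \in cover K)].
have sD : D \subset clusters by apply/subsetP => K; rewrite inE => /andP[].
have [|h _] := @degenerate_at T s E Eu free7 v D sD; first by move=> K; rewrite inE => /and3P[].
rewrite (eq_bigl (fun K => K \in D)) -?(card_clusters sD) // => K; rewrite !inE andbA //.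
Qed.

(** These clusters are set aside so that two tight pairs of [K] cannot be covered by the same other
    cluster, see [covered_inj]. *)
Definition bad (K : {set {set T}}) := [exists K' in clusters,
  [&& K' != K, #|K| + #|K'| <= 6 & 2 < #|cover K :&: cover K'|]].

(** [K1] and its partner share three vertices, so their union is degenerate and absorbs any further
    cluster through [v]. With two clusters of size at least 3 and a nonempty third, this exceeds six
    edges. So at most two bad clusters, of at most six edges each, pass through [v]. *)
Lemma bad_sum : \sum_(K in clusters | (2 < #|K|) && bad K) #|K| <= 12 * #|T|.
Proof.
pose S := [set K in clusters | (2 < #|K|) && bad K].
rewrite (eq_bigl (fun K => K \in S)); last by move=> K; rewrite !inE.
have SP : S \subset clusters by apply/subsetP => K; rewrite inE => /andP[].
apply: sum_at_vertices => // v.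
pose Sv := [set K in S | v \in cover K].
suff c2 : #|Sv| <= 2.
  rewrite (eq_bigl (fun K => K \in Sv)); last by move=> K; rewrite !inE.
  apply: leq_trans (_ : \sum_(K in Sv) 6 <= _).
    apply: leq_sum => K /setIdP[/(subsetP SP) KP _].
    by have [] := cluster_card Eu free7 KP.
  by rewrite sum_nat_const -[12]/(2 * 6) leq_mul2r c2.
case: (set_0Vmem Sv) => [->|[K1]]; first by rewrite cards0.
rewrite !inE -!andbA => /and4P[K1P K13 /existsP[K1' /and4P[K1P' ne le6 cap]] vK1].
rewrite eq_sym in ne.
apply: leq_trans (_ : #|[set K1; K1']| <= _); last by rewrite cards2; case: (_ != _).
apply/subset_leq_card/subsetP => K; rewrite !inE -!andbA => /and4P[KP K3 _ vK].
apply: contraT; rewrite negb_or => /andP[n1 n2].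
have d1 := cluster_disj KP K1P n1; have d2 := cluster_disj KP K1P' n2.
have d := cluster_disj K1P K1P' ne.
pose W := K1 :|: K1'.
have cW : #|W| = #|K1| + #|K1'| by apply/eqP; rewrite leq_card_setU.
have [_ h1] := cluster_card Eu free7 K1P; have [_ h2] := cluster_card Eu free7 K1P'.
have dW : #|cover W| <= s * #|W| + 1.
  have := card_setU_cap (subxx (cover K1 :&: cover K1')); rewrite coverU cW mulnDr.
  by move: h1 h2 cap; clear; lia.
have [e eK ve] := bigcupP vK; have eE := subsetP (cluster_sub KP) e eK.
have eW : e \notin W by rewrite inE (disjointFr d1 eK) (disjointFr d2 eK).
have vW : v \in cover W by rewrite coverU inE vK1.
have sC : [set v] \subset e :&: cover W by rewrite sub1set inE ve.
have WE : W \subset E by rewrite subUset !cluster_sub.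
have := @grow T s E Eu free7 K (e |: W) e KP; rewrite !inE eK eqxx subUset sub1set eE WE cardsU1 eW add1n ltnS.
have W6 : #|W| <= 6 by rewrite cW.
move=> /(_ isT isT W6); rewrite coverU1.
have := cover_add Eu eE dW sC; rewrite cards1 => hc.
case=> [|r6 _]; first by move: hc; clear; lia.
have sub : W :|: K \subset (e |: W) :|: K by rewrite setSU // subsetUr.
have dWK : [disjoint W & K].
  by rewrite -setI_eq0 setIUl setU_eq0 !setI_eq0 ![[disjoint _ & K]]disjoint_sym d1.
have := leq_trans (subset_leq_card sub) r6.
have -> : #|W :|: K| = #|W| + #|K| by apply/eqP; rewrite leq_card_setU.
have [e1 e1K] := cluster_neq0 K1P'.
have : 0 < #|K1'| by apply/card_gt0P; exists e1.
rewrite cW; move: K13 K3; clear; lia.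
Qed.

Definition pairs_in (Q : {set {set T}}) : {set {set T}} := [set p : {set T} | (#|p| == 2) && [exists e in Q, p \subset e]].
(** Such a pair is a docking place: two linked edges spanning it can be added to any dense family
    that covers both of its vertices, see [dock0]. *)
Definition tight_pairs (Q : {set {set T}}) : {set {set T}} := [set p : {set T} | [&& #|p| == 2, p \notin pairs_in Q &
  [exists e in Q, [exists f in Q, (1 < #|e :&: f|) && (p \subset e :|: f)]]]].

Lemma card_pairs_in1 e : e \in E -> #|pairs_in [set e]| = 'C(s + 2, 2).
Proof.
move=> eE; rewrite -(Eu eE) -cards_draws; apply: eq_card => p; rewrite !inE andbC.
by congr (_ && _); apply/existsP/idP => [[f]|pe]; [rewrite inE => /andP[/eqP ->]|exists e; rewrite inE eqxx].
Qed.

Lemma pairs_inP (Q : {set {set T}}) (p : {set T}) : reflect (#|p| = 2 /\ exists2 e, e \in Q & p \subset e) (p \in pairs_in Q).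
Proof.
rewrite inE; apply: (iffP andP) => [[/eqP p2 /existsP[e /andP[]]]|[-> [e eQ pe]]]; first by split=> //; exists e.
by split=> //; apply/existsP; exists e; rewrite eQ.
Qed.

(** Unless the cluster degenerates, each added edge meets the earlier part in exactly two vertices.
    It loses one pair and creates a tight pair, joining a new vertex to a vertex of the edge it is
    linked to. *)
Lemma cluster_structure K : K \in clusters -> ~~ degenerate K ->
  #|K| * 'C(s + 2, 2) <= #|pairs_in K| + (#|K| - 1) /\ #|K| - 1 <= #|tight_pairs K|.
Proof.
move=> KP; have KE := cluster_sub KP.
suff : #|cover K| <= s * #|K| + 1 \/ [/\ #|cover K| <= s * #|K| + 2,
    #|K| * 'C(s + 2, 2) <= #|pairs_in K| + (#|K| - 1) & #|K| - 1 <= #|tight_pairs K|].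
  by case=> [h|[_ h1 h2]]; rewrite /Clusters.degenerate ?h.
apply: (cluster_ind (P := fun K => #|cover K| <= s * #|K| + 1 \/ [/\ #|cover K| <= s * #|K| + 2,
    #|K| * 'C(s + 2, 2) <= #|pairs_in K| + (#|K| - 1) & #|K| - 1 <= #|tight_pairs K|]) KP).
  move=> e /(subsetP KE) eE; right; rewrite cards1 /cover big_set1 Eu // card_pairs_in1 //.
  by rewrite muln1 mul1n subnn addn0.
move=> Q e f QK eK eQ fQ ef IH; have eE := subsetP KE e eK.
have cQ : #|e |: Q| = #|Q|.+1 by rewrite cardsU1 eQ add1n.
rewrite coverU1 cQ subn1 /=.
have sC : e :&: f \subset e :&: cover Q by rewrite setIS // cover_sup.
case: IH => [h|[h1 h2 h3]].
  left; have hc := @cover_add T s E Eu (cover Q) (e :&: f) e #|Q| 1 eE h sC; exact: drop2 hc ef.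
case: (ltnP 2 #|e :&: cover Q|) => c3.
  by left; have hc := @cover_add T s E Eu (cover Q) _ e #|Q| 2 eE h1 (subxx (e :&: cover Q)); exact: drop3 hc c3.
have /eqP eqI : e :&: f == e :&: cover Q by rewrite eqEcard sC (leq_trans c3).
have c2 : #|e :&: f| = 2 by apply/eqP; rewrite eqn_leq ef {1}eqI c3.
right; split.
- by have hc := @cover_add T s E Eu (cover Q) _ e #|Q| 2 eE h1 sC; rewrite c2 leq_add2r in hc.
- have Q0 : 0 < #|Q| by apply/card_gt0P; exists f.
  have sub : e :&: f |: (pairs_in Q :|: pairs_in [set e]) \subset pairs_in (e |: Q).
    apply/subsetP => p; rewrite !in_setU in_set1 => /or3P[/eqP ->|/pairs_inP[p2 [g gQ pg]]|/pairs_inP[p2 [g /set1P -> pg]]].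
    + by apply/pairs_inP; split=> //; exists e; rewrite ?subsetIl // !inE eqxx.
    + by apply/pairs_inP; split=> //; exists g; rewrite ?inE ?gQ ?orbT.
    + by apply/pairs_inP; split=> //; exists e; rewrite ?inE ?eqxx.
  have := subset_leq_card (subset_trans (subsetUr _ _) sub); rewrite cardsU card_pairs_in1 //.
  have : #|pairs_in Q :&: pairs_in [set e]| <= 1.
    rewrite -(cards1 (e :&: f)); apply/subset_leq_card/subsetP => p /setIP[/pairs_inP[p2 [g gQ pg]] /pairs_inP[_ [g' /set1P -> pe]]].
    rewrite inE eqEcard p2 c2 leqnn andbT eqI subsetI pe (subset_trans pg) //.
    exact: cover_sup.
  by move=> u1 u2; exact: pairs_arith h2 Q0 u1 u2.
have eN : exists a, a \in e :\: f.
  by apply/card_gt0P; rewrite cardsD c2 (Eu eE) addnK.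
have fE := subsetP KE f (subsetP QK f fQ).
have fN : exists b, b \in f :\: e.
  by apply/card_gt0P; rewrite cardsD setIC c2 (Eu fE) addnK.
have [a /setDP[ae af]] := eN; have [b /setDP[bf be]] := fN.
have aQ : a \notin cover Q.
  apply: contra af => aQ; have : a \in e :&: cover Q by rewrite inE ae.
  by rewrite -eqI inE => /andP[].
have ab : a != b by apply: contraNneq be => <-.
have ab2 : #|[set a; b]| = 2 by rewrite cards2 ab.
have Q0 : 0 < #|Q| by apply/card_gt0P; exists f.
have tQ p : p \in tight_pairs Q -> p \subset cover Q.
  rewrite inE => /and3P[_ _ /existsP[g /andP[gQ /existsP[g' /and3P[gQ' _]]]]] /subset_trans -> //.
  by rewrite subUset !cover_sup.
have new : [set a; b] \notin tight_pairs Q.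
  by apply: contra aQ => /tQ /subsetP -> //; rewrite !inE eqxx.
have : #|[set a; b] |: tight_pairs Q| <= #|tight_pairs (e |: Q)|.
  apply/subset_leq_card/subsetP => p /setU1P[->|pt].
    rewrite inE ab2 eqxx /=; apply/andP; split.
      apply/pairs_inP => -[_ [g /setU1P[->|gQ] /subsetP abg]].
        by move: be; rewrite abg // !inE eqxx orbT.
      by move: aQ; rewrite (subsetP (cover_sup gQ)) // abg // !inE eqxx.
    apply/existsP; exists e; rewrite !inE eqxx /=; apply/existsP; exists f.
    by rewrite !inE fQ orbT ef; apply/subsetP => x /set2P[] ->; rewrite inE ?ae ?bf ?orbT.
  have pQ := tQ p pt; move: pt; rewrite !inE => /and3P[p2 pn /existsP[g /andP[gQ /existsP[g' /and3P[gQ' gg pg]]]]].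
  rewrite p2 /=; apply/andP; split.
    rewrite p2 /= in pn; apply: contra pn => /existsP[h /andP[/setU1P[he|hQ] ph]]; apply/existsP; last by exists h; rewrite hQ.
    by exists f; rewrite fQ; apply: subset_trans (subsetIr e f); rewrite eqI subsetI -he ph.
  apply/existsP; exists g; rewrite !inE gQ orbT /=; apply/existsP; exists g'.
  by rewrite !inE gQ' gg pg orbT.
rewrite cardsU1 new => h4; exact: pred_arith h3 Q0 h4.
Qed.

End Bad.

End ClusterStructure.

(** * The upper bound by discharging *)

Module Discharging.
Import SparsePacking Clusters ClusterStructure.
(** The last term is the one unit a cluster of three cannot obtain when all its tight pairs are
    covered; it is asked of a single edge. *)
Lemma deficit_arith m u c : 2 < m -> m - 1 <= u + c -> m + c <= 6 ->
  m - 2 <= (if 3 < m then 2 else 1) * u + ((m == 3) && (u == 0)).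
Proof. case: (ltnP 3 m) => h; case: (eqVneq m 3) => e; case: (eqVneq u 0) => f /=; lia. Qed.

(** With every pair worth 2 and every edge costing 2C - 1, a cluster of m edges has deficit m - 2; a
    single edge has surplus 1. *)
Lemma charge_arith C m P : 0 < m -> m * C <= P + (m - 1) -> 0 < C ->
  (2 * C - 1) * m + (m == 1) <= 2 * P + (m - 2).
Proof.
move=> m0 h C0; have e : (2 * C - 1) * m + m = 2 * (m * C).
  by rewrite mulnBl mul1n subnK ?mulnA ?leq_pmull ?muln_gt0 // mulnAC; lia.
case: eqP => [m1|m1] /=; move: e h; move: ((2 * C - 1) * m) (m * C) => x y; lia.
Qed.

Section Discharge.
Variables (T : finType) (s : nat) (E : {set {set T}}).
Hypothesis s0 : 0 < s.
Hypothesis Eu : forall e, e \in E -> #|e| = s + 2.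
Hypothesis free7 : forall Q : {set {set T}}, Q \subset E -> #|Q| = 7 -> s * 7 + 3 <= #|cover Q|.
Notation clusters := (clusters E).
Notation degenerate := (degenerate s).
Notation bad := (bad E).

Lemma tight_pairP K (p : {set T}) : p \in tight_pairs K -> [/\ #|p| = 2, p \notin pairs_in K &
  exists e f, [/\ e \in K, f \in K, e != f, 1 < #|e :&: f| & p \subset e :|: f]].
Proof.
rewrite inE => /and3P[/eqP p2 pn /existsP[e /andP[eK /existsP[f /and3P[fK ef pef]]]]].
split=> //; exists e, f; split=> //; apply: contra pn => /eqP h.
by apply/pairs_inP; split=> //; exists e; rewrite // -[e]setUid {2}h.
Qed.

Lemma tight_cover K (p : {set T}) : p \in tight_pairs K -> p \subset cover K.
Proof.
case/tight_pairP => _ _ [e [f [eK fK _ _ /subset_trans]]]; apply.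
by rewrite subUset !cover_sup.
Qed.

(** Two linked edges cover at most 2s + 2 vertices, and the two vertices of [p] are already present,
    so density is preserved. *)
Lemma dock0 (K Y : {set {set T}}) (p : {set T}) : K \in clusters -> p \in tight_pairs K -> Y \subset E -> [disjoint Y & K] ->
  p \subset cover Y -> #|cover Y| <= s * #|Y| + 2 ->
  exists2 D : {set {set T}}, D \subset K & [/\ #|Y :|: D| = #|Y| + 2, p \subset cover D,
    D != set0 & #|cover (Y :|: D)| <= s * #|Y :|: D| + 2].
Proof.
move=> KP /tight_pairP[p2 _ [e [f [eK fK ef cef pef]]]] YE d pY cY.
have KE := cluster_sub KP.
have cD : cover [set e; f] = e :|: f by rewrite coverU1 /cover big_set1.
exists [set e; f]; first by apply/subsetP => x /set2P[] ->.
have c2 : #|Y :|: [set e; f]| = #|Y| + 2.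
  rewrite cardsU (_ : Y :&: _ = set0) ?cards0 ?subn0 ?cards2 ?ef //.
  by apply/setP => x; rewrite !inE; apply/andP => -[xY /orP[] /eqP xe]; move: (disjointFr d xY); rewrite xe ?eK ?fK.
split=> //; first by rewrite cD.
  by apply/set0Pn; exists e; rewrite !inE eqxx.
rewrite c2 coverU cD.
have h1 : #|e :|: f| + 2 <= #|e| + #|f| by rewrite -(cardsUI e f) leq_add2l.
have sC : p \subset cover Y :&: (e :|: f) by rewrite subsetI pY.
have h2 := card_setU_cap sC; rewrite p2 in h2.
have h3 : #|e| = s + 2 by apply/Eu/(subsetP KE).
have h4 : #|f| = s + 2 by apply/Eu/(subsetP KE).
by rewrite mulnDr; move: h1 h2 h3 h4 cY; move: #|e| #|f| #|e :|: f| #|cover Y| #|_ :|: _| (s * #|Y|); clear; lia.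
Qed.

Lemma dock (K Y : {set {set T}}) (p : {set T}) : K \in clusters -> p \in tight_pairs K -> Y \subset E -> [disjoint Y & K] ->
  p \subset cover Y -> #|cover Y| <= s * #|Y| + 2 -> #|Y| <= 5 ->
  #|Y| + #|K| <= 6 /\ #|cover (Y :|: K)| <= s * #|Y :|: K| + 2.
Proof.
move=> KP pK YE d pY cY Y5.
have [D DK [c2 pD D0 cD]] := dock0 KP pK YE d pY cY.
have [f0 f0D] := set0Pn _ D0.
have YDE : Y :|: D \subset E by rewrite subUset YE (subset_trans DK) // cluster_sub.
have fK : f0 \in K :&: (Y :|: D) by rewrite !inE f0D orbT (subsetP DK).
have c7 : #|Y :|: D| <= 7 by rewrite c2 -[7]/(5 + 2) leq_add2r.
have := grow Eu free7 KP YDE fK c7 cD; rewrite -setUA (setUidPr DK).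
have -> : #|Y :|: K| = #|Y| + #|K| by apply/eqP; rewrite leq_card_setU.
by case.
Qed.

Lemma attach (K Y : {set {set T}}) (p e : {set T}) : K \in clusters -> Y \subset E -> [disjoint Y & K] ->
  #|p| = 2 -> p \subset cover Y -> e \in K -> p \subset e -> #|cover Y| <= s * #|Y| + 2 -> #|Y| <= 6 ->
  #|Y| + #|K| <= 6 /\ #|cover (Y :|: K)| <= s * #|Y :|: K| + 2.
Proof.
move=> KP YE d p2 pY eK pe cY Y6; have eE := subsetP (cluster_sub KP) e eK.
have sC : p \subset e :&: cover Y by rewrite subsetI pe.
have := @cover_add T s E Eu (cover Y) p e #|Y| 2 eE cY sC; rewrite p2 leq_add2r => hc.
have eY : e \notin Y by apply/negP => /(disjointFr d); rewrite eK.
have cX : #|e |: Y| = #|Y|.+1 by rewrite cardsU1 eY.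
have XE : e |: Y \subset E by rewrite subUset sub1set eE.
have fK : e \in K :&: (e |: Y) by rewrite !inE eK eqxx.
have := grow Eu free7 KP XE fK; rewrite cX coverU1 ltnS => /(_ Y6 hc).
rewrite -setUA [Y :|: K]setUC setUA (setUidPr (_ : [set e] \subset K)) ?sub1set // setUC.
have -> : #|Y :|: K| = #|Y| + #|K| by apply/eqP; rewrite leq_card_setU.
by case.
Qed.

(** Two edges containing the same pair are linked, so the cluster does not depend on the edge
    picked. The empty set is the default for an uncovered pair. *)
Definition owner (p : {set T}) : {set {set T}} :=
  if [pick e in E | p \subset e] is Some e then pblock clusters e else set0.

Lemma ownerP (p : {set T}) : p \in pairs_in E -> owner p \in clusters /\ exists2 e, e \in owner p & p \subset e.
Proof.
case/pairs_inP => p2 [e eE pe]; rewrite /owner; case: pickP => [f /andP[fE pf]|/(_ e)]; last by rewrite eE pe.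
have fc : f \in cover clusters by rewrite (cover_partition (clusters_partition E)).
by split; [exact: pblock_mem | exists f; rewrite ?mem_pblock].
Qed.

Lemma owner_uniq K (p : {set T}) : K \in clusters -> p \in pairs_in K -> owner p = K.
Proof.
move=> KP /pairs_inP[p2 [f fK pf]]; have fE := subsetP (cluster_sub KP) f fK.
have pE : p \in pairs_in E by apply/pairs_inP; split=> //; exists f.
have [OP [e eO pe]] := ownerP pE; apply: (cluster_eq OP KP (e := f)) => //.
apply: (cluster_closed OP eO fE); rewrite -p2; apply: subset_leq_card.
by rewrite subsetI pe.
Qed.

Definition covered_pairs (K : {set {set T}}) := tight_pairs K :&: pairs_in E.

Lemma covered_owner (K : {set {set T}}) (p : {set T}) : p \in covered_pairs K -> [/\ owner p \in clusters, owner p != K, #|p| = 2, p \subset cover K &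
  exists2 e, e \in owner p & p \subset e].
Proof.
case/setIP => pt /ownerP[OP [e eO pe]]; have [p2 pn _] := tight_pairP pt.
split=> //; [|exact: tight_cover|by exists e].
by apply: contraNneq pn => <-; apply/pairs_inP; split=> //; exists e.
Qed.

Lemma covered_size (K : {set {set T}}) (p : {set T}) : K \in clusters -> p \in covered_pairs K ->
  #|K| + #|owner p| <= 6 /\ #|cover (K :|: owner p)| <= s * #|K :|: owner p| + 2.
Proof.
move=> KP /covered_owner[OP ne p2 pK [e eO pe]]; have [K6 cK] := cluster_card Eu free7 KP.
apply: (attach OP (cluster_sub KP) _ p2 pK eO pe cK K6).
by rewrite (cluster_disj KP OP) // eq_sym.
Qed.

(** Two pairs with the same owner put three vertices in both clusters, which makes [K] bad. *)
Lemma covered_inj K : K \in clusters -> ~~ bad K -> {in covered_pairs K &, injective owner}.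
Proof.
move=> KP nb p p' pc pc' oo; apply/eqP; apply: contraNT nb => pp.
have [OP ne p2 pK [e eO pe]] := covered_owner pc.
have [OP' ne' p2' pK' [e' eO' pe']] := covered_owner pc'.
apply/existsP; exists (owner p); rewrite OP ne (proj1 (covered_size KP pc)) /=.
apply: leq_trans (_ : #|p :|: p'| <= _); last first.
  apply: subset_leq_card; rewrite subsetI !subUset pK pK' /=.
  by rewrite (subset_trans pe (cover_sup eO)) oo (subset_trans pe' (cover_sup eO')).
rewrite ltnNge; apply: contra pp => h.
have e1 : p == p :|: p' by rewrite eqEcard subsetUl p2.
have e2 : p' == p :|: p' by rewrite eqEcard subsetUr p2'.
by rewrite (eqP e1) {2}(eqP e2).
Qed.

(** The owners are distinct clusters and each attaches along its own pair, so [K] together with all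
    of them is one dense family. *)
Lemma owners K (A : {set {set T}}) : K \in clusters -> ~~ bad K -> A \subset covered_pairs K ->
  exists Y : {set {set T}}, [/\ Y \subset E, K \subset Y, #|Y| = #|K| + \sum_(p in A) #|owner p|, #|Y| <= 6 &
    #|cover Y| <= s * #|Y| + 2 /\ forall K', K' \in clusters -> K' != K -> 
      (forall p, p \in A -> owner p != K') -> [disjoint Y & K']].
Proof.
move=> KP nb; have [k] := ubnP #|A|; elim: k A => // k IH A; rewrite ltnS => Ak sA.
case: (set_0Vmem A) => [->|[p pA]].
  have [K6 cK] := cluster_card Eu free7 KP.
  exists K; rewrite big_set0 addn0; split=> //; first exact: cluster_sub.
  by split=> // K' KP' ne _; rewrite (cluster_disj KP KP') // eq_sym.
have sA' : A :\ p \subset covered_pairs K by rewrite (subset_trans (subsetDl _ _)).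
have [|Y [YE KY cY Y6 [dY disj]]] := IH (A :\ p) _ sA'.
  by apply: leq_trans Ak; rewrite [ltnRHS](cardsD1 p) pA.
have pc := subsetP sA p pA; have [OP ne p2 pK [e eO pe]] := covered_owner pc.
have d : [disjoint Y & owner p].
  apply: disj => // q /setD1P[qp qA]; apply: contra qp => /eqP qo; apply/eqP.
  exact: covered_inj KP nb _ _ (subsetP sA q qA) pc qo.
have pY : p \subset cover Y by rewrite (subset_trans pK) // -(setUidPr KY) coverU subsetUl.
have [h1 h2] := attach OP YE d p2 pY eO pe dY Y6.
have cU : #|Y :|: owner p| = #|Y| + #|owner p| by apply/eqP; rewrite leq_card_setU.
exists (Y :|: owner p); split.
- by rewrite subUset YE cluster_sub.
- by rewrite (subset_trans KY) // subsetUl.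
- by rewrite cU cY (big_setD1 p pA) /= [#|owner p| + _]addnC addnA.
- by rewrite cU.
split=> // K' KP' ne' oA; rewrite -setI_eq0 setIUl setU_eq0 !setI_eq0; apply/andP; split.
  by apply: disj => // q /setD1P[_ /oA].
exact: (cluster_disj OP KP' (oA p pA)).
Qed.

Lemma owners_sum K : K \in clusters -> ~~ bad K -> #|K| + \sum_(p in covered_pairs K) #|owner p| <= 6.
Proof. by move=> KP nb; have [Y [_ _ <-]] := owners KP nb (subxx _). Qed.

Lemma owner_gt0 (K : {set {set T}}) (p : {set T}) : p \in covered_pairs K -> 0 < #|owner p|.
Proof. by case/covered_owner => _ _ _ _ [e eO _]; apply/card_gt0P; exists e. Qed.

Lemma covered_le K : K \in clusters -> ~~ bad K -> #|K| + #|covered_pairs K| <= 6.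
Proof.
move=> KP nb; apply: leq_trans (owners_sum KP nb); rewrite leq_add2l -sum1_card.
by apply: leq_sum => p /owner_gt0.
Qed.

Definition uncovered (K : {set {set T}}) := tight_pairs K :\: pairs_in E.

Lemma split_tight K : #|tight_pairs K| = #|uncovered K| + #|covered_pairs K|.
Proof. by rewrite addnC cardsID. Qed.

(** There are at least two tight pairs, all covered, and their owners have at most three edges in
    total; one owner is a single edge. *)
Lemma exists_single K : K \in clusters -> ~~ degenerate K -> ~~ bad K -> #|K| = 3 -> #|uncovered K| = 0 ->
  exists2 p, p \in covered_pairs K & #|owner p| = 1.
Proof.
move=> KP nd nb K3 u0; have [_ h] := cluster_structure s0 Eu KP nd.
rewrite split_tight u0 K3 add0n in h.
case: (pickP [pred p | (p \in covered_pairs K) && (#|owner p| == 1)]) => [p /andP[pc /eqP p1]|no]; first by exists p.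
have : #|covered_pairs K| * 2 <= \sum_(p in covered_pairs K) #|owner p|.
  rewrite -sum_nat_const; apply: leq_sum => p pc; have := owner_gt0 pc; have := no p.
  by rewrite /= pc /=; case: #|owner p| => [|[|]].
have := owners_sum KP nb; rewrite K3; move: h; clear; lia.
Qed.

(** Docking [K] on two edges of [K'] shows that [K] has at most four edges, which leaves room for
    docking [K'] on the whole of [K]. *)
Lemma two_claims K K' (p : {set T}) : K \in clusters -> K' \in clusters -> K != K' -> p \in tight_pairs K ->
  p \in tight_pairs K' -> #|K| + #|K'| <= 6.
Proof.
move=> KP KP' ne pt pt'; have [p2 _ [e [f [eK fK ef cef pef]]]] := tight_pairP pt'.
have sD : [set e; f] \subset K' by apply/subsetP => x /set2P[] ->.
have d : [disjoint K' & K] by rewrite (cluster_disj KP' KP) // eq_sym.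
have cD : cover [set e; f] = e :|: f by rewrite coverU1 /cover big_set1.
have DE : [set e; f] \subset E by rewrite (subset_trans sD) // cluster_sub.
have c2 : #|[set e; f]| = 2 by rewrite cards2 ef.
have [K6 cK] := cluster_card Eu free7 KP.
have h3 : #|e| = s + 2 by apply/Eu/(subsetP (cluster_sub KP')).
have h4 : #|f| = s + 2 by apply/Eu/(subsetP (cluster_sub KP')).
have h1 : #|e :|: f| + 2 <= #|e| + #|f| by rewrite -(cardsUI e f) leq_add2l.
have dD : #|cover [set e; f]| <= s * #|[set e; f]| + 2.
  by rewrite cD c2; move: h1; rewrite h3 h4; clear; lia.
have D5 : #|[set e; f]| <= 5 by rewrite c2.
have pefc : p \subset cover [set e; f] by rewrite cD.
have [h _] := dock KP pt DE (disjointWl sD d) pefc dD D5.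
have K5 : #|K| <= 5 by move: h; rewrite c2; clear; lia.
have dKK : [disjoint K & K'] by rewrite disjoint_sym.
by have [] := dock KP' pt' (cluster_sub KP) dKK (tight_cover pt) cK K5.
Qed.

(** [K1] and two edges of [K2] form a dense family of five, on which [K3] with its three edges
    cannot dock. *)
Lemma three_claims K1 K2 K3 (p : {set T}) : K1 \in clusters -> K2 \in clusters -> K3 \in clusters ->
  K1 != K2 -> K1 != K3 -> K2 != K3 -> #|K1| = 3 -> #|K3| = 3 ->
  p \in tight_pairs K1 -> p \in tight_pairs K2 -> p \in tight_pairs K3 -> False.
Proof.
move=> P1 P2 P3 n12 n13 n23 c1 c3 t1 t2 t3; have [_ dK] := cluster_card Eu free7 P1.
have [D DK [cD pD _ dD]] := dock0 P2 t2 (cluster_sub P1) (cluster_disj P1 P2 n12) (tight_cover t1) dK.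
have YE : K1 :|: D \subset E by rewrite subUset cluster_sub // (subset_trans DK) // cluster_sub.
have d : [disjoint K1 :|: D & K3].
  rewrite -setI_eq0 setIUl setU_eq0 !setI_eq0 (cluster_disj P1 P3 n13) /=.
  exact: disjointWl DK (cluster_disj P2 P3 n23).
have pY : p \subset cover (K1 :|: D) by rewrite coverU (subset_trans pD) // subsetUr.
have := dock P3 t3 YE d pY dD; rewrite cD c1 c3.
by move=> /(_ isT)[].
Qed.

(** [K1] and the single edge form a dense family of four that spans [p2]; docking [K2] there would
    give seven edges. *)
Lemma single_asked_once (K1 K2 : {set {set T}}) (p1 p2 : {set T}) : K1 \in clusters -> K2 \in clusters -> #|K1| = 3 -> #|K2| = 3 ->
  p1 \in covered_pairs K1 -> p2 \in covered_pairs K2 -> #|owner p1| = 1 -> owner p1 = owner p2 -> K1 = K2.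
Proof.
move=> P1 P2 c1 c2 k1 k2 o1 oo; apply/eqP; apply: contraT => ne.
have [O1 n1 _ _ _] := covered_owner k1; have [_ n2 q2 pK2 [e2 eO2 pe2]] := covered_owner k2.
have [_ dY] := covered_size P1 k1; have /setIP[t2 _] := k2.
have dd : [disjoint K1 & owner p1] by rewrite (cluster_disj P1 O1) // eq_sym.
have cY : #|K1 :|: owner p1| = 4.
  by have := leq_card_setU K1 (owner p1); rewrite dd c1 o1 => -[_ /eqP].
have YE : K1 :|: owner p1 \subset E by rewrite subUset !cluster_sub.
have d : [disjoint K1 :|: owner p1 & K2].
  by rewrite -setI_eq0 setIUl setU_eq0 !setI_eq0 (cluster_disj P1 P2 ne) (cluster_disj O1 P2) // oo.
have pY : p2 \subset cover (K1 :|: owner p1).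
  by rewrite coverU oo (subset_trans pe2) // (subset_trans (cover_sup eO2)) // subsetUr.
have := dock P2 t2 YE d pY dY; rewrite cY c2.
by move=> /(_ isT)[].
Qed.

Definition ok (K : {set {set T}}) := ~~ degenerate K && ~~ ((2 < #|K|) && bad K).
Let U : {set {set T}} := [set p : {set T} | #|p| == 2] :\: pairs_in E.
Let C := 'C(s + 2, 2).
Let singles := [set K in clusters | #|K| == 1].
Let big := [set K in clusters | ok K && (2 < #|K|)].

Lemma bigP K : K \in big -> [/\ K \in clusters, ~~ degenerate K, ~~ bad K & 2 < #|K|].
Proof. by rewrite inE /ok => /and3P[-> /andP[-> nb] c]; rewrite c in nb *. Qed.

(* Clusters of sizes [m] and [m'] claiming the same pair satisfy [m + m' <= 6]. *)
Lemma claims_le (p : {set T}) : \sum_(K in big | p \in tight_pairs K) (if 3 < #|K| then 2 else 1) <= 2.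
Proof.
pose S := [set K in big | p \in tight_pairs K].
rewrite (eq_bigl (fun K => K \in S)); last by move=> K; rewrite [RHS]inE.
case: (boolP [exists K in S, 3 < #|K|]) => [/existsP[K /andP[KS K3]]|no].
  have /setIdP[/bigP[KP _ _ _] pt] := KS.
  have -> : S = [set K].
    apply/eqP; rewrite eqEsubset sub1set KS andbT; apply/subsetP => K' /setIdP[/bigP[KP' _ _ K3'] pt'].
    rewrite inE; apply: contraT; rewrite eq_sym => /two_claims/(_ pt pt') h.
    by have := h KP KP'; move: K3 K3'; clear; lia.
  by rewrite big_set1 K3.
have le3 K : K \in S -> #|K| = 3.
  move=> KS; have /setIdP[/bigP[_ _ _ K3] _] := KS; apply/eqP; rewrite eqn_leq K3 andbT leqNgt.
  by apply: contra no => K4; apply/existsP; exists K; rewrite KS.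
rewrite (eq_bigr (fun=> 1)) => [|K /le3 -> //]; rewrite sum1_card leqNgt; apply/negP.
case/card_gt2P => K1 [K2 [K3 [[S1 S2 S3] [n12 n23 n31]]]].
have /setIdP[/bigP[P1 _ _ _] t1] := S1; have /setIdP[/bigP[P2 _ _ _] t2] := S2; have /setIdP[/bigP[P3 _ _ _] t3] := S3.
by apply: (three_claims P1 P2 P3 n12 _ n23 (le3 _ S1) (le3 _ S3) t1 t2 t3); rewrite eq_sym.
Qed.

Lemma asking_le : #|[set K in big | (#|K| == 3) && (#|uncovered K| == 0)]| <= #|singles|.
Proof.
set S := [set K in big | _].
pose h K := if [pick p in covered_pairs K | #|owner p| == 1] is Some p then owner p else set0.
have hP K : K \in S -> exists p, [/\ p \in covered_pairs K, #|owner p| = 1, h K = owner p, K \in clusters & #|K| = 3].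
  case/setIdP => /bigP[KP nd nb _] /andP[/eqP K3 /eqP u0].
  have [q qc q1] := exists_single KP nd nb K3 u0.
  rewrite /h; case: pickP => [p /andP[pc /eqP p1]|/(_ q)]; first by exists p.
  by rewrite qc q1.
have hi : {in S &, injective h}.
  move=> K1 K2 /hP[p1 [c1 o1 -> P1 k1]] /hP[p2 [c2 o2 -> P2 k2]] oo.
  exact: single_asked_once P1 P2 k1 k2 c1 c2 o1 oo.
rewrite -(card_in_imset hi); apply/subset_leq_card/subsetP => _ /imsetP[K /hP[p [c o -> _ _]] ->].
by have [O _ _ _ _] := covered_owner c; rewrite inE O o.
Qed.

Lemma deficits_le : \sum_(K in clusters | ok K) (#|K| - 2) <= 2 * #|U| + #|singles|.
Proof.
apply: leq_trans (_ : \sum_(K in big) (#|K| - 2) <= _).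
  rewrite big_mkcond [leqRHS]big_mkcond; apply: leq_sum => K _; rewrite inE.
  case: (K \in clusters) => //=; case: (ok K) => //=; case: ltnP => // h.
  by rewrite leqn0 subn_eq0.
apply: leq_trans (_ : \sum_(K in big) ((if 3 < #|K| then 2 else 1) * #|uncovered K| +
    ((#|K| == 3) && (#|uncovered K| == 0))) <= _).
  apply: leq_sum => K /bigP[KP nd nb K3]; apply: (deficit_arith (c := #|covered_pairs K|)) => //.
    by rewrite -split_tight; have [] := cluster_structure s0 Eu KP nd.
  exact: covered_le.
rewrite big_split /= leq_add //; last first.
  rewrite (leq_trans _ asking_le) // -sum1_card [leqRHS]big_mkcond [leqLHS]big_mkcond /=.
  by apply: leq_sum => K _; rewrite [in leqRHS]inE; case: (K \in big) => //=; case: (_ && _).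
apply: leq_trans (_ : \sum_(K in big) \sum_(p in U | p \in tight_pairs K) (if 3 < #|K| then 2 else 1) <= _).
  apply: leq_sum => K _; rewrite sum_nat_const mulnC leq_mul2r; apply/orP; right.
  apply/subset_leq_card/subsetP => p /setDP[pt pn]; rewrite unfold_in /= pt andbT inE pn /=.
  by have [p2 _ _] := tight_pairP pt; rewrite inE p2.
rewrite (exchange_big_dep (fun p => p \in U)) //=; last by move=> K p _ /andP[].
rewrite mulnC -sum_nat_const; apply: leq_sum => p pU.
by apply: leq_trans (claims_le p); rewrite leq_eqVlt; apply/orP; left; apply/eqP/eq_bigl => K; rewrite pU.
Qed.

Lemma pairs_sum : \sum_(K in clusters) #|pairs_in K| <= #|pairs_in E|.
Proof.
apply: leq_trans (_ : \sum_(K in clusters) \sum_(p in pairs_in E | p \in pairs_in K) 1 <= _).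
  apply: leq_sum => K KP; rewrite sum1_card; apply/subset_leq_card/subsetP => p pK.
  rewrite unfold_in /= pK andbT; case/pairs_inP: pK => p2 [e eK pe].
  by apply/pairs_inP; split=> //; exists e => //; apply: subsetP eK; exact: cluster_sub.
rewrite (exchange_big_dep (fun p => p \in pairs_in E)) //=; last by move=> K p _ /andP[].
rewrite -[leqRHS]sum1_card; apply: leq_sum => p pE.
rewrite sum1_card -(cards1 (owner p)); apply/subset_leq_card/subsetP => K.
by rewrite unfold_in /= => /and3P[KP _ /(owner_uniq KP) ->]; rewrite inE.
Qed.

Theorem packing_upper : (2 * C - 1) * #|E| <= #|T| ^ 2 + (2 * C - 1) * (18 * #|T|).
Proof.
have C0 : 0 < C by rewrite bin_gt0 addn2.
have single_ok K : K \in clusters -> #|K| = 1 -> ok K.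
  move=> KP K1; have [e eK] := cluster_neq0 KP; have eE := subsetP (cluster_sub KP) e eK.
  have KE : K = [set e] by apply/eqP; rewrite eq_sym eqEcard sub1set eK cards1 K1.
  rewrite /ok K1 andbT /Clusters.degenerate K1 KE /cover big_set1 (Eu eE) -ltnNge; lia.
have main : (2 * C - 1) * \sum_(K in clusters | ok K) #|K| <= 2 * #|pairs_in E| + 2 * #|U|.
  (* Single edges enter on both sides: as a surplus on the left, as payment for clusters of three on
     the right. *)
  rewrite -(leq_add2r #|singles|) -[leqRHS]addnA; 
  apply: (@leq_trans (2 * \sum_(K in clusters) #|pairs_in K| + \sum_(K in clusters | ok K) (#|K| - 2))); last first.
    by apply: leq_add; [rewrite leq_mul2l pairs_sum | exact: deficits_le].
  apply: leq_trans (_ : \sum_(K in clusters | ok K) ((2 * C - 1) * #|K| + (#|K| == 1)) <= _).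
    rewrite big_split /= big_distrr /= leq_add2l -sum1_card [leqLHS]big_mkcond [leqRHS]big_mkcond.
    apply: leq_sum => K _; rewrite inE; case: (boolP (K \in clusters)) => //= KP.
    by case: eqP => //= K1; rewrite single_ok.
  apply: leq_trans (_ : \sum_(K in clusters | ok K) (2 * #|pairs_in K| + (#|K| - 2)) <= _).
    apply: leq_sum => K /andP[KP /andP[nd _]]; apply: charge_arith => //.
      by have [e eK] := cluster_neq0 KP; apply/card_gt0P; exists e.
    by have [] := cluster_structure s0 Eu KP nd.
  rewrite big_split /= -big_distrr /= leq_add2r leq_mul2l /=.
  by rewrite [leqRHS](bigID ok) /= leq_addr.
have tot : 2 * #|pairs_in E| + 2 * #|U| <= #|T| ^ 2.
  rewrite -mulnDr; have -> : #|pairs_in E| + #|U| = 'C(#|T|, 2).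
    rewrite -card_draws -(cardsID (pairs_in E) [set p : {set T} | #|p| == 2]) (setIidPr _) //.
    by apply/subsetP => p /pairs_inP[p2 _]; rewrite inE p2.
  have := mul_bin_diag #|T| 1; rewrite bin1 => <-; rewrite -mulnn leq_mul2l leq_pred orbT //.
have split : #|E| <= \sum_(K in clusters | ok K) #|K| + 18 * #|T|.
  have -> : #|E| = \sum_(K in clusters) #|K|.
    by rewrite -(card_clusters (subxx clusters)) (cover_partition (clusters_partition E)).
  rewrite (bigID ok) /= leq_add2l; have := degenerate_sum Eu free7; have := bad_sum Eu free7.
  move=> hb hd; rewrite -[18]/(12 + 6) mulnDl; apply: leq_trans (leq_add hb hd).
  rewrite [leqLHS]big_mkcond [in leqRHS]big_mkcond [X in _ + X]big_mkcond /= -big_split /=.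
  apply: leq_sum => K _; case: (K \in clusters) => //=; rewrite /ok negb_and !negbK.
  case: (Clusters.degenerate _ _) => /=; first by rewrite leq_addl.
  by case: (_ && _); rewrite ?addn0.
apply: leq_trans (leq_mul (leqnn _) split) _; rewrite mulnDr leq_add2r.
exact: leq_trans main tot.
Qed.

End Discharge.

End Discharging.

(** * Diamonds and the edges built from them *)

Module Diamonds.
Import SparsePacking Clusters.
Lemma cap_arith2 t q P D c b : P <= 2 * t * q + 2 -> D + c = P + 2 * t.+1 -> 2 * t * q.+1 + 2 <= D ->
  c <= 2 /\ (b <= c -> 2 <= b -> D <= 2 * t * q.+1 + 2).
Proof. rewrite !mulnS; move: (2 * t * q) => x; lia. Qed.

Lemma half_arith t y m e P W k : m + e = 2 * y -> W + k <= P + t.+1 * m ->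
  2 * t * y + 2 <= W -> t.+1 * e + (2 + k) <= 2 * y + P.
Proof.
move=> h1 h2 h3; have : t.+1 * m + t.+1 * e = t.+1 * (2 * y) by rewrite -mulnDr h1.
have -> : t.+1 * (2 * y) = 2 * t * y + 2 * y by rewrite mulSn mulnA [t * 2]mulnC addnC.
by move: (t.+1 * m) (t.+1 * e) (2 * t * y) h2 h3 => a b c; lia.
Qed.

Lemma cross_arith a b c k n m : a + k <= b -> c + k <= n -> m = b + n -> 0 < k -> a + c + k <= m.
Proof. lia. Qed.

Lemma sub1_arith a x : a + 2 <= x -> x != a + 2 -> a + 2 <= x - 1.
Proof. lia. Qed.

Lemma cross_step a c d k z : a + c = k + 1 + d -> z + 1 <= d -> c <= 1 -> k + z + 1 <= a.
Proof. lia. Qed.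

Section Diamonds.
Variables (t N M : nat).
Let s := t.+1.
(** The function places the 2(t + 1) outer vertices, one in each class of size N. The second
    component is a colour, so that diamonds can outnumber the cross pairs they share. *)
Definition diamond := ({ffun bool * 'I_t.+1 -> 'I_N} * 'I_M)%type.
Definition site := ((bool * 'I_t.+1) * 'I_N)%type.

Definition part (D : diamond) (b : bool) : {set site} := [set ((b, i), D.1 (b, i)) | i : 'I_t.+1].
Definition sites (D : diamond) : {set site} := part D true :|: part D false.
Definition cross (D : diamond) : {set site * site} := setX (part D true) (part D false).
Definition all_sites (Y : {set diamond}) := \bigcup_(D in Y) sites D.
Definition all_cross (Y : {set diamond}) := \bigcup_(D in Y) cross D.

Lemma card_part D b : #|part D b| = t.+1.
Proof. by rewrite card_imset ?card_ord // => i j []. Qed.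

Lemma part_side D b x : x \in part D b -> x.1.1 = b.
Proof. by case/imsetP => i _ ->. Qed.

Lemma part_disj D D' : [disjoint part D true & part D' false].
Proof.
by rewrite -setI_eq0; apply/set0Pn => -[x /setIP[/part_side h /part_side]]; rewrite h.
Qed.

Lemma card_sites D : #|sites D| = 2 * t.+1.
Proof.
rewrite cardsU !card_part (_ : _ :&: _ = set0) ?cards0 ?subn0 ?mul2n ?addnn //.
by apply/eqP; rewrite setI_eq0 part_disj.
Qed.

Lemma card_cross D : #|cross D| = t * (t + 2) + 1.
Proof. by rewrite cardsX !card_part; lia. Qed.

Lemma part_sites D b : part D b \subset sites D.
Proof. by case: b; rewrite ?subsetUl ?subsetUr. Qed.

Lemma sites_all D (Y : {set diamond}) : D \in Y -> sites D \subset all_sites Y.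
Proof. by move=> DY; apply: (bigcup_sup D). Qed.

Lemma all_sitesU1 D (Y : {set diamond}) : all_sites (D |: Y) = sites D :|: all_sites Y.
Proof. by rewrite /all_sites bigcup_setU big_set1. Qed.

Lemma all_crossU1 D (Y : {set diamond}) : all_cross (D |: Y) = cross D :|: all_cross Y.
Proof. by rewrite /all_cross bigcup_setU big_set1. Qed.

Lemma all_crossP (Y : {set diamond}) x y : (x, y) \in all_cross Y -> x \in all_sites Y /\ y \in all_sites Y.
Proof.
case/bigcupP => D DY; rewrite in_setX => /andP[xD yD].
by split; apply: (subsetP (sites_all DY)); apply: (subsetP (part_sites _ _)); eassumption.
Qed.

(** A diamond has t(t + 2) + 1 cross pairs. The second bound says that a family on the least number
    of sites shares at least |Y| - 1 of them, counted with multiplicity. *)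
Definition clean (Z : {set diamond}) : Prop := forall Y : {set diamond}, Y \subset Z -> 1 < #|Y| <= 7 ->
  2 * t * #|Y| + 2 <= #|all_sites Y| /\
  (#|all_sites Y| = 2 * t * #|Y| + 2 -> #|all_cross Y| <= #|Y| * (t * (t + 2)) + 1).

Lemma clean_sites (Z Y : {set diamond}) : clean Z -> Y \subset Z -> 0 < #|Y| <= 7 -> 2 * t * #|Y| + 2 <= #|all_sites Y|.
Proof.
move=> cZ YZ /andP[Y0 Y7]; case: (ltnP 1 #|Y|) => Y1; first by have [] := cZ Y YZ; rewrite ?Y1.
have /eqP/cards1P[D ->] : #|Y| = 1 by apply/eqP; rewrite eqn_leq Y1.
by rewrite /all_sites big_set1 card_sites cards1; lia.
Qed.

(** Take a maximal subfamily on at most 2t|Q| + 2 sites satisfying the bound. A diamond sharing a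
    cross pair with it would meet its sites in just these two and could be added; so the other
    diamonds share no cross pair with it, and induction applies to them. *)
Lemma cross_lower (Z Y : {set diamond}) : clean Z -> Y \subset Z -> 0 < #|Y| <= 7 ->
  #|Y| * (t * (t + 2)) + 1 <= #|all_cross Y|.
Proof.
move=> cZ; have [k] := ubnP #|Y|; elim: k Y => // k IH Y; rewrite ltnS => Yk YZ /andP[Y0 Y7].
pose P (Q : {set diamond}) := [&& Q \subset Y, 0 < #|Q|, #|all_sites Q| <= 2 * t * #|Q| + 2 &
  #|Q| * (t * (t + 2)) + 1 <= #|all_cross Q|].
have [D0 D0Y] : exists D, D \in Y by apply/card_gt0P.
have P0 : P [set D0].
  apply/and4P; rewrite sub1set cards1 /all_sites /all_cross !big_set1 card_sites card_cross mul1n.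
  by split=> //; rewrite muln1 mulnS addnC.
have [Q /maxsetP[/and4P[QY Q0 sQ cQ] Qmax] _] := maxset_exists P0.
case: (eqVneq Q Y) => [<- //|QnY].
case: (pickP [pred D | (D \in Y :\: Q) && (cross D :&: all_cross Q != set0)]) => [D /andP[/setDP[DY DQ] /set0Pn[[x y] /setIP[xyD xyQ]]]|no].
  exfalso; have QD : #|D |: Q| = #|Q|.+1 by rewrite cardsU1 DQ.
  have sub : D |: Q \subset Y by rewrite subUset sub1set DY.
  have c7 : 0 < #|D |: Q| <= 7 by rewrite QD /= -QD (leq_trans (subset_leq_card sub)).
  have low := clean_sites cZ (subset_trans sub YZ) c7.
  have := cardsUI (sites D) (all_sites Q); rewrite -all_sitesU1 card_sites => eqn.
  rewrite QD in low.
  have [xQ yQ] := all_crossP xyQ; move: (xyD); rewrite in_setX => /andP[/= xD yD].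
  have xy : x != y by apply: contraTneq xD => ->; rewrite (disjointFl (part_disj D D) yD).
  have sxy : [set x; y] \subset sites D :&: all_sites Q.
    apply/subsetP => z /set2P[] ->; rewrite inE ?xQ ?yQ andbT.
      exact: (subsetP (part_sites D true)).
    exact: (subsetP (part_sites D false)).
  have b2 : #|[set x; y]| = 2 by rewrite cards2 xy.
  have [cap2 hi] := @cap_arith2 t #|Q| _ _ _ #|[set x; y]| sQ (etrans eqn (addnC _ _)) low.
  have eqxy : sites D :&: all_sites Q = [set x; y].
    by apply/eqP; rewrite eq_sym eqEcard sxy b2.
  have capc : cross D :&: all_cross Q \subset [set (x, y)].
    apply/subsetP => -[x' y'] /setIP[h1 /all_crossP[x'Q y'Q]]; move: h1; rewrite in_setX => /andP[/= x'D y'D].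
    have : x' \in [set x; y] by rewrite -eqxy inE x'Q andbT; exact: (subsetP (part_sites _ _)) x'D.
    have : y' \in [set x; y] by rewrite -eqxy inE y'Q andbT; exact: (subsetP (part_sites _ _)) y'D.
    have nt z : z \in part D true -> z \in part D false -> False.
      by move=> z1; rewrite (disjointFr (part_disj D D) z1).
    case/set2P => ey; case/set2P => ex; rewrite inE.
    - by case: (nt x xD); rewrite -ey.
    - by case: (nt x xD); rewrite -ey.
    - by rewrite ex ey.
    - by case: (nt y _ yD); rewrite -ex.
  have PDQ : P (D |: Q).
    rewrite /P sub QD /=; apply/andP; split.
      rewrite -(leq_add2r #|sites D :&: all_sites Q|) eqn eqxy b2 addnC; move: sQ.
      by rewrite !mulnS; move: (2 * t * #|Q|) => z; clear; lia.
    have := cardsUI (cross D) (all_cross Q); rewrite -all_crossU1 card_cross => eqc.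
    have := subset_leq_card capc; rewrite cards1 mulSn => capc1.
    exact: cross_step eqc cQ capc1.
  by have := Qmax _ PDQ (subsetUr _ _) => e; move: DQ; rewrite -e setU11.
have nQ : #|Y :\: Q| = #|Y| - #|Q| by rewrite cardsD (setIidPr QY).
have lt : #|Q| < #|Y| by apply: proper_card; rewrite properEneq QnY.
have YQ : Y :\: Q \subset Y by exact: subsetDl.
have low := IH (Y :\: Q) _ (subset_trans YQ YZ) _.
have d : [disjoint all_cross Q & all_cross (Y :\: Q)].
  rewrite -setI_eq0; apply/set0Pn => -[z /setIP[zQ /bigcupP[D DYQ zD]]].
  have := no D; rewrite inE /= DYQ => /negbT/negP; apply; apply/set0Pn; exists z.
  by rewrite inE zD.
have eqY : all_cross Y = all_cross Q :|: all_cross (Y :\: Q).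
  by rewrite /all_cross -bigcup_setU -{1}(setIidPr QY) setID.
have cY : #|all_cross Y| = #|all_cross Q| + #|all_cross (Y :\: Q)|.
  by rewrite eqY; apply/eqP; rewrite leq_card_setU.
have sz : #|Q| + #|Y :\: Q| = #|Y| by rewrite nQ subnKC // ltnW.
rewrite -{1}sz mulnDl; apply: (cross_arith cQ _ cY) => //; apply: low.
  by apply: leq_trans Yk; rewrite nQ -{2}[#|Y|]subn0 ltn_sub2l // (leq_trans Q0) // ltnW.
by rewrite nQ subn_gt0 lt (leq_trans (leq_subr _ _)).
Qed.

(** Otherwise [D] shares no cross pair with the others, and [cross_lower] for these exceeds the
    bound in [clean]. *)
Lemma tight_meets (Z Y : {set diamond}) D : clean Z -> Y \subset Z -> 1 < #|Y| <= 7 ->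
  #|all_sites Y| = 2 * t * #|Y| + 2 -> D \in Y -> forall b, exists x D',
  [/\ D' \in Y, D' != D, x \in part D b & x \in part D' b].
Proof.
move=> cZ YZ /andP[Y1 Y7] tY DY b.
suff /set0Pn[[x y] /setIP[xyD /bigcupP[D' /setD1P[D'D D'Y] xyD']]] : cross D :&: all_cross (Y :\ D) != set0.
  move: xyD xyD'; rewrite !in_setX => /andP[/= xD yD] /andP[/= xD' yD'].
  by case: b; [exists x | exists y]; exists D'.
apply/negP => /eqP c0.
have cYD : #|Y| = #|Y :\ D|.+1 by rewrite (cardsD1 D) DY.
have sYD : Y :\ D \subset Z by rewrite (subset_trans (subsetDl _ _)).
have := cross_lower cZ sYD; rewrite -ltnS -cYD Y1 -[X in _ && X]ltnS -cYD (ltnW _) ?ltnS // => /(_ isT) low.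
have [_ /(_ tY)] := cZ Y YZ ltac:(by rewrite Y1).
have := cardsUI (cross D) (all_cross (Y :\ D)); rewrite c0 cards0 addn0 -all_crossU1 setD1K // card_cross => ->.
by move: low; rewrite cYD mulSn; move: (#|Y :\ D| * (t * (t + 2))) (t * (t + 2)) => a c; clear; lia.
Qed.

Definition vertex := (site + diamond * bool)%type.
(** Both halves of a diamond are completed by the same two private vertices, which form the pair the
    two edges share. *)
Definition edge (Db : diamond * bool) : {set vertex} :=
  inl @: part Db.1 Db.2 :|: [set inr (Db.1, b) | b : bool].

Lemma in_edge_r D b x : (inr x \in edge (D, b)) = (x.1 == D).
Proof.
rewrite inE /=; case: imsetP => [[y _ //]|_] /=; apply/imsetP/eqP => [[c _ [->]] //|h].
by exists x.2 => //; rewrite -h -surjective_pairing.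
Qed.

Lemma in_edge_l D b x : (inl x \in edge (D, b)) = (x \in part D b).
Proof.
rewrite inE /= mem_imset => [|y z []//]; case: (boolP (x \in _)) => //= _.
by apply/imsetP => -[].
Qed.

Lemma edge_inj : injective edge.
Proof.
move=> [D b] [D' b'] /setP h.
have e1 : D = D' by have := h (inr (D, true)); rewrite !in_edge_r eqxx => /esym/eqP.
congr pair => //; have i0 : 'I_t.+1 := ord0.
have xD : ((b, i0), D.1 (b, i0)) \in part D b by apply/imsetP; exists i0.
by have := h (inl ((b, i0), D.1 (b, i0))); rewrite !in_edge_l xD => /esym/part_side.
Qed.

Lemma card_edge Db : #|edge Db| = t.+1 + 2.
Proof.
case: Db => D b; rewrite /edge cardsU (_ : _ :&: _ = set0) ?cards0 ?subn0.
  rewrite card_imset ?card_part => [|x y [] //]; congr (_ + _).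
  by rewrite card_imset ?card_bool // => x y [].
by apply/setP => x; rewrite !inE; apply/andP => -[/imsetP[y _ ->] /imsetP[]].
Qed.

Section Config.
Variables (Z : {set diamond}) (Q : {set diamond * bool}).
Hypotheses (cZ : clean Z) (QZ : forall Db, Db \in Q -> Db.1 \in Z).
Let Y := fst @: Q.
Let P := \bigcup_(Db in Q) part Db.1 Db.2.

Lemma card_cover_edges : #|cover (edge @: Q)| = 2 * #|Y| + #|P|.
Proof.
have -> : cover (edge @: Q) = inl @: P :|: inr @: setX Y setT.
  apply/setP => -[x|[D b]]; rewrite in_setU.
    rewrite mem_imset => [|a c []//]; rewrite (_ : inl x \in inr @: _ = false) ?orbF; last by apply/imsetP => -[].
    apply/bigcupP/bigcupP => [[_ /imsetP[[D b] DQ ->]]|[[D b] DQ xD]].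
      by rewrite in_edge_l; exists (D, b).
    by exists (edge (D, b)); rewrite ?imset_f // in_edge_l.
  rewrite (_ : inr (D, b) \in inl @: _ = false) /=; last by apply/imsetP => -[].
  rewrite mem_imset => [|a c []//]; rewrite in_setX inE andbT /=.
  apply/bigcupP/imsetP => [[_ /imsetP[[D' b'] DQ ->]]|[[D' b'] DQ /= ->]].
    by rewrite in_edge_r /= => /eqP ->; exists (D', b').
  by exists (edge (D', b')); rewrite ?imset_f // in_edge_r.
rewrite cardsU (_ : _ :&: _ = set0) ?cards0 ?subn0.
  have i1 : injective (@inl site (diamond * bool)) by move=> x y [].
  have i2 : injective (@inr site (diamond * bool)) by move=> x y [].
  rewrite (card_imset _ i1) (card_imset _ i2) cardsX cardsT card_bool.
  by rewrite addnC mulnC.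
by apply/setP => x; rewrite !inE; apply/andP => -[/imsetP[y _ ->] /imsetP[]].
Qed.

Let full : {set diamond * bool} := setX Y setT.
Let miss := full :\: Q.

Let card_miss : #|miss| + #|Q| = 2 * #|Y|.
Proof.
have QF : Q \subset full.
  by apply/subsetP => -[D b] DQ; rewrite in_setX inE andbT; exact: (imset_f fst DQ).
by rewrite addnC mulnC -[2]card_bool -cardsT -cardsX -(cardsID Q full) (setIidPr QF).
Qed.

Let Y0 : 0 < #|Q| -> 0 < #|Y|.
Proof. by case/card_gt0P => Db DQ; apply/card_gt0P; exists Db.1; exact: imset_f. Qed.

Let Y_le : #|Y| <= #|Q|. Proof. exact: leq_imset_card. Qed.
Let YZ : Y \subset Z. Proof. by apply/subsetP => _ /imsetP[Db /QZ ? ->]. Qed.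

Let sitesE x : x \in all_sites Y -> exists Db, Db \in full /\ x \in part Db.1 Db.2.
Proof.
case/bigcupP => D DY /setUP[xD|xD]; [exists (D, true) | exists (D, false)]; by rewrite in_setX DY inE.
Qed.

(** All sites of the diamonds involved are covered, except at most t + 1 for each missing half. *)
Lemma config_ge : 0 < #|Q| <= 7 -> t.+1 * #|Q| + 2 <= #|cover (edge @: Q)|.
Proof.
case/andP => Q0 Q7; rewrite card_cover_edges -[2]/(2 + 0); apply: (half_arith card_miss (W := #|all_sites Y|)).
  rewrite addn0; apply: leq_trans (_ : #|P :|: \bigcup_(Db in miss) part Db.1 Db.2| <= _).
    apply/subset_leq_card/subsetP => x /sitesE[Db [Df xD]]; rewrite inE.
    case: (boolP (Db \in Q)) => DQ; apply/orP; [left|right]; apply/bigcupP; exists Db => //.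
    by rewrite inE DQ.
  apply: leq_trans (leq_card_setU _ _) _; rewrite leq_add2l mulnC -sum_nat_const.
  by apply: leq_trans (card_bigcup_le _ _) _; apply: leq_sum => Db _; rewrite card_part.
by apply: (clean_sites cZ YZ); rewrite Y0 // (leq_trans Y_le).
Qed.

(** If the sites exceed their minimum, there is a vertex to spare. If not, a missing half contains a
    site of another diamond by [tight_meets], so one loss is counted too often. *)
Lemma config_half : 1 < #|Y| -> #|Q| <= 7 -> #|Q| < 2 * #|Y| -> t.+1 * #|Q| + 3 <= #|cover (edge @: Q)|.
Proof.
move=> Y1 Q7 half; rewrite card_cover_edges.
have Y7 : 1 < #|Y| <= 7 by rewrite Y1 (leq_trans Y_le).
have [m mM] : exists m, m \in miss.
  by apply/card_gt0P; rewrite -(ltn_add2r #|Q|) card_miss.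
have [low _] := cZ YZ Y7.
have up : #|all_sites Y| <= #|P| + t.+1 * #|miss|.
  apply: leq_trans (_ : #|P :|: \bigcup_(Db in miss) part Db.1 Db.2| <= _).
    apply/subset_leq_card/subsetP => x /sitesE[Db [Df xD]]; rewrite inE.
    case: (boolP (Db \in Q)) => DQ; apply/orP; [left|right]; apply/bigcupP; exists Db => //.
    by rewrite inE DQ.
  apply: leq_trans (leq_card_setU _ _) _; rewrite leq_add2l mulnC -sum_nat_const.
  by apply: leq_trans (card_bigcup_le _ _) _; apply: leq_sum => Db _; rewrite card_part.
case: (eqVneq #|all_sites Y| (2 * t * #|Y| + 2)) => [tY|ne]; last first.
  have lt : 2 * t * #|Y| + 2 <= #|all_sites Y| - 1.
    exact: sub1_arith low ne.
  have := @half_arith t #|Y| #|miss| #|Q| #|P| _ 1 card_miss _ lt; apply.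
  by rewrite subnK // (leq_trans _ low) // addn2.
move: mM; case: m => D b mM; have /setDP[mf mQ] := mM; move: (mf); rewrite in_setX => /andP[/= DY _].
have [x [D' [D'Y D'D xD xD']]] := tight_meets cZ YZ Y7 tY DY b.
have := @half_arith t #|Y| #|miss| #|Q| #|P| #|all_sites Y| 1 card_miss _ low; apply.
pose rest := miss :\ (D, b).
have cm : #|miss| = #|rest|.+1 by rewrite (cardsD1 (D, b)) mM.
apply: leq_trans (_ : #|P :|: ((part D b :\ x) :|: \bigcup_(Db in rest) part Db.1 Db.2)| + 1 <= _).
  rewrite leq_add2r; apply/subset_leq_card/subsetP => z /sitesE[Db [Df zD]]; rewrite in_setU in_setU.
  case: (boolP (Db \in Q)) => DQ; first by apply/orP; left; apply/bigcupP; exists Db.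
  case: (eqVneq Db (D, b)) => [e|ne]; last first.
    apply/orP; right; apply/orP; right; apply/bigcupP; exists Db => //.
    by rewrite in_setD1 ne inE DQ.
  rewrite e /= in zD; case: (eqVneq z x) => [->|zx]; last by rewrite in_setD1 zx zD orbT.
  case: (boolP ((D', b) \in Q)) => D'Q; first by apply/orP; left; apply/bigcupP; exists (D', b).
  apply/orP; right; apply/orP; right; apply/bigcupP; exists (D', b) => //.
  by rewrite in_setD1 inE D'Q in_setX D'Y inE xpair_eqE (negPf D'D).
apply: leq_trans (leq_add (leq_trans (leq_card_setU _ _) (leq_add (leqnn _) (leq_card_setU _ _))) (leqnn 1)) _.
have c1 : #|part D b :\ x| = t by have := card_part D b; rewrite (cardsD1 x) xD => -[].
have c2 : #|\bigcup_(Db in rest) part Db.1 Db.2| <= #|rest| * t.+1.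
  rewrite -sum_nat_const; apply: leq_trans (card_bigcup_le _ _) _.
  by apply: leq_sum => Db _; rewrite card_part.
rewrite c1 cm mulnC mulSn -!addnA leq_add2l [_ + 1]addnC addnA addn1 leq_add2l //.
Qed.

End Config.

End Diamonds.

End Diamonds.

(** * The fixed gadget and its set of pairs *)

Module Gadgets.
Import SparsePacking Clusters ClusterStructure Diamonds.
(** [gadget_seven] serves seven edges inside one copy. Otherwise each copy holds at most six of
    them, and of any two copies one holds at most three. *)
Record gadget (s : nat) (V : finType) (EF J : {set {set V}}) : Prop := Gadget {
  gadget_V : 2 < #|V|;
  gadget_uniform : forall e, e \in EF -> #|e| = s + 2;
  gadget_J2 : forall p, p \in J -> #|p| = 2;
  gadget_pairs : pairs_in EF \subset J;
  gadget_ge : forall Q : {set {set V}}, Q \subset EF -> 0 < #|Q| <= 6 -> s * #|Q| + 2 <= #|cover Q|;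
  gadget_seven : forall Q : {set {set V}}, Q \subset EF -> #|Q| = 7 -> s * 7 + 3 <= #|cover Q|;
  gadget_three : forall (Q : {set {set V}}) (p : {set V}), Q \subset EF -> 0 < #|Q| <= 3 -> #|p| = 2 ->
    p \subset cover Q -> p \notin J -> s * #|Q| + 3 <= #|cover Q|
}.

Lemma two_half y e : e <= 3 -> 1 < y -> e < 2 * y.
Proof. lia. Qed.

Lemma seven_half y e : e = 7 -> e <= 2 * y -> 1 < y /\ e < 2 * y.
Proof. lia. Qed.

Section Build.
Variables (t N M : nat).
Notation diamond := (diamond t N M).
Notation site := (site t N).
Variables (Z : {set diamond}) (K : {set site * site}).
Hypothesis Z0 : 0 < #|Z|.
Hypothesis cZ : clean Z.
Hypothesis K_side : forall xy, xy \in K -> xy.1.1.1 && ~~ xy.2.1.1.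
Hypothesis KZ : forall D, D \in Z -> cross D \subset K.

Definition gadget_edges : {set {set vertex t N M}} := (@edge t N M) @: setX Z setT.
Definition cross_pair (xy : site * site) : {set vertex t N M} := [set inl xy.1; inl xy.2].
Definition gadget_J : {set {set vertex t N M}} := pairs_in gadget_edges :|: cross_pair @: K.

Lemma card_cross_pair xy : xy \in K -> #|cross_pair xy| = 2.
Proof.
move=> /K_side /andP[h1 h2]; rewrite cards2 (_ : _ != _ = true) //; apply/eqP => -[e].
by move: h1 h2; rewrite e => ->.
Qed.

Lemma card_gadget_edges : #|gadget_edges| = 2 * #|Z|.
Proof. by rewrite card_imset ?cardsX ?cardsT ?card_bool 1?mulnC //; exact: edge_inj. Qed.

Lemma pairs_diamond (D : diamond) : #|pairs_in [set edge (D, true); edge (D, false)]| <= 2 * 'C(t.+1 + 2, 2) - 1.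
Proof.
have sub : pairs_in [set edge (D, true); edge (D, false)] \subset pairs_in [set edge (D, true)] :|: pairs_in [set edge (D, false)].
  apply/subsetP => p /pairs_inP[p2 [e /set2P[] -> pe]]; rewrite inE; apply/orP; [left|right]; apply/pairs_inP; split=> //.
    by exists (edge (D, true)); rewrite ?inE.
  by exists (edge (D, false)); rewrite ?inE.
apply: leq_trans (subset_leq_card sub) _; rewrite cardsU.
have c b : #|pairs_in [set edge (D, b)]| = 'C(t.+1 + 2, 2).
  by apply: (@card_pairs_in1 _ t.+1 [set edge (D, b)]); rewrite ?inE // => e /set1P ->; exact: card_edge.
rewrite !c addnn -mul2n leq_sub2l // card_gt0; apply/set0Pn.
pose p : {set vertex t N M} := [set inr (D, true); inr (D, false)]; exists p.
have ne : inr (D, true) != inr (D, false) :> vertex t N M by apply/eqP => -[].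
have p2 : #|p| = 2 by rewrite cards2 ne.
have pe b : p \subset edge (D, b) by apply/subsetP => x /set2P[] ->; rewrite in_edge_r.
by rewrite inE; apply/andP; split; apply/pairs_inP; split=> //; [exists (edge (D, true))|exists (edge (D, false))]; rewrite ?inE.
Qed.

Lemma card_gadget_J : #|gadget_J| <= #|Z| * (2 * 'C(t.+1 + 2, 2) - 1) + #|K|.
Proof.
apply: leq_trans (leq_card_setU _ _) _; apply: leq_add; last exact: leq_imset_card.
apply: leq_trans (_ : #|\bigcup_(D in Z) pairs_in [set edge (D, true); edge (D, false)]| <= _).
  apply/subset_leq_card/subsetP => p /pairs_inP[p2 [_ /imsetP[[D b] /setXP[/= DZ _] ->] pe]].
  apply/bigcupP; exists D => //; apply/pairs_inP; split=> //; exists (edge (D, b)) => //.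
  by case: b {pe}; rewrite !inE eqxx ?orbT.
apply: leq_trans (card_bigcup_le _ _) _; rewrite -sum_nat_const.
by apply: leq_sum => D _; exact: pairs_diamond.
Qed.

Section Sub.
Variable Q : {set {set vertex t N M}}.
Hypothesis QE : Q \subset gadget_edges.
Let Qi := (@edge t N M) @^-1: Q.

Let Q_E : Q = (@edge t N M) @: Qi.
Proof.
apply/setP => e; apply/idP/imsetP => [eQ|[Db + ->]]; last by rewrite inE.
by have /imsetP[Db _ eE] := subsetP QE e eQ; exists Db; rewrite // inE -eE.
Qed.

Let cE : cover Q = cover ((@edge t N M) @: Qi). Proof. by rewrite -Q_E. Qed.

Let cQ : #|Q| = #|Qi|.
Proof. by rewrite Q_E card_imset //; exact: edge_inj. Qed.

Let QiZ Db : Db \in Qi -> Db.1 \in Z.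
Proof.
rewrite inE => /(subsetP QE)/imsetP[[D b] /setXP[/= DZ _] /edge_inj ->] //.
Qed.

Let Qi_le : #|Qi| <= 2 * #|fst @: Qi|.
Proof.
rewrite mulnC -[2]card_bool -cardsT -cardsX; apply/subset_leq_card/subsetP => -[D b] h.
by rewrite in_setX inE andbT; exact: (imset_f fst h).
Qed.

Lemma sub_ge : 0 < #|Q| <= 7 -> t.+1 * #|Q| + 2 <= #|cover Q|.
Proof. by rewrite cQ cE => h; exact: (config_ge cZ QiZ h). Qed.

Lemma sub_seven : #|Q| = 7 -> t.+1 * 7 + 3 <= #|cover Q|.
Proof.
rewrite cQ => c7; have [h1 h2] := seven_half c7 Qi_le.
by have := config_half cZ QiZ h1 _ h2; rewrite c7 -cE; apply.
Qed.

(** If two diamonds are involved, three edges leave a half out and [config_half] applies. Within a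
    single diamond, a pair spanned but not covered is a cross pair, hence in [J]. *)
Lemma sub_three (p : {set vertex t N M}) : 0 < #|Q| <= 3 -> #|p| = 2 -> p \subset cover Q -> p \notin gadget_J ->
  t.+1 * #|Q| + 3 <= #|cover Q|.
Proof.
case/andP => Q0 Q3 p2 pQ pJ.
case: (ltnP 1 #|fst @: Qi|) => [y1|y1].
  rewrite cQ cE; apply: (config_half cZ QiZ) => //; first by rewrite -cQ (leq_trans Q3).
  by apply: two_half => //; rewrite -cQ.
exfalso; move/negP: pJ; apply.
have [e0 e0Q] : exists e, e \in Q by apply/card_gt0P.
have /imsetP[[D b0] Db0 _] : e0 \in (@edge t N M) @: Qi by rewrite -Q_E.
have fD Db : Db \in Qi -> Db.1 = D.
  have /eqP/cards1P[D' hD] : #|fst @: Qi| = 1.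
    by apply/eqP; rewrite eqn_leq y1; apply/card_gt0P; exists D; exact: (imset_f fst Db0).
  have := imset_f fst Db0; rewrite hD => /set1P /= -> /(imset_f fst).
  by rewrite hD => /set1P.
have eD e : e \in Q -> exists2 b, e = edge (D, b) & edge (D, b) \in gadget_edges.
  move=> eQ; move: (eQ); rewrite Q_E => /imsetP[[D' b] h eE]; have /= <- := fD _ h.
  by exists b => //; rewrite -eE (subsetP QE).
have DZ : D \in Z := QiZ Db0.
have eEF b : edge (D, b) \in gadget_edges by apply: imset_f; rewrite in_setX DZ inE.
rewrite inE; case: (boolP (p \in pairs_in _)) => //= pn.
have np b : ~~ (p \subset edge (D, b)).
  by apply: contra pn => pb; apply/pairs_inP; split=> //; exists (edge (D, b)); rewrite ?eEF.
have pt x : x \in p -> exists b, x \in edge (D, b).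
  by move=> xp; have /bigcupP[e /eD[b -> _] xe] := subsetP pQ x xp; exists b.
have pick b : exists2 x, inl x \in p & x \in part D b /\ inl x \notin edge (D, ~~ b).
  have /subsetPn[v vp vn] := np (~~ b); have [c vc] := pt v vp.
  have cb : c = b by move: vc vn; case: c; case: b => // ->.
  rewrite cb in vc; case: v vp vn vc => [x|y] vp vn vc; last by rewrite !in_edge_r in vc vn; rewrite vc in vn.
  by exists x => //; split=> //; rewrite in_edge_l in vc.
have [x xp [xD _]] := pick true; have [y yp [yD _]] := pick false.
apply/imsetP; exists (x, y); first by apply: (subsetP (KZ DZ)); rewrite in_setX xD yD.
have xy : inl x != inl y :> vertex t N M.
  by apply/eqP => -[e]; have := part_side xD; rewrite e (part_side yD).
apply/eqP; rewrite eq_sym eqEcard p2 cards2 xy andbT.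
by apply/subsetP => z /set2P[] ->.
Qed.

End Sub.

Lemma gadgetP : gadget t.+1 gadget_edges gadget_J.
Proof.
split.
- have [D _] : exists D, D \in Z by apply/card_gt0P.
  by apply: leq_trans (max_card (edge (D, true))); rewrite card_edge addn2.
- by move=> _ /imsetP[Db _ ->]; exact: card_edge.
- by move=> p /setUP[/pairs_inP[]//|/imsetP[xy h ->]]; exact: card_cross_pair.
- exact: subsetUl.
- by move=> Q QE /andP[Q0 Q6]; apply: sub_ge; rewrite // Q0 ltnW.
- exact: sub_seven.
- by move=> Q p QE; exact: (sub_three QE).
Qed.

End Build.

End Gadgets.

(** * A random gadget of the right density *)

Module RandomDiamonds.
Import RandomProcess Counting SparsePacking PackingExistence Clusters ClusterStructure Diamonds Gadgets.
Import Order.TTheory GRing.Theory Num.Theory.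

Lemma mul_rot4 a b c d : a * (b * c) * d = a * b * d * c.
Proof. by rewrite mulnA mulnAC. Qed.

Section Count.
Variables (t N M : nat).
Notation diamond := (diamond t N M).
Notation site := (site t N).
Hypothesis N0 : 0 < N.

Lemma card_diamond : #|{: diamond}| = N ^ (2 * t.+1) * M.
Proof. by rewrite card_prod card_ffun card_prod card_bool !card_ord. Qed.

Lemma card_diamonds j k : #|[set Y : {set diamond} | (#|Y| == j) && (#|all_sites Y| <= k)]| <=
  k ^ (j * (2 * t.+1)) * (2 * t.+1 * N) ^ k * M ^ j.
Proof.
pose A := ('I_j * (bool * 'I_t.+1))%type.
pose S := setX [set h : {ffun A -> site} | #|(h @: setT) :\: set0| <= k] [set: {ffun 'I_j -> 'I_M}].
pose dec (hc : {ffun A -> site} * {ffun 'I_j -> 'I_M}) : {set diamond} :=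
  [set ([ffun x => (hc.1 (i, x)).2], hc.2 i) | i : 'I_j].
apply: leq_trans (_ : #|S| <= _); last first.
  rewrite cardsX cardsT card_ffun !card_ord leq_mul2r; apply/orP; right.
  have := @card_small_image A site set0 k ((true, ord0), Ordinal N0).
  by rewrite cards0 !card_prod card_bool !card_ord.
apply: leq_trans (leq_imset_card dec _); apply/subset_leq_card/subsetP => Y.
rewrite inE => /andP[/eqP cY Yk].
pose e (i : 'I_j) : diamond := enum_val (cast_ord (esym cY) i).
pose h : {ffun A -> site} := [ffun ix : A => (ix.2, (e ix.1).1 ix.2)].
pose c : {ffun 'I_j -> 'I_M} := [ffun i => (e i).2].
apply/imsetP; exists (h, c).
  rewrite in_setX !inE andbT setD0; apply: leq_trans Yk; apply/subset_leq_card/subsetP => x.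
  case/imsetP => -[i [b k']] _ ->; rewrite ffunE /=; apply/bigcupP; exists (e i); first exact: enum_valP.
  by apply: (subsetP (part_sites _ b)); apply/imsetP; exists k'.
have decE i : ([ffun x => (h (i, x)).2], c i) = e i.
  rewrite [RHS]surjective_pairing ffunE; congr pair; apply/ffunP => x; by rewrite !ffunE.
apply/setP => D; apply/idP/imsetP => [DY|[i _ ->]]; last by rewrite decE enum_valP.
exists (cast_ord cY (enum_rank_in DY D)) => //.
by rewrite decE /e cast_ordK enum_rankK_in.
Qed.

Definition violation (Y : {set diamond}) : bool := [&& 1 < #|Y|, #|Y| <= 7 &
  (#|all_sites Y| <= 2 * t * #|Y| + 1) ||
  (#|all_sites Y| <= 2 * t * #|Y| + 2) && (#|Y| * (t * (t + 2)) + 2 <= #|all_cross Y|)].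

Lemma clean_of (Z : {set diamond}) : (forall Y, violation Y -> ~~ (Y \subset Z)) -> clean Z.
Proof.
move=> h Y YZ /andP[Y1 Y7]; have nv : ~~ violation Y by apply/negP => /h; rewrite YZ.
move: nv; rewrite /violation Y1 Y7 /= negb_or => /andP[]; rewrite -ltnNge addn1 => low.
rewrite negb_and -!ltnNge => hi; split; first by rewrite addn2.
by move=> e; move: hi; rewrite e ltnn /= addn2 addn1 ltnS.
Qed.

End Count.

(* The exponent of [q] in [N] makes [N * q ^ (j * t * (t + 2)) <= N ^ 2 / q ^ 2] for [j <= 7]. *)
Section Random.
Local Open Scope ring_scope.
Variables (R : realType) (t q M : nat).
Let N := (q ^ (7 * (t * (t + 2)) + 2))%N.
Notation diamond := (diamond t N M).
Notation site := (site t N).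
Hypothesis q1 : (1 < q)%N.
Let q0 : (0 : R) < q%:R. Proof. by rewrite ltr0n ltnW. Qed.
Let N0 : (0 < N)%N. Proof. by rewrite expn_gt0 ltnW. Qed.
Let N0R : (0 : R) < N%:R. Proof. by rewrite ltr0n. Qed.
Let a := (t * (t + 2))%N.
(** Normalised so that M N^2/q diamonds are active on average, that is, M for each kept cross
    pair. *)
Let rho : R := q%:R ^+ a / N%:R ^+ (2 * t).
Let pr (x : site * site + diamond) : R := if x is inl _ then q%:R^-1 else rho.

Let rho_ge0 : 0 <= rho. Proof. by rewrite divr_ge0 // exprn_ge0 // ler0n. Qed.
Let rho_le1 : rho <= 1.
Proof.
rewrite ler_pdivrMr ?exprn_gt0 // mul1r -!natrX ler_nat -expnM leq_pexp2l ?(ltnW q1) //.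
case: t @a => [|u] /=; first by rewrite mul0n.
by rewrite mulnDl; nia.
Qed.
Let pr01 x : 0 <= pr x <= 1.
Proof.
case: x => [x|D] /=; last by rewrite rho_ge0.
by rewrite invr_ge0 ltW //= invf_le1 // ler1n ltnW.
Qed.

Definition needs (D : diamond) : {set site * site + diamond} := inl @: cross D :|: [set inr D].
Definition active (w : {set site * site + diamond}) : {set diamond} := [set D | needs D \subset w].
Definition kept (w : {set site * site + diamond}) : {set site * site} :=
  [set xy : site * site | xy.1.1.1 && ~~ xy.2.1.1 & inl xy \in w].

Lemma wt_count (X : finType) (P : pred X) (rq : X -> {set site * site + diamond}) :
  \sum_w wt pr w * #|[set x | P x & rq x \subset w]|%:R = \sum_(x | P x) \prod_(i in rq x) pr i.
Proof.
transitivity (\sum_w \sum_(x | P x) wt pr w * ((rq x \subset w) && [disjoint set0 & w])%:R).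
  apply: eq_bigr => w _; rewrite -mulr_sumr; congr (_ * _).
  rewrite -sum1_card natr_sum [LHS]big_mkcond [RHS]big_mkcond; apply: eq_bigr => x _.
  by rewrite inE -setI_eq0 set0I eqxx andbT; case: (P x) => //=; case: (_ \subset _).
rewrite exchange_big /=; apply: eq_bigr => x _; rewrite wt_ind ?big_set0 ?mulr1 //.
by rewrite -setI_eq0 setI0.
Qed.

Lemma prod_family (C : {set site * site}) (Y : {set diamond}) :
  \prod_(i in inl @: C :|: inr @: Y) pr i = (q%:R^-1) ^+ #|C| * rho ^+ #|Y|.
Proof.
have i1 : injective (@inl (site * site) diamond) by move=> x y [].
have i2 : injective (@inr (site * site) diamond) by move=> x y [].
rewrite (eq_bigl [predU inl @: C & inr @: Y]); last by move=> x; rewrite !inE.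
rewrite bigU /=; last first.
  by rewrite -setI_eq0; apply/set0Pn => -[x /setIP[/imsetP[y _ ->] /imsetP[]]].
by rewrite !big_imset /= ?prodr_const // => x y _ _; [apply: i2|apply: i1].
Qed.

Lemma active_sub (Y : {set diamond}) (w : {set site * site + diamond}) : (Y \subset active w) = (inl @: all_cross Y :|: inr @: Y \subset w).
Proof.
apply/subsetP/subsetP => h.
  move=> x /setUP[/imsetP[xy /bigcupP[D DY xyD] ->]|/imsetP[D DY ->]].
    by have := h D DY; rewrite inE => /subsetP; apply; rewrite inE imset_f.
  by have := h D DY; rewrite inE => /subsetP; apply; rewrite !inE eqxx orbT.
move=> D DY; rewrite inE; apply/subsetP => x /setUP[/imsetP[xy xyD ->]|/set1P ->]; apply: h.
  by rewrite inE imset_f //; apply/bigcupP; exists D.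
by rewrite inE [X in _ || X]imset_f ?orbT.
Qed.

Definition viol_const : R := (2 * ((2 * t * 7 + 2) ^ (7 * (2 * t.+1)) * (2 * t.+1) ^ (2 * t * 7 + 2) * M.+1 ^ 7))%:R.

(** A missing site gains a factor N, which exceeds the factor q^(aj) left over by [rho]; an excess
    of cross pairs gains q^-2. Either way the bound is a factor q below the number of diamonds. *)
Lemma viol_weight_j j : (1 < j <= 7)%N ->
  \sum_(Y : {set diamond} | violation Y && (#|Y| == j)) (q%:R^-1) ^+ #|all_cross Y| * rho ^+ #|Y| <=
  viol_const * (N%:R ^+ 2 / q%:R ^+ 2).
Proof.
case/andP => j1 j7.
have qi0 : 0 <= q%:R^-1 :> R by rewrite invr_ge0 ltW.
have qi1 : q%:R^-1 <= 1 :> R by rewrite invf_le1 // ler1n ltnW.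
pose S k := [set Y : {set diamond} | (#|Y| == j) && (#|all_sites Y| <= 2 * t * j + k)%N].
pose W : R := N%:R ^+ 2 / q%:R ^+ 2.
have W0 : 0 <= W by rewrite divr_ge0 // exprn_ge0 // ltW.
pose c0 := ((2 * t * 7 + 2) ^ (7 * (2 * t.+1)) * (2 * t.+1) ^ (2 * t * 7 + 2) * M.+1 ^ 7)%N.
have cS k : (k <= 2)%N -> (#|S k| <= c0 * N ^ (2 * t * j + k))%N.
  move=> k2; apply: leq_trans (card_diamonds t M N0 j (2 * t * j + k)) _.
  rewrite expnMn mul_rot4 /c0 leq_mul2r; apply/orP; right.
  have kk : (2 * t * j + k <= 2 * t * 7 + 2)%N by rewrite leq_add // leq_mul2l j7 orbT.
  apply: leq_mul; first apply: leq_mul.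
  - apply: leq_trans (leq_exp2rW _ kk) _; rewrite leq_pexp2l ?addn2 //.
    by rewrite leq_mul2r j7 orbT.
  - by rewrite leq_pexp2l.
  - by apply: leq_trans (leq_exp2rW j (leqnSn M)) _; rewrite leq_pexp2l.
have rj : rho ^+ j * N%:R ^+ (2 * t * j) = q%:R ^+ (a * j).
  by rewrite /rho expr_div_n -!exprM divfK // expf_neq0 // gt_eqF.
have h1 : \sum_(Y in S 1%N) rho ^+ j <= c0%:R * W.
  rewrite sumr_const -[X in X <= _]mulr_natl.
  apply: le_trans (ler_wpM2r (exprn_ge0 j rho_ge0) (_ : _ <= (c0 * N ^ (2 * t * j + 1))%:R)) _.
    by rewrite ler_nat cS.
  rewrite natrM -mulrA ler_wpM2l ?ler0n // natrX exprD mulrC mulrA rj expr1.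
  rewrite /W ler_pdivlMr ?exprn_gt0 // mulrAC -exprD [N%:R ^+ 2]expr2 ler_wpM2r ?(ltW N0R) //.
  rewrite -natrX ler_nat /N leq_pexp2l ?(ltnW q1) // leq_add2r mulnC leq_mul2r j7 orbT //.
have h2 : \sum_(Y in S 2%N) rho ^+ j * (q%:R^-1) ^+ (j * a + 2) <= c0%:R * W.
  rewrite sumr_const -[X in X <= _]mulr_natl.
  have r0 : 0 <= rho ^+ j * q%:R^-1 ^+ (j * a + 2) by rewrite mulr_ge0 ?exprn_ge0.
  apply: le_trans (ler_wpM2r r0 (_ : _ <= (c0 * N ^ (2 * t * j + 2))%:R)) _.
    by rewrite ler_nat cS.
  rewrite natrM -mulrA ler_wpM2l ?ler0n // natrX exprD mulrA [_ * rho ^+ j]mulrC mulrA rj.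
  by rewrite [(j * a)%N]mulnC exprD !exprVn mulrACA mulfV ?expf_neq0 ?gt_eqF // mul1r.
apply: le_trans (_ : c0%:R * W + c0%:R * W <= _); last first.
  have -> : viol_const = 2 * c0%:R by rewrite /viol_const natrM.
  by rewrite -/W -mulrA [2 * (_ * _)]mulr_natl mulr2n.
apply: le_trans (lerD h1 h2).
rewrite [X in X <= _]big_mkcond [X in _ <= X + _]big_mkcond [X in _ <= _ + X]big_mkcond -big_split /=.
apply: ler_sum => Y _; rewrite !inE.
case: (boolP (_ && _)) => [/andP[/and3P[_ _ v] /eqP Yj]|_]; last first.
  by apply: addr_ge0; case: ifP => // _; rewrite ?mulr_ge0 ?exprn_ge0.
rewrite Yj eqxx /=; rewrite Yj in v; case/orP: v => [v|/andP[v c]].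
  rewrite v; apply: le_trans (_ : rho ^+ j + 0 <= _).
    by rewrite addr0 ler_piMl ?exprn_ge0 // exprn_ile1.
  by rewrite lerD2l; case: ifP => // _; rewrite mulr_ge0 ?exprn_ge0.
rewrite v -[X in X <= _]add0r; apply: lerD; first by case: ifP => // _; rewrite exprn_ge0.
by rewrite mulrC ler_wpM2l ?exprn_ge0 // ler_wiXn2l.
Qed.

(** First moment of diamonds minus violations minus [lam] times kept pairs, then alteration; the
    weight [lam] lets a single outcome control both sizes. *)
Lemma exists_good (lam : R) : 0 <= lam -> exists (Z : {set diamond}) (K : {set site * site}),
  [/\ clean Z, (forall xy, xy \in K -> xy.1.1.1 && ~~ xy.2.1.1), (forall D, D \in Z -> cross D \subset K) &
   N%:R ^+ 2 / q%:R * (M%:R - lam * (t.+1 ^ 2)%:R - 8 * viol_const / q%:R) <= #|Z|%:R - lam * #|K|%:R].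
Proof.
move=> lam0.
pose v (w : {set site * site + diamond}) : R := #|[set D : diamond | true & needs D \subset w]|%:R -
  #|[set Y : {set diamond} | violation Y & inl @: all_cross Y :|: inr @: Y \subset w]|%:R -
  lam * #|[set xy : site * site | (xy.1.1.1 && ~~ xy.2.1.1) & ([set inl xy] : {set site * site + diamond}) \subset w]|%:R.
have EA : \sum_(D : diamond | true) \prod_(i in needs D) pr i = M%:R * (N%:R ^+ 2 / q%:R).
  rewrite (eq_bigr (fun=> (q%:R^-1) ^+ a.+1 * rho)) => [|D _]; last first.
    have := prod_family (cross D) [set D]; rewrite imset_set1 card_cross cards1 expr1 -/a addn1 => <-.
    by [].
  rewrite sumr_const -[X in X = _]mulr_natl card_diamond natrM natrX /rho.
  have -> : (2 * t.+1 = 2 * t + 2)%N by rewrite mulnS addnC.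
  rewrite exprD [q%:R^-1 ^+ _]exprS exprVn; field.
  by rewrite !expf_neq0 ?gt_eqF.
have EK : \sum_(xy : site * site | xy.1.1.1 && ~~ xy.2.1.1) \prod_(i in [set inl xy]) pr i = (t.+1 ^ 2)%:R * (N%:R ^+ 2 / q%:R).
  rewrite (eq_bigr (fun=> q%:R^-1)) => [|xy _]; last by rewrite big_set1.
  rewrite sumr_const -[X in X = _]mulr_natl mulrA; congr (_ / _).
  pose B b : {set site} := [set x | x.1.1 == b].
  have cB b : #|B b| = (t.+1 * N)%N.
    pose h (iy : 'I_t.+1 * 'I_N) : site := ((b, iy.1), iy.2).
    have -> : B b = h @: setT.
      apply/setP => -[[b' i] y]; rewrite inE /=; apply/eqP/imsetP => [->|[[i' y'] _ [-> _ _]] //].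
      by exists (i, y).
    by rewrite card_imset ?cardsT ?card_prod ?card_ord // => -[x y] [x' y'] [-> ->].
  rewrite (_ : #|_| = #|setX (B true) (B false)|).
    by rewrite cardsX !cB -natrX -natrM; congr _%:R; rewrite -!mulnn mulnACA.
  apply: eq_card => -[x y]; rewrite !inE unfold_in /=; by case: (x.1.1); case: (y.1.1).
have EV : \sum_(Y : {set diamond} | violation Y) \prod_(i in inl @: all_cross Y :|: inr @: Y) pr i <=
    8 * (viol_const * (N%:R ^+ 2 / q%:R ^+ 2)).
  rewrite (eq_bigr _ (fun Y _ => prod_family (all_cross Y) Y)).
  rewrite (partition_big (fun Y : {set diamond} => inord #|Y| : 'I_8) predT) //=.
  rewrite [X in _ <= X]mulr_natl -[8%N in X in _ <= X]card_ord -sumr_const; apply: ler_sum => j _.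
  rewrite (eq_bigl (fun Y : {set diamond} => violation Y && (#|Y| == j))); last first.
    move=> Y; case: (boolP (violation Y)) => //= /and3P[_ Y7 _].
    by rewrite -val_eqE /= inordK // ltnS.
  case: (ltnP 1 j) => jj; first by apply: viol_weight_j; rewrite jj -ltnS ltn_ord.
  rewrite big_pred0; first by rewrite mulr_ge0 ?ler0n // divr_ge0 // exprn_ge0 // ltW.
  move=> Y; apply/negP => /andP[/and3P[Y1 _ _] /eqP Yj].
  by move: Y1; rewrite Yj ltnNge jj.
have avg : N%:R ^+ 2 / q%:R * (M%:R - lam * (t.+1 ^ 2)%:R - 8 * viol_const / q%:R) <= \sum_w wt pr w * v w.
  rewrite (eq_bigr (fun w => wt pr w * #|[set D : diamond | true & needs D \subset w]|%:R -
    wt pr w * #|[set Y : {set diamond} | violation Y & inl @: all_cross Y :|: inr @: Y \subset w]|%:R -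
    lam * (wt pr w * #|[set xy : site * site | (xy.1.1.1 && ~~ xy.2.1.1) & ([set inl xy] : {set site * site + diamond}) \subset w]|%:R))); last first.
    by move=> w _; rewrite /v; ring.
  rewrite !sumrB -mulr_sumr !wt_count EA EK.
  have -> : N%:R ^+ 2 / q%:R * (M%:R - lam * (t.+1 ^ 2)%:R - 8 * viol_const / q%:R) =
    M%:R * (N%:R ^+ 2 / q%:R) - 8 * (viol_const * (N%:R ^+ 2 / q%:R ^+ 2)) - lam * ((t.+1 ^ 2)%:R * (N%:R ^+ 2 / q%:R)).
    by field; rewrite gt_eqF.
  by rewrite lerD2r lerD2l lerN2.
have [w hw] := exists_ge_avg (fun w => wt_ge0 w pr01) (wt_sum pr) avg.
have [Z ZA [nv cZ]] := @delete_bad _ (active w) (@violation t N M) ltac:(by move=> Y /and3P[Y1 _ _]; rewrite -card_gt0 ltnW).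
exists Z, (kept w); split.
- exact: clean_of.
- by move=> xy; rewrite inE => /andP[].
- move=> D /(subsetP ZA); rewrite inE => /subsetP nD; apply/subsetP => -[x y] xyD.
  rewrite inE nD ?inE ?imset_f // andbT; move: xyD; rewrite in_setX => /andP[/part_side /= -> /part_side /= ->] //.
apply: le_trans hw _; rewrite /v.
have -> : [set D : diamond | true & needs D \subset w] = active w by apply/setP => D; rewrite !inE.
have -> : [set xy : site * site | (xy.1.1.1 && ~~ xy.2.1.1) & ([set inl xy] : {set site * site + diamond}) \subset w] = kept w.
  by apply/setP => xy; rewrite !inE sub1set.
rewrite lerD2r lerBlDr -natrD ler_nat; apply: leq_trans cZ _; rewrite leq_add2l.
by apply/subset_leq_card/subsetP => Y; rewrite !inE active_sub.
Qed.

End Random.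

Theorem exists_gadget (R : realType) (t : nat) (e : R) : (0 < e < 1)%R ->
  exists (V : finType) (EF J : {set {set V}}), [/\ gadget t.+1 EF J, 0 < #|J| &
    (2 * (1 - e) * #|J|%:R <= #|EF|%:R * (2 * 'C(t.+1 + 2, 2) - 1)%:R :> R)%R].
Proof.
move=> /andP[e0 e1].
(* [M] makes the cross pairs at most a fraction [e] of the diamonds; [q] comes after [M], on which
   [viol_const] depends. *)
have [M hM] := natr_large (e^-1 * (t.+1 ^ 2)%:R + 1).
have [q1 hq1] := natr_large (8 * viol_const R t M + 1).
pose q := maxn q1 2; have q2 : 1 < q by rewrite leq_maxr.
have q0 : (0 < q%:R :> R)%R by rewrite ltr0n ltnW.
have [|Z [K [cZ Ks KZ h]]] := @exists_good R t q M q2 (e^-1); first by rewrite invr_ge0 ltW.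
have pos : (0 < #|Z|%:R - e^-1 * #|K|%:R :> R)%R.
  apply: lt_le_trans h; apply: mulr_gt0.
    by rewrite divr_gt0 // exprn_gt0 // ltr0n expn_gt0 ltnW.
  have x1 : (8 * viol_const R t M / q%:R < 1)%R.
    rewrite ltr_pdivrMr // mul1r; apply: lt_le_trans (hq1 q (leq_maxl _ _)).
    by rewrite ltrDl.
  by have := hM M (leqnn M); lra.
have KZe : (#|K|%:R <= e * #|Z|%:R :> R)%R.
  by rewrite mulrC -ler_pdivrMr // mulrC; apply: ltW; rewrite -subr_gt0.
have Z0 : 0 < #|Z|.
  rewrite -(ltr0n R); apply: lt_le_trans pos _; rewrite gerBl.
  by rewrite mulr_ge0 // invr_ge0 ltW.
exists (vertex t _ M), (gadget_edges Z), (gadget_J Z K); split; first exact: gadgetP.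
  have [D DZ] : exists D, D \in Z by apply/card_gt0P.
  have c2 := card_pairs_in1; apply/card_gt0P.
  have /card_gt0P[p pP] : 0 < #|pairs_in [set edge (D, true)]|.
    rewrite (@card_pairs_in1 _ t.+1 [set edge (D, true)]) ?inE // ?bin_gt0 ?addn2 // => x /set1P ->.
    exact: card_edge.
  exists p; rewrite inE; apply/orP; left; have /pairs_inP[p2 [x /set1P -> px]] := pP.
  by apply/pairs_inP; split=> //; exists (edge (D, true)) => //; apply: imset_f; rewrite in_setX DZ inE.
rewrite card_gadget_edges.
set C1 := (2 * 'C(t.+1 + 2, 2) - 1)%N.
have C10 : 0 < C1 by rewrite subn_gt0 (leq_trans (_ : 1 < 2 * 1)) // leq_mul2l bin_gt0 addn2.
have hJ : (#|gadget_J Z K|%:R <= #|Z|%:R * C1%:R + #|K|%:R :> R)%R.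
  by rewrite -natrM -natrD ler_nat; exact: card_gadget_J.
have C1R : (1 <= C1%:R :> R)%R by rewrite ler1n.
have Z0R : (0 <= #|Z|%:R :> R)%R by exact: ler0n.
rewrite natrM; move: hJ KZe C1R Z0R; move: (#|gadget_J Z K|%:R : R)%R (#|Z|%:R : R)%R (#|K|%:R : R)%R (C1%:R : R)%R.
move=> j z k c hj hk c1 z0.
have e1' : (0 <= 1 - e)%R by lra.
have : ((1 - e) * j <= (1 - e) * (z * c + e * z))%R by rewrite ler_wpM2l //; lra.
have : (0 <= e * z * (c - 1 + e))%R by rewrite !mulr_ge0 //; lra.
nra.
Qed.

End RandomDiamonds.

(** * Packing gadgets into a dense graph without forbidden configuration *)

Module UnionOfGadgets.
Import RandomProcess Blocks Items SparsePacking PackingExistence Clusters ClusterStructure Discharging Diamonds Gadgets RandomDiamonds.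
Import Order.TTheory GRing.Theory Num.Theory.

(** The three sources of the missing vertex: [g] a loss counted twice, [g'] a copy with a surplus,
    [g''] copies spanning more than the minimum. *)
Lemma union_arith v j s X cov L Sc g g' g'' : 2 <= v -> X + g <= cov + L -> L + Sc = v * j ->
  s * 7 + 2 * j + g' <= Sc -> (v - 2) * j + 2 + g'' <= X -> 0 < g + g' + g'' -> s * 7 + 3 <= cov.
Proof.
move=> v2 h1 h2 h3 h4 h5; have : (v - 2) * j + 2 * j = v * j by rewrite -mulnDl subnK.
by move: ((v - 2) * j) (v * j) (s * 7) h2 h3 h4 => a b c; lia.
Qed.

Lemma pair_eq_arith v x c : 2 < v -> x + c = 2 * v -> c <= 2 -> (v - 2) * 2 + 2 <= x /\ (x = (v - 2) * 2 + 2 -> c = 2).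
Proof. lia. Qed.

Lemma seven_split a b c : a + (b + c) = 7 -> 3 < a -> 3 < b -> False.
Proof. lia. Qed.

Section Union.
Variables (s : nat) (V : finType) (EF J : {set {set V}}) (n : nat) (S : {set block V n}).
Hypothesis gad : gadget s EF J.
Hypothesis s0 : 0 < s.
Hypothesis spS : sparse_packing J S.

Definition place (fe : block V n * {set V}) : {set 'I_n} := img fe.1 fe.2.
Definition union_edges : {set {set 'I_n}} := place @: setX S EF.

Lemma V3 : 2 < #|V|. Proof. exact: gadget_V gad. Qed.

Lemma place_inj : {in setX S EF &, injective place}.
Proof.
move=> [f e] [g e'] /setXP[/= fS eE] /setXP[/= gS eE']; rewrite /place /= => h.
case: (eqVneq f g) => [fg|fg]; first by rewrite fg in h *; rewrite (img_inj h).
exfalso; have [_ [c2 _]] := (spS.2, spS.1 f g fS gS fg).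
have : #|img f e| <= #|vs f :&: vs g| by rewrite subset_leq_card // subsetI img_sub h img_sub.
by rewrite card_img (gadget_uniform gad eE); move: c2 s0; clear; lia.
Qed.

Lemma card_union_edges : #|union_edges| = #|S| * #|EF|.
Proof. by rewrite card_in_imset ?cardsX //; exact: place_inj. Qed.

Lemma union_uniform e : e \in union_edges -> #|e| = s + 2.
Proof. by case/imsetP => -[f e'] /setXP[/= _ eE] ->; rewrite card_img (gadget_uniform gad eE). Qed.

Lemma packing_VV (C : {set block V n}) : C \subset S -> 1 < #|C| <= 7 ->
  (#|V| - 2) * #|C| + 2 <= #|VV C| /\
  (#|VV C| = (#|V| - 2) * #|C| + 2 -> exists f, exists g, [/\ f \in C, g \in C, f != g & #|vs f :&: vs g| = 2]).
Proof.
move=> CS /andP[C1 C7]; case: (ltnP 2 #|C|) => C2; first by apply: (spS.2 C CS); rewrite C2.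
have /eqP/cards2P[f [g [fg CE]]] : #|C| = 2 by apply/eqP; rewrite eqn_leq C2.
have fC : f \in C by rewrite CE !inE eqxx.
have gC : g \in C by rewrite CE !inE eqxx orbT.
have [c2 _] := spS.1 f g (subsetP CS f fC) (subsetP CS g gC) fg.
have := pair_eq_arith V3 (cap_VV2 f g) c2; rewrite -CE.
have -> : #|C| = 2 by apply/eqP; rewrite eqn_leq C2.
by case=> h1 h2; split=> // /h2 h; exists f, g.
Qed.

Section Config.
Variable Q : {set block V n * {set V}}.
Hypothesis QS : Q \subset setX S EF.
Hypothesis Q7 : #|Q| = 7.
Let C := fst @: Q.
Let fib (f : block V n) : {set {set V}} := [set e | (f, e) \in Q].
Let P f := img f (cover (fib f)).

Let CS : C \subset S.
Proof. by apply/subsetP => _ /imsetP[[f e] /(subsetP QS)/setXP[/= fS _] ->]. Qed.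

Let fibE f : fib f \subset EF.
Proof. by apply/subsetP => e; rewrite inE => /(subsetP QS)/setXP[]. Qed.

Let fib_gt0 f : f \in C -> 0 < #|fib f|.
Proof. by case/imsetP => -[g e] h ->; apply/card_gt0P; exists e; rewrite inE. Qed.

Let fib_sum : \sum_(f in C) #|fib f| = 7.
Proof.
rewrite -Q7 -[RHS]sum1_card (partition_big fst (mem C)) /=; last by move=> x xQ; exact: imset_f.
apply: eq_bigr => f _; rewrite sum1_card.
rewrite -(card_imset (mem (fib f)) (_ : injective (fun e => (f, e)))); last by move=> e e' [].
apply: eq_card => -[g e]; rewrite unfold_in /=; apply/imsetP/andP => [[e' + [-> ->]]|[gQ /eqP /= gf]].
  by rewrite inE.
by exists e; rewrite ?inE -gf.
Qed.

Let cover_P : cover (place @: Q) = \bigcup_(f in C) P f.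
Proof.
apply/setP => x; apply/bigcupP/bigcupP => [[_ /imsetP[[f e] fQ ->]]|[f fC /imsetP[y /bigcupP[e ef ye] ->]]].
  move=> /imsetP[y ye ->]; exists f; first exact: (imset_f fst fQ).
  by apply: imset_f; apply/bigcupP; exists e; rewrite ?inE.
by exists (place (f, e)); [apply: imset_f; rewrite inE in ef | apply: imset_f].
Qed.

Let card_P f : #|P f| = #|cover (fib f)|. Proof. exact: card_img. Qed.

Let P_sub f : P f \subset vs f. Proof. exact: img_sub. Qed.

Let fib_lt f : 1 < #|C| -> f \in C -> 0 < #|fib f| <= 6.
Proof.
move=> C1 fC; rewrite fib_gt0 //=.
have : 0 < \sum_(g in C :\ f) #|fib g|.
  have /card_gt0P[g gC] : 0 < #|C :\ f| by move: C1; rewrite (cardsD1 f) fC.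
  by rewrite (big_setD1 g gC) /= addn_gt0 fib_gt0 // (subsetP (subsetDl C [set f])).
have := fib_sum; rewrite (big_setD1 f fC) /=; clear; lia.
Qed.

Let fib_cover f : 1 < #|C| -> f \in C -> s * #|fib f| + 2 <= #|cover (fib f)|.
Proof. by move=> C1 fC; apply: (gadget_ge gad (fibE f)); exact: fib_lt. Qed.

Let loss : \sum_(f in C) #|vs f :\: P f| + \sum_(f in C) #|cover (fib f)| = #|V| * #|C|.
Proof.
rewrite -big_split /= mulnC -sum_nat_const; apply: eq_bigr => f _.
by rewrite -card_P addnC -{1}(setIidPr (P_sub f)) cardsID card_vs.
Qed.

Let cover_sum k : 1 < #|C| -> (exists f, f \in C /\ s * #|fib f| + 2 + k <= #|cover (fib f)|) ->
  s * 7 + 2 * #|C| + k <= \sum_(f in C) #|cover (fib f)|.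
Proof.
move=> C1 [f [fC hf]]; rewrite -fib_sum big_distrr /= mulnC -sum_nat_const -big_split /=.
rewrite (big_setD1 f fC) [leqRHS](big_setD1 f fC) /= addnAC; apply: leq_add => //.
by apply: leq_sum => g /setD1P[_ gC]; exact: fib_cover.
Qed.

Let basic : #|VV C| <= #|cover (place @: Q)| + \sum_(f in C) #|vs f :\: P f|.
Proof.
apply: leq_trans (_ : #|cover (place @: Q) :|: \bigcup_(f in C) (vs f :\: P f)| <= _).
  apply/subset_leq_card/bigcupsP => f fC; apply/subsetP => x xf; rewrite inE cover_P.
  case: (boolP (x \in P f)) => xP; apply/orP; [left|right]; apply/bigcupP; exists f => //.
  by rewrite inE xP.
apply: leq_trans (leq_card_setU _ _) _; rewrite leq_add2l; exact: card_bigcup_le.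
Qed.

(** The vertex [x] counts as lost for [f], although it is covered through [g] or counts as lost for
    [g] as well. *)
Let gain f g x : f \in C -> g \in C -> f != g -> x \in vs f -> x \notin P f -> x \in vs g ->
  #|VV C| + 1 <= #|cover (place @: Q)| + \sum_(f in C) #|vs f :\: P f|.
Proof.
move=> fC gC fg xf xP xg.
apply: leq_trans (_ : #|cover (place @: Q) :|: (((vs f :\: P f) :\ x) :|: \bigcup_(h in C :\ f) (vs h :\: P h))| + 1 <= _).
  rewrite leq_add2r; apply/subset_leq_card/bigcupsP => h hC; apply/subsetP => z zh; rewrite in_setU in_setU cover_P.
  case: (boolP (z \in P h)) => zP; first by apply/orP; left; apply/bigcupP; exists h.
  case: (eqVneq h f) => [hf|hf]; last first.
    by apply/orP; right; apply/orP; right; apply/bigcupP; exists h; [rewrite in_setD1 hf | rewrite inE zP].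
  rewrite hf in zh zP; case: (eqVneq z x) => [->|zx]; last by rewrite in_setD1 zx inE zP zh orbT.
  case: (boolP (x \in P g)) => xPg; first by apply/orP; left; apply/bigcupP; exists g.
  apply/orP; right; apply/orP; right; apply/bigcupP; exists g; last by rewrite inE xPg.
  by rewrite in_setD1 eq_sym fg.
apply: leq_trans (leq_add (leq_trans (leq_card_setU _ _) (leq_add (leqnn _) (leq_card_setU _ _))) (leqnn 1)) _.
rewrite (big_setD1 f fC) /= -!addnA leq_add2l addnCA [leqRHS]addnC leq_add ?card_bigcup_le //.
by rewrite addnC [leqRHS](cardsD1 x) inE xP xf.
Qed.

Lemma union_config : s * 7 + 3 <= #|cover (place @: Q)|.
Proof.
case: (ltnP 1 #|C|) => C1; last first.
  have [x xQ] : exists x, x \in Q by apply/card_gt0P; rewrite Q7.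
  have xC : x.1 \in C by exact: imset_f.
  have C0 : C = [set x.1] by apply/eqP; rewrite eq_sym eqEcard sub1set xC cards1.
  have := fib_sum; rewrite C0 big_set1 => f7.
  rewrite cover_P C0 big_set1 card_P; exact: (gadget_seven gad (fibE _) f7).
have C7 : #|C| <= 7 by rewrite -Q7; exact: leq_imset_card.
have C17 : 1 < #|C| <= 7 by rewrite C1.
have v2 : 2 <= #|V| by exact: ltnW V3.
have [low tight] := packing_VV CS C17.
have [f0 f0C] : exists f, f \in C by apply/card_gt0P; exact: ltnW.
have cs0 : s * 7 + 2 * #|C| + 0 <= \sum_(f in C) #|cover (fib f)|.
  by apply: cover_sum => //; exists f0; rewrite addn0 fib_cover.
case: (eqVneq #|VV C| ((#|V| - 2) * #|C| + 2)) => [tE|ne]; last first.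
  have low1 : (#|V| - 2) * #|C| + 2 + 1 <= #|VV C| by rewrite addn1 ltn_neqAle eq_sym ne.
  have b0 : #|VV C| + 0 <= #|cover (place @: Q)| + \sum_(f in C) #|vs f :\: P f| by rewrite addn0; exact: basic.
  exact: union_arith v2 b0 loss cs0 low1 isT.
have low0 : (#|V| - 2) * #|C| + 2 + 0 <= #|VV C| by rewrite addn0.
have [f [g [fC gC fg cap]]] := tight tE.
wlog f3 : f g fC gC fg cap / #|fib f| <= 3.
  move=> wl; case: (leqP #|fib f| 3) => [h|f4]; first exact: (wl f g).
  case: (leqP #|fib g| 3) => [h|g4]; first by apply: (wl g f) => //; rewrite 1?eq_sym // setIC.
  exfalso; have := fib_sum; rewrite (big_setD1 f fC) /= (big_setD1 g) /=; last by rewrite in_setD1 eq_sym fg.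
  by move=> h; exact: seven_split h f4 g4.
set p := vs f :&: vs g in cap.
(* Either a vertex of the shared pair is lost in [f] and counted too often, or the edges in [f] span
   a pair outside [J] and [gadget_three] applies. *)
case: (boolP (p \subset P f)) => [pP|/subsetPn[x xp xP]]; last first.
  have /setIP[xf xg] := xp.
  exact: union_arith v2 (gain fC gC fg xf xP xg) loss cs0 low0 isT.
have pf : p \subset vs f by exact: subsetIl.
have [e e2 pe] := img_pair cap pf.
have eJ : e \notin J.
  have [_ /(_ cap)] := spS.1 f g (subsetP CS f fC) (subsetP CS g gC) fg; rewrite -/p.
  by apply: contra => eJ; rewrite pe imset_f.
have ec : e \subset cover (fib f).
  apply/subsetP => x xe; have : val f x \in P f by apply: (subsetP pP); rewrite pe imset_f.
  by case/imsetP => y yc /block_inj ->.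
have hf : s * #|fib f| + 2 + 1 <= #|cover (fib f)|.
  rewrite -addnA; apply: (gadget_three gad (fibE f) _ e2 ec eJ).
  by rewrite f3 fib_gt0.
have cs1 := cover_sum C1 (ex_intro _ f (conj fC hf)).
have b0 : #|VV C| + 0 <= #|cover (place @: Q)| + \sum_(f in C) #|vs f :\: P f| by rewrite addn0; exact: basic.
exact: union_arith v2 b0 loss cs1 low0 isT.
Qed.

End Config.

Lemma union_free (Q : {set {set 'I_n}}) : Q \subset union_edges -> #|Q| = 7 -> s * 7 + 3 <= #|cover Q|.
Proof.
move=> QE c7; pose Qi := [set fe in setX S EF | place fe \in Q].
have Q_E : Q = place @: Qi.
  apply/setP => e; apply/idP/imsetP => [eQ|[fe + ->]]; last by rewrite inE => /andP[].
  by have /imsetP[fe feS eE] := subsetP QE e eQ; exists fe; rewrite // inE feS -eE.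
have sQ : Qi \subset setX S EF by apply/subsetP => fe; rewrite inE => /andP[].
rewrite Q_E; apply: union_config => //.
rewrite -c7 Q_E card_in_imset // => x y xQ yQ; apply: place_inj; exact: (subsetP sQ).
Qed.

End Union.

Theorem exists_dense_free (R : realType) (t : nat) (e : R) : (0 < e < 1)%R -> exists n0, forall n, n0 <= n ->
  exists E : {set {set 'I_n}}, [/\ (forall x, x \in E -> #|x| = t.+1 + 2),
    (forall Q : {set {set 'I_n}}, Q \subset E -> #|Q| = 7 -> t.+1 * 7 + 3 <= #|cover Q|) &
    (2 * (1 - e) ^+ 2 * 'C(n, 2)%:R <= #|E|%:R * (2 * 'C(t.+1 + 2, 2) - 1)%:R :> R)%R].
Proof.
move=> e01; have [V [EF [J [gad J0 dens]]]] := exists_gadget t e01.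
case/andP: e01 => e0 e1.
have [n0 hn] := packing (gadget_V gad) (gadget_J2 gad) J0 e0.
exists n0 => n /hn[S sp hS]; exists (union_edges EF S); split.
- by move=> x; exact: (union_uniform gad).
- exact: (union_free gad).
rewrite (card_union_edges gad) // natrM.
move: dens hS; set D := (2 * _ - 1)%N; have J0R : (0 < #|J|%:R :> R)%R by rewrite ltr0n.
have S0 : (0 <= #|S|%:R :> R)%R by exact: ler0n.
move: (#|J|%:R : R)%R (#|EF|%:R : R)%R (#|S|%:R : R)%R ('C(n, 2)%:R : R)%R (D%:R : R)%R J0R S0 => j ef z c d j0 z0 h1 h2.
rewrite -(ler_pM2l j0).
have a1 := ler_wpM2r z0 h1.
have e1' : (0 <= 2 * (1 - e))%R by lra.
have a2 := ler_wpM2l e1' h2.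
apply: (@le_trans _ _ (j * (2 * (1 - e) * (j * z)))%R).
  by apply: ler_wpM2l; [exact: ltW | rewrite expr2; lra].
by have a3 := ler_wpM2l (ltW j0) a1; lra.
Qed.

End UnionOfGadgets.

(** * The two bounds on the extremal function and the limit *)

Import PackingExistence Clusters ClusterStructure Discharging UnionOfGadgets.
Import Order.TTheory GRing.Theory Num.Theory.

Lemma f_r_upper s n : (0 < s)%N ->
  ((2 * 'C(s + 2, 2) - 1) * f_r (s + 2) n (s * 7 + 2) 7 <= n ^ 2 + (2 * 'C(s + 2, 2) - 1) * (18 * n))%N.
Proof.
move=> s0; have [->|[E /andP[/forallP uE fE] ->]] : f_r (s + 2) n (s * 7 + 2) 7 = 0%N \/
    exists2 E : {set {set 'I_n}}, uniform (s + 2) E && sk_free (s * 7 + 2) 7 E & f_r (s + 2) n (s * 7 + 2) 7 = #|E|.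
  rewrite /f_r; case: (pickP (fun E : {set {set 'I_n}} => uniform (s + 2) E && sk_free (s * 7 + 2) 7 E)) => [E0 h0|no].
    right; have [E hE ->] := eq_bigmax_cond (fun E : {set {set 'I_n}} => #|E|) (ltac:(by apply/card_gt0P; exists E0) : (0 < #|[pred E : {set {set 'I_n}} | uniform (s + 2) E && sk_free (s * 7 + 2) 7 E]|)%N).
    by exists E.
  by left; rewrite big_pred0.
- by rewrite muln0.
have := @packing_upper 'I_n s E s0 _ _; rewrite card_ord; apply.
- by move=> e eE; apply/eqP; have := uE e; rewrite eE.
move=> Q QE Q7; rewrite leqNgt addn3 ltnS -addn2; apply/negP => h; move/negP: fE; apply.
by apply/existsP; exists Q; rewrite QE Q7 eqxx.
Qed.

Lemma f_r_lower s n (E : {set {set 'I_n}}) : (forall x, x \in E -> #|x| = s + 2)%N ->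
  (forall Q : {set {set 'I_n}}, Q \subset E -> #|Q| = 7 -> s * 7 + 3 <= #|cover Q|)%N ->
  (#|E| <= f_r (s + 2) n (s * 7 + 2) 7)%N.
Proof.
move=> uE fE; apply: (leq_bigmax_cond (F := fun E : {set {set 'I_n}} => #|E|)); apply/andP; split.
  by apply/forallP => e; apply/implyP => /uE ->.
apply/negP => /existsP[Q /and3P[QE /eqP Q7]]; have := fE Q QE Q7.
by rewrite /cover addn3 addn2 => h /(leq_trans h); rewrite ltnn.
Qed.

Lemma degree_bin s : (2 * 'C(s + 2, 2) - 1 = (s + 2) ^ 2 - (s + 2) - 1)%N.
Proof.
have := mul_bin_diag (s + 2) 1; rewrite bin1 => <-; rewrite -mulnn; congr (_ - _)%N.
by rewrite -subn1 mulnBr muln1.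
Qed.

Local Open Scope ring_scope.

Lemma ratio_bounds (R : realType) s (e : R) : (0 < s)%N -> 0 < e -> exists n0, forall n, (n0 <= n)%N ->
  `|(2 * 'C(s + 2, 2) - 1)%N%:R^-1 - (f_r (s + 2) n (s * 7 + 2) 7)%:R / n%:R ^+ 2| <= e.
Proof.
move=> s0 e0; set D := (2 * 'C(s + 2, 2) - 1)%N.
have D1 : 1 <= D%:R :> R.
  by rewrite ler1n subn_gt0 (leq_trans (_ : 1 < 2 * 1)%N) // leq_mul2l bin_gt0 addn2.
pose e' : R := Num.min e 1 / 4.
have e'0 : 0 < e' by rewrite divr_gt0 // lt_min e0 ltr01.
have e'e : e' * 4 <= e by rewrite /e' divfK ?pnatr_eq0 // ge_min lexx.
have e'1 : 0 < e' < 1.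
  rewrite e'0 /e' ltr_pdivrMr // mul1r (@le_lt_trans _ _ 1) ?ge_min ?lexx ?orbT ?ltr1n //.
have [t st] : exists t, s = t.+1 by exists s.-1; rewrite prednK.
have [n1 h1] := exists_dense_free t e'1.
(* From here on the linear term 18n of the upper bound is at most e n^2. *)
have [n2 h2] := natr_large (18 / e).
exists (maxn n1 (maxn n2 1)) => n; rewrite !geq_max => /and3P[/h1[E [uE fE dE]] /h2 n18 n0].
have := f_r_upper n s0; have := f_r_lower uE fE; rewrite -st -/D.
set f := f_r _ _ _ _ => lowE upE.
have N0 : 0 < n%:R :> R by rewrite ltr0n.
have D0 : 0 < D%:R :> R by exact: lt_le_trans D1.
have up : D%:R * f%:R <= n%:R ^+ 2 + D%:R * (18 * n%:R) :> R.
  by rewrite -natrX -!natrM -natrD ler_nat.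
have low : 2 * (1 - e') ^+ 2 * 'C(n, 2)%:R <= f%:R * D%:R :> R.
  rewrite -st in dE; apply: le_trans dE _; rewrite ler_wpM2r ?ler0n // ler_nat; exact: lowE.
have bin : 2 * 'C(n, 2)%:R = n%:R * (n%:R - 1) :> R.
  have := mul_bin_diag n 1; rewrite bin1 => h.
  by rewrite -natrM -h natrM -subn1 natrB.
have n18' : 18 <= e * n%:R by rewrite mulrC -ler_pdivrMr.
have y1 : 1 <= n%:R :> R by rewrite ler1n.
move: up low bin n18' N0 y1 D1 D0; move: (f%:R : R) (n%:R : R) (D%:R : R) ('C(n, 2)%:R : R) => x y d c up low bin n18' y0 y1 d1 d0.
have y20 : 0 < y ^+ 2 by rewrite exprn_gt0.
have -> : d^-1 - x / y ^+ 2 = (y ^+ 2 - d * x) / (d * y ^+ 2) by field; rewrite !gt_eqF.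
have dy0 : 0 < d * y ^+ 2 by exact: mulr_gt0.
rewrite normrM normfV (gtr0_norm dy0) ler_pdivrMr // ler_norml.
have y18 : 18 * y <= e * y ^+ 2 by rewrite expr2 mulrA ler_wpM2r // ltW.
have dy : y ^+ 2 <= d * y ^+ 2 by rewrite ler_peMl // ltW.
apply/andP; split.
  have : d * (18 * y) <= d * (e * y ^+ 2) by rewrite ler_wpM2l // ltW.
  move: up; rewrite mulrCA; lra.
have e2 : (1 - e') ^+ 2 >= 1 - 2 * e' by have := sqr_ge0 e'; rewrite !expr2; lra.
have c0 : 0 <= 2 * c by rewrite bin mulr_ge0 ?(ltW y0) // subr_ge0.
have low' : (1 - 2 * e') * (2 * c) <= x * d.
  apply: le_trans low; rewrite [2 * _ * c]mulrAC [2 * c * _]mulrC; exact: ler_wpM2r.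
have a1 : 0 <= e' * y by rewrite mulr_ge0 ?ltW.
have a2 : e' * 4 * y ^+ 2 <= e * y ^+ 2 by rewrite ler_wpM2r // ltW.
have a3 : e * y ^+ 2 <= e * (d * y ^+ 2) by rewrite ler_wpM2l // ltW.
have eqc : 2 * c = y ^+ 2 - y by rewrite bin expr2; ring.
move: low'; rewrite eqc [x * d]mulrC; lra.
Qed.

From mathcomp Require Import all_classical all_reals all_analysis.
Local Open Scope classical_set_scope.

Theorem theorem1p2 (R : realType) (r : nat) (hr : (3 <= r)%N) :
  (fun n : nat => (f_r r n (7 * r - 12) 7)%:R / (n%:R ^+ 2) : R^o) @ \oo
    --> ((((r ^ 2 - r - 1)%N)%:R)^-1 : R^o).
Proof.
have [s s0 rs] : exists2 s, (0 < s)%N & r = (s + 2)%N.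
  by exists (r - 2)%N; rewrite ?subn_gt0 ?subnK // ltnW.
(* With r = s + 2 the truncated subtraction in 7r - 12 is exact. *)
have e7 : (7 * (s + 2) - 12 = s * 7 + 2)%N by rewrite mulnDr mulnC; lia.
rewrite rs e7 -degree_bin; apply/cvgrPdist_le => e e0.
have [n0 h] := ratio_bounds s0 e0.
by exists n0 => // n /= /h.
Qed.
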